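(* Let $\overline f$ be a simple boundary singularity, i.e. one of type $B_n$ ($n\ge2$), $C_n$ ($n\ge3$) or $F_4$, with ambient singularity $(X,0)$. Let $\phi_X$ be the characteristic polynomial of the monodromy operator of $(X,0)$, $\phi_{\overline f}$ the characteristic polynomial of the monodromy of $\overline f$, $\psi_X$ the characteristic polynomial of the Coxeter element of the affine root system corresponding to $(X,0)$, and put $\phi_1:=\phi_X/\phi_{\overline f}$ and $\psi_{\overline f}:=\psi_X/\phi_1$. Then the Poincaré series of $(X,0)$ satisfies $$p_X=\frac{\phi_{\overline f}}{\psi_{\overline f}}.$$
   Context: **Boundary singularities.** A boundary singularity (in three variables) is a germ of a holomorphic function $\overline f:(\mathbb C^3,0)\to(\mathbb C,0)$ in coordinates $x,y,z$ having an isolated critical point at $0$ both on $\mathbb C^3$ and on the boundary $\{x=0\}$. Put $f(x,y,z):=\overline f(x^2,y,z)$, which is invariant under $\sigma:(x,y,z)\mapsto(-x,y,z)$. The singularity $(X,0)$ defined by $f=0$ is the ambient singularity of $\overline f$. **Simple boundary singularities** (with ambient singularity, weights of $(x,y,z)$ for $f$, and degree $d$ of $f$): - $B_n$: $\overline f=x^n+y^2+z^2$; ambient $A_{2n-1}$; weights $(1,n,n)$, $d=2n$. - $C_n$: $\overline f=xy+y^n+z^2$; ambient $D_{n+1}$; weights $(n-1,2,n)$, $d=2n$. - $F_4$: $\overline f=x^2+y^3+z^2$; ambient $E_6$; weights $(3,4,6)$, $d=12$. **Poincaré series.** For $f$ weighted homogeneous with weights $q_1,q_2,q_3$ and degree $d$,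 the algebra $A=\mathbb C[x,y,z]/(f)$ is graded, $A=\bigoplus_{m\ge0}A_m$, and $p_X(t)=\sum_{m\ge0}\dim A_m\,t^m$. **Monodromy.** Let $X_\lambda=f^{-1}(\lambda)\cap B_\varepsilon$ be a Milnor fibre of $f$ (with $B_\varepsilon\subset\mathbb C^3$ a small ball around $0$ and $0<|\lambda|$ sufficiently small), with intersection form $\langle\cdot,\cdot\rangle$ on $H_2(X_\lambda)=H_2(X_\lambda;\mathbb Z)$. $\phi_X(t)$ is the characteristic polynomial of the monodromy operator $c:H_2(X_\lambda)\to H_2(X_\lambda)$. Let $H^-$ be the sublattice of $\sigma_*$-antiinvariant cycles. There is a distinguished basis $\delta^{(1)}_1,\dots,\delta^{(1)}_{\mu_0},\delta^{(2)}_1,\dots,\delta^{(2)}_{\mu_0},\delta'_1,\dots,\delta'_{\mu_1}$ of vanishing cycles of $H_2(X_\lambda)$ (all of self-intersection $-2$) with $\sigma_*\delta^{(1)}_i=\delta^{(2)}_i$, $\sigma_*\delta'_j=-\delta'_j$ and intersection matrix $\begin{pmatrix}A&0&B\\ 0&A&-B\\ B^t&-B^t&A'\end{pmatrix}$. Put $\widehat\delta_i=\delta^{(1)}_i-\delta^{(2)}_i$. Then $\widehat\delta_1,\dots,\widehat\delta_{\mu_0},\delta'_1,\dots,\delta'_{\mu_1}$ span $H^-$. For $v$ in this basis let $s_v(u)=u-\frac{2\langle u,v\rangle}{\langle v,v\rangle}v$ for $u\in H^-$. The monodromy of the boundary singularity $\overline f$ is the product of the reflections $s_v$ in the order of this basis,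 and $\phi_{\overline f}$ is its characteristic polynomial. **Affine Coxeter element.** The affine root system corresponding to $(X,0)$ is the affine (extended Dynkin) root system $\widetilde A_{2n-1}$, $\widetilde D_{n+1}$, $\widetilde E_6$ respectively. Its Coxeter element is the product of the reflections in the simple roots (vertices of the extended Dynkin diagram), acting on the root lattice they freely span. For $\widetilde A_{2n-1}$, which is a cycle with $2n$ vertices, where the conjugacy class depends on the order of the factors, the order is bipartite: first all vertices of one colour of a 2-colouring of the cycle, then all vertices of the other colour. *)

(* Defs.v *)
From HB Require Import structures.
From mathcomp Require Import all_boot all_order all_algebra.
From mathcomp Require Import complex.
From mathcomp Require Import all_classical all_reals all_analysis.
From mathcomp Require Import freeg.
From mathcomp Require Import -(notations) mpoly.

Set Implicit Arguments.
Unset Strict Implicit.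
Unset Printing Implicit Defensive.

Import Order.TTheory GRing.Theory Num.Theory.
Import numFieldNormedType.Exports.

Local Open Scope classical_set_scope.
Local Open Scope ring_scope.
Local Open Scope complex_scope.

(* The complex numbers R[i] carry no topology in the library; they get the one
   of their norm. *)
HB.instance Definition _ (R : realType) := PseudoMetric.copy R[i] (R[i]^o).
HB.instance Definition _ (R : realType) := NormedModule.copy R[i] (R[i]^o).

Lemma cts_mx (T U : topologicalType) m n (f : T -> 'M[U]_(m, n)) :
  (forall i j, continuous (fun t => f t i j)) -> continuous f.
Proof.
move=> cf t A [P nP sPA].
have : \forall s \near t, forall i j, P i j (f s i j).
  apply: filter_forall => i; apply: filter_forall => j.
  exact: cf (nP i j).
by apply: filterS => s Ps; apply: sPA.
Qed.

Lemma cts_coord (T : topologicalType) m n i j :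
  continuous (fun M : 'M[T]_(m, n) => M i j).
Proof.
move=> M A nA; exists (fun i' j' => if (i' == i) && (j' == j) then A else setT).
  move=> i' j'; case: ifP => [/andP[/eqP-> /eqP->] //|_]; exact: filterT.
by move=> N /(_ i j); rewrite !eqxx.
Qed.

Lemma cts_val (T : topologicalType) (A : set T) : continuous (val : A -> T).
Proof. exact: initial_continuous. Qed.

Lemma cts_val_coord (T : topologicalType) m n (A : set 'M[T]_(m, n)) i j :
  continuous (fun t : A => val t i j).
Proof.
move=> t.
move=> B nB; apply: (@cts_val _ A t (fun M => B (M i j))).
exact: (@cts_coord T m n i j (val t) B nB).
Qed.

Lemma cts_into (T U : topologicalType) (A : set U) (f : T -> A) :
  continuous (val \o f) -> continuous f.
Proof. by move=> cf; apply/continuous_comp_initial. Qed.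

Lemma cts_pair (T U V : topologicalType) (f : T -> U) (g : T -> V) :
  continuous f -> continuous g -> continuous (fun x => (f x, g x)).
Proof. by move=> cf cg x; apply: cvg_pair; [exact: cf|exact: cg]. Qed.

(* Integral singular homology of pairs, in the cubical version: singular cubes,
  chains taken modulo degenerate cubes. *)

Definition cube_set (R : realType) (n : nat) : set 'rV[R]_n :=
  [set t | forall j, 0 <= t 0 j <= 1].
Arguments cube_set : clear implicits.

Section Homology.
Variable R : realType.

Definition scube n (X : topologicalType) := continuousType (cube_set R n) X.

Definition chain n (X : topologicalType) := {freeg (scube n X)}.

Definition face_fun n (i : 'I_n.+1) (e : bool) (t : cube_set R n) :
    'rV[R]_n.+1 :=
  \row_j (if unlift i j is Some k then val t 0 k else e%:R).

Lemma face_funP n (i : 'I_n.+1) e (t : cube_set R n) :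
  face_fun i e t \in cube_set R n.+1.
Proof.
apply/mem_set => j; rewrite mxE; case: unlift => [k|].
  by have /set_mem := valP t; apply.
by case: e; rewrite ?lexx ler01.
Qed.

Definition face n (i : 'I_n.+1) e (t : cube_set R n) : cube_set R n.+1 :=
  SigSub (face_funP i e t).

Lemma cts_face n (i : 'I_n.+1) e : continuous (@face n i e).
Proof.
apply: cts_into; apply: cts_mx => i0 j /=.
rewrite /comp /=; under eq_fun do rewrite mxE.
case: unlift => [k|]; last exact: cst_continuous.
exact: cts_val_coord.
Qed.

Definition cube_comp n (X Y : topologicalType) (f : continuousType X Y)
  (s : scube n X) : scube n Y := f \o s.

Definition cube_face n (X : topologicalType) (s : scube n.+1 X) i e :
  scube n X := s \o mkcts (@cts_face n i e).

Definition bd n (X : topologicalType) : chain n.+1 X -> chain n X :=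
  fglift (fun s => \sum_(i < n.+1)
    (-1) ^+ i *: (<< cube_face s i true >> - << cube_face s i false >>)).

Lemma bd_additive n X : zmod_morphism (@bd n X).
Proof. exact: lift_is_additive. Qed.

HB.instance Definition _ n X :=
  GRing.isZmodMorphism.Build _ _ (@bd n X) (@bd_additive n X).

Definition degenerate n (X : topologicalType) (s : scube n X) :=
  exists i, forall t u : cube_set R n,
    (forall j, j != i -> val t 0 j = val u 0 j) -> s t = s u.

(* Chains that vanish in the normalized relative chain group of (X, A), the
   quotient of the free group on all cubes by the span of the degenerate cubes
   and of the cubes in A. Cycles and boundaries below are taken modulo these. *)
Definition trivial_chain n (X : topologicalType) (A : set X) (z : chain n X) :=
  forall s, s \in dom z -> degenerate s \/ range s `<=` A.

Definition rel_cycle n (X : topologicalType) (A : set X) :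
    pred (chain n X) :=
  match n return pred (chain n X) with
  | 0 => fun=> true
  | m.+1 => fun z => `[< trivial_chain A (bd z) >]
  end.

Lemma trivial_chainB n (X : topologicalType) (A : set X) :
  zmod_closed (fun z : chain n X => `[< trivial_chain A z >]).
Proof.
split; first by apply/asboolP => s; rewrite dom0.
move=> y z /asboolP ty /asboolP tz; apply/asboolP => s /domB.
by rewrite mem_cat => /orP[/ty|/tz].
Qed.

Lemma rel_cycle_zmod n X A : zmod_closed (@rel_cycle n X A).
Proof.
case: n => [|n] //; have [t0 tB] := @trivial_chainB n X A.
split; first by rewrite unfold_in /= raddf0.
by move=> y z; rewrite !unfold_in /= raddfB => /tB; apply.
Qed.

HB.instance Definition _ n X A :=
  GRing.isZmodClosed.Build (chain n X) (@rel_cycle n X A) (@rel_cycle_zmod n X A).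

Record cycles n (X : topologicalType) (A : set X) := Cycle {
  cycle_val : chain n X;
  _ : cycle_val \in rel_cycle A }.

HB.instance Definition _ n X A := [isSub for @cycle_val n X A].
HB.instance Definition _ n X A := [Choice of @cycles n X A by <:].
HB.instance Definition _ n X A :=
  [SubChoice_isSubZmodule of @cycles n X A by <:].

Definition rel_boundary n (X : topologicalType) (A : set X) :
    cycles n A -> bool :=
  fun z => `[< exists w : chain n.+1 X, trivial_chain A (val z - bd w) >].

Lemma rel_boundary_zmod n X A : zmod_closed (@rel_boundary n X A).
Proof.
have [/asboolP t0 tB] := @trivial_chainB n X A.
split; first by apply/asboolP; exists 0; rewrite [val 0]raddf0 [bd 0]raddf0 subr0.
move=> y z /asboolP[v tv] /asboolP[w tw]; apply/asboolP; exists (v - w).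
have -> : val (y - z) - bd (v - w) = (val y - bd v) - (val z - bd w).
  by rewrite [val (y - z)]raddfB [bd (v - w)]raddfB opprD addrACA -opprD.
by apply/asboolP/tB; apply/asboolP.
Qed.

HB.instance Definition _ n X A :=
  GRing.isZmodClosed.Build (cycles n A) (@rel_boundary n X A)
    (@rel_boundary_zmod n X A).

Definition homology n (X : topologicalType) (A : set X) :=
  Quotient.quot (GRing.ZmodClosed.clone (cycles n A) (@rel_boundary n X A) _).

HB.instance Definition _ n X A := GRing.Zmodule.on (@homology n X A).

(* hclass is the class of a relative cycle (junk value 0 on other chains), and
   hrep picks a representing cycle. The maps hmap and hcross induced on homology
   by chain maps are defined through such a representative; they do not depend
   on its choice. *)
Definition hclass n (X : topologicalType) (A : set X) (z : chain n X) :
    homology n A :=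
  (\pi_(homology n A) (insubd (0 : cycles n A) z))%qT.

Definition hrep n (X : topologicalType) (A : set X) (a : homology n A) :
  chain n X := val (repr a).

Definition push n (X Y : topologicalType) (f : continuousType X Y)
  (z : chain n X) : chain n Y := fglift (fun s => << cube_comp f s >>) z.

Definition hmap n (X Y : topologicalType) (A : set X) (B : set Y)
    (f : continuousType X Y) (a : homology n A) : homology n B :=
  hclass B (push f (hrep a)).

Lemma lproj_subproof n m (v : cube_set R (n + m)) :
  lsubmx (val v) \in cube_set R n.
Proof.
by apply/mem_set => j; rewrite mxE; have /set_mem := valP v; apply.
Qed.

Lemma rproj_subproof n m (v : cube_set R (n + m)) :
  rsubmx (val v) \in cube_set R m.
Proof.
by apply/mem_set => j; rewrite mxE; have /set_mem := valP v; apply.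
Qed.

Definition lproj n m (v : cube_set R (n + m)) : cube_set R n :=
  SigSub (lproj_subproof v).

Definition rproj n m (v : cube_set R (n + m)) : cube_set R m :=
  SigSub (rproj_subproof v).

Lemma cts_lproj n m : continuous (@lproj n m).
Proof.
apply: cts_into; apply: cts_mx => i j; rewrite /comp /=.
under eq_fun do rewrite mxE; exact: cts_val_coord.
Qed.

Lemma cts_rproj n m : continuous (@rproj n m).
Proof.
apply: cts_into; apply: cts_mx => i j; rewrite /comp /=.
under eq_fun do rewrite mxE; exact: cts_val_coord.
Qed.

Lemma cts_cube_prod n m (X Y : topologicalType)
    (s : scube n X) (t : scube m Y) :
  continuous (fun v => (s (@lproj n m v), t (@rproj n m v))).
Proof.
have cs : continuous (s \o @lproj n m).
  by move=> v; apply: continuous_comp; [exact: cts_lproj|exact: cts_fun].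
have ct : continuous (t \o @rproj n m).
  by move=> v; apply: continuous_comp; [exact: cts_rproj|exact: cts_fun].
exact: cts_pair cs ct.
Qed.

Definition cube_prod n m (X Y : topologicalType)
    (s : scube n X) (t : scube m Y) : scube (n + m) (X * Y)%type :=
  mkcts (@cts_cube_prod n m X Y s t).

Definition cross n m (X Y : topologicalType)
    (z : chain n X) (w : chain m Y) : chain (n + m) (X * Y)%type :=
  fglift (fun s => fglift (fun t => << cube_prod s t >>) w) z.

Definition hcross n m (X Y : topologicalType) (C : set (X * Y))
    (a : homology n (set0 : set X)) (b : homology m (set0 : set Y)) :
    homology (n + m) C :=
  hclass C (cross (hrep a) (hrep b)).

End Homology.

(* An orientation of M is encoded by its Thom class of the diagonal: a map
  H_4(M x M, M x M - diagonal) -> Z that restricts to an isomorphism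
  H_4(M, M - p) -> Z on every slice {p} x M. The intersection number of two
  classes in H_2(M) is the value of the Thom class on their cross product. The
  reverse orientation changes the sign of the form. *)

Section IntersectionForm.
Variables (R : realType) (M : topologicalType).

Local Notation H2 := (homology R 2 (set0 : set M)).

Definition off_diagonal : set (M * M) := [set x | x.1 <> x.2].

Lemma cts_slice (p : M) : continuous (fun q : M => (p, q)).
Proof. by apply: cts_pair => q; [exact: cvg_cst|exact: cvg_id]. Qed.

Definition slice (p : M) : continuousType M (M * M)%type :=
  mkcts (@cts_slice p).

Definition orientation (tau : {additive homology R 4 off_diagonal -> int}) :=
  forall p : M, bijective
    (fun a : homology R 4 [set q | q <> p] => tau (hmap off_diagonal (slice p) a)).

Definition intersection_form (form : H2 -> H2 -> int) :=
  exists2 tau, orientation tau &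
    forall a b, form a b = tau (hcross off_diagonal a b : homology R (2 + 2) _).

End IntersectionForm.

Section Lattice.
Variable H : zmodType.

Definition is_basis (V : set H) k (b : 'I_k -> H) :=
  (forall i, V (b i)) /\
  forall u, V u -> exists! c : 'cV[int]_k, u = \sum_i b i *~ c i 0.

(* T has characteristic polynomial p on the subgroup V, which is free of finite
   rank and mapped to itself by T. *)
Definition is_charpoly (V : set H) (T : H -> H) (p : {poly int}) :=
  exists k (b : 'I_k -> H) (N : 'M[int]_k),
    [/\ is_basis V b,
        forall j, T (b j) = \sum_i b i *~ N i j &
        p = char_poly N].

Definition charpoly (V : set H) (T : H -> H) : {poly int} :=
  xget 0 [set p | is_charpoly V T p].

(* The division is exact when v is in antiinvariant_basis below and u is in the
   antiinvariant sublattice: form v v is - 2, or - 4 with form u v even. *)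
Definition reflection (form : H -> H -> int) (v u : H) : H :=
  u - v *~ ((2 * form u v) %/ form v v)%Z.

(* The composition s_{b 0} \o s_{b 1} \o ... *)
Definition reflection_product (form : H -> H -> int) k
    (b : 'I_k -> H) : H -> H :=
  fun u => foldr (fun i w => reflection form (b i) w) u (enum 'I_k).

(* d lists delta^(1)_1, ..., delta^(1)_mu0, delta^(2)_1, ..., delta^(2)_mu0,
   delta'_1, ..., delta'_mu1 in this order. *)
Section BoundaryBasis.
Variables (mu0 mu1 : nat) (d : 'I_(mu0 + mu0 + mu1) -> H).

Definition delta1 (i : 'I_mu0) : H := d (lshift mu1 (lshift mu0 i)).
Definition delta2 (i : 'I_mu0) : H := d (lshift mu1 (rshift mu0 i)).
Definition delta' (j : 'I_mu1) : H := d (rshift (mu0 + mu0) j).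

Definition boundary_basis (form : H -> H -> int) (sigma : H -> H) :=
  [/\ is_basis setT d,
      forall i, form (d i) (d i) = - 2,
      forall i, sigma (delta1 i) = delta2 i,
      forall j, sigma (delta' j) = - delta' j &
      exists (A : 'M[int]_mu0) (B : 'M[int]_(mu0, mu1)) (A' : 'M[int]_mu1),
        forall i j, form (d i) (d j) =
          block_mx (block_mx A 0 0 A) (col_mx B (- B))
                   (row_mx B^T (- B^T)) A' i j].

Definition antiinvariant_basis (i : 'I_(mu0 + mu1)) : H :=
  match fintype.split i with
  | inl i => delta1 i - delta2 i
  | inr j => delta' j
  end.

End BoundaryBasis.

Definition antiinvariant (sigma : H -> H) : set H :=
  [set u | sigma u = - u].

End Lattice.

Section Milnor.
Variable R : realType.
Local Notation C := R[i].
Local Notation C3 := 'rV[R[i]]_3.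
Local Notation poly3 := (mpoly 3 R[i]).

Definition pvar (i : 'I_3) : poly3 := mpolyX C (mnm1 i).
Definition px : poly3 := pvar (@Ordinal 3 0 isT).
Definition py : poly3 := pvar (@Ordinal 3 1 isT).
Definition pz : poly3 := pvar (@Ordinal 3 2 isT).

Definition peval (f : poly3) (p : C3) : C := meval (p 0) f.

Definition ambient (fbar : poly3) : poly3 :=
  comp_mpoly [tuple px ^+ 2; py; pz] fbar.

Definition milnor_fibre (f : poly3) (eps : R) (lam : C) : set C3 :=
  [set p | peval f p = lam /\ \sum_i `|p 0 i| ^+ 2 < (eps ^+ 2)%:C].

Definition flip (p : C3) : C3 :=
  \row_i (if i == 0 then - p 0 i else p 0 i).

Lemma flip_fibre fbar eps lam (p : milnor_fibre (ambient fbar) eps lam) :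
  flip (val p) \in milnor_fibre (ambient fbar) eps lam.
Proof.
case: p => p /= /set_mem[fp bp]; apply/mem_set; split.
  rewrite -fp /peval /ambient !comp_mpoly_meval.
  apply: meval_eq => -[[|[|[|//]]] h];
    rewrite !(tnth_nth 0) /= /px /py /pz /pvar.
  - by rewrite !rmorphXn /= !mevalXU !mxE /= sqrrN.
  - by rewrite !mevalXU !mxE.
  - by rewrite !mevalXU !mxE.
rewrite (eq_bigr (fun i => `|p 0 i| ^+ 2)) // => i _.
by rewrite mxE; case: ifP; rewrite ?normrN.
Qed.

Definition involution_fun fbar eps lam (p : milnor_fibre (ambient fbar) eps lam) :
    milnor_fibre (ambient fbar) eps lam := SigSub (flip_fibre p).

Lemma cts_involution fbar eps lam : continuous (@involution_fun fbar eps lam).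
Proof.
apply: cts_into; rewrite /comp /=; apply: cts_mx => i j.
set g := (X in continuous X); have [j0|j0] := boolP (j == 0).
  have -> : g = (fun t => - val t 0 j).
    by apply/funext => p; rewrite /g mxE j0.
  by move=> p; exact: cvgN (@cts_val_coord _ _ _ _ 0 j p).
have -> : g = (fun t => val t 0 j); last exact: cts_val_coord.
by apply/funext => p; rewrite /g mxE (negbTE j0).
Qed.

Definition involution fbar eps lam :
    continuousType (milnor_fibre (ambient fbar) eps lam)
                   (milnor_fibre (ambient fbar) eps lam) :=
  mkcts (@cts_involution fbar eps lam).

Definition unit_interval : set R := `[0, 1].

Definition loop (lam : C) (t : R) : C :=
  lam * (cos (2 * pi * t) +i* sin (2 * pi * t)).

(* The Milnor fibration pulled back along the loop t |-> lam e^(2 i pi t). *)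
Definition milnor_tube (f : poly3) (eps : R) (lam : C) : set (R * C3) :=
  [set q | unit_interval q.1 /\ milnor_fibre f eps (loop lam q.1) q.2].

(* h is the end of a trivialization, over [0, 1], of the pulled back fibration
   that starts at the identity of the fibre. *)
Definition geometric_monodromy (f : poly3) (eps : R) (lam : C)
    (h : continuousType (milnor_fibre f eps lam) (milnor_fibre f eps lam)) :=
  exists (Phi : (unit_interval * milnor_fibre f eps lam)%type ->
                milnor_tube f eps lam)
         (Psi : milnor_tube f eps lam ->
                (unit_interval * milnor_fibre f eps lam)%type),
    [/\ continuous Phi, continuous Psi, cancel Phi Psi & cancel Psi Phi] /\
    [/\ forall t p, (val (Phi (t, p))).1 = val t,
        forall t p, val t = 0 -> (val (Phi (t, p))).2 = val p &
        forall t p, val t = 1 -> (val (Phi (t, p))).2 = val (h p)].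

Definition weighted_homogeneous (w : 'I_3 -> nat) (m : nat) (g : poly3) :=
  forall e, e \in msupp g -> (\sum_i w i * e i)%N = m.

(* b induces a basis of the degree m part of C[x, y, z] / (f). *)
Definition graded_basis (w : 'I_3 -> nat) (f : poly3) (m k : nat)
    (b : 'I_k -> poly3) :=
  (forall i, weighted_homogeneous w m (b i)) /\
  forall g, weighted_homogeneous w m g ->
    exists! c : 'cV[C]_k, exists q, g - \sum_i c i 0 *: b i = q * f.

(* The dimension of the degree m part of C[x, y, z] / (f): the coefficient of
   t^m in the Poincare series. *)
Definition poincare_coef (w : 'I_3 -> nat) (f : poly3) (m : nat) : nat :=
  xget 0%N [set k | exists b : 'I_k -> poly3, graded_basis w f m b].

End Milnor.

(* The power series \sum_m a_m t^m equals the rational function r. *)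
Definition expands_to (r : {fraction {poly int}}) (a : nat -> nat) :=
  exists N D : {poly int},
    [/\ D != 0, r = tofrac N / tofrac D &
        forall m, \sum_(i < m.+1) D`_i * (a (m - i)%N)%:Z = N`_m].

Inductive simple_boundary := B_type of nat | C_type of nat | F4_type.

Definition admissible (T : simple_boundary) : bool :=
  match T with
  | B_type n => (2 <= n)%N
  | C_type n => (3 <= n)%N
  | F4_type => true
  end.

Definition fbar (R : realType) (T : simple_boundary) : mpoly 3 R[i] :=
  match T with
  | B_type n => px R ^+ n + py R ^+ 2 + pz R ^+ 2
  | C_type n => px R * py R + py R ^+ n + pz R ^+ 2
  | F4_type => px R ^+ 2 + py R ^+ 3 + pz R ^+ 2
  end.

Definition weights (T : simple_boundary) (i : 'I_3) : nat :=
  nth 0%N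
    match T with
    | B_type n => [:: 1; n; n]
    | C_type n => [:: n.-1; 2; n]
    | F4_type => [:: 3; 4; 6]
    end%N i.

(* Extended Dynkin diagrams of types A_{2n-1} (the cycle 0, ..., 2n-1), D_{n+1}
   (the chain 1, ..., n with 0 attached to 2 and n+1 attached to n-1) and E_6
   (three arms of length 2 at 0). *)
Definition affine_size (T : simple_boundary) : nat :=
  match T with
  | B_type n => n.*2
  | C_type n => n.+2
  | F4_type => 7
  end.

Definition affine_arrow (T : simple_boundary) : rel nat :=
  match T with
  | B_type n => fun i j => j == i.+1 %% n.*2
  | C_type n => fun i j => [|| (0 < i < n) && (j == i.+1),
                               (i == 0) && (j == 2) |
                               (i == n.-1) && (j == n.+1)]
  | F4_type => fun i j =>
      (i, j) \in [:: (0, 1); (1, 2); (0, 3); (3, 4); (0, 5); (5, 6)]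
  end%N.

Definition affine_edge (T : simple_boundary) (i j : 'I_(affine_size T)) : bool :=
  affine_arrow T i j || affine_arrow T j i.

Definition affine_form (T : simple_boundary) : 'M[int]_(affine_size T) :=
  \matrix_(i, j) if i == j then 2 else - (affine_edge i j)%:R.

(* u |-> u - (u, alpha_j) alpha_j, acting on columns of coordinates with respect
   to the simple roots. *)
Definition simple_reflection (T : simple_boundary) (j : 'I_(affine_size T)) :
    'M[int]_(affine_size T) :=
  1%:M - delta_mx j j *m affine_form T.

Definition coxeter_order (T : simple_boundary) (s : seq 'I_(affine_size T)) :=
  perm_eq s (enum 'I_(affine_size T)) /\
  if T is B_type _ then
    exists2 colour : pred 'I_(affine_size T),
      forall i j, affine_edge i j -> colour i != colour j &
      s = seq.filter colour s ++ seq.filter (predC colour) s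
  else True.

Definition affine_coxeter (T : simple_boundary) (s : seq 'I_(affine_size T)) :
    'M[int]_(affine_size T) :=
  \big[mulmx/1%:M]_(j <- s) simple_reflection j.

(* Main.v *)
(* As phi_f is monic, phi_f / psi_f = phi_X / psi_X, and both sides of the theorem
   can be computed.

   The monomials x^i y^j z^e with e < 2 form a basis of C[x, y, z] / (f), whence
   p_X = (1 + t^q3) / ((1 - t^q1) (1 - t^q2)).

   Let U be the unitriangular matrix, for the chosen order of the simple roots,
   with U + U^T the matrix of the form. The Coxeter element P satisfies
   U P = - U^T, hence psi_X = det (t U + U^T). Putting t = u^2 and conjugating by
   a diagonal matrix of powers of u turns this into det (u^2 + 1 - u Adj), where
   Adj is the adjacency matrix of the diagram; the order has disappeared. The
   determinant is evaluated by exhibiting a triangular X with M X triangular.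

   For phi_X write f = g (x, y) + z^2 and use the coordinates a = g / lam and
   w = z / sqrt lam on the Milnor fibre, so that w^2 = 1 - a. Following Pham, the
   fibre retracts to the part where a lies in [0, 1] or is small. This part is the
   union of two contractible pieces, according to the sign of Re w, whose
   intersection retracts to the curve g = lam in the plane z = 0, and then to a
   graph. The graph is the union of two open sets U and V such that the components
   of U, V and their intersection are contractible and are labelled by roots of
   unity. Two Mayer-Vietoris arguments identify H_2 with the group of integral
   functions on the set of edges (the components of the intersection) whose sums
   around every component of U and of V vanish. The monodromy is homotopic to
   the rotation by (e^(2 i pi q1 / d), e^(2 i pi q2 / d), -1), which permutes the
   edges and, interchanging the signs of Re w, acts by minus this permutation.
   For A and E_6 the graph is the join of two groups of roots of unity, with
   x^p / lam in [0, 1]. For D_(n+1) it lies over the circle |y^n / lam| = 1. *)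

Require Import Defs.
From HB Require Import structures.
From mathcomp Require Import all_boot all_order all_algebra.
From mathcomp Require Import complex.
From mathcomp Require Import all_classical all_reals all_analysis.
From mathcomp Require Import freeg.
From mathcomp Require Import -(notations) mpoly.
From mathcomp Require Import ring lra zify.
Set Implicit Arguments.
Unset Strict Implicit.
Unset Printing Implicit Defensive.
Import Order.TTheory GRing.Theory Num.Theory.
Import numFieldNormedType.Exports.
Local Open Scope classical_set_scope.
Local Open Scope ring_scope.
Local Open Scope complex_scope.

(** * Characteristic polynomials on lattices *)

Section Companion.

(** The fibre is cut out by a round ball whereas the available scalings are weighted, so every
    deformation has to be checked against the Euclidean norm. Multipliers are arranged to have
    modulus at most 1, and nonnegative real part, so that their principal roots are continuous.
    Points near z = 0 may leave the ball when moved to z = 0; hence the two halves overlap only in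
    the points that can be moved. Shrinking (x, y) makes z grow, which is harmless once |lam| d <
    eps^2. For D_(n+1), |y| grows inside the circle, and |x| has to outweigh it. No exact sequence
    is formed: vanishing relative homology and the connecting homomorphisms are relations between
    chains modulo degenerate cubes. Characteristic polynomials are defined by choice, with default
    0; that of the fibre is computed in integral coordinates, while on the antiinvariant lattice the
    existence of a basis suffices for cancelling. *)

Definition comp_mx n (p : nat -> int) : 'M[int]_n :=
  \matrix_(i, j) if i == n.-1 :> nat then - p j else (i.+1 == j :> nat)%:R.

Lemma char_comp_mx n (p : nat -> int) : (0 < n)%N ->
  char_poly (comp_mx n p) = 'X^n + \poly_(i < n) p i.
Proof.
move=> n0; set P := _ + _.
have sP : (size (\poly_(i < n) p i)%R < n.+1)%N by rewrite ltnS size_poly.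
have szP : size P = n.+1 by rewrite /P size_polyDl size_polyXn.
have mP : P \is monic.
  rewrite monicE lead_coefE szP /= coefD coefXn eqxx coef_poly ltnn addr0 //.
have := companionmxK mP; rewrite /companionmx; move: (szP); set d := (size P).-1 => szP'.
have -> : d = n by rewrite /d szP.
move=> <-; congr char_poly; apply/matrixP => i j; rewrite !mxE.
have -> // : P`_j = p j.
by rewrite /P coefD coefXn coef_poly (ltn_ord j) ltn_eqF // add0r.
Qed.
End Companion.

Section Transport.
Variable H : zmodType.

Lemma additive_sum (K : zmodType) (f : H -> K) : (forall a b, f (a - b) = f a - f b) ->
  forall k (b : 'I_k -> H) (c : 'I_k -> int), f (\sum_i b i *~ c i) = \sum_i f (b i) *~ c i.
Proof.
move=> fB k b c.
have f0 : f 0 = 0 by rewrite -(subr0 0) fB subrr.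
have fN a : f (- a) = - f a by rewrite -sub0r fB f0 sub0r.
have fD a a' : f (a + a') = f a + f a' by rewrite -[a' in LHS]opprK fB fN opprK.
have fM a n : f (a *+ n) = f a *+ n.
  by elim: n => [|n IH]; rewrite ?mulr0n // !mulrS fD IH.
rewrite (big_morph f fD f0); apply: eq_bigr => i _; case: (c i) => n; first exact: fM.
by rewrite NegzE !mulrNz fN -!pmulrn fM.
Qed.

(** The matrices come from two bases of one lattice, whose sizes could differ a priori; mutually
    inverse P and Q force m = k. Then (X - N) P = P (X - N'), and det P cancels. *)
Lemma char_poly_sim m k (N : 'M[int]_m) (N' : 'M[int]_k) (P : 'M[int]_(m, k)) (Q : 'M[int]_(k, m)) :
  P *m Q = 1%:M -> Q *m P = 1%:M -> N *m P = P *m N' -> char_poly N = char_poly N'.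
Proof.
move=> PQ QP; have mk : m = k.
  by apply/eqP; rewrite eqn_leq (mulmx1_min PQ) (mulmx1_min QP).
case: _ / mk in N' P Q PQ QP * => sim.
have dP : \det (map_mx polyC P) != 0.
  apply/eqP => d0; have := congr1 (fun A => \det (map_mx polyC A)) PQ.
  by rewrite map_mxM det_mulmx d0 mul0r map_mx1 det1 => /eqP; rewrite eq_sym oner_eq0.
apply: (mulIf dP); rewrite /char_poly -det_mulmx [RHS]mulrC -det_mulmx; congr (\det _).
by rewrite /char_poly_mx mulmxBl mulmxBr -!map_mxM sim scalar_mxC.
Qed.

(** [charpoly] is a choice among all admissible polynomials, so existence and uniqueness are both at
    stake. The preimages [a i] of the unit vectors under [Phi] form a basis with matrix N, and any
    other basis gives a similar matrix. *)
Lemma charpoly_transport (T : H -> H) m (Phi : H -> 'cV[int]_m) (N : 'M[int]_m) :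
  (forall a b, Phi (a - b) = Phi a - Phi b) -> (forall a, Phi a = 0 -> a = 0) ->
  (forall x, exists a, Phi a = x) -> (forall a, Phi (T a) = N *m Phi a) ->
  charpoly setT T = char_poly N.
Proof.
move=> PhiB Phi0 PhiS PhiT.
have [a aE] := choice (fun i : 'I_m => PhiS (delta_mx i 0)).
have sumE k (b : 'I_k -> H) (c : 'cV[int]_k) :
    Phi (\sum_i b i *~ c i 0) = \matrix_(i, j) Phi (b j) i 0 *m c.
  rewrite (additive_sum PhiB b (fun i => c i 0)); apply/matrixP => i j.
  rewrite (ord1 j) summxE mxE; apply: eq_bigr => l _; rewrite mxE.
  by case: (c l 0) => n; rewrite ?NegzE ?mulrNz ?mulrN ?mxE -pmulrn mulmxnE -mulr_natr natz.
have Phi_inj u v : Phi u = Phi v -> u = v.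
  by move=> E; apply/eqP; rewrite -subr_eq0; apply/eqP/Phi0; rewrite PhiB E subrr.
have aI : \matrix_(i, j) Phi (a j) i 0 = 1%:M.
  by apply/matrixP => i j; rewrite mxE aE !mxE eqxx andbT.
have uniq q : is_charpoly setT T q -> q = char_poly N.
  move=> [k [b [N' [[_ bu] bT ->]]]].
  have [Q QE] := choice (fun i => let: ex_intro c cE := bu (a i) Logic.I in ex_intro _ c cE.1).
  pose P : 'M[int]_(m, k) := \matrix_(i, j) Phi (b j) i 0.
  pose QM : 'M[int]_(k, m) := \matrix_(i, j) Q j i 0.
  have PQ : P *m QM = 1%:M.
    rewrite -aI; apply/matrixP => i j; rewrite [RHS]mxE QE sumE mxE [RHS]mxE.
    by apply: eq_bigr => l _; rewrite [QM _ _]mxE.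
  (* P is injective because coordinates in the basis b are unique; together with P Q = 1 this yields
     Q P = 1. *)
  have P0 (c c' : 'cV_k) : P *m c = P *m c' -> c = c'.
    rewrite -!sumE => /Phi_inj E; have [c0 [_ cu]] := bu _ (Logic.I : setT (\sum_i b i *~ c i 0)).
    by rewrite -(cu c) // -(cu c').
  have QP : QM *m P = 1%:M.
    apply/matrixP => i j; have := P0 (QM *m P *m delta_mx j 0) (delta_mx j 0).
    rewrite -!mulmxA mulmxA PQ mul1mx => /(_ erefl)/(congr1 (fun M : 'cV_k => M i 0)).
    by rewrite mulmxA -colE !mxE eqxx andbT.
  apply/esym; apply: (char_poly_sim PQ QP); apply/matrixP => i j.
  have := PhiT (b j); rewrite bT (_ : \sum_i _ = \sum_i b i *~ (col j N') i 0); last first.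
    by apply: eq_bigr => l _; rewrite mxE.
  rewrite sumE => /(congr1 (fun M : 'cV_m => M i 0)); rewrite colE mulmxA -colE mxE => ->.
  by rewrite !mxE; apply: eq_bigr => l _; rewrite !mxE.
apply: xget_subset1 => [|p q /uniq -> /uniq -> //].
exists m, a, N; split=> //.
  split=> // u _; exists (Phi u); split; last by move=> c ->; rewrite sumE aI mul1mx.
  by apply: Phi_inj; rewrite sumE aI mul1mx.
move=> j; apply: Phi_inj.
rewrite PhiT (_ : \sum_i _ = \sum_i a i *~ (col j N) i 0); last first.
  by apply: eq_bigr => l _; rewrite mxE.
by rewrite sumE aI mul1mx aE colE.
Qed.
End Transport.

Section ThetaTransport.
Variables (H : zmodType) (E : finType) (T : H -> H) (B : {ffun E -> int} -> Prop).
Variables (Theta : H -> {ffun E -> int}) (m : nat).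
Variables (kap : {ffun E -> int} -> 'cV[int]_m) (N : 'M[int]_m).
Hypothesis ThetaB : forall a b, Theta (a - b) = Theta a - Theta b.
Hypothesis Theta0 : forall a, Theta a = 0 -> a = 0.
Hypothesis ThetaE : forall th, B th <-> exists a, Theta a = th.
Hypothesis kapB : forall x y, kap (x - y) = kap x - kap y.
Hypothesis kap0 : forall th, B th -> kap th = 0 -> th = 0.
Hypothesis kapS : forall x, exists2 th, B th & kap th = x.
Hypothesis kapT : forall a, kap (Theta (T a)) = N *m kap (Theta a).

(** [kap] is defined on all functions on E but is bijective only on the image B of [Theta]: it may
    select a few values that determine the rest. *)
Lemma charpoly_Theta : charpoly setT T = char_poly N.
Proof.
apply: (@charpoly_transport _ _ _ (fun a => kap (Theta a))) => //.
- by move=> a b; rewrite ThetaB kapB.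
- by move=> a /kap0 h; apply: Theta0; apply: h; apply/ThetaE; exists a.
- by move=> x; have [th /ThetaE[a <-] <-] := kapS x; exists a.
Qed.
End ThetaTransport.

Section SumPairs.
Variables (I J : finType) (F : I * J -> int).

Lemma sum_fst i : \sum_(e | e.1 == i) F e = \sum_j F (i, j).
Proof.
rewrite (eq_bigl (fun e => (e.1 == i) && true)); last by move=> e; rewrite andbT.
rewrite (eq_bigr (fun e => F (e.1, e.2))); last by case.
by rewrite -(pair_big (fun a => a == i) xpredT (fun a b => F (a, b))) /= big_pred1_eq.
Qed.

Lemma sum_snd j : \sum_(e | e.2 == j) F e = \sum_i F (i, j).
Proof.
rewrite (eq_bigr (fun e => F (e.1, e.2))); last by case.
rewrite -(pair_big xpredT (fun b => b == j) (fun a b => F (a, b))) /=.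
by apply: eq_bigr => i _; rewrite big_pred1_eq.
Qed.
End SumPairs.

(** * Coxeter elements of affine diagrams *)

Section CoxeterProduct.
Variables (n : nat) (F : 'M[int]_n).
Hypothesis F2 : forall i, F i i = 2.
Hypothesis Fsym : forall i j, F i j = F j i.

Let refl j : 'M[int]_n := 1%:M - delta_mx j j *m F.
Let cox s : 'M[int]_n := \big[mulmx/1%:M]_(j <- s) refl j.
Let aft s (i k : 'I_n) := (k \in s) && (index i s < index k s)%N.

Lemma mul_refl j (A : 'M[int]_n) i k :
  (refl j *m A) i k = A i k - (i == j)%:R * \sum_l F j l * A l k.
Proof.
rewrite /refl mulmxBl mul1mx -mulmxA [LHS]mxE [in LHS]mxE; congr (_ - _).
rewrite mxE (bigD1 j) //= big1 ?addr0 => [|l lj]; last first.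
  by rewrite !mxE (negbTE lj) andbF mul0r.
by rewrite !mxE eqxx andbT.
Qed.

Lemma cox_notin s i j : i \notin s -> cox s i j = (i == j)%:R.
Proof.
elim: s => [|a s IH]; first by rewrite /cox big_nil mxE.
rewrite inE negb_or => /andP[ia /IH is_].
by rewrite /cox big_cons mul_refl (negbTE ia) mul0r subr0.
Qed.

(** Row i of U P = - U^T, stated for partial products so that induction on s applies. A further
    reflection in [a] on the left changes only row a, which has all of s after it; the other rows
    and their [aft] stay the same. *)
Lemma cox_row s i j : uniq s -> i \in s ->
  cox s i j + \sum_k (aft s i k)%:R * F i k * cox s k j =
  - ((i == j)%:R + (~~ aft s i j && (j != i))%:R * F i j).
Proof.
elim: s => [//|a s IH] /= /andP[a_s us].
have consE k l : cox (a :: s) k l = cox s k l - (k == a)%:R * \sum_m F a m * cox s m l.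
  by rewrite /cox big_cons mul_refl.
rewrite inE; case: (eqVneq i a) => [-> _|ia /= is_].
  have aftE k : aft (a :: s) a k = (k \in s).
    rewrite /aft inE /= eqxx; case: (eqVneq a k) => [<-|ak]; first by rewrite ltnn andbF (negbTE a_s).
    by rewrite andbT.
  rewrite consE eqxx mul1r (cox_notin _ a_s) aftE.
  under eq_bigr => k _ do rewrite aftE consE.
  have -> : \sum_k (k \in s)%:R * F a k * (cox s k j - (k == a)%:R * \sum_m F a m * cox s m j) =
      \sum_k (k \in s)%:R * F a k * cox s k j.
    apply: eq_bigr => k _; case: (eqVneq k a) => [->|_]; first by rewrite (negbTE a_s) !mul0r.
    by rewrite mul0r subr0.
  rewrite -addrA [- _ + _]addrC -sumrB.
  rewrite (eq_bigr (fun k => - ((k \notin s)%:R * F a k * (k == j)%:R))); last first.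
    by move=> k _; case: (boolP (k \in s)) => ks /=; rewrite ?(cox_notin _ ks); ring.
  rewrite (bigD1 j) //= big1 ?addr0 => [|k kj]; last by rewrite (negbTE kj) mulr0 oppr0.
  rewrite eqxx mulr1; case: (eqVneq j a) => [->|ja].
    by rewrite a_s F2 /= mul0r; ring.
  by rewrite andbT /= mulr0n; ring.
have aftE k : aft (a :: s) i k = aft s i k.
  rewrite /aft inE /= ![a == _]eq_sym (negbTE ia); case: (eqVneq k a) => [->|ka] //=.
  by rewrite (negbTE a_s).
rewrite consE (negbTE ia) mul0r subr0 aftE -(IH us is_); congr (_ + _).
apply: eq_bigr => k _; rewrite aftE consE; case: (eqVneq k a) => [->|_].
  by rewrite /aft (negbTE a_s) !mul0r.
by rewrite mul0r subr0.
Qed.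

Variable s : seq 'I_n.
Hypothesis s_enum : perm_eq s (enum 'I_n).

Let U : 'M[int]_n := \matrix_(i, j) ((i == j)%:R + (index i s < index j s)%N%:R * F i j).

Lemma mul_cox : U *m cox s = - U^T.
Proof.
have us : uniq s by rewrite (perm_uniq s_enum) enum_uniq.
have sT i : i \in s by rewrite (perm_mem s_enum) mem_enum.
apply/matrixP => i j; rewrite !mxE.
have -> : \sum_k U i k * cox s k j = cox s i j + \sum_k (aft s i k)%:R * F i k * cox s k j.
  rewrite (bigD1 i) //= [in RHS](bigD1 i) //= /aft ltnn andbF !mul0r add0r !mxE eqxx ltnn mul0r addr0 mul1r.
  by congr (_ + _); apply: eq_bigr => k ki; rewrite mxE eq_sym (negbTE ki) sT add0r.
rewrite cox_row // /aft sT /= -leqNgt eq_sym Fsym; congr (- (_ + _%:R * _)).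
case: (eqVneq j i) => [->|ji]; first by rewrite ltnn andbF.
rewrite andbT leq_eqVlt; case: eqVneq => //= E; case/eqP: ji.
by have := congr1 (nth i s) E; rewrite !nth_index.
Qed.

Local Notation X := ('X : {poly int}).

Lemma char_cox_det :
  (\det U)%:P * char_poly (cox s) = \det (X *: map_mx polyC U + map_mx polyC U^T).
Proof.
rewrite -det_map_mx /char_poly -det_mulmx /char_poly_mx mulmxBr -map_mxM mul_cox.
by rewrite mul_mx_scalar map_mxN opprK.
Qed.

(* With t = u^2, conjugation by the diagonal matrix of the powers u^(pot i)
   makes the matrix independent of the order s. *)
Lemma char_cox (pot : 'I_n -> nat) (psi : {poly int}) : psi \is monic ->
  (forall i j, i != j -> F i j != 0 -> (index i s < index j s)%N -> pot i = (pot j).+1) ->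
  \det (\matrix_(i, j) if i == j then X ^+ 2 + 1 else X * (F i j)%:P) = psi \Po X ^+ 2 ->
  char_poly (cox s) = psi.
Proof.
move=> psim potP; set M := \matrix_(i, j) _ => detM.
have us : uniq s by rewrite (perm_uniq s_enum) enum_uniq.
have sT i : i \in s by rewrite (perm_mem s_enum) mem_enum.
set K := X *: map_mx polyC U + map_mx polyC U^T.
pose D := diag_mx (\row_i X ^+ pot i).
have KD : map_mx (comp_poly (X ^+ 2)) K *m D = D *m M.
  apply/matrixP => i j; rewrite mul_mx_diag mul_diag_mx !mxE [j == i]eq_sym.
  rewrite comp_polyD comp_polyM comp_polyX !comp_polyC.
  case: (eqVneq i j) => [->|ij]; first by rewrite ltnn mul0r addr0 polyC1; ring.
  rewrite (Fsym j i) !add0r.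
  have [F0|F0] := eqVneq (F i j) 0; first by rewrite F0 !mulr0 polyC0; ring.
  have [lt_ij|lt_ji|E] := ltngtP (index i s) (index j s).
  - by rewrite (potP i j) // [X ^+ (pot j).+1]exprS mul1r mul0r polyC0; ring.
  - have Fji : F j i != 0 by rewrite Fsym.
    have -> : pot j = (pot i).+1 by apply: (potP _ _ _ Fji lt_ji); rewrite eq_sym.
    by rewrite [X ^+ (pot i).+1]exprS mul1r mul0r polyC0; ring.
  - by case/eqP: ij; have := congr1 (nth i s) E; rewrite !nth_index.
have D0 : \det D != 0.
  by rewrite det_diag; apply/prodf_neq0 => i _; rewrite mxE expf_neq0 // polyX_eq0.
have XI : injective (comp_poly (X ^+ 2)).
  move=> p q /eqP; rewrite -subr_eq0 -raddfB /= comp_poly_eq0 ?subr_eq0 => [/eqP//|].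
  by rewrite size_polyXn.
have KE : \det K = psi.
  apply: XI; rewrite -detM.
  apply: (mulIf D0); rewrite [RHS]mulrC -[RHS]det_mulmx -KD det_mulmx; congr (_ * _).
  by rewrite -(det_map_mx (comp_poly (X ^+ 2))).
move: char_cox_det; rewrite -/K KE => E.
(* det U = 1 is read off from the leading coefficients, since [psi] and the characteristic
   polynomial are monic. *)
have := congr1 lead_coef E.
rewrite lead_coefM lead_coefC (monicP (char_poly_monic _)) mulr1 (monicP psim) => detU.
by move: E; rewrite detU polyC1 mul1r.
Qed.
End CoxeterProduct.

Section AffineDeterminants.
Local Notation P := {poly int}.
Local Notation X := ('X : {poly int}).

Lemma comp_poly1 (q : P) : 1 \Po q = 1.
Proof. by rewrite -polyC1 comp_polyC. Qed.

Lemma det_triangular (A : 'M[P]_7) : (forall i j : 'I_7, (i < j)%N -> A i j = 0) ->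
  \det A = \prod_i A i i.
Proof. by move=> A0; apply/det_trig/is_trig_mxP. Qed.

Let MX T := \matrix_(i, j) if i == j then X ^+ 2 + 1 else X * (affine_form T i j)%:P.

Lemma det_F : \det (MX F4_type) =
  ((X + 1) * (X - 1) ^+ 2 * (X ^+ 2 + X + 1) ^+ 2) \Po X ^+ 2.
Proof.
pose c := X ^+ 2 + 1; pose u := X.
pose col (l : seq P) (i : nat) := nth 0 l i.
(* Elimination from the tips of the three arms to the centre: the column of a vertex lives on this
   vertex and what lies beyond it, and solves the equations at the vertices beyond. Hence X is lower
   and M X upper triangular. *)
pose x := [:: [:: c ^+ 2 - u ^+ 2; c * u; u ^+ 2; c * u; u ^+ 2; c * u; u ^+ 2];
  [:: 0; c; u]; [:: 0; 0; 1]; [:: 0; 0; 0; c; u]; [:: 0; 0; 0; 0; 1];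
  [:: 0; 0; 0; 0; 0; c; u]; [:: 0; 0; 0; 0; 0; 0; 1]].
pose y := [:: [:: c ^+ 3 - 4%:R * c * u ^+ 2]; [:: - (c * u); c ^+ 2 - u ^+ 2];
  [:: 0; - u; c]; [:: - (c * u); 0; 0; c ^+ 2 - u ^+ 2]; [:: 0; 0; 0; - u; c];
  [:: - (c * u); 0; 0; 0; 0; c ^+ 2 - u ^+ 2]; [:: 0; 0; 0; 0; 0; - u; c]].
pose Xm : 'M[P]_7 := \matrix_(i, j) nth 0 (nth [::] x j) i.
pose Ym : 'M[P]_7 := \matrix_(i, j) nth 0 (nth [::] y j) i.
have XY : MX F4_type *m Xm = Ym.
  apply/matrixP => i j; rewrite mxE.
  transitivity (\sum_(k < 7) (if i == k :> nat then c else - u * (affine_arrow F4_type i k || affine_arrow F4_type k i)%:R) * nth 0 (nth [::] x j) k).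
    apply: eq_bigr => k _; rewrite !mxE (inj_eq val_inj); congr (_ * _); case: eqVneq => // ik.
    by rewrite polyCN -[affine_arrow _ i k || _]/(affine_edge i k); case: (affine_edge i k); rewrite /= ?mulr1n ?mulr0n ?polyC1 ?polyC0 /u; ring.
  rewrite mxE; case: i j => [i i7] [j j7] /=; rewrite !big_ord_recr big_ord0 /=.
  case: j j7 => [|[|[|[|[|[|[|//]]]]]]] j7; case: i i7 => [|[|[|[|[|[|[|//]]]]]]] i7 /=;
    rewrite /c /u; ring.
have dX : \det Xm = c ^+ 3 * (c ^+ 2 - u ^+ 2).
  rewrite det_triangular ?big_ord_recr ?big_ord0 /=; last first.
    by move=> [i i7] [j j7] /=; rewrite !mxE /=; case: i i7 => [|[|[|[|[|[|[|//]]]]]]] i7; case: j j7 => [|[|[|[|[|[|[|//]]]]]]] j7.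
  by rewrite !mxE /=; ring.
have dY : \det Ym = (c ^+ 3 - 4%:R * c * u ^+ 2) * c ^+ 3 * (c ^+ 2 - u ^+ 2) ^+ 3.
  rewrite -det_tr det_triangular ?big_ord_recr ?big_ord0 /=; last first.
    by move=> [i i7] [j j7] /=; rewrite !mxE /=; case: i i7 => [|[|[|[|[|[|[|//]]]]]]] i7; case: j j7 => [|[|[|[|[|[|[|//]]]]]]] j7.
  by rewrite !mxE /=; ring.
have nz : c ^+ 3 * (c ^+ 2 - u ^+ 2) != 0.
  apply/negP => /eqP /(congr1 (fun p : P => p.[0])).
  by rewrite /c /u !hornerE /=.
apply: (mulIf nz); rewrite -[in LHS]dX -det_mulmx XY dY.
rewrite ![in X in _ = X]expr2 !(comp_polyM, comp_polyD, comp_polyB, comp_polyX, comp_poly1).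
by rewrite /c /u; ring.
Qed.

(** With S the cyclic shift of the 2n vertices, S S^T = 1 gives (u - S) (u - S)^T = u^2 + 1 - u (S +
    S^T), which is the matrix in question. So the determinant is (u^(2n) - 1)^2. *)
Lemma det_B n : (1 < n)%N -> \det (MX (B_type n)) = (X ^+ n - 1) ^+ 2 \Po X ^+ 2.
Proof.
move=> n1; set N := n.*2; have N2 : (2 < N)%N by rewrite /N; lia.
pose S := comp_mx N (fun j => - (j == 0%N)%:R).
have SE (i j : 'I_N) : S i j = (j == (i.+1 %% N)%N :> nat)%:R.
  rewrite mxE opprK; have iN := ltn_ord i; case: eqVneq => [E|E].
    by rewrite (_ : i.+1 = N) ?modnn // E; lia.
  by rewrite modn_small ?[_ == i.+1]eq_sym //; lia.
pose nx (i : 'I_N) : 'I_N := Ordinal (ltn_pmod i.+1 (ltn_trans (isT : 0 < 2)%N N2)).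
have SST : S *m S^T = 1%:M.
  apply/matrixP => i j; rewrite !mxE (bigD1 (nx i)) //= big1 ?addr0 => [|k ki]; last first.
    by rewrite SE (_ : (_ == _) = false) ?mul0r //; apply/negbTE; apply: contraNneq ki => E; apply/eqP/val_inj.
  rewrite [S^T _ _]mxE !SE eqxx mul1r /=; congr (_%:R); congr (nat_of_bool _); apply/eqP/eqP => [|-> //].
  have iN := ltn_ord i; have jN := ltn_ord j; have [Ei|Ei] := eqVneq i.+1 N; have [Ej|Ej] := eqVneq j.+1 N.
  - by move=> _; apply: ord_inj; lia.
  - by rewrite Ei modnn modn_small; lia.
  - by rewrite Ej modnn modn_small; lia.
  - by rewrite !modn_small; [move=> [?]; exact: ord_inj|lia|lia].
have charS : char_poly S = X ^+ N - 1.
  rewrite char_comp_mx; last by lia.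
  congr (_ + _); apply/polyP => i; rewrite coef_poly coefN coef1.
  by case: i => [|i] /=; [rewrite (ltn_trans _ N2)|rewrite mulr0n oppr0 if_same].
clearbody S.
have -> : MX (B_type n) = char_poly_mx S *m (char_poly_mx S)^T.
  rewrite /char_poly_mx [(_ - _)^T]linearB /= tr_scalar_mx map_trmx.
  rewrite mulmxBl !mulmxBr -map_mxM SST map_mx1 !mul_scalar_mx mul_mx_scalar.
  apply/matrixP => i j; rewrite !mxE !SE; case: eqVneq => [->|ij] /=.
    have -> : (j == (j.+1 %% N)%N :> nat) = false.
      have jN := ltn_ord j; have [E|E] := eqVneq j.+1 N; first by rewrite E modnn; lia.
      by rewrite modn_small; lia.
    by rewrite polyC0; ring.
  rewrite !mulr0n polyCN -[affine_edge _ _]/((j == (i.+1 %% N)%N :> nat) || (i == (j.+1 %% N)%N :> nat)).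
  (* As 2n > 2, the two neighbours of a vertex are distinct, so that no entry of S + S^T is 2. *)
  have : ~~ ((j == (i.+1 %% N)%N :> nat) && (i == (j.+1 %% N)%N :> nat)).
    have iN := ltn_ord i; have jN := ltn_ord j.
    by have [Ei|Ei] := eqVneq i.+1 N; have [Ej|Ej] := eqVneq j.+1 N; rewrite ?Ei ?Ej ?modnn ?modn_small; lia.
  by case: (j == _ :> nat); case: (i == _ :> nat) => //= _; rewrite ?mulr1n ?mulr0n ?polyC1 ?polyC0; ring.
rewrite det_mulmx det_tr -[\det _]/(char_poly S) charS.
rewrite [(X ^+ n - 1) ^+ 2]expr2 comp_polyM comp_polyB comp_Xn_poly comp_poly1 -exprM.
by rewrite mul2n.
Qed.

Lemma sum_at N (g : nat -> P) (b : bool) a : (a < N)%N ->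
  \sum_(k < N) (b && (k == a :> nat))%:R * g k = if b then g a else 0.
Proof.
move=> aN; rewrite (bigD1 (Ordinal aN)) //= eqxx andbT big1 ?addr0 => [|k ka].
  by case: b; rewrite ?mul1r ?mul0r.
rewrite (_ : (k == a :> nat) = false) ?andbF ?mul0r //.
by apply/negbTE; apply: contraNneq ka => E; apply/eqP/val_inj.
Qed.

(** The six terms are the two directions of the three kinds of edges in [affine_arrow]. A function g
    on [nat] allows the columns of X to be given by formulas. *)
Lemma MX_C_mul n (g : nat -> P) (i : 'I_n.+2) : (2 < n)%N ->
  \sum_k MX (C_type n) i k * g k = (X ^+ 2 + 1) * g i - X *
    ((if (0 < i < n)%N then g i.+1 else 0) + (if i == 0%N :> nat then g 2%N else 0) +
     (if i == n.-1 :> nat then g n.+1 else 0) + (if (1 < i <= n)%N then g i.-1 else 0) +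
     (if i == 2%N :> nat then g 0%N else 0) + (if i == n.+1 :> nat then g n.-1 else 0)).
Proof.
move=> n2; set c := X ^+ 2 + 1.
have iN := ltn_ord i.
have H (b : bool) a : (b -> (a < n.+2)%N) -> (if b then g a else 0) =
    \sum_(k < n.+2) (b && (k == a :> nat))%:R * g k.
  case: b => [/(_ isT) aN|_]; first by rewrite sum_at.
  by rewrite big1 // => k _; rewrite mul0r.
rewrite !H; try by lia.
rewrite -!big_split /= mulr_sumr.
have -> : c * g i = \sum_(k < n.+2) (true && (k == i :> nat))%:R * (c * g k).
  by rewrite (sum_at (fun k => c * g k)).
rewrite -sumrB; apply: eq_bigr => k _; rewrite !mxE.
rewrite -!mulrDl mulrCA mulrA [X * (_ * _)]mulrA -mulrBl; congr (_ * _).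
have kN := ltn_ord k; rewrite (eq_sym i k) -val_eqE /= -!natrD.
have [->|ki] := eqVneq (k : nat) i.
  rewrite mulr1 (_ : (_ + _)%N = 0%N) ?mulr0n ?mulr0 ?subr0 //; lia.
rewrite mulr0n mulr0 sub0r polyCN mulrN; congr (- (_ * _)).
rewrite rmorph_nat; congr (_%:R).
rewrite -[affine_edge _ _]/(affine_arrow (C_type n) i k || affine_arrow (C_type n) k i) /=.
have orE (a b : bool) : ~~ (a && b) -> (a || b : nat) = (a + b)%N by case: a; case: b.
have -> : (0 < k < n)%N && (i == k.+1 :> nat) = (1 < i <= n)%N && (k == i.-1 :> nat).
  by apply/idP/idP; lia.
rewrite -!orbA andbC [(k == n.-1 :> nat) && _]andbC [(k == _ :> nat) && (i == _ :> nat)]andbC.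
rewrite !orE; lia.
Qed.

Section TypeC.
Variable n' : nat.
Let n := n'.+3.
Let c : P := X ^+ 2 + 1.

(** Along the chain, (u^2 + 1) g(i) = u (g(i-1) + g(i+1)) has the solutions u^i and u^(-i). The
    combination u^(k-i) + u^(k+i-2) is symmetric about i = 1, and its value 2 u^(k-1) there is
    shared by the two leaves 0 and 1; for 2 <= k <= n, column k is this solution cut off after row
    k. The last column is c times the solution for k = n, its value at i = n being divided between
    the leaves n and n+1. *)
Let xc (k i : nat) : P :=
  if (i < 2)%N then
    if (k < 2)%N then (i == k)%:R else
    if (k <= n)%N then X ^+ k.-1 else c * X ^+ n.-1
  else if (k <= n)%N then if (i <= k)%N then X ^+ (k - i) + X ^+ (k + i - 2) else 0
  else if (i < n)%N then c * (X ^+ (n - i) + X ^+ (n + i - 2)) else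
    if i == n then X ^+ 2 + X ^+ (n + n - 2) else 1 + X ^+ (n + n).

Let yc (k : nat) : P :=
  if (k < 2)%N then c else
  if (k <= n)%N then 1 + X ^+ (k + k) else c * (1 - X ^+ 2) * (1 - X ^+ (n.-1 + n.-1)).

Let Xc : 'M[P]_n.+2 := \matrix_(i, k) xc k i.

Lemma MX_C_upper (i k : 'I_n.+2) : (i <= k)%N ->
  (MX (C_type n) *m Xc) i k = if i == k then yc k else 0.
Proof.
have e1 : (n + n - 2 = (n' + n').+4)%N by rewrite /n; lia.
have e2 : (n + n'.+2 - 2 = (n' + n').+3)%N by rewrite /n; lia.
have e3 : (n + n = (n' + n').+4.+2)%N by rewrite /n; lia.
have e4 : (n'.+2 + n'.+2 = (n' + n').+4)%N by lia.
have e5 : (n + n'.+2 - 1 = (n' + n').+4)%N by rewrite /n; lia.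
have e6 : (n + 2 - 3 = n'.+2)%N by rewrite /n; lia.
move=> le_ik; rewrite mxE; under eq_bigr => j _ do rewrite [Xc _ _]mxE.
rewrite MX_C_mul // -/c -val_eqE /=; have := ltn_ord k; move: le_ik; move: (val i) (val k) => {}i {}k.
move=> le_ik; rewrite ltnS leq_eqVlt => /predU1P[kE|kn]; last first.
  have [k2|k2] := ltnP k 2.
    by move: k k2 le_ik {kn} => [|[|//]] _; move: i => [|[|//]] _; rewrite /xc /yc /=; ring.
  have kn' : (k <= n)%N by lia.
  have xk m e : (2 <= m)%N -> (e + m)%N = k -> xc k m = X ^+ e + X ^+ (k + m - 2).
    move=> m1 me; rewrite /xc kn' ltnNge m1 /= (_ : (m <= k)%N); last by lia.
    by congr (X ^+ _ + _); lia.
  have x0 m : (m < 2)%N -> xc k m = X ^+ k.-1 by move=> m1; rewrite /xc m1 kn' ltnNge k2.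
  have xz m : (k < m)%N -> xc k m = 0.
    move=> m1; rewrite /xc kn' (_ : (m < 2)%N = false); last by lia.
    by rewrite leqNgt m1.
  have ykE : yc k = 1 + X ^+ (k + k) by rewrite /yc ltnNge k2 kn'.
  have /orP[i2|i2] : (i < 2)%N || (1 < i)%N by lia.
    have -> : (i == k) = false by lia.
    have x2 : xc k 2%N = X ^+ (k - 2) + X ^+ k by rewrite (@xk 2%N (k - 2)%N) ?addnK //; lia.
    rewrite (x0 i) //; have [k0 kE] : exists k0, k = k0.+2 by exists (k - 2)%N; lia.
    by move: i i2 le_ik => [|[|//]] _ _ /=; rewrite x2 kE subn2 /c /= !exprS; ring.
  have down : (if (1 < i <= n)%N then xc k i.-1 else 0) + (if i == 2%N then xc k 0 else 0) =
      X ^+ (k - i).+1 + X ^+ (k + i - 3).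
    rewrite (_ : (1 < i <= n)%N = true); last by lia.
    case: eqVneq => [->|i3]; first by rewrite !x0 //; congr (X ^+ _ + X ^+ _); lia.
    by rewrite addr0 (@xk i.-1 (k - i).+1); [congr (_ + X ^+ _)|..]; lia.
  have up : (if (0 < i < n)%N then xc k i.+1 else 0) + (if i == n'.+2 then xc k n.+1 else 0) =
      if i == k then 0 else X ^+ (k - i).-1 + X ^+ (k + i - 1).
    rewrite [X in _ + (if _ then X else _)]xz ?ltnS // if_same addr0.
    case: eqVneq => [->|i3]; first by rewrite xz ?if_same.
    rewrite (_ : (0 < i < n)%N = true); last by lia.
    by rewrite (@xk i.+1 (k - i).-1); [congr (_ + X ^+ _)|..]; lia.
  have i0 : (i == 0%N) = false by apply: gtn_eqF; apply: ltnW.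
  rewrite i0 (ltn_eqF (leq_ltn_trans le_ik kn)) !addr0 -addrA up down.
  rewrite (@xk i (k - i)%N) ?subnK //.
  have [b [b3 b2 b1]] : exists b, [/\ (k + i - 3 = b)%N, (k + i - 2 = b.+1)%N & (k + i - 1 = b.+2)%N].
    by exists (k + i - 3)%N; split; lia.
  rewrite b3 b2 b1; have [E|ik] := eqVneq i k.
    rewrite E subnn ykE (_ : (k + k = b.+3)%N); last by lia.
    by rewrite /c !exprS; ring.
  have [a ->] : exists a, (k - i = a.+1)%N by exists (k - i).-1; lia.
  by rewrite /c /= !exprS; ring.
rewrite kE {k kE} in le_ik *.
have x0 m : (m < 2)%N -> xc n.+1 m = c * X ^+ n'.+2 by rewrite /xc ltnn => ->.
have xm m e : (2 <= m)%N -> (e + m)%N = n -> (0 < e)%N -> xc n.+1 m = c * (X ^+ e + X ^+ (n + m - 2)).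
  move=> m1 me e0; rewrite /xc ltnn ltnNge m1 /= (_ : (m < n)%N); last by lia.
  by congr (_ * (X ^+ _ + _)); lia.
have xn : xc n.+1 n = X ^+ 2 + X ^+ (n + n - 2) by rewrite /xc !ltnn eqxx.
have xn1 : xc n.+1 n.+1 = 1 + X ^+ (n + n) 
  by rewrite /xc ltnn (_ : (n.+1 < n)%N = false) ?(gtn_eqF (ltnSn n)) // ltnNge leqnSn.
have /orP[i2|i2] : (i < 2)%N || (1 < i)%N by lia.
  rewrite (x0 i) // (_ : (i == n.+1) = false); last by move: i2; case: (i) => [|[|]].
  have := @xm 2%N n'.+1 isT (addn2 _) isT.
  rewrite (_ : n + 2 - 2 = n'.+3)%N ?addnK // => x2.
  by move: i i2 le_ik => [|[|//]] _ _ /=; rewrite x2 /c !exprS; ring.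
have /orP[le_in|lt_ni] : (i < n)%N || (n <= i)%N by lia.
all: cycle 1.
  have [->|in1] := eqVneq i n.
    rewrite /= ltnn (gtn_eqF (ltnSn n'.+2)) (ltn_eqF (ltnSn n)) leqnn xn (@xm n'.+2 1%N) //.
    by rewrite e1 e2 /= !exprS /c; ring.
  have -> : i = n.+1 by apply/eqP; rewrite eqn_leq le_ik ltn_neqAle eq_sym in1.
  rewrite /= eqxx ltnNge leqnSn ltnn (gtn_eqF (ltnW (ltnSn n'.+3))) xn1 (@xm n'.+2 1%N) //.
  by rewrite e3 e2 /yc ltnn /= e4 !exprS /c; ring.
have down : (if (1 < i <= n)%N then xc n.+1 i.-1 else 0) + (if i == 2%N then xc n.+1 0 else 0) =
    c * (X ^+ (n - i).+1 + X ^+ (n + i - 3)).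
  rewrite i2 (ltnW le_in) /=.
  case: eqVneq => [->|i3].
    by rewrite !x0 // subn2 e6 /=; ring.
  by rewrite addr0 (@xm i.-1 (n - i).+1); [congr (_ * (_ + X ^+ _))|..]; lia.
have up : (if (0 < i < n)%N then xc n.+1 i.+1 else 0) + (if i == n'.+2 then xc n.+1 n.+1 else 0) =
    c * (X ^+ (n - i).-1 + X ^+ (n + i - 1)).
  rewrite le_in (ltnW i2) /=; case: eqVneq => [->|i3].
    by rewrite xn xn1 e1 e5 e3 subSnn /c !exprS; ring.
  by rewrite addr0 (@xm i.+1 (n - i).-1); [congr (_ * (_ + X ^+ _))|..]; lia.
have i0 : (i == 0%N) = false by apply: gtn_eqF; apply: ltnW.
have in1 : (i == n.+1) = false by apply: ltn_eqF; apply: ltnW.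
rewrite i0 in1 !addr0 -addrA up down (@xm i (n - i)%N) ?subnK ?subn_gt0 //; last exact: ltnW.
have [b [b3 b2 b1]] : exists b, [/\ (n + i - 3 = b)%N, (n + i - 2 = b.+1)%N & (n + i - 1 = b.+2)%N].
  by exists (n + i - 3)%N; split; lia.
have [a ->] : exists a, (n - i = a.+1)%N by exists (n - i).-1; lia.
by rewrite b3 b2 b1 /c /= !exprS; ring.
Qed.

(** Both triangular determinants contain the product Q of the 1 + u^(2k), 1 <= k <= n, which is
    nonzero and cancels. *)
Lemma det_C_aux : \det (MX (C_type n)) = c ^+ 2 * ((1 - X ^+ 2) * (1 - X ^+ (n.-1 + n.-1))).
Proof.
set Q := \prod_(k < n) (1 + X ^+ (k.+1 + k.+1)).
have Q0 : Q != 0.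
  apply/prodf_neq0 => k _; apply/negP => /eqP /(congr1 (fun p : P => p.[0])).
  by rewrite !hornerE expr0n /= addr0.
have QE : Q = (\prod_(k < n'.+2) (1 + X ^+ (k.+1 + k.+1))) * (1 + X ^+ (n + n)).
  by rewrite /Q big_ord_recr.
have QE' : Q = (1 + X ^+ 2) * \prod_(k < n'.+2) (1 + X ^+ (k.+2 + k.+2)).
  by rewrite [LHS]big_ord_recl; congr (_ * _); apply: eq_bigr => k _; rewrite /= /bump add1n.
have dX : \det Xc = Q.
  rewrite -det_tr det_trig; last first.
    apply/is_trig_mxP => k i lt_ki; rewrite !mxE /xc; have iN := ltn_ord i.
    have -> : (i <= k)%N = false by rewrite leqNgt lt_ki.
    have -> : (i == k :> nat) = false by rewrite gtn_eqF.
    have -> : (k <= n)%N by rewrite -ltnS (leq_trans lt_ki).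
    by case: ifP => // i2; rewrite (ltn_trans lt_ki).
  rewrite big_ord_recr /= 2!big_ord_recl /= !mxE /= !mul1r QE.
  congr (_ * _); last first.
    by rewrite /xc ltnn (_ : (n.+1 < n)%N = false) ?(gtn_eqF (ltnSn n)) // ltnNge leqnSn.
  apply: eq_bigr => i _; rewrite !mxE /= /bump /= !add1n /xc /=.
  have iN := ltn_ord i; rewrite (_ : (i.+2 <= n)%N) ?leqnn ?subnn; last by lia.
  by rewrite expr0; congr (1 + X ^+ _); lia.
have dY : \det (MX (C_type n) *m Xc) = Q * (c ^+ 2 * ((1 - X ^+ 2) * (1 - X ^+ (n.-1 + n.-1)))).
  rewrite det_trig; last first.
    apply/is_trig_mxP => i k lt_ik; rewrite MX_C_upper ?(ltnW lt_ik) //.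
    by case: eqVneq => // E; rewrite E ltnn in lt_ik.
  under eq_bigr => i _ do rewrite MX_C_upper // eqxx.
  rewrite big_ord_recr /= 2!big_ord_recl /= QE'.
  rewrite (eq_bigr (fun i : 'I_n'.+2 => 1 + X ^+ (i.+2 + i.+2))); last first.
    by move=> i _; rewrite /yc /bump /= !add1n ifT //; have := ltn_ord i; lia.
  by rewrite /yc ltnn /= /c; ring.
by apply: (mulfI Q0); rewrite -dY -dX [RHS]det_mulmx mulrC.
Qed.
End TypeC.

Lemma det_C n : (2 < n)%N -> \det (MX (C_type n)) =
  ((X + 1) ^+ 2 * ((X ^+ n.-1 - 1) * (X - 1))) \Po X ^+ 2.
Proof.
case: n => [|[|[|n']]] // _; rewrite det_C_aux [(X + 1) ^+ 2]expr2.
rewrite !(comp_Xn_poly, comp_polyM, comp_polyD, comp_polyB, comp_polyX, comp_poly1) -exprM mul2n -addnn.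
by ring.
Qed.
End AffineDeterminants.

Section AffineCoxeter.
Variables (T : simple_boundary) (s : seq 'I_(affine_size T)).
Hypothesis s_enum : perm_eq s (enum 'I_(affine_size T)).

Definition before (i j : 'I_(affine_size T)) : bool := (index i s < index j s)%N.

(** [ph] is an integral potential that drops by 1 along an edge from the earlier to the later
    reflection. On a tree there is one for every order; on a cycle the steps have to add up to 0, as
    they do for a bipartite order. Adding B makes the values nonnegative, as exponents must be. *)
Lemma char_affine_coxeter (ph : 'I_(affine_size T) -> int) (psi : {poly int}) :
  psi \is monic ->
  (forall i j : 'I_(affine_size T), affine_arrow T i j -> ph i - ph j = if before i j then 1 else - 1) ->
  \det (\matrix_(i, j) if i == j then 'X^2 + 1 else 'X * (affine_form T i j)%:P)
    = psi \Po 'X^2 ->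
  char_poly (affine_coxeter s) = psi.
Proof.
move=> psim phP; pose B : int := \sum_i `|ph i|.
have posB i : 0 <= ph i + B.
  have : `|ph i| <= B by rewrite /B (bigD1 i) //= lerDl sumr_ge0.
  by have := ler_norm (- ph i); rewrite normrN; lia.
move=> detM.
have F2 i : affine_form T i i = 2 by rewrite mxE eqxx.
have Fs i j : affine_form T i j = affine_form T j i by rewrite !mxE eq_sym /affine_edge orbC.
apply: (char_cox F2 Fs s_enum (pot := fun i => absz (ph i + B)) psim _ detM).
move=> i j ij; rewrite mxE (negbTE ij) oppr_eq0 pnatr_eq0 eqb0 negbK => e_ij lt_ij.
have E : ph i - ph j = 1.
  case/orP: e_ij => /phP; first by rewrite /before lt_ij.
  by rewrite /before ltnNge (ltnW lt_ij) /=; lia.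
by have := posB i; have := posB j; lia.
Qed.
End AffineCoxeter.

Lemma psi_B n (s : seq 'I_(affine_size (B_type n))) : (1 < n)%N -> coxeter_order s ->
  char_poly (affine_coxeter s) = ('X^n - 1) ^+ 2.
Proof.
move=> n1 [s_enum [col colP sE]].
have sT i : i \in s by rewrite (perm_mem s_enum) mem_enum.
have bef i j : col i -> ~~ col j -> before s i j.
  move=> ci cj; rewrite /before sE !index_cat !mem_filter ci (negbTE cj) sT /=.
  by rewrite ltn_addr // index_mem mem_filter ci sT.
apply: (@char_affine_coxeter (B_type n) s s_enum (fun i => (col i)%:R)).
- by rewrite rpredX // monicXnsubC //; lia.
- move=> i j ij; have := colP i j; rewrite /affine_edge ij => /(_ isT).
  case ci: (col i); case cj: (col j) => // _; first by rewrite bef ?ci ?cj.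
  by have := @bef j i; rewrite ci cj /before => /(_ isT isT) /ltnW; rewrite leqNgt => /negbTE ->.
exact: det_B.
Qed.

Lemma psi_C n (s : seq 'I_(affine_size (C_type n))) : (2 < n)%N -> coxeter_order s ->
  char_poly (affine_coxeter s) = ('X + 1) ^+ 2 * (('X^(n.-1) - 1) * ('X - 1)).
Proof.
move=> n2 [s_enum _].
have z1 : (n.-1 == 0)%N = false by lia.
have z2 : (n.-1 == n.+1) = false by lia.
pose sg (i j : nat) : int := if before s (@inord n.+1 i) (@inord n.+1 j) then 1 else - 1.
(* The potential is summed along the chain; the leaves 0 and n+1 are then fixed by their neighbours
   2 and n-1. *)
pose c k := - \sum_(l < k) sg l l.+1.
have cS k : c k - c k.+1 = sg k k.+1.
  by rewrite /c big_ord_recr /=; ring.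
pose ph k := if k == 0%N then c 2%N + sg 0%N 2%N else
  if k == n.+1 then c n.-1 - sg n.-1 n.+1 else c k.
apply: (@char_affine_coxeter (C_type n) s s_enum (fun i => ph i)).
- have m1 : ('X + 1 : {poly int}) \is monic by have := monicXaddC (1 : int); rewrite polyC1.
  have m2 : ('X - 1 : {poly int}) \is monic by have := monicXsubC (1 : int); rewrite polyC1.
  have m3 : ('X^(n.-1) - 1 : {poly int}) \is monic.
    by rewrite monicXnsubC //; lia.
  by rewrite !rpredM ?rpredX.
- move=> i j ij; have -> : (if before s i j then 1 else -1) = sg i j by rewrite /sg !inord_val.
  have iN := ltn_ord i; have jN := ltn_ord j.
  case/or3P: ij => /andP[/= i1 /eqP jE].
  - have /andP[i0 i_n] := i1.
    by rewrite /ph jE (gtn_eqF i0) (ltn_eqF (ltn_trans i_n (ltnSn n))) /= eqSS (ltn_eqF i_n).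
  - rewrite /ph (eqP i1) jE /= (_ : (2%N == n.+1) = false); last by lia.
    by rewrite addrAC subrr add0r.
  - rewrite /ph (eqP i1) jE /= eqxx z1 z2.
    by rewrite opprB addrC subrK.
exact: det_C.
Qed.

Lemma psi_F (s : seq 'I_(affine_size F4_type)) : coxeter_order s ->
  char_poly (affine_coxeter s) = ('X + 1) * ('X - 1) ^+ 2 * ('X^2 + 'X + 1) ^+ 2.
Proof.
move=> [s_enum _].
pose sg (i j : nat) : int := if before s (@inord 6 i) (@inord 6 j) then 1 else - 1.
pose ph := nth 0 [:: 0; - sg 0%N 1%N; - sg 0%N 1%N - sg 1%N 2%N;
  - sg 0%N 3%N; - sg 0%N 3%N - sg 3%N 4%N; - sg 0%N 5%N; - sg 0%N 5%N - sg 5%N 6%N].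
apply: (@char_affine_coxeter F4_type s s_enum (fun i => ph i)).
- have m1 : ('X + 1 : {poly int}) \is monic by have := monicXaddC (1 : int); rewrite polyC1.
  have m2 : ('X - 1 : {poly int}) \is monic by have := monicXsubC (1 : int); rewrite polyC1.
  have m3 : ('X^2 + 'X + 1 : {poly int}) \is monic.
    by rewrite monicE -addrA lead_coefDl ?lead_coefXn // size_polyXn -polyC1 size_XaddC.
  by rewrite !rpredM ?rpredX.
- move=> i j ij; have -> : (if before s i j then 1 else -1) = sg i j by rewrite /sg !inord_val.
  move: ij; rewrite /= !inE !xpair_eqE.
  by case/or4P => [||| /or3P[]] /andP[/eqP -> /eqP ->]; rewrite /ph /=; ring.
exact: det_F.
Qed.

(* [ring] needs a commutative ring; [abel] decides additive identities in a
   zmodType, by comparing coefficients. *)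
Inductive zterm := ZVar of nat | ZAdd of zterm & zterm | ZOpp of zterm | ZZero.

Section ZTerm.
Variable V : zmodType.
Fixpoint zval (e : seq V) (t : zterm) : V :=
  match t with
  | ZVar i => nth 0 e i
  | ZAdd t u => zval e t + zval e u
  | ZOpp t => - zval e t
  | ZZero => 0
  end.
Fixpoint zcoef (t : zterm) (i : nat) : int :=
  match t with
  | ZVar j => if i == j then 1 else 0
  | ZAdd t u => zcoef t i + zcoef u i
  | ZOpp t => - zcoef t i
  | ZZero => 0
  end.

Lemma zvalE e t : zval e t = \sum_(i < size e) nth 0 e i *~ zcoef t i.
Proof.
elim: t => [j|t IHt u IHu|t IHt|] /=.
- have [je|ej] := ltnP j (size e).
    rewrite (bigD1 (Ordinal je)) //= eqxx mulr1z big1 ?addr0 // => i.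
    by rewrite -val_eqE /= => /negbTE ->.
  rewrite nth_default // big1 // => i _.
  by rewrite (ltn_eqF (leq_trans (ltn_ord i) ej)).
- by rewrite IHt IHu -big_split; apply: eq_bigr => i _; rewrite mulrzDr.
- by rewrite IHt -sumrN; apply: eq_bigr => i _; rewrite mulrNz.
- by rewrite big1.
Qed.

Lemma zval_eq e t u :
  all (fun i => zcoef t i == zcoef u i) (iota 0 (size e)) -> zval e t = zval e u.
Proof.
move=> /allP tu; rewrite !zvalE; apply: eq_bigr => i _.
by rewrite (eqP (tu i _)) // mem_iota ltn_ord.
Qed.
End ZTerm.

Ltac zindex x e :=
  lazymatch e with
  | x :: _ => constr:(0%N)
  | _ :: ?e => let n := zindex x e in constr:(S n)
  end.
Ltac zin x e :=
  lazymatch e with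
  | x :: _ => e
  | ?y :: ?e' => let e'' := zin x e' in constr:(y :: e'')
  | [::] => constr:([:: x])
  end.
Ltac zatoms t e :=
  lazymatch t with
  | (?a + ?b)%R => let e := zatoms a e in zatoms b e
  | (- ?a)%R => zatoms a e
  | 0%R => e
  | _ => zin t e
  end.
Ltac zquote t e :=
  lazymatch t with
  | (?a + ?b)%R => let x := zquote a e in let y := zquote b e in constr:(ZAdd x y)
  | (- ?a)%R => let x := zquote a e in constr:(ZOpp x)
  | 0%R => constr:(ZZero)
  | _ => let n := zindex t e in constr:(ZVar n)
  end.
Ltac abel :=
  lazymatch goal with
  | |- @eq ?V ?a ?b =>
      let e := zatoms a (@nil V) in let e := zatoms b e in
      let x := zquote a e in let y := zquote b e in
      exact (@zval_eq _ e x y isT)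
  end.

(** * Normalized cubical chains *)

Section Chains.
Variable R : realType.
Implicit Types X Y Z : topologicalType.
Local Notation cube n := (cube_set R n).
Local Notation T := trivial_chain.

(** The value 0 for discontinuous f lets operations on chains be written for bare functions on
    cubes, such as prisms of a homotopy that is continuous only over a subset. *)
Definition cub n X (f : cube n -> X) : chain R n X :=
  if pselect (continuous f) is left cf then << (mkcts cf : scube R n X) >>
  else 0.

Lemma cubE n X (f : cube n -> X) (s : scube R n X) : f = s -> cub f = << s >>.
Proof.
rewrite /cub => ->; case: pselect => [cf|/(_ (@cts_fun _ _ s))//].
by congr << _ >>; apply/continuousEP.
Qed.

Lemma cub_scube n X (s : scube R n X) : cub s = << s >>.
Proof. exact: cubE. Qed.

Definition degf n X (f : cube n -> X) :=
  exists i, forall t u : cube n,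
    (forall j, j != i -> val t 0 j = val u 0 j) -> f t = f u.

Lemma T0 n X (A : set X) : T A (0 : chain R n X).
Proof. by have [/asboolP] := @trivial_chainB R n X A. Qed.

Lemma TB n X (A : set X) (y z : chain R n X) : T A y -> T A z -> T A (y - z).
Proof.
have [_ tB] := @trivial_chainB R n X A.
by move=> Ty Tz; apply/asboolP/(tB y z); apply/asboolP.
Qed.

Lemma TN n X (A : set X) (z : chain R n X) : T A z -> T A (- z).
Proof. by rewrite -sub0r => Tz; apply: TB => //; exact: T0. Qed.

Lemma TD n X (A : set X) (y z : chain R n X) : T A y -> T A z -> T A (y + z).
Proof. by move=> Ty Tz; rewrite -[z]opprK; apply: TB => //; exact: TN. Qed.

Lemma T_sum n X (A : set X) I r (P : pred I) (F : I -> chain R n X) :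
  (forall i, P i -> T A (F i)) -> T A (\sum_(i <- r | P i) F i).
Proof. by move=> TF; elim/big_ind: _ => //; [exact: T0|exact: TD]. Qed.

Lemma TMsign n X (A : set X) k (z : chain R n X) :
  T A z -> T A ((-1) ^+ k *: z).
Proof.
by rewrite -signr_odd; case: odd => Tz; rewrite ?scaleN1r ?scale1r //; exact: TN.
Qed.

Lemma TS n X (A B : set X) (z : chain R n X) : A `<=` B -> T A z -> T B z.
Proof.
by move=> AB Tz s /Tz[|sA]; [left|right; exact: subset_trans sA AB].
Qed.

Lemma TI n X (A B : set X) (z : chain R n X) : T A z -> T B z -> T (A `&` B) z.
Proof.
move=> TA TB0 s sz; have [|sA] := TA s sz; first by left.
by have [|sB] := TB0 s sz; [left|right => x sx; split; [exact: sA|exact: sB]].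
Qed.

Lemma T_cub n X (A : set X) (f : cube n -> X) :
  degf f \/ (forall t, A (f t)) -> T A (cub f).
Proof.
move=> fA; rewrite /cub; case: pselect => [cf|_]; last exact: T0.
move=> s; rewrite domU1 inE => /eqP -> /=; case: fA => [|fA]; first by left.
by right => _ [t _ <-]; exact: fA.
Qed.

(** Trivial chains are generated by degenerate cubes and cubes in A, so additive properties can be
    checked on these. With A = [setT] this is induction over all chains. *)
Lemma T_ind n X (A : set X) (P : chain R n X -> Prop) :
  P 0 -> (forall y z, P y -> P z -> P (y - z)) ->
  (forall s : scube R n X, degf s \/ (forall t, A (s t)) -> P (cub s)) ->
  forall z, T A z -> P z.
Proof.
move=> P0 PB PU z Tz.
have PN y : P y -> P (- y) by move=> Py; rewrite -sub0r; apply/PB.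
have PD y1 y2 : P y1 -> P y2 -> P (y1 + y2).
  by move=> p1 p2; rewrite -[y2]opprK; apply/PB => //; apply/PN.
rewrite -(freeg_sumE z) big_seq; elim/big_ind: _ => // s sz.
have {}PU : P << s >>.
  rewrite -cub_scube; apply/PU; have [|sA] := Tz s sz; first by left.
  by right => t; apply: sA; exists t.
have -> : << coeff s z *g s >> = << s >> *~ coeff s z :> chain R n X.
  by rewrite -[in RHS]/(<< (1 : int) *g s >>) freeg_mulz intz.
by case: (coeff s z) => k; rewrite ?NegzE ?mulrNz; [|apply/PN];
  rewrite -pmulrn; elim: (k in _ *+ k) => // ? ?; rewrite mulrS; apply/PD.
Qed.

Definition clift n m X Y (Phi : (cube n -> X) -> chain R m Y) :
  chain R n X -> chain R m Y := fglift (fun s : scube R n X => Phi s).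

Lemma clift_additive n m X Y Phi : zmod_morphism (@clift n m X Y Phi).
Proof. exact: lift_is_additive. Qed.

HB.instance Definition _ n m X Y Phi :=
  GRing.isZmodMorphism.Build _ _ (@clift n m X Y Phi)
    (@clift_additive n m X Y Phi).

Lemma cliftE n m X Y (Phi : (cube n -> X) -> chain R m Y) (s : scube R n X) :
  clift Phi (cub s) = Phi s.
Proof. by rewrite cub_scube /clift liftU scale1r. Qed.

Lemma T_clift n m X Y (A : set X) (B : set Y)
    (Phi : (cube n -> X) -> chain R m Y) :
  (forall s : scube R n X, degf s \/ (forall t, A (s t)) -> T B (Phi s)) ->
  forall z, T A z -> T B (clift Phi z).
Proof.
move=> TPhi; apply: T_ind => [|y z|s /TPhi]; first by rewrite raddf0; exact: T0.
  by rewrite raddfB; exact: TB.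
by rewrite cliftE.
Qed.

Lemma bd0 n X : bd (0 : chain R n.+1 X) = 0. Proof. exact: raddf0. Qed.

Lemma bdB n X (y z : chain R n.+1 X) : bd (y - z) = bd y - bd z.
Proof. exact: raddfB. Qed.

Lemma bdD n X (y z : chain R n.+1 X) : bd (y + z) = bd y + bd z.
Proof. exact: raddfD. Qed.

Lemma bdN n X (z : chain R n.+1 X) : bd (- z) = - bd z.
Proof. exact: raddfN. Qed.

Lemma degf_comp n m X (f : cube n -> X) (u : cube m -> cube n) k :
  (forall t t' : cube m, (forall j, j != k -> val t 0 j = val t' 0 j) ->
     f (u t) = f (u t')) -> degf (f \o u).
Proof. by move=> H; exists k => t t' /H. Qed.

Lemma val_face n (i : 'I_n.+1) e (t : cube n) j :
  val (face i e t) 0 j = if unlift i j is Some k then val t 0 k else e%:R.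
Proof. by rewrite mxE. Qed.

Lemma val_face_id n (i : 'I_n.+1) e (t : cube n) : val (face i e t) 0 i = e%:R.
Proof. by rewrite val_face unlift_none. Qed.

Lemma val_face_lift n (i : 'I_n.+1) e (t : cube n) j :
  val (face i e t) 0 (fintype.lift i j) = val t 0 j.
Proof. by rewrite val_face liftK. Qed.

Lemma cubeP n (t u : cube n) : (forall j, val t 0 j = val u 0 j) -> t = u.
Proof. by move=> tu; apply/val_inj/rowP => j; exact: tu. Qed.

Lemma cts_comp n m X (f : cube n -> X) (u : cube m -> cube n) :
  continuous f -> continuous u -> continuous (f \o u).
Proof. by move=> cf cu t; apply: continuous_comp; [exact: cu|exact: cf]. Qed.

Definition bdf n X (f : cube n.+1 -> X) : chain R n X :=
  \sum_(i < n.+1) (-1) ^+ i *: (cub (f \o face i true) - cub (f \o face i false)).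

Lemma bdE n X (s : scube R n.+1 X) : bd (cub s) = bdf s.
Proof.
rewrite cub_scube /bd liftU scale1r; apply: eq_bigr => i _.
by congr (_ *: (_ - _)); symmetry; apply: cubE.
Qed.

Lemma bd_clift n X (z : chain R n.+1 X) : bd z = clift (@bdf n X) z.
Proof.
have Tz : T setT z by move=> s _; right.
elim/T_ind: z / Tz => [|y z yE zE|s _]; first by rewrite !raddf0.
  by rewrite bdB raddfB yE zE.
by rewrite bdE cliftE.
Qed.

(** For a cube degenerate in direction k, the two faces in direction k cancel and the other faces
    are degenerate. *)
Lemma T_bd n X (A : set X) (z : chain R n.+1 X) : T A z -> T A (bd z).
Proof.
rewrite bd_clift; apply: T_clift => s [[k sk]|sA].
  apply: T_sum => i _; apply: TMsign; have [ik|ki] := eqVneq i k.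
    have -> : s \o face i true = s \o face i false.
      apply/funext => t; apply: sk => j /negbTE jk; rewrite !val_face.
      by case: unliftP => // jE; rewrite jE ik eqxx in jk.
    by rewrite subrr; exact: T0.
  case: (unliftP i k) => [k' kE|kE]; last by rewrite kE eqxx in ki.
  have H e : degf (s \o face i e).
    apply: (@degf_comp _ _ _ _ _ k') => t t' tt'; apply: sk => j jk.
    rewrite !val_face; case: unliftP => // j' jE; apply: tt'.
    by apply: contraNneq jk; rewrite jE kE => ->.
  by apply: TB; apply: T_cub; left.
by apply: T_sum => i _; apply: TMsign; apply: TB; apply: T_cub; right => t; exact: sA.
Qed.

Lemma face_face n (i : 'I_n.+2) (j : 'I_n.+1) (i' : 'I_n.+2) (j' : 'I_n.+1) e e'
    (t : cube n) :
  (i <= j)%N -> i' = fintype.lift ord0 j -> j' = i :> nat ->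
  face i e (face j e' t) = face i' e' (face j' e t).
Proof.
move=> ij i'E j'E; apply: cubeP => l; rewrite !val_face.
have i'j : i' = j.+1 :> nat by rewrite i'E.
case: unliftP => [l1 l1E|li]; case: unliftP => [l2 l2E|li']; last 1 first.
- exfalso; have : l = i' :> nat by rewrite li'.
  by rewrite li i'j => E; move: ij; rewrite E ltnn.
- rewrite !val_face.
  have l12 : bump i l1 = bump i' l2.
    by have := congr1 val l1E; rewrite l2E.
  case: unliftP => [l3 /(congr1 val) l3E|/(congr1 val) l3E];
    case: unliftP => [l4 /(congr1 val) l4E|/(congr1 val) l4E] //;
    rewrite /= in l3E l4E; move: l12; rewrite ?l3E ?l4E i'j.
  + move=> E; congr (val t 0 _); apply/val_inj => /=.
    by move: E ij; rewrite j'E /bump; lia.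
  + by move: ij; rewrite j'E /bump; lia.
  + by move: ij; rewrite j'E /bump; lia.
  + by move: ij; rewrite j'E /bump; lia.
- have : l = bump i l1 :> nat by rewrite l1E.
  rewrite li' i'j => E; rewrite val_face.
  have l1j : l1 = j.
    apply/val_inj; move: E; rewrite /bump; case: leqP => il; first by case.
    by rewrite add0n => E; move: il; rewrite -E ltnNge (leq_trans ij).
  by rewrite l1j unlift_none.
- have : l = bump i' l2 :> nat by rewrite l2E.
  rewrite li => E.
  have l2j : l2 = j'.
    apply/val_inj; rewrite /= j'E; move: E; rewrite /bump i'j; case: leqP => // jl.
    by rewrite add1n => E; move: ij; rewrite E leqNgt (ltn_trans jl).
  by rewrite val_face l2j unlift_none.
Qed.

Lemma bd_bd n X (z : chain R n.+2 X) : bd (bd z) = 0.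
Proof.
have Tz : T setT z by move=> s _; right.
elim/T_ind: z / Tz => [|y z yE zE|s _]; first by rewrite !bd0.
  by rewrite !bdB yE zE subrr.
pose c (i : 'I_n.+2) (j : 'I_n.+1) e e' :=
  cub (fun t => s (face i e (face j e' t))).
pose F (p : 'I_n.+2 * 'I_n.+1) := (-1) ^+ (p.1 + p.2) *:
  (c p.1 p.2 true true - c p.1 p.2 true false -
   (c p.1 p.2 false true - c p.1 p.2 false false)).
have -> : bd (bd (cub s)) = \sum_p F p.
  rewrite bdE /bdf raddf_sum /= -(pair_bigA _ (fun i j => F (i, j))) /=.
  apply: eq_bigr => i _.
  rewrite raddfZsign raddfB /=.
  have bdf_ e : bd (cub (s \o face i e)) = bdf (s \o face i e).
    by rewrite -(bdE (cube_face s i e)).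
  rewrite !bdf_ /bdf -sumrB scaler_sumr; apply: eq_bigr => j _.
  by rewrite /F /= -scalerBr scalerA -exprD.
(* The involution pairs (i, j), i <= j, with (j + 1, i): by the cubical identity both index the same
   face of codimension 2, with opposite signs. *)
pose h (p : 'I_n.+2 * 'I_n.+1) : 'I_n.+2 * 'I_n.+1 :=
  if (p.1 <= p.2)%N then (fintype.lift ord0 p.2, inord p.1)
  else (widen_ord (leqnSn _) p.2, inord p.1.-1).
have h1 (i : 'I_n.+2) (j : 'I_n.+1) : (i <= j)%N ->
    h (i, j) = (fintype.lift ord0 j, inord i) by rewrite /h /= => ->.
have h2 (i : 'I_n.+2) (j : 'I_n.+1) : (j < i)%N ->
    h (i, j) = (widen_ord (leqnSn _) j, inord i.-1) by rewrite /h ltnNge /= => /negbTE ->.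
have hF (p : 'I_n.+2 * 'I_n.+1) : (p.1 <= p.2)%N -> F (h p) = - F p.
  case: p => i j /= ij; rewrite /h /F /= ij /=.
  have iE : @inord n i = i :> nat by rewrite inordK // (leq_ltn_trans ij).
  have cE e e' : c (fintype.lift ord0 j) (inord i) e e' = c i j e' e.
    by rewrite /c; congr cub; apply/funext => t; rewrite (@face_face _ i j (fintype.lift ord0 j) (inord i)).
  rewrite !cE iE /bump /= add1n addSn exprS mulN1r scaleNr [in X in _ = X]addnC.
  by congr (- (_ *: _)); rewrite !opprD !opprK addrACA.
rewrite (bigID (fun p : 'I_n.+2 * 'I_n.+1 => p.1 <= p.2)%N) /=.
rewrite [X in _ + X](reindex_onto h h) /=.
  rewrite [X in _ + X](eq_bigl (fun p : 'I_n.+2 * 'I_n.+1 => p.1 <= p.2)%N) => [|[i j]] /=.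
    by rewrite [X in _ + X](eq_bigr _ hF) sumrN subrr.
  have [ij|ij] := leqP i j.
    have iE : @inord n i = i :> nat by rewrite inordK // (leq_ltn_trans ij).
    rewrite h1 //= h2 ?iE /bump ?add1n ?ltnS //= -ltnNge ltnS ij /=; apply/eqP.
    by rewrite add0n inord_val; congr (_, _); apply/val_inj.
  have iE : @inord n i.-1 = i.-1 :> nat by rewrite inordK //; case: i ij => -[|i].
  rewrite h2 //= iE; apply/negbTE; rewrite negb_and negbK; apply/orP; left.
  by rewrite -ltnS prednK // (leq_ltn_trans _ ij).
move=> [i j] /=; rewrite -ltnNge => ji.
have iE : @inord n i.-1 = i.-1 :> nat by rewrite inordK //; case: i ji => -[|i].
have i0 : (0 < i)%N by apply: leq_ltn_trans ji.
rewrite h2 // h1; last by rewrite /= iE -ltnS prednK.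
congr (_, _); apply/val_inj => /=.
  by rewrite iE /bump add1n prednK.
by rewrite inordK.
Qed.
End Chains.

(** * Homotopies, prisms and vanishing relative homology *)

Section Homotopy.
Variables (R : realType) (X : topologicalType).
Local Notation cube n := (cube_set R n).
Local Notation T := trivial_chain.

Lemma tl_subproof n (v : cube n.+1) :
  (\row_(j < n) val v 0 (fintype.lift ord0 j)) \in cube_set R n.
Proof. by apply/mem_set => j; rewrite mxE; have /set_mem := valP v; apply. Qed.

Definition tl n (v : cube n.+1) : cube n := SigSub (tl_subproof v).

Lemma val_tl n (v : cube n.+1) j : val (tl v) 0 j = val v 0 (fintype.lift ord0 j).
Proof. by rewrite mxE. Qed.

Lemma cts_tl n : continuous (@tl n).
Proof.
apply: cts_into; apply: cts_mx => i j; rewrite /comp /=.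
under eq_fun do rewrite mxE; exact: cts_val_coord.
Qed.

Lemma tl_face0 n e (t : cube n) : tl (face ord0 e t) = t.
Proof. by apply: cubeP => j; rewrite val_tl val_face_lift. Qed.

Lemma tl_face n (j : 'I_n.+1) e (t : cube n.+1) :
  tl (face (fintype.lift ord0 j) e t) = face j e (tl t).
Proof.
apply: cubeP => k; rewrite val_tl !val_face.
case: (unliftP j k) => [k' ->|->]; last first.
  by rewrite unlift_none.
have -> : fintype.lift ord0 (fintype.lift j k') =
          fintype.lift (fintype.lift ord0 j) (fintype.lift ord0 k').
  by apply/val_inj; rewrite /= /bump; case: leqP => //=; lia.
by rewrite liftK val_tl.
Qed.

Lemma val_face_lift0 n (j : 'I_n.+1) e (t : cube n.+1) :
  val (face (fintype.lift ord0 j) e t) 0 ord0 = val t 0 ord0.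
Proof.
have -> : (ord0 : 'I_n.+2) = fintype.lift (fintype.lift ord0 j) ord0.
  by apply/val_inj.
by rewrite val_face_lift; congr (val t 0 _); apply/val_inj.
Qed.

Lemma cube01 n (v : cube n) j : 0 <= val v 0 j <= 1.
Proof. by have /set_mem := valP v; apply. Qed.

(** Continuity on [0, 1] x A, tested by composition with continuous maps into it. Prisms over cubes
    in A are instances. *)
Definition cont_on (A : set X) (F : R -> X -> X) :=
  forall (S : topologicalType) (u : S -> R) (s : S -> X),
    continuous u -> continuous s ->
    (forall t, 0 <= u t <= 1) -> (forall t, A (s t)) ->
    continuous (fun t => F (u t) (s t)).

Definition prism (F : R -> X -> X) n (s : cube n -> X) : cube n.+1 -> X :=
  fun v => F (val v 0 ord0) (s (tl v)).

Definition hK F n := clift (fun s : cube n -> X => cub (prism F s)).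
Definition push1 (f : X -> X) n := clift (fun s : cube n -> X => cub (f \o s)).

Lemma T_push f A B : (forall p, A p -> B (f p)) ->
  forall n (z : chain R n X), T A z -> T B (push1 f z).
Proof.
move=> fAB n; apply: T_clift => s [[k sk]|sA]; apply: T_cub.
  by left; exists k => t u /sk /= ->.
by right => t; exact: fAB.
Qed.

Lemma degf_prism F n (s : cube n -> X) : degf s -> degf (prism F s).
Proof.
move=> [k sk]; exists (fintype.lift ord0 k) => t u tu; rewrite /prism.
congr F; first by apply: tu; rewrite -(inj_eq val_inj).
apply: sk => j jk; rewrite !val_tl; apply: tu.
by rewrite (inj_eq lift_inj).
Qed.

Lemma T_hK F (A B : set X) :
  (forall t p, 0 <= t <= 1 -> A p -> B (F t p)) ->
  forall n (z : chain R n X), T A z -> T B (hK F z).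
Proof.
move=> FAB n; apply: T_clift => s [ds|sA]; apply: T_cub.
  by left; exact: degf_prism.
by right => t; apply: FAB => //; exact: cube01.
Qed.

Lemma cliftB n m Phi (y z : chain R n X) :
  clift Phi (y - z) = clift Phi y - clift Phi z :> chain R m X.
Proof. exact: (raddfB (clift _)). Qed.

Lemma cliftZs n m Phi k (z : chain R n X) :
  clift Phi ((-1) ^+ k *: z) = (-1) ^+ k *: clift Phi z :> chain R m X.
Proof. exact: (raddfZsign (clift _)). Qed.

Lemma hKB F n (y z : chain R n X) : hK F (y - z) = hK F y - hK F z.
Proof. exact: (raddfB (clift _)). Qed.

Lemma pushB f n (y z : chain R n X) : push1 f (y - z) = push1 f y - push1 f z.
Proof. exact: (raddfB (clift _)). Qed.

Lemma T00 (A : set X) n (z : chain R n X) : T set0 z -> T A z.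
Proof. by apply: TS; exact: sub0set. Qed.

Lemma T_ind_add n m (A B : set X) (L : chain R n X -> chain R m X) :
  (forall y z, L (y - z) = L y - L z) ->
  (forall s : scube R n X, degf s \/ (forall t, A (s t)) -> T B (L (cub s))) ->
  forall z, T A z -> T B (L z).
Proof.
move=> LB LU z Tz; elim/T_ind: z / Tz => [|y z yE zE|//].
  by rewrite -(subrr 0) LB subrr; exact: T0.
by rewrite LB; exact: TB.
Qed.

Lemma bd_cub n (f : cube n.+1 -> X) : continuous f -> bd (cub f) = bdf f.
Proof. by move=> cf; rewrite -[f]/(mkcts cf : _ -> _) bdE. Qed.

Lemma clift_cub n m (Phi : (cube n -> X) -> chain R m X) f :
  continuous f -> clift Phi (cub f) = Phi f.
Proof. by move=> cf; rewrite -[f]/(mkcts cf : _ -> _) cliftE. Qed.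

Lemma cts_face_comp n (s : cube n.+1 -> X) i e :
  continuous s -> continuous (s \o face i e).
Proof. by move=> cs; apply: cts_comp => //; exact: cts_face. Qed.

Lemma prism_cts A F n (s : cube n -> X) : cont_on A F -> continuous s ->
  (forall t, A (s t)) -> continuous (prism F s).
Proof.
move=> cF cs sA; apply: cF => //; first exact: cts_val_coord.
- by move=> v; apply: continuous_comp; [exact: cts_tl|exact: cs].
- by move=> t; exact: cube01.
Qed.

Lemma prism_face1 F n (s : cube n -> X) : prism F s \o face ord0 true = F 1 \o s.
Proof. by apply/funext => t; rewrite /prism /= val_face_id tl_face0. Qed.

Lemma prism_face0 F n (s : cube n -> X) : prism F s \o face ord0 false = F 0 \o s.
Proof. by apply/funext => t; rewrite /prism /= val_face_id tl_face0. Qed.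

Lemma prism_face F n (s : cube n.+1 -> X) j e :
  prism F s \o face (fintype.lift ord0 j) e = prism F (s \o face j e).
Proof.
by apply/funext => t; rewrite /prism /= val_face_lift0 tl_face.
Qed.

(** The chain homotopy formula up to degenerate cubes. As the new coordinate comes first, the faces
    of a prism are its two ends and, with the opposite sign, the prisms over the faces. *)
Lemma bd_hK A F n (z : chain R n.+1 X) : cont_on A F -> T A z ->
  T set0 (bd (hK F z) + hK F (bd z) - (push1 (F 1) z - push1 (F 0) z)).
Proof.
move=> cF; move: z; apply: T_ind_add => [y z|s].
  by rewrite !(bdB, hKB, pushB); abel.
case=> [ds|sA].
  (* A degenerate cube of z may lie outside A, where F need not be continuous; here each term is
     degenerate on its own. *)
  have ds0 : T set0 (cub s) by apply: T_cub; left.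
  apply: TB; last first.
    by apply: TB; apply: T_push ds0 => p [].
  by apply: TD; [apply: T_bd; apply: T_hK ds0|apply: T_hK (T_bd ds0)] => t p _ [].
rewrite /hK /push1 !cliftE bd_cub; last by apply: (prism_cts cF) sA; exact: cts_fun.
rewrite bdE /bdf big_ord_recl expr0 scale1r prism_face0 prism_face1.
rewrite [clift _ _]raddf_sum /=; set S := (X in _ + X + _).
rewrite (_ : \sum_(i < _) _ = - S).
  by rewrite (_ : _ - _ = 0); [exact: T0|abel].
rewrite /S -sumrN; apply: eq_bigr => j _.
rewrite cliftZs cliftB !clift_cub; try by apply: cts_face_comp; exact: cts_fun.
by rewrite !prism_face /bump /= add1n exprS mulN1r scaleNr.
Qed.

Lemma bd_hK0 A F (z : chain R 0 X) : cont_on A F -> T A z ->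
  T set0 (bd (hK F z) - (push1 (F 1) z - push1 (F 0) z)).
Proof.
move=> cF; move: z; apply: T_ind_add => [y z|s].
  by rewrite !(bdB, hKB, pushB); abel.
case=> [[[]]//|sA].
rewrite /hK /push1 !cliftE bd_cub; last by apply: (prism_cts cF) sA; exact: cts_fun.
rewrite /bdf big_ord_recl big_ord0 expr0 scale1r prism_face0 prism_face1 addr0 subrr.
exact: T0.
Qed.

(* The relative homology of (A, B) vanishes in positive degrees, i.e. the
   homology of A is carried by B. *)
Definition Rel (A B : set X) := forall n (z : chain R n.+1 X),
  T A z -> T B (bd z) -> exists2 w : chain R n.+2 X, T A w & T B (z - bd w).

Lemma push_id A f n (z : chain R n X) : (forall p, A p -> f p = p) -> T A z ->
  T set0 (push1 f z - z).
Proof.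
move=> fA; move: z; apply: T_ind_add => [y z|s]; first by rewrite pushB; abel.
case=> [ds|sA].
  have ds0 : T set0 (cub s) by apply: T_cub; left.
  by apply: TB => //; apply: T_push ds0 => p [].
rewrite /push1 cliftE (_ : f \o s = s) ?subrr; first exact: T0.
by apply/funext => t; exact: fA.
Qed.

(** The prism over - z is the required chain. The last hypothesis covers two uses: F 1 maps A into
    B, or F 1 makes every cube of positive dimension constant, hence degenerate. *)
Lemma Rel_homotopy (A B : set X) F : B `<=` A -> cont_on A F ->
  (forall t p, 0 <= t <= 1 -> A p -> A (F t p)) ->
  (forall t p, 0 <= t <= 1 -> B p -> B (F t p)) ->
  (forall p, A p -> F 0 p = p) ->
  (forall n (s : scube R n.+1 X), (forall t, A (s t)) -> T B (cub (F 1 \o s))) ->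
  Rel A B.
Proof.
move=> BA cF FA FB F0 F1 n z Tz Tbz; exists (- hK F z).
  by apply: TN; exact: T_hK Tz.
rewrite bdN opprK.
have H1 := bd_hK cF Tz; have H2 := T_hK FB Tbz.
have H3 : T B (push1 (F 1) z).
  move: z Tz {Tbz H1 H2}; apply: T_clift => s [[k sk]|/F1//].
  by apply: T_cub; left; exists k => t u /sk /= ->.
have H4 := push_id F0 Tz.
have -> : z + bd (hK F z) = (bd (hK F z) + hK F (bd z) -
   (push1 (F 1) z - push1 (F 0) z)) - hK F (bd z) + push1 (F 1) z
   - (push1 (F 0) z - z).
  abel.
by apply: TB (T00 B H4); apply: TD => //; apply: TB => //; exact: T00.
Qed.

Lemma Rel_retract (A B : set X) F : B `<=` A -> cont_on A F ->
  (forall t p, 0 <= t <= 1 -> A p -> A (F t p)) ->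
  (forall t p, 0 <= t <= 1 -> B p -> B (F t p)) ->
  (forall p, A p -> F 0 p = p) -> (forall p, A p -> B (F 1 p)) -> Rel A B.
Proof.
move=> BA cF FA FB F0 F1; apply: (Rel_homotopy BA cF) => // n s sA.
by apply: T_cub; right => t; exact: F1.
Qed.

Lemma Rel_trans (A B C : set X) : C `<=` B -> B `<=` A ->
  Rel A B -> Rel B C -> Rel A C.
Proof.
move=> CB BA AB BC n z Tz Tbz.
have [w Tw zw] := AB n z Tz (TS CB Tbz).
have [|v Tv zv] := BC n _ zw; first by rewrite bdB bd_bd subr0.
exists (w + v); first by apply: TD => //; exact: TS Tv.
by rewrite bdD opprD addrA.
Qed.

(** F 1 is constant on each cube rather than on A, so that A may have several contractible
    components. *)
Lemma Rel_contract (A : set X) F : cont_on A F ->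
  (forall t p, 0 <= t <= 1 -> A p -> A (F t p)) ->
  (forall p, A p -> F 0 p = p) ->
  (forall n (s : scube R n.+1 X), (forall t, A (s t)) ->
     forall t u, F 1 (s t) = F 1 (s u)) -> Rel A set0.
Proof.
move=> cF FA F0 F1; apply: (Rel_homotopy _ cF) => // n s sA.
by apply: T_cub; left; exists ord0 => t u _ /=; exact: F1.
Qed.
End Homotopy.

Section ContinuousField.
Variables (S : topologicalType) (K : numFieldType).
Implicit Types f g : S -> K.
Lemma ctsD f g : continuous f -> continuous g -> continuous (fun t => f t + g t).
Proof. by move=> cf cg t; apply: cvgD; [exact: cf|exact: cg]. Qed.
Lemma ctsB f g : continuous f -> continuous g -> continuous (fun t => f t - g t).
Proof. by move=> cf cg t; apply: cvgB; [exact: cf|exact: cg]. Qed.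
Lemma ctsN f : continuous f -> continuous (fun t => - f t).
Proof. by move=> cf t; apply: cvgN; exact: cf. Qed.
Lemma ctsM f g : continuous f -> continuous g -> continuous (fun t => f t * g t).
Proof. by move=> cf cg t; apply: cvgM; [exact: cf|exact: cg]. Qed.
Lemma ctsC (a : K) : continuous (fun _ : S => a).
Proof. by move=> t; exact: cvg_cst. Qed.
Lemma ctsX f n : continuous f -> continuous (fun t => f t ^+ n).
Proof.
move=> cf; elim: n => [|n IHn]; first by under eq_fun do rewrite expr0; exact: ctsC.
by under eq_fun do rewrite exprS; exact: ctsM.
Qed.
End ContinuousField.

Lemma cube0_subproof (R : realType) n : (0 : 'rV[R]_n) \in cube_set R n.
Proof. by apply/mem_set => j; rewrite mxE lexx ler01. Qed.

Definition cube0 (R : realType) n : cube_set R n := SigSub (cube0_subproof R n).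

(** * Subdivision of cubes and small chains *)

Section Subdivision.
Variables (R : realType) (X : topologicalType).
Local Notation cube n := (cube_set R n).
Local Notation T := trivial_chain.
Local Notation ind n := {ffun 'I_n -> bool}.

(* At t = 0 these maps are the identity and a constant, so that only one of the
   pieces is nondegenerate; at t = 1 they cut the interval into halves. For every
   t they meet in 1 - t / 2, so that inner faces cancel. *)
Definition sub_coord (t : R) (e : bool) (x : R) : R :=
  if e then (1 - t / 2) + t * x / 2 else x * (1 - t / 2).

Lemma sub_coord01 t e x : 0 <= t <= 1 -> 0 <= x <= 1 -> 0 <= sub_coord t e x <= 1.
Proof.
move=> /andP[t0 t1] /andP[x0 x1]; rewrite /sub_coord.
by case: e; apply/andP; split; nra.
Qed.

Lemma hs_subproof n (e : ind n) (v : cube n.+1) :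
  (\row_(j < n) sub_coord (val v 0 ord0) (e j) (val (tl v) 0 j)) \in cube_set R n.
Proof. by apply/mem_set => j; rewrite mxE; apply: sub_coord01; exact: cube01. Qed.

Definition hs n (e : ind n) (v : cube n.+1) : cube n := SigSub (hs_subproof e v).

Lemma val_hs n (e : ind n) v j :
  val (hs e v) 0 j = sub_coord (val v 0 ord0) (e j) (val (tl v) 0 j).
Proof. by rewrite mxE. Qed.

Lemma cts_hs n (e : ind n) : continuous (hs e).
Proof.
apply: cts_into; apply: cts_mx => i j; rewrite /comp /=.
under eq_fun do rewrite !mxE /sub_coord.
have c0 k : continuous (fun v : cube n.+1 => val v 0 k) by exact: cts_val_coord.
case: (e j).
  apply: ctsD; first by apply: ctsB; [exact: ctsC|apply: ctsM; [exact: c0|exact: ctsC]].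
  by apply: ctsM; [apply: ctsM; exact: c0|exact: ctsC].
apply: ctsM; first exact: c0.
by apply: ctsB; [exact: ctsC|apply: ctsM; [exact: c0|exact: ctsC]].
Qed.

Definition sh n (e : ind n) : cube n -> cube n := hs e \o face ord0 true.

Lemma cts_sh n (e : ind n) : continuous (sh e).
Proof. by apply: cts_comp; [exact: cts_hs|exact: cts_face]. Qed.

Lemma val_sh n (e : ind n) v j : val (sh e v) 0 j = (val v 0 j + (e j)%:R) / 2.
Proof.
rewrite val_hs val_face_id tl_face0 /sub_coord; by case: (e j) => /=; field.
Qed.

Definition Df n (f : cube n -> X) := \sum_(e : ind n) cub (f \o hs e).
Definition sdf n (f : cube n -> X) := \sum_(e : ind n) cub (f \o sh e).
Definition D n := clift (@Df n).
Definition sd n := clift (@sdf n).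

Lemma DB n (y z : chain R n X) : D (y - z) = D y - D z.
Proof. exact: (raddfB (clift _)). Qed.
Lemma sdB n (y z : chain R n X) : sd (y - z) = sd y - sd z.
Proof. exact: (raddfB (clift _)). Qed.
Lemma sdD n (y z : chain R n X) : sd (y + z) = sd y + sd z.
Proof. exact: (raddfD (clift _)). Qed.
Lemma T_D A n (z : chain R n X) : T A z -> T A (D z).
Proof.
apply: T_clift => s [[k sk]|sA]; apply: T_sum => e _; apply: T_cub; last first.
  by right => t; exact: sA.
left; exists (fintype.lift ord0 k) => t u tu /=; apply: sk => j jk.
rewrite !val_hs !val_tl !tu ?(inj_eq lift_inj) //.
Qed.

Lemma T_sd A n (z : chain R n X) : T A z -> T A (sd z).
Proof.
apply: T_clift => s [[k sk]|sA]; apply: T_sum => e _; apply: T_cub; last first.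
  by right => t; exact: sA.
by left; exists k => t u tu /=; apply: sk => j jk; rewrite !val_sh tu.
Qed.

Lemma hs_face1 n (j : 'I_n.+1) (b : bool) (e : ind n) (e1 : ind n.+1) v :
  (forall k, e1 k = if unlift j k is Some k' then e k' else b) ->
  hs e1 (face (fintype.lift ord0 j) b v) = face j b (hs e v).
Proof.
move=> e1E; apply: cubeP => k; rewrite val_hs e1E.
rewrite val_face_lift0 tl_face !val_face; case: unliftP => [k' kE|kE].
  by rewrite val_hs.
by rewrite /sub_coord; case: b {e1E} => /=; field.
Qed.

Lemma hs_face2 n (j : 'I_n.+1) (e : ind n) (e1 e0 : ind n.+1) v :
  (forall k, e1 k = if unlift j k is Some k' then e k' else true) ->
  (forall k, e0 k = if unlift j k is Some k' then e k' else false) ->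
  hs e1 (face (fintype.lift ord0 j) false v) = hs e0 (face (fintype.lift ord0 j) true v).
Proof.
move=> e1E e0E; apply: cubeP => k; rewrite !val_hs e1E e0E.
rewrite !val_face_lift0 !tl_face !val_face; case: unliftP => // _.
by rewrite /sub_coord /=; field.
Qed.

(** The faces of the pieces in direction j: those on the boundary of the cube make up the
    subdivision of its face, and those on the common wall cancel in pairs. *)
Lemma sum_face_hs n (s : cube n.+1 -> X) (j : 'I_n.+1) :
  \sum_(e : ind n.+1) (cub (s \o hs e \o face (fintype.lift ord0 j) true) -
                       cub (s \o hs e \o face (fintype.lift ord0 j) false)) =
  Df (s \o face j true) - Df (s \o face j false).
Proof.
pose h (p : bool * ind n) : ind n.+1 :=
  [ffun k => if unlift j k is Some k' then p.2 k' else p.1].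
pose h' (e : ind n.+1) : bool * ind n :=
  (e j, [ffun k => e (fintype.lift j k)]).
have hK : cancel h h'.
  move=> [b e]; congr (_, _); first by rewrite ffunE unlift_none.
  by apply/ffunP => k; rewrite !ffunE liftK.
have h'K : cancel h' h.
  move=> e; apply/ffunP => k; rewrite !ffunE.
  by case: unliftP => [k' ->|->] //=; rewrite ffunE.
rewrite (reindex h) /=; last by apply: onW_bij; exists h'.
rewrite -(pair_bigA _ (fun b e =>
   cub (s \o hs (h (b, e)) \o face (fintype.lift ord0 j) true) -
   cub (s \o hs (h (b, e)) \o face (fintype.lift ord0 j) false))) /=.
rewrite big_bool /= -big_split /Df -sumrB /=; apply: eq_bigr => e _ /=.
have hE b k : h (b, e) k = if unlift j k is Some k' then e k' else b.
  by rewrite ffunE.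
have E2 : s \o hs (h (true, e)) \o face (fintype.lift ord0 j) false =
    s \o hs (h (false, e)) \o face (fintype.lift ord0 j) true.
  by apply/funext => v /=; rewrite (hs_face2 _ (hE true) (hE false)).
have E1 b : s \o hs (h (b, e)) \o face (fintype.lift ord0 j) b =
    s \o face j b \o hs e.
  by apply/funext => v /=; rewrite (hs_face1 _ (hE b)).
rewrite E2 !E1; abel.
Qed.

Lemma bd_sum n I r (P : pred I) (F : I -> chain R n.+1 X) :
  bd (\sum_(i <- r | P i) F i) = \sum_(i <- r | P i) bd (F i).
Proof. exact: raddf_sum. Qed.

Lemma clift_sum n m (Phi : (cube n -> X) -> chain R m X) I r (P : pred I) (F : I -> chain R n X) :
  clift Phi (\sum_(i <- r | P i) F i) = \sum_(i <- r | P i) clift Phi (F i).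
Proof. exact: (raddf_sum (clift _)). Qed.

Lemma bd_D n (z : chain R n.+1 X) : T set0 (bd (D z) + D (bd z) - (sd z - z)).
Proof.
have Tz : T setT z by move=> s _; right.
move: z Tz; apply: T_ind_add => [y z|s _]; first by rewrite !(bdB, DB, sdB); abel.
have cs : continuous s by exact: cts_fun.
rewrite /D /sd !cliftE bdE /bdf clift_sum {1}/Df bd_sum.
have bdE1 (e : ind n.+1) : bd (cub (s \o hs e)) =
    cub (s \o sh e) - cub (s \o hs e \o face ord0 false) -
    \sum_(j < n.+1) (-1) ^+ j *: (cub (s \o hs e \o face (fintype.lift ord0 j) true) -
       cub (s \o hs e \o face (fintype.lift ord0 j) false)).
  rewrite bd_cub; last by apply: cts_comp => //; exact: cts_hs.
  rewrite /bdf big_ord_recl expr0 scale1r -sumrN; congr (_ + _).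
  by apply: eq_bigr => j _; rewrite lift0 exprS mulN1r scaleNr.
under eq_bigr do rewrite bdE1.
rewrite !sumrB exchange_big /=.
have -> : \sum_(j < n.+1) \sum_(e : ind n.+1) ((-1) ^+ j *:
   (cub (s \o hs e \o face (fintype.lift ord0 j) true) -
    cub (s \o hs e \o face (fintype.lift ord0 j) false))) =
  \sum_(i < n.+1) clift (@Df n) ((-1) ^+ i *: (cub (s \o face i true) - cub (s \o face i false))).
  apply: eq_bigr => j _; rewrite -scaler_sumr sum_face_hs cliftZs cliftB.
  by rewrite !clift_cub //; apply: cts_face_comp.
rewrite -/(sdf s); set S := \sum_(i < n.+1) _.
(* At t = 0 the piece with all [e j] false is the cube itself, and every other piece is constant in
   some direction. *)
rewrite (bigD1 [ffun=> false]) //= (_ : s \o hs _ \o _ = s); last first.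
  apply/funext => v /=; congr (s _); apply: cubeP => k.
  by rewrite val_hs val_face_id tl_face0 ffunE /sub_coord /=; field.
set G := \sum_(i | _) _; rewrite (_ : _ - _ = - G); last abel.
apply: TN; apply: T_sum => e; have [k ek|ek] := pickP (fun k => e k).
  move=> _; apply: T_cub; left; exists k => t u tu /=; congr (s _).
  apply: cubeP => l; rewrite !val_hs !val_face_id !tl_face0 /sub_coord /=.
  have [->|lk] := eqVneq l k; first by rewrite ek !mul0r.
  by rewrite tu.
by move=> /eqP[]; apply/ffunP => k; rewrite ffunE; apply: negbTE; rewrite ek.
Qed.

Definition Sm (A B : set X) n (z : chain R n X) :=
  exists u v, [/\ T A u, T B v & z = u + v].

Lemma SmB A B n (y z : chain R n X) : Sm A B y -> Sm A B z -> Sm A B (y - z).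
Proof.
move=> [u [v [Tu Tv ->]]] [u' [v' [Tu' Tv' ->]]].
by exists (u - u'), (v - v'); split; [exact: TB|exact: TB|abel].
Qed.

Lemma Sm_l A B n (z : chain R n X) : T A z -> Sm A B z.
Proof. by exists z, 0; split; rewrite ?addr0 //; exact: T0. Qed.

Lemma Sm_r A B n (z : chain R n X) : T B z -> Sm A B z.
Proof. by exists 0, z; split; rewrite ?add0r //; exact: T0. Qed.

Lemma Sm0 A B n : Sm A B (0 : chain R n X).
Proof. by apply: Sm_l; exact: T0. Qed.

Lemma SmN A B n (z : chain R n X) : Sm A B z -> Sm A B (- z).
Proof. by rewrite -sub0r; apply: SmB; exact: Sm0. Qed.

Lemma SmD A B n (y z : chain R n X) : Sm A B y -> Sm A B z -> Sm A B (y + z).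
Proof. by move=> Sy /SmN; rewrite -{2}[z]opprK; exact: SmB. Qed.

Lemma Sm_bd A B n (z : chain R n.+1 X) : Sm A B z -> Sm A B (bd z).
Proof.
move=> [u [v [Tu Tv ->]]]; exists (bd u), (bd v).
by split; [exact: T_bd|exact: T_bd|rewrite bdD].
Qed.

Lemma Sm_D A B n (z : chain R n X) : Sm A B z -> Sm A B (D z).
Proof.
move=> [u [v [Tu Tv ->]]]; exists (D u), (D v).
by split; [exact: T_D|exact: T_D|exact: (raddfD (clift _))].
Qed.

Lemma Sm_sd A B n (z : chain R n X) : Sm A B z -> Sm A B (sd z).
Proof.
move=> [u [v [Tu Tv ->]]]; exists (sd u), (sd v).
by split; [exact: T_sd|exact: T_sd|rewrite sdD].
Qed.

Lemma Sm_iter A B n (z : chain R n X) k : Sm A B z -> Sm A B (iter k (@sd n) z).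
Proof. by move=> Sz; elim: k => //= k; exact: Sm_sd. Qed.

Lemma iter_sdB n k (y z : chain R n X) :
  iter k (@sd n) (y - z) = iter k (@sd n) y - iter k (@sd n) z.
Proof. by elim: k => //= k ->; rewrite sdB. Qed.

Lemma iter_sd_sum n k I (r : seq I) (F : I -> chain R n X) :
  iter k (@sd n) (\sum_(i <- r) F i) = \sum_(i <- r) iter k (@sd n) (F i).
Proof. by elim: k => //= k ->; exact: clift_sum. Qed.

(** z and its subdivision differ by bd (D z) up to D (bd z), which is small because bd z is, and up
    to degenerate cubes. *)
Lemma sd_homology A B C k n (z : chain R n.+1 X) :
  T C z -> Sm A B (bd z) ->
  exists2 w : chain R n.+2 X, T C w & Sm A B (z - bd w - iter k (@sd n.+1) z).
Proof.
elim: k z => [|k IHk] z Tz Sbz.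
  by exists 0; [exact: T0|rewrite bd0 subr0 subrr; exact: Sm0].
have H := Sm_l B (T00 A (@bd_D _ z)).
have H2 := Sm_D Sbz.
have [||w Tw Sw] := IHk (sd z).
- exact: T_sd.
- rewrite (_ : bd _ = bd z + bd (D (bd z)) - bd (bd (D z) + D (bd z) - (sd z - z))).
    by apply: SmB; [apply: SmD => //; exact: Sm_bd|exact: Sm_bd].
  by rewrite !(bdB, bdD) bd_bd; abel.
exists (w - D z); first by apply: TB => //; exact: T_D.
rewrite bdB -iterSr in Sw *.
rewrite (_ : _ - _ = (sd z - bd w - iter k.+1 (@sd n.+1) z) - D (bd z)
  + (bd (D z) + D (bd z) - (sd z - z))); first by apply: SmD => //; exact: SmB.
by rewrite iterSr; abel.
Qed.

Definition fine_map k n (phi : cube n -> cube n) := continuous phi /\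
  forall u v j, `|val (phi u) 0 j - val (phi v) 0 j| <= 2^-1 ^+ k.

(** The cubes of the k-th subdivision are compositions of s with maps whose image has width at most
    2^-k. Carrying out the first subdivision replaces s by its compositions with [sh e]. *)
Lemma iter_sd_fine A B k n (s : cube n -> X) : continuous s ->
  (forall phi, fine_map k phi -> Sm A B (cub (s \o phi))) ->
  Sm A B (iter k (@sd n) (cub s)).
Proof.
elim: k s => [|k IHk] s cs sfine.
  have /= := sfine id; apply; split; first by move=> ?; exact: cvg_id.
  move=> u v j; rewrite expr0; have := cube01 u j; have := cube01 v j.
  by rewrite ler_norml => /andP[? ?] /andP[? ?]; apply/andP; split; lra.
rewrite iterSr {2}/sd clift_cub // /sdf.
rewrite iter_sd_sum.
elim/big_ind: _ => [||e _]; [exact: Sm0|by move=> ? ?; exact: SmD|].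
apply: IHk => [|phi [cphi fphi]]; first by apply: cts_comp => //; exact: cts_sh.
rewrite -compA; apply: sfine; split; first by apply: cts_comp => //; exact: cts_sh.
move=> u v j; rewrite !val_sh -mulrBl opprD addrACA subrr addr0 normrM.
by rewrite [`|2^-1|]ger0_norm ?invr_ge0 // exprSr ler_pM2r ?invr_gt0.
Qed.

Lemma nbhs_cube n (x : cube n) (P : set (cube n)) : nbhs x P ->
  exists2 e : R, 0 < e & forall y : cube n, (forall j, `|val x 0 j - val y 0 j| < e) -> P y.
Proof.
rewrite nbhsE => -[V [ [U oU <-] Ux] UP].
have : nbhs (val x) U by apply: open_nbhs_nbhs.
move=> /nbhs_ballP[e /= e0 xe]; exists e => // y xy; apply: UP; apply: xe; split=> // i j.
by rewrite ord1; exact: xy.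
Qed.

Definition relopen (A C : set X) := forall p, A p -> \forall q \near p, C q -> A q.

(** The Lebesgue number argument. [Q C k x] says that s maps all points within 2^-k of x into C;
    near each x this holds for A or for B and all large k, and compactness of the cube makes k
    uniform. *)
Lemma small_cub A B n (s : scube R n X) :
  relopen A (A `|` B) -> relopen B (A `|` B) -> (forall t, (A `|` B) (s t)) ->
  exists k, Sm A B (iter k (@sd n) (cub s)).
Proof.
move=> oA oB sAB.
pose Q (C : set X) (k : nat) (x : 'rV[R]_n) :=
  forall y : cube n, (forall j, `|x 0 j - val y 0 j| <= 2^-1 ^+ k) -> C (s y).
pose P k x := Q A k x \/ Q B k x.
have cK := @rV_compact R n (fun=> `[0, 1]%classic) (fun=> @segment_compact R 0 1).
have half_cvg : (fun k => 2^-1 ^+ k : R) @ \oo --> (0 : R).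
  by apply: cvg_expr; rewrite ger0_norm ?invr_ge0 // invf_lt1 // ltr1n.
have : \forall k \near \oo, [set v : 'rV[R]_n | forall i, `[0, 1]%classic (v ord0 i)] `<=` P k.
  move/compact_near_coveringP: cK; apply => x x01.
  have xc : x \in cube_set R n.
    by apply/mem_set => j; have := x01 j; rewrite /= in_itv.
  have key (C : set X) : C (s (SigSub xc)) -> relopen C (A `|` B) ->
     exists2 e : R, 0 < e & forall y : cube n, (forall j, `|x 0 j - val y 0 j| < e) -> C (s y).
    move=> Cx oC; have /(@cts_fun _ _ s (SigSub xc)) := oC _ Cx.
    move=> /nbhs_cube[e e0 eC]; exists e => // y xy; exact: (eC y xy (sAB y)).
  have fin (C : set X) (e : R) : 0 < e -> (forall y : cube n, (forall j, `|x 0 j - val y 0 j| < e) -> C (s y)) ->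
    \forall x' \near x & k \near \oo, Q C k x'.
    move=> e0 eC; near=> x' k => y x'y; apply: eC => j.
    have h1 : `|x 0 j - x' 0 j| < e / 2.
      have : ball x (e / 2) x' by near: x'; apply: nbhsx_ballx; rewrite divr_gt0.
      by move=> [_ /(_ 0 j)].
    have h2 : 2^-1 ^+ k < e / 2 :> R.
      near: k; apply: (cvgr_lt (0 : R)) => //; by rewrite divr_gt0.
    have -> : x 0 j - val y 0 j = (x 0 j - x' 0 j) + (x' 0 j - val y 0 j) by ring.
    apply: le_lt_trans (ler_normD _ _) _; rewrite [e]splitr.
    by apply: ltrD => //; exact: le_lt_trans (x'y j) h2.
  have [Ax|Bx] := sAB (SigSub xc).
    have [e e0 /(fin _ _ e0) H] := key _ Ax oA.
    by apply: filterS H => -[x' k] /= H; left.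
  have [e e0 /(fin _ _ e0) H] := key _ Bx oB.
  by apply: filterS H => -[x' k] /= H; right.
move=> [k _ /(_ k (leqnn k)) KP]; exists k.
apply: iter_sd_fine => [|phi [cphi fphi]]; first exact: cts_fun.
(* The image of phi lies within 2^-k of one of its points, so testing there decides between A and
   B. *)
have [|H|H] := KP (val (phi (cube0 R n))).
- by move=> j; rewrite /= in_itv; exact: cube01.
- by apply: Sm_l; apply: T_cub; right => t; apply: H => j; exact: fphi.
- by apply: Sm_r; apply: T_cub; right => t; apply: H => j; exact: fphi.
Unshelve. all: by end_near. Qed.

Lemma small_chain A B n (z : chain R n X) :
  relopen A (A `|` B) -> relopen B (A `|` B) -> T (A `|` B) z ->
  exists k, Sm A B (iter k (@sd n) z).
Proof.
move=> oA oB Tz.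
suff [k kz] : exists k, forall k', (k <= k')%N -> Sm A B (iter k' (@sd n) z).
  by exists k; exact: kz.
elim/T_ind: z / Tz => [|y z [k ky] [l lz]|s [ds|sAB]].
- by exists 0%N => k _; rewrite -(subrr 0) iter_sdB subrr; exact: Sm0.
- exists (maxn k l) => m; rewrite geq_max => /andP[km lm]; rewrite iter_sdB.
  by apply: SmB; [exact: ky|exact: lz].
- by exists 0%N => k _; apply: Sm_iter; apply: Sm_l; apply: T_cub; left.
have [k Sk] := small_cub oA oB sAB; exists k => k' kk'.
by rewrite -(subnK kk') iterD; exact: Sm_iter.
Qed.

Lemma small_cycle A B n (z : chain R n.+1 X) :
  relopen A (A `|` B) -> relopen B (A `|` B) -> T (A `|` B) z -> Sm A B (bd z) ->
  exists2 w : chain R n.+2 X, T (A `|` B) w & Sm A B (z - bd w).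
Proof.
move=> oA oB Tz Sbz; have [k Sk] := small_chain oA oB Tz.
have [w Tw Sw] := sd_homology k Tz Sbz; exists w => //.
by have := SmD Sw Sk; rewrite addrNK.
Qed.
End Subdivision.

(** * Chains of degree 0 and components *)

Section Components.
Variables (R : realType) (X : topologicalType).
Local Notation cube n := (cube_set R n).
Local Notation T := trivial_chain.

Lemma cube0_eq (t : cube 0) : t = cube0 R 0.
Proof. by apply: cubeP => -[]. Qed.

(** A 0-cube has no direction in which it could be degenerate. *)
Lemma T0_deg0 (z : chain R 0 X) : T set0 z -> z = 0.
Proof.
move=> Tz; apply/eqP; rewrite -dom_eq0; case E: (dom z) => [//|s r].
have := Tz s; rewrite E in_cons eqxx => /(_ isT) [[[]]//|/(_ (s (cube0 R 0)))]; by case; exists (cube0 R 0).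
Qed.

Definition cnt (I : eqType) (l : X -> I) (i : I) (z : chain R 0 X) : int :=
  fglift (fun s : scube R 0 X => ((l (s (cube0 R 0)) == i)%:R : int^o)) z.

Lemma cntB (I : eqType) (l : X -> I) i y z : cnt l i (y - z) = cnt l i y - cnt l i z.
Proof.
exact: (lift_is_additive (fun s : scube R 0 X =>
  ((l (s (cube0 R 0)) == i)%:R : int^o)) y z).
Qed.

Lemma cnt_cub (I : eqType) (l : X -> I) i (f : cube 0 -> X) : continuous f ->
  cnt l i (cub f) = (l (f (cube0 R 0)) == i)%:R.
Proof.
move=> cf; rewrite -[f]/(mkcts cf : _ -> _) cub_scube /cnt liftU scale1r.
by [].
Qed.

Lemma cts_cst0 (p : X) n : continuous (fun _ : cube n => p).
Proof. exact: cst_continuous. Qed.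

Lemma push0 f n : push1 f (0 : chain R n X) = 0.
Proof. exact: (raddf0 (clift _)). Qed.

Lemma cts_deg0 (f : cube 0 -> X) : continuous f.
Proof.
have -> : f = fun=> f (cube0 R 0) by apply/funext => t; rewrite (cube0_eq t).
exact: cts_cst0.
Qed.

Lemma cntD (I : eqType) (l : X -> I) i y z : cnt l i (y + z) = cnt l i y + cnt l i z.
Proof. by rewrite -[z in LHS]opprK cntB -(sub0r z) cntB -(subrr 0) cntB subrr sub0r opprK. Qed.

Lemma cnt0 (I : eqType) (l : X -> I) i : cnt l i 0 = 0.
Proof. by rewrite -(subrr 0) cntB subrr. Qed.

Lemma cntN (I : eqType) (l : X -> I) i z : cnt l i (- z) = - cnt l i z.
Proof. by rewrite -sub0r cntB cnt0 sub0r. Qed.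

Lemma cnt_sum (I : eqType) (l : X -> I) i J r (P : pred J) F :
  cnt l i (\sum_(j <- r | P j) F j) = \sum_(j <- r | P j) cnt l i (F j).
Proof. by apply: (big_morph (cnt l i)); [exact: cntD|exact: cnt0]. Qed.

Lemma cnt_mulz (I : eqType) (l : X -> I) i z k : cnt l i (z *~ k) = cnt l i z * k.
Proof.
have Hn n : cnt l i (z *+ n) = cnt l i z *+ n.
  by elim: n => [|n IH]; rewrite ?mulr0n ?cnt0 // !mulrS cntD IH.
case: k => n; first by rewrite -pmulrn Hn -mulr_natr natz.
by rewrite NegzE mulrNz cntN -pmulrn Hn mulrN -mulr_natr natz.
Qed.

(* A subset with contractible components, the component of a point being told
   by its label in I. *)
Record clusters (A : set X) (I : eqType) (l : X -> I) := Clusters {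
  clus_ctr : I -> X;
  clus_F : R -> X -> X;
  _ : cont_on A clus_F;
  _ : forall t p, 0 <= t <= 1 -> A p -> A (clus_F t p);
  _ : forall p, A p -> clus_F 0 p = p;
  _ : forall p, A p -> clus_F 1 p = clus_ctr (l p);
  _ : forall i, A (clus_ctr i);
  _ : forall i, l (clus_ctr i) = i;
  _ : forall n (s : scube R n X), (forall t, A (s t)) ->
        forall t u, l (s t) = l (s u)
}.

Definition pt (p : X) : chain R 0 X := cub (fun=> p).

Section Clusters.
Variables (A : set X) (I : finType) (l : X -> I) (cl : clusters A l).

Lemma clus_Rel : Rel R A set0.
Proof.
case: cl => ctr F cF FA F0 F1 Actr lctr lc.
apply: (Rel_contract cF FA F0) => n s sA t u.
by rewrite !F1 // (lc _ s sA t u).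
Qed.

Lemma clus_cnt_bd i (w : chain R 1 X) : T A w -> cnt l i (bd w) = 0.
Proof.
case: cl => ctr F cF FA F0 F1 Actr lctr lc.
move=> Tw; elim/T_ind: w / Tw => [|y z yE zE|s sA]; first by rewrite bd0 cnt0.
  by rewrite bdB cntB yE zE subr0.
rewrite bdE /bdf big_ord_recl big_ord0 addr0 expr0 scale1r cntB.
rewrite !cnt_cub; try exact: cts_deg0.
rewrite /= (_ : l _ = l (s (face ord0 false (cube0 R 0)))) ?subrr //.
case: sA => [[k sk]|sA]; last exact: lc.
by congr l; apply: sk => j; rewrite (ord1 j) (ord1 k) eqxx.
Qed.

Lemma clus_push (z : chain R 0 X) ctr : T A z ->
  push1 (ctr \o l) z = \sum_i pt (ctr i) *~ cnt l i z.
Proof.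
move=> Tz; elim/T_ind: z / Tz => [|y z yE zE|s sA].
- rewrite push0 big1 // => i _; by rewrite cnt0.
- by rewrite pushB yE zE -sumrB; apply: eq_bigr => i _; rewrite cntB mulrzBr.
rewrite /push1 cliftE (bigD1 (l (s (cube0 R 0)))) //= cnt_cub ?eqxx; last exact: cts_deg0.
rewrite mulr1z big1 ?addr0 => [|i /negbTE il]; last first.
  by rewrite cnt_cub ?(eq_sym _ i) ?il //; exact: cts_deg0.
by congr cub; apply/funext => t; rewrite (cube0_eq t).
Qed.

(** The contraction moves z to the chain of centres with coefficients [cnt l i z], which all vanish;
    the prism is the filling. *)
Lemma clus_H0 (z : chain R 0 X) : T A z -> (forall i, cnt l i z = 0) ->
  exists2 w : chain R 1 X, T A w & z = bd w.
Proof.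
move=> Tz z0; have := clus_push (clus_ctr cl) Tz; case: cl => ctr F cF FA F0 F1 Actr lctr lc /=.
rewrite big1 => [pz|i _]; last by rewrite z0.
exists (- hK F z); first by apply: TN; exact: T_hK Tz.
have /T0_deg0/eqP := bd_hK0 cF Tz; rewrite subr_eq0 => /eqP bz.
have /T0_deg0/eqP := push_id F0 Tz; rewrite subr_eq0 => /eqP pz0.
rewrite bdN bz pz0 (_ : push1 (F 1) z = 0) ?sub0r ?opprK //.
rewrite -pz; apply/eqP; rewrite -subr_eq0; apply/eqP/T0_deg0.
move: z Tz {z0 pz bz pz0}; apply: T_ind_add => [y z|s [[[]]//|sA]].
  by rewrite !pushB; abel.
rewrite /push1 !cliftE (_ : F 1 \o s = (ctr \o l) \o s) ?subrr; first exact: T0.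
by apply/funext => t; exact: F1.
Qed.

Lemma clus_pt i j : cnt l i (pt (clus_ctr cl j)) = (j == i)%:R.
Proof.
case: cl => ctr F cF FA F0 F1 Actr lctr lc /=.
by rewrite /pt cnt_cub ?lctr //; exact: cts_cst0.
Qed.

Lemma clus_ctrA i : A (clus_ctr cl i).
Proof. by case: cl. Qed.

End Clusters.

Lemma T_pt (A : set X) p : A p -> T A (pt p).
Proof. by move=> Ap; apply: T_cub; right. Qed.

Lemma bd_push f n (z : chain R n.+1 X) : continuous f ->
  bd (push1 f z) = push1 f (bd z).
Proof.
move=> cf; have Tz : T setT z by move=> s _; right.
elim/T_ind: z / Tz => [|y z yE zE|s _].
- by rewrite bd0 !push0 bd0.
- by rewrite !(bdB, pushB) yE zE.
have cfs : continuous (f \o s).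
  by move=> t; apply: continuous_comp; [exact: cts_fun|exact: cf].
rewrite /push1 cliftE bd_cub // bdE /bdf clift_sum; apply: eq_bigr => i _.
rewrite cliftZs cliftB !clift_cub //; by apply: cts_face_comp; exact: cts_fun.
Qed.

Lemma cnt_push (E : eqType) (l : X -> E) (A : set X) f (pi : E -> E) e
    (z : chain R 0 X) : injective pi -> (forall p, A p -> l (f p) = pi (l p)) -> T A z ->
  cnt l (pi e) (push1 f z) = cnt l e z.
Proof.
move=> pi_inj lf Tz; elim/T_ind: z / Tz => [|y z yE zE|s [[[]]//|sA]].
- by rewrite push0 !cnt0.
- by rewrite pushB !cntB yE zE.
rewrite /push1 cliftE !cnt_cub; try exact: cts_deg0.
by rewrite /= lf // (inj_eq pi_inj).
Qed.

Lemma cnt_coarse (E : finType) (I : eqType) (l : X -> E) (m : X -> I) (io : E -> I)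
    (A : set X) (z : chain R 0 X) i : (forall p, A p -> m p = io (l p)) -> T A z ->
  cnt m i z = \sum_(e | io e == i) cnt l e z.
Proof.
move=> ml Tz; elim/T_ind: z / Tz => [|y z yE zE|s [[[]]//|sA]].
- by rewrite cnt0 big1 // => e _; rewrite cnt0.
- by rewrite cntB yE zE -sumrB; apply: eq_bigr => e _; rewrite cntB.
rewrite cnt_cub ?ml //; try exact: cts_deg0.
rewrite (eq_bigr (fun e => (l (s (cube0 R 0)) == e)%:R)) => [|e _]; last first.
  by rewrite cnt_cub //; exact: cts_deg0.
have [li|li] := eqVneq (io (l (s (cube0 R 0)))) i.
  rewrite (bigD1 (l (s (cube0 R 0)))) ?li //= eqxx big1 ?addr0 // => e /andP[_ /negbTE].
  by rewrite eq_sym => ->.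
rewrite big1 // => e /eqP ei; case: eqP => // le; by rewrite le ei eqxx in li.
Qed.
End Components.

(** * Second homology by two Mayer-Vietoris arguments *)

Section HomologyClasses.
Variables (R : realType) (X : topologicalType).
Local Notation T := trivial_chain.
Local Notation H2 := (homology R 2 (set0 : set X)).

Lemma homology_eqP n (A : set X) (x y : cycles R n A) :
  reflect (exists w : chain R n.+1 X, trivial_chain A (val x - val y - bd w))
   (\pi_(homology R n A) x == \pi_(homology R n A) y)%qT.
Proof.
rewrite eqmodE -[X in reflect _ X]/(asbool (exists w : chain R n.+1 X,
   trivial_chain A (val (x - y) - bd w))).
by rewrite raddfB; exact: asboolP.
Qed.

Definition cycle2 (z : chain R 2 X) := T set0 (bd z).

Lemma hrep_cycle (a : H2) : cycle2 (hrep a).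
Proof. by rewrite /hrep; case: (repr a) => z /= /asboolP. Qed.

Lemma hclassE (z : chain R 2 X) (cz : cycle2 z) :
  exists2 x : cycles R 2 (set0 : set X), val x = z & hclass set0 z = (\pi_H2 x)%qT.
Proof.
have zc : z \in rel_cycle (set0 : set X) by apply/asboolP.
by exists (insubd (0 : cycles R 2 (set0 : set X)) z) => //; rewrite insubdK.
Qed.

Lemma hclassP (y z : chain R 2 X) : cycle2 y -> cycle2 z ->
  hclass set0 y = hclass set0 z <-> exists w, T set0 (y - z - bd w).
Proof.
move=> /hclassE[y' <- ->] /hclassE[z' <- ->].
by split => [/eqP/homology_eqP|?]; [|apply/eqP/homology_eqP].
Qed.

Lemma hrepK (a : H2) : hclass set0 (hrep a) = a.
Proof.
rewrite /hclass /hrep (_ : insubd _ _ = repr a) ?reprK //.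
by apply/val_inj; rewrite insubdK //; exact: valP.
Qed.

Lemma hclassB (y z : chain R 2 X) : cycle2 y -> cycle2 z ->
  hclass set0 (y - z) = hclass set0 y - hclass set0 z.
Proof.
move=> cy cz; have cyz : cycle2 (y - z) by rewrite /cycle2 bdB; exact: TB.
have [y' y'E ->] := hclassE cy; have [z' z'E ->] := hclassE cz.
have [x xE ->] := hclassE cyz.
have -> : x = y' - z' by apply/val_inj; rewrite xE -y'E -z'E; symmetry; exact: raddfB.
by rewrite raddfB.
Qed.

Lemma pushE (f : continuousType X X) n (z : chain R n X) : push f z = push1 f z.
Proof.
have Tz : T setT z by move=> s _; right.
have pB (x y : chain R n X) : push f (x - y) = push f x - push f y.
  exact: (lift_is_additive (fun s => << cube_comp f s >>) x y).
elim/T_ind: z / Tz => [|y z yE zE|s _].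
- by rewrite push0 -[X in push _ X](subrr (0 : chain R n X)) pB subrr.
- by rewrite pushB pB yE zE.
rewrite /push1 cliftE cub_scube /push liftU scale1r.
by symmetry; exact: cubE.
Qed.

Lemma hmapE (h : continuousType X X) (a : H2) :
  hmap set0 h a = hclass set0 (push1 h (hrep a)).
Proof. by rewrite -pushE. Qed.

Lemma push_cycle (f : X -> X) z : continuous f -> cycle2 z -> cycle2 (push1 f z).
Proof. by move=> cf; rewrite /cycle2 bd_push //; apply: T_push. Qed.

Lemma hmapB (h : continuousType X X) (a b : H2) :
  hmap set0 h (a - b) = hmap set0 h a - hmap set0 h b :> H2.
Proof.
have ch : continuous h by exact: cts_fun.
have ca := @hrep_cycle a; have cb := @hrep_cycle b; have cab := @hrep_cycle (a - b).
rewrite !hmapE -hclassB; try exact: push_cycle.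
rewrite -pushB; apply/hclassP.
- exact: push_cycle.
- by apply: push_cycle => //; rewrite /cycle2 bdB; exact: TB.
have [] := hclassP cab (_ : cycle2 (hrep a - hrep b)); first by rewrite /cycle2 bdB; exact: TB.
rewrite hrepK hclassB // !hrepK => /(_ erefl)[w Tw] _.
exists (push1 h w); rewrite bd_push // -!pushB.
by apply: T_push Tw.
Qed.

Lemma push_homotopic (F : R -> X -> X) z : cont_on setT F -> cycle2 z ->
  exists w, T set0 (push1 (F 1) z - push1 (F 0) z - bd w).
Proof.
move=> cF cz; have Tz : T setT z by move=> s _; right.
exists (hK F z); have H := bd_hK cF Tz.
have H2 : T set0 (hK F (bd z)) by apply: T_hK cz => t p _ [].
rewrite (_ : _ - _ = hK F (bd z) - (bd (hK F z) + hK F (bd z) - (push1 (F 1) z - push1 (F 0) z))).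
  exact: TB.
abel.
Qed.
End HomologyClasses.

Section MayerVietoris.
Variables (R : realType) (X : topologicalType).
Local Notation T := trivial_chain.
Local Notation H2 := (homology R 2 (set0 : set X)).
Variables (Y Vp Vm G U V : set X).
Let N := Vp `&` Vm.
Let W := U `&` V.
Variables (E I J : finType) (lW : X -> E) (lU : X -> I) (lV : X -> J).
Variables (iU : E -> I) (iV : E -> J).
Hypothesis RelY : Rel R setT Y.
Hypothesis YV : Y = Vp `|` Vm.
Hypothesis Vp_open : relopen Vp (Vp `|` Vm).
Hypothesis Vm_open : relopen Vm (Vp `|` Vm).
Hypothesis RelVp : Rel R Vp set0.
Hypothesis RelVm : Rel R Vm set0.
Hypothesis RelN : Rel R N G.
Hypothesis GN : G `<=` N.
Hypothesis GU : G = U `|` V.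
Hypothesis U_open : relopen U (U `|` V).
Hypothesis V_open : relopen V (U `|` V).
Hypothesis clU : clusters R U lU.
Hypothesis clV : clusters R V lV.
Hypothesis clW : clusters R W lW.
Hypothesis lUW : forall p, W p -> lU p = iU (lW p).
Hypothesis lVW : forall p, W p -> lV p = iV (lW p).

Definition balanced (theta : {ffun E -> int}) :=
  (forall i, \sum_(e | iU e == i) theta e = 0) /\
  (forall j, \sum_(e | iV e == j) theta e = 0).

(* theta is the image of the cycle z under the two connecting homomorphisms
   H_2(Vp u Vm) -> H_1(Vp n Vm) = H_1(U u V) -> H_0(U n V). *)
Definition mv (z : chain R 2 X) (theta : {ffun E -> int}) :=
  exists u v m e1 e2 w, [/\ T Vp u, T Vm v & T set0 (z - u - v - bd m)] /\
    [/\ T U e1, T V e2, T N w, T set0 (bd u - e1 - e2 - bd w) &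
     forall e, theta e = cnt lW e (bd e1)].

Lemma UN : U `<=` N. Proof. by move=> p Up; apply: GN; rewrite GU; left. Qed.
Lemma VN : V `<=` N. Proof. by move=> p Up; apply: GN; rewrite GU; right. Qed.

Lemma mvB z z' th th' : mv z th -> mv z' th' -> mv (z - z') (th - th').
Proof.
move=> [u [v [m [e1 [e2 [w [[Tu Tv Tz] [T1 T2 Tw Tb thE]]]]]]]].
move=> [u' [v' [m' [e1' [e2' [w' [[Tu' Tv' Tz'] [T1' T2' Tw' Tb' thE']]]]]]]].
exists (u - u'), (v - v'), (m - m'), (e1 - e1'), (e2 - e2'), (w - w').
split; split; try exact: TB.
- rewrite bdB (_ : _ - _ = (z - u - v - bd m) - (z' - u' - v' - bd m')); first exact: TB.
  abel.
- rewrite !bdB (_ : _ - _ = (bd u - e1 - e2 - bd w) - (bd u' - e1' - e2' - bd w')).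
    exact: TB.
  abel.
by move=> e; rewrite !ffunE bdB cntB thE thE'.
Qed.

(** Taking boundaries in bd u = e1 + e2 + bd w gives bd e1 = - bd e2, so this 0-chain lies in U and
    in V. *)
Lemma T_bd_e1 z u v m e1 e2 (w : chain R 2 X) : cycle2 z -> T Vm v -> T U e1 -> T V e2 ->
  T set0 (z - u - v - bd m) -> T set0 (bd u - e1 - e2 - bd w) -> T W (bd e1 : chain R 0 X).
Proof.
move=> cz Tv T1 T2 Tz Tb; apply: TI; first exact: T_bd.
have H := T_bd Tb; rewrite !bdB !bd_bd !subr0 sub0r in H.
rewrite (_ : bd e1 = - (- bd e1 - bd e2) - bd e2); last abel.
by apply: TB; [apply: TN; exact: T00|exact: T_bd].
Qed.

(** The sum of theta around a component of U counts the points of bd e1 in it, which is 0 because e1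
    lies in U. For V the same holds by bd e1 = - bd e2. *)
Lemma mv_balanced z th : cycle2 z -> mv z th -> balanced th.
Proof.
move=> cz [u [v [m [e1 [e2 [w [[Tu Tv Tz] [T1 T2 Tw Tb thE]]]]]]]].
have T1W := T_bd_e1 cz Tv T1 T2 Tz Tb.
have E2 : bd e1 = - bd e2.
  have := T_bd Tb; rewrite !bdB !bd_bd !subr0 sub0r => /T0_deg0/eqP.
  by rewrite subr_eq0 => /eqP <-; rewrite opprK.
split => i; rewrite (eq_bigr (fun e => cnt lW e (bd e1))) => [|e _] //.
  by rewrite -(cnt_coarse i lUW T1W) (clus_cnt_bd clU).
by rewrite -(cnt_coarse i lVW T1W) E2 cntN (clus_cnt_bd clV) ?oppr0.
Qed.

(** Well-definedness of theta. A filling of u + v is moved into Y and made small; its part in Vp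
    corrects u by a boundary to a chain in N, which fills e1 + e2 up to w. The same step with G, U
    and V, one degree lower, corrects e1 by a boundary to a chain in W, on whose boundary all counts
    vanish. *)
Lemma mv_boundary z th m : mv z th -> T set0 (z - bd m) -> th = 0.
Proof.
move=> [u [v [m' [e1 [e2 [w [[Tu Tv Tz] [T1 T2 Tw Tb thE]]]]]]]] zm.
have TT k (x : chain R k X) : T setT x by move=> s _; right.
have Tuv : T Y (u + v).
  by rewrite YV; apply: TD; [apply: TS Tu|apply: TS Tv] => p; [left|right].
have E1 : T set0 (u + v - bd (m - m')).
  rewrite bdB (_ : _ - _ = (z - bd m) - (z - u - v - bd m')); first exact: TB.
  abel.
have [|k _] := RelY (TT _ (m - m')).
  rewrite (_ : bd _ = (u + v) - (u + v - bd (m - m'))); last abel.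
  by apply: TB => //; exact: T00.
set mY := _ - bd k => TmY.
have E2 : T set0 (u + v - bd mY) by rewrite /mY bdB bd_bd subr0.
rewrite YV in TmY; have [|k' _] := small_cycle Vp_open Vm_open TmY.
  rewrite (_ : bd _ = (u + v) - (u + v - bd mY)); last abel.
  by exists u, (v - (u + v - bd mY)); split => //; [apply: TB => //; exact: T00|abel].
case=> mu [mv' [Tmu Tmv mE]].
have E3 : T set0 ((u - bd mu) + (v - bd mv')).
  rewrite (_ : _ + _ = u + v - bd mY) //.
  have <- : bd (mY - bd k') = bd mY by rewrite (bdB mY) bd_bd subr0.
  by rewrite mE bdD; abel.
have TN0 : T N (u - bd mu).
  apply: TI; first by apply: TB => //; exact: T_bd.
  rewrite (_ : u - _ = ((u - bd mu) + (v - bd mv')) - (v - bd mv')); last abel.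
  by apply: TB; [exact: T00|apply: TB => //; exact: T_bd].
pose n := u - bd mu - w.
have Tn : T N n by exact: TB.
have E4 : T set0 (e1 + e2 - bd n).
  rewrite /n !bdB bd_bd subr0 -[X in T _ X]opprK; apply: TN.
  by rewrite (_ : - (e1 + e2 - (bd u - bd w)) = bd u - e1 - e2 - bd w); last abel.
have TG : T G (e1 + e2).
  by rewrite GU; apply: TD; [apply: TS T1|apply: TS T2] => p; [left|right].
have [|l Tl] := RelN Tn.
  rewrite (_ : bd n = (e1 + e2) - (e1 + e2 - bd n)); last abel.
  by apply: TB => //; exact: T00.
set nG := _ - bd l => TnG.
have E5 : T set0 (e1 + e2 - bd nG) by rewrite /nG bdB bd_bd subr0.
rewrite GU in TnG; have [|l' _] := small_cycle U_open V_open TnG.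
  exists e1, (e2 - (e1 + e2 - bd nG)); split => //; last abel.
  by apply: TB => //; exact: T00.
case=> n1 [n2 [Tn1 Tn2 nE]].
have E6 : T set0 ((e1 - bd n1) + (e2 - bd n2)).
  rewrite (_ : _ + _ = e1 + e2 - bd nG) //.
  have <- : bd (nG - bd l') = bd nG by rewrite (bdB nG) bd_bd subr0.
  by rewrite nE bdD; abel.
have TW : T W (e1 - bd n1).
  apply: TI; first by apply: TB => //; exact: T_bd.
  rewrite (_ : e1 - _ = ((e1 - bd n1) + (e2 - bd n2)) - (e2 - bd n2)); last abel.
  by apply: TB; [exact: T00|apply: TB => //; exact: T_bd].
apply/ffunP => e; rewrite thE ffunE -(subr0 (bd e1)) -(bd_bd n1) -bdB.
exact: (clus_cnt_bd clW).
Qed.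

(** The same step twice: deform into the smaller set, subdivide and split. *)
Lemma mv_total z : cycle2 z -> exists th, mv z th.
Proof.
move=> cz.
have TT k (x : chain R k X) : T setT x by move=> s _; right.
have [|m0 _ Tz0] := RelY (TT _ z); first exact: T00.
rewrite YV in Tz0; have [|m1 _] := small_cycle Vp_open Vm_open Tz0.
  by apply: Sm_l; apply: T00; rewrite bdB bd_bd subr0.
case=> u [v [Tu Tv zE]].
have Ez : z - u - v - bd (m0 + m1) = 0.
  by rewrite bdD -[u in LHS](addrK v) -zE; abel.
have Tbu : T N (bd u).
  apply: TI; first exact: T_bd.
  rewrite (_ : bd u = bd z - bd v); first by apply: TB; [exact: T00|exact: T_bd].
  by have := congr1 (@bd R _ X) zE; rewrite !bdB !bd_bd !subr0 bdD => ->; abel.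
have [|w0 Tw0 Tb0] := RelN Tbu; first by rewrite bd_bd; exact: T0.
rewrite GU in Tb0; have [|w1 Tw1] := small_cycle U_open V_open Tb0.
  by rewrite bdB !bd_bd subrr; exact: Sm0.
case=> e1 [e2 [T1 T2 uE]].
exists [ffun e => cnt lW e (bd e1)], u, v, (m0 + m1), e1, e2, (w0 + w1).
split; split => //.
- by rewrite Ez; exact: T0.
- by apply: TD => //; apply: TS Tw1; rewrite -GU; exact: GN.
- rewrite (_ : _ - _ = 0); first exact: T0.
  by rewrite bdD -[e1 in LHS](addrK e2) -uE; abel.
- by move=> e; rewrite ffunE.
Qed.

(** As all counts vanish, bd e1 bounds a chain k in W. Then e1 - k and e2 + k are cycles, filled in
    U and in V; these fillings and w add up to n, and the cycles u - n and v + n are filled in Vp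
    and in Vm. *)
Lemma mv_inj z : cycle2 z -> mv z 0 -> exists m, T set0 (z - bd m).
Proof.
move=> cz [u [v [m [e1 [e2 [w [[Tu Tv Tz] [T1 T2 Tw Tb thE]]]]]]]].
have T1W := T_bd_e1 cz Tv T1 T2 Tz Tb.
have [|k Tk kE] := clus_H0 clW T1W; first by move=> e; rewrite -thE ffunE.
have E2 : bd e1 = - bd e2.
  have := T_bd Tb; rewrite !bdB !bd_bd !subr0 sub0r => /T0_deg0/eqP.
  by rewrite subr_eq0 => /eqP <-; rewrite opprK.
have [||x Tx Ex] := clus_Rel clU (_ : T U (e1 - k)).
- by apply: TB => //; apply: TS Tk => p [].
- by rewrite bdB kE subrr; exact: T0.
have [||y Ty Ey] := clus_Rel clV (_ : T V (e2 + k)).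
- by apply: TD => //; apply: TS Tk => p [].
- by rewrite bdD -kE E2 subrr; exact: T0.
pose n := x + y + w.
have Tn : T N n.
  by apply: TD => //; apply: TD; [exact: TS UN Tx|exact: TS VN Ty].
have En : T set0 (bd u - bd n).
  rewrite /n !bdD (_ : _ - _ = (bd u - e1 - e2 - bd w) + (e1 - k - bd x) + (e2 + k - bd y)).
    by apply: TD => //; exact: TD.
  abel.
have [||p Tp Ep] := RelVp (_ : T Vp (u - n)).
- by apply: TB => //; apply: TS Tn => ? [].
- by rewrite bdB.
have [||q Tq Eq] := RelVm (_ : T Vm (v + n)).
- by apply: TD => //; apply: TS Tn => ? [].
- rewrite bdD (_ : _ + _ = bd z - bd (z - u - v - bd m) - (bd u - bd n)).
    by apply: TB => //; apply: TB => //; exact: T_bd.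
  by rewrite !bdB bd_bd; abel.
exists (m + p + q); rewrite !bdD.
rewrite (_ : _ - _ = (z - u - v - bd m) + (u - n - bd p) + (v + n - bd q)).
  by apply: TD => //; exact: TD.
abel.
Qed.

(** t puts the weight [th e] at the centre of the component e. Balance makes it bound in U and in V,
    and the resulting 1-cycle bounds in Vp and in Vm. *)
Lemma mv_surj th : balanced th -> exists2 z, cycle2 z & mv z th.
Proof.
move=> [bU bV].
pose t : chain R 0 X := \sum_e pt R (clus_ctr clW e) *~ th e.
have Tt : T W t.
  apply: T_sum => e _; have Tp := @T_pt R X W _ (clus_ctrA clW e).
  have Tn n : T W (pt R (clus_ctr clW e) *+ n).
    by elim: n => [|n IH]; [exact: T0|rewrite mulrS; exact: TD].
  by case: (th e) => n; rewrite ?NegzE ?mulrNz; [|apply: TN]; exact: Tn.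
have ct e : cnt lW e t = th e.
  rewrite /t cnt_sum (bigD1 e) //= cnt_mulz clus_pt eqxx mul1r.
  rewrite big1 ?addr0 // => f /negbTE fe; by rewrite cnt_mulz clus_pt fe mul0r.
have [||e1 T1 e1E] := clus_H0 clU (_ : T U t).
- by apply: TS Tt => p [].
- by move=> i; rewrite (cnt_coarse i lUW Tt) (eq_bigr th).
have [||e2 T2 e2E] := clus_H0 clV (_ : T V (- t)).
- by apply: TN; apply: TS Tt => p [].
- by move=> i; rewrite cntN (cnt_coarse i lVW Tt) (eq_bigr th) // bV oppr0.
have Te : T N (e1 + e2) by apply: TD; [exact: TS UN T1|exact: TS VN T2].
have be : bd (e1 + e2) = 0 by rewrite bdD -e1E -e2E subrr.
have [||u Tu Eu] := RelVp (_ : T Vp (e1 + e2)).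
- by apply: TS Te => ? [].
- by rewrite be; exact: T0.
have [||v Tv Ev] := RelVm (_ : T Vm (- (e1 + e2))).
- by apply: TN; apply: TS Te => ? [].
- by rewrite bdN be oppr0; exact: T0.
exists (u + v).
  rewrite /cycle2 bdD (_ : _ + _ = - (e1 + e2 - bd u) - (- (e1 + e2) - bd v)).
    by apply: TB => //; exact: TN.
  abel.
exists u, v, 0, e1, e2, 0; split; split => //.
- by rewrite bd0 (_ : _ - _ = 0); [exact: T0|abel].
- exact: T0.
- by rewrite bd0 (_ : _ - _ = - (e1 + e2 - bd u)); [exact: TN|abel].
- by move=> e; rewrite -e1E ct.
Qed.

(** As g exchanges Vp and Vm, the part of the image in Vp comes from v, and bd v = - bd u up to
    boundaries and degenerate cubes: hence the minus sign. *)
Lemma mv_push (g : X -> X) (pi : E -> E) z th :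
  continuous g -> (forall p, Vp p -> Vm (g p)) -> (forall p, Vm p -> Vp (g p)) ->
  (forall p, U p -> U (g p)) -> (forall p, V p -> V (g p)) ->
  injective pi -> (forall p, W p -> lW (g p) = pi (lW p)) ->
  cycle2 z -> mv z th ->
  exists2 th', mv (push1 g z) th' & forall e, th' (pi e) = - th e.
Proof.
move=> cg gp gm gU gV pi_inj lg cz [u [v [m [e1 [e2 [w [[Tu Tv Tz] [T1 T2 Tw Tb thE]]]]]]]].
exists [ffun e => cnt lW e (bd (- push1 g e1))]; last first.
  move=> e; rewrite ffunE bdN bd_push // cntN thE; congr (- _).
  apply: (cnt_push e pi_inj lg).
  exact: T_bd_e1 cz Tv T1 T2 Tz Tb.
exists (push1 g v), (push1 g u), (push1 g m), (- push1 g e1), (- push1 g e2), (- push1 g w).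
have gN : forall p, N p -> N (g p) by move=> p [/gp ? /gm ?].
have g0 : forall p, (set0 : set X) p -> set0 (g p) by [].
split; split.
- exact: T_push gm _ _ Tv.
- exact: T_push gp _ _ Tu.
- rewrite bd_push // (_ : _ - _ = push1 g (z - u - v - bd m)); first exact: T_push g0 _ _ Tz.
  by rewrite !pushB; abel.
- by apply: TN; exact: T_push gU _ _ T1.
- by apply: TN; exact: T_push gV _ _ T2.
- by apply: TN; exact: T_push gN _ _ Tw.
- rewrite !bdN !bd_push // (_ : _ - _ =
    push1 g (bd z - bd (z - u - v - bd m) - (bd u - e1 - e2 - bd w))).
    apply: T_push g0 _ _ _; apply: TB => //; apply: TB => //; exact: T_bd.
  by rewrite !(pushB, bdB) bd_bd push0; abel.
- by move=> e; rewrite ffunE.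
Qed.

Theorem mayer_vietoris (h g : X -> X) (ch : continuous h) (F : R -> X -> X) (pi : E -> E) :
  cont_on setT F -> F 0 = g -> F 1 = h ->
  continuous g -> (forall p, Vp p -> Vm (g p)) -> (forall p, Vm p -> Vp (g p)) ->
  (forall p, U p -> U (g p)) -> (forall p, V p -> V (g p)) ->
  injective pi -> (forall p, W p -> lW (g p) = pi (lW p)) ->
  exists Theta : H2 -> {ffun E -> int},
    [/\ forall a b, Theta (a - b) = Theta a - Theta b,
        forall a, Theta a = 0 -> a = 0,
        forall th, balanced th <-> exists a, Theta a = th &
        forall a e, Theta (hmap set0 (mkcts ch) a) (pi e) = - Theta a e].
Proof.
move=> cF F0 F1 cg gp gm gU gV pi_inj lg.
pose Theta (a : H2) := xget 0 (mv (hrep a)).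
have ThetaP a : mv (hrep a) (Theta a).
  by rewrite /Theta; case: xgetP => // nmv; have [th /nmv] := mv_total (@hrep_cycle R X a).
have uniq z z' w th th' : T set0 (z - z' - bd w) -> mv z th -> mv z' th' -> th = th'.
  move=> zz' mz mz'; apply/eqP; rewrite -subr_eq0; apply/eqP.
  exact: mv_boundary (mvB mz mz') zz'.
have ThetaE z th : cycle2 z -> mv z th -> Theta (hclass set0 z) = th.
  move=> cz mz; have [] := hclassP (@hrep_cycle R X (hclass set0 z)) cz.
  by rewrite hrepK => /(_ erefl)[w Tw] _; exact: uniq Tw (ThetaP _) mz.
exists Theta; split.
- move=> a b; rewrite -{1}[a]hrepK -{1}[b]hrepK -hclassB; try exact: hrep_cycle.
  apply: ThetaE (mvB (ThetaP a) (ThetaP b)).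
  by rewrite /cycle2 bdB; apply: TB; exact: hrep_cycle.
- move=> a a0; have := ThetaP a; rewrite a0 => /(mv_inj (@hrep_cycle R X a))[m Tm].
  have c0 : cycle2 (0 : chain R 2 X) by rewrite /cycle2 bd0; exact: T0.
  have [_] := hclassP (@hrep_cycle R X a) c0.
  rewrite hrepK subr0 => ->; last by exists m.
  by rewrite -(subrr (0 : chain R 2 X)) hclassB // subrr.
- move=> th; split => [/mv_surj[z cz mz]|[a <-]].
    by exists (hclass set0 z); exact: ThetaE.
  exact: mv_balanced (@hrep_cycle R X a) (ThetaP a).
move=> a e; have [th' mth' <-] := mv_push cg gp gm gU gV pi_inj lg (@hrep_cycle R X a) (ThetaP a).
congr (fun_of_fin _ (pi e)); rewrite hmapE.
have [w] := push_homotopic cF (@hrep_cycle R X a); rewrite F0 F1 => Tw.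
have cgz := push_cycle cg (@hrep_cycle R X a); have chz := push_cycle ch (@hrep_cycle R X a).
rewrite -[push1 (mkcts ch) _]/(push1 h (hrep a)).
have [_ ->] := hclassP chz cgz; last by exists w.
exact: ThetaE.
Qed.
End MayerVietoris.

(** * Monodromy on balanced functions: types A and E_6 *)

Section PhiValues.

(** [comp_mx] acts as a shift that enters the next term of a linear recurrence in the last place.
    Coordinates are chosen below so that the monodromy takes this form. *)
Lemma comp_mxP n (p : nat -> int) (x y : 'cV[int]_n) :
  (forall i j : 'I_n, i.+1 = j :> nat -> y i 0 = x j 0) ->
  (forall i : 'I_n, i = n.-1 :> nat -> y i 0 = - \sum_(j < n) p j * x j 0) ->
  y = comp_mx n p *m x.
Proof.
move=> h1 h2; apply/colP => i; rewrite mxE; have [E|E] := eqVneq (i : nat) n.-1.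
  rewrite (h2 _ E) -sumrN; apply: eq_bigr => j _; rewrite mxE E eqxx mulNr //.
have lt : (i.+1 < n)%N by have := ltn_ord i; move/eqP: E; lia.
rewrite (h1 i (Ordinal lt)) // (bigD1 (Ordinal lt)) //= mxE (negbTE E) eqxx mul1r.
rewrite big1 ?addr0 // => j /eqP jN; rewrite mxE (negbTE E); case: eqP => [e|]; last by rewrite mul0r.
by case: jN; apply: val_inj.
Qed.

Section Brieskorn2.
Variables (H : zmodType) (T : H -> H) (p' : nat).
Local Notation p := p'.+1.
Variable Theta : H -> {ffun 'I_p * 'I_2 -> int}.
Hypothesis p0 : (0 < p')%N.
Hypothesis ThetaB : forall a b, Theta (a - b) = Theta a - Theta b.
Hypothesis Theta0 : forall a, Theta a = 0 -> a = 0.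
Hypothesis ThetaE : forall th, balanced fst snd th <-> exists a, Theta a = th.
Hypothesis ThetaT : forall a e, Theta (T a) (ordS e.1, ordS e.2) = - Theta a e.

(** The values at (p', 0), ..., (1, 0), in this order because the monodromy raises the index.
    Balance gives the values at (i, 1) and, as minus the sum of the coordinates, the one at (0, 0):
    so all coefficients of the polynomial are 1. *)
Let kap (th : {ffun 'I_p * 'I_2 -> int}) : 'cV[int]_p' :=
  \col_(i < p') th (fintype.lift (ord0 : 'I_p) (rev_ord i), ord0).

Lemma balanced2 th : balanced (fst : 'I_p * 'I_2 -> 'I_p) snd th <->
  (forall i, th (i, fintype.lift (ord0 : 'I_2) ord0) = - th (i, ord0)) /\
  th (ord0, ord0) = - \sum_i kap th i 0.
Proof.
have K : \sum_i kap th i 0 = \sum_i th (fintype.lift (ord0 : 'I_p) i, ord0).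
  by rewrite (reindex_inj rev_ord_inj) /=; apply: eq_bigr => i _; rewrite mxE rev_ordK.
have E i : \sum_(e | e.1 == i) th e = th (i, ord0) + th (i, fintype.lift (ord0 : 'I_2) ord0).
  by rewrite sum_fst !big_ord_recl big_ord0 addr0.
split=> [[b1 b2]|[h1 h2]].
  split=> [i|]; first by have := b1 i; rewrite E => /eqP; rewrite addrC addr_eq0 => /eqP.
  have := b2 ord0; rewrite sum_snd big_ord_recl K => /eqP.
  by rewrite addr_eq0 => /eqP.
split=> [i|j]; first by rewrite E h1 subrr.
rewrite sum_snd.
have E0 : \sum_i th (i, ord0) = 0 by rewrite big_ord_recl h2 K addNr.
case: (unliftP ord0 j) => [k ->|-> //]; rewrite (ord1 k).
by under eq_bigr do rewrite h1; rewrite sumrN E0 oppr0.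
Qed.

Lemma charpoly_brieskorn2 : charpoly setT T = 'X^p' + \poly_(i < p') 1.
Proof.
rewrite -(@char_comp_mx p' (fun=> 1) p0).
apply: (@charpoly_Theta _ _ _ _ _ _ kap _ ThetaB Theta0 ThetaE).
- by move=> x y; apply/colP => i; rewrite !mxE !ffunE.
- move=> th /balanced2[h1 h2] k0; apply/ffunP => -[i j]; rewrite ffunE.
  have vi k : th (k, ord0) = 0.
    case: (unliftP ord0 k) => [l ->|->].
      by have := congr1 (fun M : 'cV_p' => M (rev_ord l) 0) k0; rewrite !mxE rev_ordK.
    by rewrite h2 k0 big1 ?oppr0 // => l _; rewrite mxE.
  by case: (unliftP ord0 j) => [l ->|->] //; rewrite (ord1 l) h1 vi oppr0.
- move=> x; pose v (k : 'I_p) := if unlift ord0 k is Some i then x (rev_ord i) 0 else - \sum_i x i 0.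
  exists [ffun e : 'I_p * 'I_2 => if e.2 == ord0 then v e.1 else - v e.1].
    have kE : kap [ffun e : 'I_p * 'I_2 => if e.2 == ord0 then v e.1 else - v e.1] = x.
      by apply/colP => i; rewrite mxE ffunE /= /v fintype.liftK rev_ordK.
    apply/balanced2; split=> [i|]; first by rewrite !ffunE.
    by rewrite kE ffunE /= /v unlift_none.
  by apply/colP => i; rewrite mxE ffunE /= /v fintype.liftK rev_ordK.
move=> a; have /balanced2[h1 h2] : balanced fst snd (Theta a) by apply/ThetaE; exists a.
have step (k k' : 'I_p) : k.+1 = k' -> Theta (T a) (k', ord0) = Theta a (k, ord0).
  move=> kk; have := ThetaT a (k, fintype.lift (ord0 : 'I_2) ord0); rewrite h1 opprK /=.
  have -> : ordS k = k' by apply: val_inj; rewrite /= kk modn_small.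
  by have -> : ordS (fintype.lift (ord0 : 'I_2) ord0) = ord0 by exact: val_inj.
apply: comp_mxP => [i j ij|i iE].
  by rewrite !mxE; apply: step; rewrite !fintype.lift0 /= -ij; have := ltn_ord j; lia.
under eq_bigr do rewrite mul1r.
by rewrite -h2 mxE; apply: step; rewrite fintype.lift0 /= iE; lia.
Qed.
End Brieskorn2.

Section Brieskorn43.
Variables (H : zmodType) (T : H -> H).
Variable Theta : H -> {ffun 'I_4 * 'I_3 -> int}.
Hypothesis ThetaB : forall a b, Theta (a - b) = Theta a - Theta b.
Hypothesis Theta0 : forall a, Theta a = 0 -> a = 0.
Hypothesis ThetaE : forall th, balanced fst snd th <-> exists a, Theta a = th.
Hypothesis ThetaT : forall a e, Theta (T a) (ordS e.1, ordS e.2) = - Theta a e.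

Definition entry (th : {ffun 'I_4 * 'I_3 -> int}) (i j : nat) : int := th (inord i, inord j).

Lemma sum_ord3 (F : 'I_3 -> int) : \sum_i F i = F (inord 0) + F (inord 1) + F (inord 2).
Proof.
rewrite !big_ord_recl big_ord0 addr0 addrA.
by congr (F _ + F _ + F _); apply: val_inj; rewrite /= ?inordK.
Qed.

Lemma sum_ord4 (F : 'I_4 -> int) :
  \sum_i F i = F (inord 0) + F (inord 1) + F (inord 2) + F (inord 3).
Proof.
rewrite !big_ord_recl big_ord0 addr0 !addrA.
by congr (F _ + F _ + F _ + F _); apply: val_inj; rewrite /= ?inordK.
Qed.

Lemma balanced43 th : balanced (fst : 'I_4 * 'I_3 -> 'I_4) snd th <->
  (forall i, (i < 4)%N -> entry th i 0 + entry th i 1 + entry th i 2 = 0) /\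
  (forall j, (j < 3)%N -> entry th 0 j + entry th 1 j + entry th 2 j + entry th 3 j = 0).
Proof.
split=> [[b1 b2]|[b1 b2]]; split=> i.
- by move=> i4; have := b1 (inord i); rewrite sum_fst sum_ord3.
- by move=> i4; have := b2 (inord i); rewrite sum_snd sum_ord4.
- by have := b1 i (ltn_ord i); rewrite sum_fst sum_ord3 /entry inord_val.
- by have := b2 i (ltn_ord i); rewrite sum_snd sum_ord4 /entry inord_val.
Qed.

(** The entries met on going back from (0, 0) by steps (1, 1), with the sign of the monodromy at
    each step, so that the monodromy shifts them by one place. Six of them are coordinates for the
    balanced functions, and balance expresses the seventh. *)
Definition coord43 (th : {ffun 'I_4 * 'I_3 -> int}) (k : nat) : int :=
  nth 0 [:: entry th 0 0; - entry th 3 2; entry th 2 1; - entry th 1 0;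
            entry th 0 2; - entry th 3 1; entry th 2 0] k.

(* t^6 + t^5 - t^3 + t + 1 = (t^4 - t^2 + 1)(t^2 + t + 1), without its leading
   term. *)
Definition poly43 (k : nat) : int := nth 0 [:: 1; 1; 0; -1; 0; 1] k.

Let kap (th : {ffun 'I_4 * 'I_3 -> int}) : 'cV[int]_6 := \col_k coord43 th k.

(** The inverse of the coordinates: the other six entries come from solving the balance
    equations. *)
Definition mat43 (x : nat -> int) (i j : nat) : int :=
  nth 0 (nth [::] [::
    [:: x 0%N; - x 0%N - x 4%N; x 4%N];
    [:: - x 3%N; x 0%N - x 2%N + x 4%N + x 5%N; - x 0%N + x 2%N + x 3%N - x 4%N - x 5%N];
    [:: - x 0%N - x 1%N + x 3%N - x 5%N; x 2%N; x 0%N + x 1%N - x 2%N - x 3%N + x 5%N];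
    [:: x 1%N + x 5%N; - x 5%N; - x 1%N]] i) j.

Lemma sum_ord6 (F : 'I_6 -> int) : \sum_i F i = F (inord 0) + F (inord 1) + F (inord 2) +
  F (inord 3) + F (inord 4) + F (inord 5).
Proof.
rewrite !big_ord_recl big_ord0 addr0 !addrA.
by congr (F _ + F _ + F _ + F _ + F _ + F _); apply: val_inj; rewrite /= ?inordK.
Qed.

Lemma charpoly_brieskorn43 : charpoly setT T = 'X^6 + \poly_(i < 6) poly43 i.
Proof.
rewrite -(@char_comp_mx 6 poly43 isT).
apply: (@charpoly_Theta _ _ _ _ _ _ kap _ ThetaB Theta0 ThetaE).
- move=> x y; apply/colP => i; rewrite !mxE /coord43 /entry !ffunE.
  by case: i => [[|[|[|[|[|[|//]]]]]] i] /=; lia.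
- move=> th /balanced43[b1 b2] k0; apply/ffunP => -[i j]; rewrite ffunE.
  have c k : (k < 6)%N -> coord43 th k = 0.
    by move=> k6; have := congr1 (fun M : 'cV_6 => M (inord k) 0) k0; rewrite !mxE inordK.
  rewrite -(inord_val i) -(inord_val j) -[LHS]/(entry th i j).
  have := (c 0%N isT, c 1%N isT, c 2%N isT, c 3%N isT, c 4%N isT, c 5%N isT).
  have := (b1 0%N isT, b1 1%N isT, b1 2%N isT, b1 3%N isT).
  have := (b2 0%N isT, b2 1%N isT, b2 2%N isT).
  rewrite /coord43 /= => -[[? ?] ?] [[[? ?] ?] ?] [[[[[? ?] ?] ?] ?] ?].
  by case: i => [[|[|[|[|//]]]] i]; case: j => [[|[|[|//]]] j] /=; lia.
- move=> x; pose y (k : nat) : int := x (inord k) 0.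
  pose th : {ffun 'I_4 * 'I_3 -> int} := [ffun e : 'I_4 * 'I_3 => mat43 y e.1 e.2].
  have thE i j : (i < 4)%N -> (j < 3)%N -> entry th i j = mat43 y i j.
    by move=> i4 j3; rewrite /entry ffunE /= !inordK.
  exists th.
    apply/balanced43; split=> [[|[|[|[|//]]]] _|[|[|[|//]]] _]; rewrite !thE //= /mat43 /=; lia.
  apply/colP => i; rewrite mxE -[X in _ = x X _](inord_val i) -[RHS]/(y i) /coord43 !thE //.
  by case: i => [[|[|[|[|[|[|//]]]]]] i] /=; rewrite /mat43 /=; lia.
move=> a; have /balanced43[b1 b2] : balanced fst snd (Theta a) by apply/ThetaE; exists a.
have step i j i' j' : (i < 4)%N -> (j < 3)%N -> i' = (i.+1 %% 4)%N -> j' = (j.+1 %% 3)%N ->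
    entry (Theta (T a)) i' j' = - entry (Theta a) i j.
  move=> i4 j3 -> ->; rewrite /entry -ThetaT /=; congr (Theta (T a) (_, _)).
    by apply: val_inj; rewrite /= !inordK ?ltn_pmod.
  by apply: val_inj; rewrite /= !inordK ?ltn_pmod.
have s0 := step 3%N 2%N 0%N 0%N isT isT erefl erefl; have s1 := step 2%N 1%N 3%N 2%N isT isT erefl erefl.
have s2 := step 1%N 0%N 2%N 1%N isT isT erefl erefl; have s3 := step 0%N 2%N 1%N 0%N isT isT erefl erefl.
have s4 := step 3%N 1%N 0%N 2%N isT isT erefl erefl; have s5 := step 2%N 0%N 3%N 1%N isT isT erefl erefl.
apply: comp_mxP => [[i i6] [j j6] /= ij|[i i6] /= iE].
  rewrite !mxE /= -ij /coord43 {ij j j6}; case: i i6 => [|[|[|[|[|[|//]]]]]] _ /=; lia.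
move: i6; rewrite iE => i6; rewrite sum_ord6 !mxE !inordK // /coord43 /poly43 /=.
have := (b1 0%N isT, b1 1%N isT, b1 2%N isT, b1 3%N isT).
have := (b2 0%N isT, b2 1%N isT, b2 2%N isT).
move=> -[[? ?] ?] [[[? ?] ?] ?]; lia.
Qed.
End Brieskorn43.
End PhiValues.

(** * Complex numbers *)

Section Continuity.
Variables (S : topologicalType) (R : realType).
Local Notation C := R[i].
Implicit Types (f g : S -> R) (x y : S -> C).

Lemma cts_comp1 (U V : topologicalType) (f : S -> U) (h : U -> V) :
  continuous f -> continuous h -> continuous (fun t => h (f t)).
Proof. by move=> cf ch t; apply: continuous_comp; [exact: cf|exact: ch]. Qed.

Lemma cts_comp_at (U V : topologicalType) (f : S -> U) (h : U -> V) :
  continuous f -> (forall t, {for f t, continuous h}) -> continuous (fun t => h (f t)).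
Proof. by move=> cf ch t; apply: continuous_comp; [exact: cf|exact: ch]. Qed.

Lemma ctsV (K : numFieldType) (f : S -> K) : continuous f -> (forall t, f t != 0) ->
  continuous (fun t => (f t)^-1).
Proof. by move=> cf f0 t; apply: cvgV => //; exact: cf. Qed.

Lemma cts_norm f : continuous f -> continuous (fun t => `|f t|).
Proof. by move=> cf; apply: cts_comp1 => // t; exact: norm_continuous. Qed.

Lemma cts_max f g : continuous f -> continuous g -> continuous (fun t => Num.max (f t) (g t)).
Proof.
move=> cf cg; under eq_fun do rewrite maxr_absE.
apply: ctsM; last exact: ctsC.
by apply: ctsD; [exact: ctsD|apply: cts_norm; exact: ctsB].
Qed.

Lemma cts_min f g : continuous f -> continuous g -> continuous (fun t => Num.min (f t) (g t)).
Proof.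
move=> cf cg; under eq_fun do rewrite minr_absE.
apply: ctsM; last exact: ctsC.
by apply: ctsB; [exact: ctsD|apply: cts_norm; exact: ctsB].
Qed.

Lemma cts_open_at (T : topologicalType) (A : set S) (h : S -> T) : open A ->
  continuous (fun t : A => h (val t)) -> forall t, A t -> {for t, continuous h}.
Proof.
move=> oA ch t At B nB.
pose t' : A := SigSub (mem_set At).
have : nbhs t' [set u : A | B (h (val u))] by apply: (ch t').
rewrite nbhsE => -[V [ [U oU <-] Ut] UB].
have : nbhs t (U `&` A) by apply: open_nbhs_nbhs; split; [exact: openI|].
by apply: filterS => u [Uu Au]; exact: (UB (SigSub (mem_set Au)) Uu).
Qed.
End Continuity.

Section Complex.
Variable R : realType.
Local Notation C := R[i].
Local Notation Re := complex.Re.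
Local Notation Im := complex.Im.

(** The modulus as a real number; the norm of R[i] takes its values in R[i]. *)
Definition nrm (z : C) : R := Num.sqrt (Re z ^+ 2 + Im z ^+ 2).

Lemma normE (z : C) : `|z| = (nrm z)%:C. Proof. exact: normc_def. Qed.

Lemma nrm_ge0 z : 0 <= nrm z. Proof. exact: sqrtr_ge0. Qed.

Lemma nrm2 z : nrm z ^+ 2 = Re z ^+ 2 + Im z ^+ 2.
Proof. by rewrite sqr_sqrtr // addr_ge0 ?sqr_ge0. Qed.

Lemma RCinj : injective (real_complex R). Proof. by move=> x y []. Qed.

Lemma nrmM z w : nrm (z * w) = nrm z * nrm w.
Proof. by apply: RCinj; rewrite rmorphM /= -!normE normrM. Qed.

Lemma nrmX z n : nrm (z ^+ n) = nrm z ^+ n.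
Proof. by apply: RCinj; rewrite rmorphXn /= -!normE normrX. Qed.

Lemma nrmV z : nrm (z^-1) = (nrm z)^-1.
Proof. by apply: RCinj; rewrite fmorphV /= -!normE normfV. Qed.

Lemma nrmN z : nrm (- z) = nrm z.
Proof. by apply: RCinj; rewrite -!normE normrN. Qed.

Lemma nrmR (r : R) : nrm r%:C = `|r|.
Proof. by rewrite /nrm /= expr0n addr0 sqrtr_sqr. Qed.

Lemma nrm0 : nrm 0 = 0. Proof. by rewrite (nrmR 0) normr0. Qed.

Lemma nrm1 : nrm 1 = 1. Proof. by rewrite (nrmR 1) normr1. Qed.

Lemma nrm_eq0 z : (nrm z == 0) = (z == 0).
Proof. by rewrite -(inj_eq RCinj) -normE normr_eq0. Qed.

Lemma nrm_gt0 z : (0 < nrm z) = (z != 0).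
Proof. by rewrite lt0r nrm_ge0 andbT nrm_eq0. Qed.

Lemma nrmD z w : nrm (z + w) <= nrm z + nrm w.
Proof. by rewrite -lecR rmorphD /= -!normE ler_normD. Qed.

Lemma Re_le_nrm z : `|Re z| <= nrm z.
Proof. by rewrite /nrm -sqrtr_sqr ler_wsqrtr // lerDl sqr_ge0. Qed.

Lemma Im_le_nrm z : `|Im z| <= nrm z.
Proof. by rewrite /nrm -sqrtr_sqr ler_wsqrtr // lerDr sqr_ge0. Qed.

Lemma complexP (z w : C) : Re z = Re w -> Im z = Im w -> z = w.
Proof. by case: z w => a b [c d] /= -> ->. Qed.

Lemma cReD (z w : C) : Re (z + w) = Re z + Re w. Proof. by case: z w => ? ? []. Qed.
Lemma cImD (z w : C) : Im (z + w) = Im z + Im w. Proof. by case: z w => ? ? []. Qed.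
Lemma cReN (z : C) : Re (- z) = - Re z. Proof. by case: z. Qed.
Lemma cImN (z : C) : Im (- z) = - Im z. Proof. by case: z. Qed.
Lemma cReM (z w : C) : Re (z * w) = Re z * Re w - Im z * Im w. Proof. by case: z w => ? ? []. Qed.
Lemma cImM (z w : C) : Im (z * w) = Re z * Im w + Im z * Re w. Proof. by case: z w => ? ? []. Qed.
Lemma cReRM (r : R) (z : C) : Re (r%:C * z) = r * Re z.
Proof. by rewrite cReM /= mul0r subr0. Qed.
Lemma cImRM (r : R) (z : C) : Im (r%:C * z) = r * Im z.
Proof. by rewrite cImM /= mul0r addr0. Qed.

Section Cts.
Variable S : topologicalType.
Implicit Types (f g : S -> R) (x y : S -> C).

Lemma nbhsC (z : C) (P : set C) : nbhs z P <->
  exists2 e : R, 0 < e & forall w, nrm (z - w) < e -> P w.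
Proof.
split.
  move=> /nbhs_ballP[e /= e0 eP]; have := e0; rewrite ltcE /= => /andP[/eqP ei er].
  exists (Re e) => // w zw; apply: eP.
  rewrite -ball_normE /= normE ltcE /= ei eqxx /=; exact: zw.
move=> [e e0 eP]; apply/nbhs_ballP; exists e%:C; first by rewrite /= ltcR.
move=> w; rewrite -ball_normE /= normE ltcR; exact: eP.
Qed.

Lemma nbhsR (r : R) (P : set R) : nbhs r P <->
  exists2 e : R, 0 < e & forall w, `|r - w| < e -> P w.
Proof.
split; first by move=> /nbhs_ballP[e /= e0 eP]; exists e => // w rw; apply: eP; rewrite -ball_normE.
move=> [e e0 eP]; apply/nbhs_ballP; exists e => // w; rewrite -ball_normE; exact: eP.
Qed.

Lemma cts_Re x : continuous x -> continuous (fun t => Re (x t)).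
Proof.
move=> cx; apply: (cts_comp1 cx) => z A /nbhsR[e e0 eA]; apply/nbhsC; exists e => // w zw.
by apply: eA; rewrite -cReN -cReD; exact: le_lt_trans (Re_le_nrm _) zw.
Qed.

Lemma cts_Im x : continuous x -> continuous (fun t => Im (x t)).
Proof.
move=> cx; apply: (cts_comp1 cx) => z A /nbhsR[e e0 eA]; apply/nbhsC; exists e => // w zw.
by apply: eA; rewrite -cImN -cImD; exact: le_lt_trans (Im_le_nrm _) zw.
Qed.

Lemma cts_ofR f : continuous f -> continuous (fun t => (f t)%:C).
Proof.
move=> cf; apply: (cts_comp1 cf) => r A /nbhsC[e e0 eA]; apply/nbhsR; exists e => // s rs.
by apply: eA; rewrite -rmorphB nrmR.
Qed.

Lemma cts_mkC f g : continuous f -> continuous g -> continuous (fun t => f t +i* g t).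
Proof.
move=> cf cg; under eq_fun do rewrite [_ +i* _]complexE.
by apply: ctsD; [exact: cts_ofR|apply: ctsM; [exact: ctsC|exact: cts_ofR]].
Qed.

Lemma cts_nrm x : continuous x -> continuous (fun t => nrm (x t)).
Proof.
move=> cx; apply: (@cts_comp1 _ _ _ _ Num.sqrt); last exact: sqrt_continuous.
by apply: ctsD; apply: ctsX; [exact: cts_Re|exact: cts_Im].
Qed.

Lemma cts_at0 (x : S -> C) t : x t = 0 ->
  (forall e : R, 0 < e -> \forall u \near t, nrm (x u) < e) -> {for t, continuous x}.
Proof.
move=> xt xe A; rewrite xt => /nbhsC[e e0 eA].
by apply: filterS (xe e e0) => u ue; apply: eA; rewrite sub0r nrmN.
Qed.

Lemma near_nrm_lt x t (e : R) : continuous x -> nrm (x t) < e -> \forall u \near t, nrm (x u) < e.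
Proof.
move=> /cts_nrm/(_ t) cx xe.
have : nbhs (nrm (x t)) [set r | r < e] by apply: open_nbhs_nbhs; split => //; exact: open_lt.
by move/cx.
Qed.

Lemma open_neq0 x : continuous x -> open [set t | x t != 0].
Proof.
move=> cx; rewrite openE => t /= xt.
have := @cts_nrm _ cx t; rewrite -nrm_gt0 in xt => cn.
have : nbhs (nrm (x t)) [set r | 0 < r] by apply: open_nbhs_nbhs; split => //; exact: open_gt.
move=> /cn H; have {}H : nbhs t [set u | 0 < nrm (x u)] := H.
by apply: filterS H => u; rewrite /= -nrm_gt0.
Qed.

(* The product is continuous even where the bounded factor m is not, provided
   that x vanishes there. *)
Lemma ctsM_bounded (m x : S -> C) (K : R) : continuous x ->
  (forall t, nrm (m t) <= K) ->
  continuous (fun t : [set t | x t != 0] => m (val t)) ->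
  continuous (fun t => m t * x t).
Proof.
move=> cx mK cm t; have [xt|xt] := eqVneq (x t) 0; last first.
  have cmt := cts_open_at (open_neq0 cx) cm xt.
  by apply: cvgM; [exact: cmt|exact: cx].
apply: cts_at0 => [|e e0]; first by rewrite xt mulr0.
have K1 : 0 < `|K| + 1 by rewrite ltr_wpDl.
have := @near_nrm_lt x t (e / (`|K| + 1)) cx; rewrite xt nrm0 => /(_ (divr_gt0 e0 K1)).
apply: filterS => u; rewrite ltr_pdivlMr // nrmM mulrC => xu.
apply: le_lt_trans xu; rewrite ler_wpM2r ?nrm_ge0 //.
by apply: le_trans (mK u) _; rewrite (le_trans (ler_norm _)) // lerDl.
Qed.
End Cts.

Definition cis (a : R) : C := cos a +i* sin a.

Lemma cisD a b : cis (a + b) = cis a * cis b.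
Proof. by rewrite /cis cosD sinD; apply: complexP; rewrite /= ?cReM ?cImM //=; ring. Qed.

Lemma cis0 : cis 0 = 1. Proof. by rewrite /cis cos0 sin0. Qed.

Lemma cisX a n : cis a ^+ n = cis (n%:R * a).
Proof.
elim: n => [|n IHn]; first by rewrite mul0r cis0.
by rewrite exprS IHn -cisD -natr1; congr cis; ring.
Qed.

Lemma nrm_cis a : nrm (cis a) = 1.
Proof. by rewrite /nrm /= cos2Dsin2 sqrtr1. Qed.

Lemma cts_cis (S : topologicalType) (f : S -> R) : continuous f -> continuous (fun t => cis (f t)).
Proof.
move=> cf; apply: cts_mkC; apply: (cts_comp1 cf).
  exact: continuous_cos.
exact: continuous_sin.
Qed.

(** The value at 0 is set apart because [expR] never vanishes. *)
Definition rroot (n : nat) (r : R) : R := if r == 0 then 0 else expR (ln r / n%:R).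

Lemma rrootX n r : (0 < n)%N -> 0 <= r -> rroot n r ^+ n = r.
Proof.
move=> n0 r0; rewrite /rroot; case: eqP => [->|/eqP rN0]; first by rewrite expr0n; case: n n0.
rewrite -expRM_natr mulfVK ?pnatr_eq0 -?lt0n // lnK // posrE lt0r rN0 //.
Qed.

Lemma rroot_ge0 n r : 0 <= rroot n r.
Proof. by rewrite /rroot; case: ifP => // _; exact: expR_ge0. Qed.

Lemma rroot_gt0 n r : 0 < r -> 0 < rroot n r.
Proof. by move=> r0; rewrite /rroot gt_eqF //; exact: expR_gt0. Qed.

Lemma rroot_uniq n r s : (0 < n)%N -> 0 <= s -> s ^+ n = r -> rroot n r = s.
Proof.
move=> n0 s0 sr; apply/eqP; rewrite -(@eqrXn2 _ n) ?rroot_ge0 //.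
by rewrite rrootX ?sr // -sr exprn_ge0.
Qed.

Lemma rroot1 n : (0 < n)%N -> rroot n 1 = 1.
Proof. by move=> n0; apply: rroot_uniq => //; rewrite ?ler01 ?expr1n. Qed.

Lemma rroot_le1 n r : (0 < n)%N -> 0 <= r <= 1 -> rroot n r <= 1.
Proof.
move=> n0 /andP[r0 r1]; rewrite -(@ler_pXn2r _ n n0) ?nnegrE ?rroot_ge0 ?ler01 //.
by rewrite rrootX // expr1n.
Qed.

Lemma cts_rroot_pos (S : topologicalType) n (f : S -> R) : continuous f ->
  (forall t, 0 < f t) -> continuous (fun t => rroot n (f t)).
Proof.
move=> cf f0; rewrite (_ : (fun _ => _) = fun t => expR (ln (f t) / n%:R)); last first.
  by apply/funext => t; rewrite /rroot gt_eqF.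
apply: cts_comp1; last exact: continuous_expR.
apply: ctsM; last exact: ctsC.
by apply: cts_comp_at => // t; exact: continuous_ln.
Qed.

(* Half-angle formula: valid off the closed negative real axis. *)
Definition carg (z : C) : R := atan (Im z / (nrm z + Re z)) *+ 2.

(** The plane without the open negative real axis. The origin is kept: the principal root is
    continuous there although the argument is not. *)
Definition slit (z : C) := Im z != 0 \/ 0 <= Re z.

Lemma slit_gt0 z : slit z -> z != 0 -> 0 < nrm z + Re z.
Proof.
move=> sz z0; have := Re_le_nrm z; rewrite ler_norml => /andP[h _].
have : 0 <= nrm z + Re z by lra.
rewrite le0r => /orP[/eqP E|//].
have n2 := nrm2 z; rewrite (_ : nrm z = - Re z) in n2; last by move/eqP: E; rewrite addr_eq0 => /eqP.
have Im0 : Im z = 0 by apply/eqP; rewrite -sqrf_eq0; apply/eqP; move: n2; rewrite sqrrN; lra.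
case: sz => [|Re0]; first by rewrite Im0 eqxx.
have n0 := nrm_ge0 z; have : nrm z = 0 by lra.
by move/eqP; rewrite nrm_eq0 (negbTE z0).
Qed.

(** u is the tangent of half the argument. The double-angle formulas reduce the claim to cos^2 (1 +
    u^2) = 1 and (1 + u^2) (|z| + Re z) = 2 |z|. *)
Lemma cos_sin_carg z : slit z -> z != 0 ->
  nrm z * cos (carg z) = Re z /\ nrm z * sin (carg z) = Im z.
Proof.
move=> sz z0; have h := slit_gt0 sz z0; have n0 : 0 < nrm z by rewrite nrm_gt0.
have n2 := nrm2 z; rewrite /carg cos_mulr2n sin_mulr2n.
set u := Im z / _; have [a0 ta] := atan_def u.
have ca : 0 < cos (atan u) by exact: cos_gt0_pihalf.
have sa : sin (atan u) = u * cos (atan u).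
  by rewrite -[X in X * _]ta /tan divfK // gt_eqF.
have c2 : cos (atan u) ^+ 2 * (1 + u ^+ 2) = 1.
  by rewrite mulrDr mulr1 -exprMn [_ * u]mulrC -sa cos2Dsin2.
have uE : u * (nrm z + Re z) = Im z by rewrite /u divfK // gt_eqF.
have u2 : (1 + u ^+ 2) * (nrm z + Re z) = nrm z *+ 2.
  apply: (mulIf (lt0r_neq0 h)).
  have -> : (1 + u ^+ 2) * (nrm z + Re z) * (nrm z + Re z) =
    (nrm z + Re z) ^+ 2 + (u * (nrm z + Re z)) ^+ 2 by ring.
  rewrite uE; move: n2; rewrite !expr2 mulr2n; lra.
have cE : cos (atan u) ^+ 2 *+ 2 * nrm z = nrm z + Re z.
  by rewrite mulrnAl -mulrnAr -u2 mulrA c2 mul1r.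
split; first by move: cE; rewrite mulr2n; lra.
rewrite sa (_ : cos _ * (u * cos _) = u * cos (atan u) ^+ 2); last by rewrite expr2; ring.
rewrite -uE -cE -mulrnAr mulrCA; congr (_ * _); exact: mulrC.
Qed.

Lemma cargP z : slit z -> z = (nrm z)%:C * cis (carg z).
Proof.
move=> sz; have [->|z0] := eqVneq z 0; first by rewrite nrm0 mul0r.
have [h1 h2] := cos_sin_carg sz z0.
by apply: complexP; rewrite ?cReRM ?cImRM /= ?h1 ?h2.
Qed.

Definition croot n (z : C) : C := (rroot n (nrm z))%:C * cis (carg z / n%:R).

Lemma crootX n z : (0 < n)%N -> slit z -> croot n z ^+ n = z.
Proof.
move=> n0 sz; rewrite /croot exprMn -rmorphXn /= rrootX ?nrm_ge0 // cisX.
by rewrite [n%:R * _]mulrC divfK -?cargP // pnatr_eq0 -lt0n.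
Qed.

Lemma nrm_croot n z : nrm (croot n z) = rroot n (nrm z).
Proof. by rewrite nrmM nrmR nrm_cis mulr1 ger0_norm // rroot_ge0. Qed.

Lemma nrm_crootX n z : (0 < n)%N -> nrm (croot n z) ^+ n = nrm z.
Proof. by move=> n0; rewrite nrm_croot rrootX // nrm_ge0. Qed.

Lemma carg_real r : carg r%:C = 0.
Proof. by rewrite /carg /= mul0r atan0 mul0rn. Qed.

Lemma croot_real n r : 0 <= r -> croot n r%:C = (rroot n r)%:C.
Proof. by move=> r0; rewrite /croot carg_real mul0r cis0 mulr1 nrmR ger0_norm. Qed.

Lemma croot1 n : (0 < n)%N -> croot n 1 = 1.
Proof. by move=> n0; rewrite (croot_real n ler01) rroot1. Qed.

Lemma slit_Re z : 0 <= Re z -> slit z. Proof. by right. Qed.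

Lemma Re_croot2_gt0 z : slit z -> z != 0 -> 0 < Re (croot 2 z).
Proof.
move=> sz z0; rewrite /croot cReRM mulr_gt0 ?rroot_gt0 ?nrm_gt0 //=.
rewrite (_ : carg z / 2%:R = atan (Im z / (nrm z + Re z))); last first.
  by rewrite /carg mulr2n; lra.
by apply: cos_gt0_pihalf; exact: (atan_def _).1.
Qed.

Lemma croot2_sqr w : 0 < Re w -> croot 2 (w ^+ 2) = w.
Proof.
move=> w0.
have wN0 : w != 0 by apply: contraTneq w0 => ->; rewrite ltxx.
have sw : slit (w ^+ 2).
  have [w1|w1] := eqVneq (Im w) 0; [right|left]; rewrite expr2 ?cReM ?cImM.
    by rewrite w1 mulr0 subr0 -expr2 sqr_ge0.
  by rewrite [Im w * _]mulrC -mulr2n -mulr_natr !mulf_neq0 // ?pnatr_eq0 ?gt_eqF.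
have := crootX (isT : (0 < 2)%N) sw; move/eqP; rewrite eqf_sqr => /orP[/eqP//|/eqP E].
by have := Re_croot2_gt0 sw (expf_neq0 2 wN0); rewrite E cReN oppr_gt0 ltNge ltW.
Qed.

Lemma cts_carg (S : topologicalType) (x : S -> C) : continuous x ->
  (forall t, slit (x t)) -> (forall t, x t != 0) -> continuous (fun t => carg (x t)).
Proof.
move=> cx sx x0; rewrite /carg; under eq_fun do rewrite -mulr_natr.
apply: ctsM; last exact: ctsC.
apply: cts_comp_at; last by move=> t; exact: continuous_atan.
apply: ctsM; first exact: cts_Im.
apply: ctsV; first by apply: ctsD; [exact: cts_nrm|exact: cts_Re].
by move=> t; rewrite gt_eqF // slit_gt0.
Qed.

Lemma cts_croot (S : topologicalType) n (x : S -> C) : (0 < n)%N -> continuous x ->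
  (forall t, slit (x t)) -> continuous (fun t => croot n (x t)).
Proof.
move=> n0 cx sx t; have [xt|xt] := eqVneq (x t) 0.
  apply: cts_at0; first by rewrite xt /croot nrm0 /rroot eqxx mul0r.
  move=> e e0; have := @near_nrm_lt _ x t (e ^+ n) cx; rewrite xt nrm0 => /(_ (exprn_gt0 n e0)).
  apply: filterS => u xu; rewrite -(@ltr_pXn2r _ n n0) ?nnegrE ?nrm_ge0 ?(ltW e0) //.
  by rewrite nrm_crootX.
move: t xt; apply: (cts_open_at (open_neq0 cx)).
have cx' : continuous (fun t : [set t | x t != 0] => x (val t)).
  by apply: cts_comp1 => //; exact: cts_val.
have x0 (t : [set t | x t != 0]) : x (val t) != 0 by have /set_mem := valP t.
apply: ctsM.
  apply: cts_ofR; apply: cts_rroot_pos => [|t]; first exact: cts_nrm.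
  by rewrite nrm_gt0.
by apply: cts_cis; apply: ctsM; [exact: cts_carg|exact: ctsC].
Qed.

Lemma cts_rroot (S : topologicalType) n (f : S -> R) : (0 < n)%N -> continuous f ->
  (forall t, 0 <= f t) -> continuous (fun t => rroot n (f t)).
Proof.
move=> n0 cf f0.
have -> : (fun t => rroot n (f t)) = fun t => Re (croot n (f t)%:C).
  by apply/funext => t; rewrite croot_real.
by apply: cts_Re; apply: cts_croot => //; [exact: cts_ofR|move=> t; right; exact: f0].
Qed.
End Complex.

(** * The antiinvariant sublattice *)

Section AntiinvariantBasis.
Variables (H : zmodType) (form : H -> H -> int) (sigma : H -> H).
Variables (mu0 mu1 : nat) (d : 'I_(mu0 + mu0 + mu1) -> H).
Hypothesis sigmaB : forall a b, sigma (a - b) = sigma a - sigma b.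
Hypothesis sigmaK : forall a, sigma (sigma a) = a.
Hypothesis bd_d : boundary_basis d form sigma.
Local Notation V := (antiinvariant sigma).
Local Notation e := (antiinvariant_basis d).

Lemma antiinvariantB a b : V a -> V b -> V (a - b).
Proof. by rewrite /antiinvariant /= sigmaB => -> ->; rewrite opprB opprK addrC. Qed.

Lemma antiinvariant0 : V 0.
Proof. by have := sigmaB 0 0; rewrite /antiinvariant /= !subrr oppr0. Qed.

Lemma antiinvariantMz a k : V a -> V (a *~ k).
Proof.
move=> Va; have VN b : V b -> V (- b).
  by move=> Vb; rewrite -sub0r; apply: antiinvariantB => //; exact: antiinvariant0.
have Vn n : V (a *+ n).
  elim: n => [|n IH]; first by rewrite mulr0n; exact: antiinvariant0.
  by rewrite mulrS -[a *+ n]opprK; apply: antiinvariantB => //; exact: VN.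
case: k => n; first exact: Vn.
by rewrite NegzE mulrNz; apply/VN/Vn.
Qed.

Lemma antiinvariant_basisP : is_basis V e.
Proof.
have [[_ du] _ s1 sd _] := bd_d.
have s2 i : sigma (delta2 d i) = delta1 d i by rewrite -s1 sigmaK.
have eV i : V (e i).
  rewrite /antiinvariant_basis; case: (fintype.split i) => j; last exact: sd.
  by rewrite /antiinvariant /= sigmaB s1 s2 opprB.
have sumd (c : 'cV[int]_(mu0 + mu0 + mu1)) : \sum_i d i *~ c i 0 =
    \sum_i delta1 d i *~ c (lshift mu1 (lshift mu0 i)) 0 +
    \sum_i delta2 d i *~ c (lshift mu1 (rshift mu0 i)) 0 +
    \sum_j delta' d j *~ c (rshift (mu0 + mu0) j) 0.
  by rewrite !big_split_ord.
have sume (c : 'cV[int]_(mu0 + mu1)) : \sum_i e i *~ c i 0 =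
    \sum_i d i *~ (col_mx (col_mx (usubmx c) (- usubmx c)) (dsubmx c)) i 0.
  rewrite sumd big_split_ord /= -big_split /=; congr (_ + _).
    apply: eq_bigr => i _; rewrite /antiinvariant_basis; case: fintype.splitP => [j|j] /= E; last first.
      by have := ltn_ord i; rewrite E; lia.
    have -> : j = i by apply: val_inj.
    by rewrite !col_mxEu col_mxEd !mxE mulrNz mulrzBl.
  apply: eq_bigr => i _; rewrite /antiinvariant_basis; case: fintype.splitP => [j|j] /= E.
    by have := ltn_ord j; rewrite -E; lia.
  have -> : j = i by apply: val_inj => /=; lia.
  by rewrite col_mxEd !mxE.
split=> // u Vu; have [c [cE cu]] := du u Logic.I.
(* For antiinvariant u, the expansion of - sigma u is a second expansion of u, in which the
   coefficients of [delta1] and [delta2] are exchanged and negated; uniqueness equates the two. *)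
have cN i : c (lshift mu1 (rshift mu0 i)) 0 = - c (lshift mu1 (lshift mu0 i)) 0.
  pose c' : 'cV[int]_(mu0 + mu0 + mu1) :=
    - col_mx (col_mx (dsubmx (usubmx c)) (usubmx (usubmx c))) (- dsubmx c).
  have c'E : u = \sum_i d i *~ c' i 0.
    have sE : sigma u = \sum_i delta2 d i *~ c (lshift mu1 (lshift mu0 i)) 0 +
        \sum_i delta1 d i *~ c (lshift mu1 (rshift mu0 i)) 0 -
        \sum_j delta' d j *~ c (rshift (mu0 + mu0) j) 0.
      rewrite cE (additive_sum sigmaB d (fun i => c i 0)) !big_split_ord /= -sumrN.
      congr (_ + _ + _); apply: eq_bigr => k _.
      - by rewrite -[sigma (d _)]/(sigma (delta1 d k)) s1.
      - by rewrite -[sigma (d _)]/(sigma (delta2 d k)) s2.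
      - by rewrite -[sigma (d _)]/(sigma (delta' d k)) sd mulNrz.
    have -> : u = - sigma u by rewrite Vu opprK.
    rewrite sE sumd !opprD opprK -!sumrN [X in X + _ = _]addrC; congr (_ + _ + _).
    - by apply: eq_bigr => k _; rewrite /c' mxE !col_mxEu !mxE mulrNz.
    - by apply: eq_bigr => k _; rewrite /c' mxE col_mxEu col_mxEd !mxE mulrNz.
    - by apply: eq_bigr => k _; rewrite /c' mxE col_mxEd !mxE opprK.
  have := cu _ c'E => /(congr1 (fun M : 'cV_(mu0 + mu0 + mu1) => M (lshift mu1 (rshift mu0 i)) 0)) ->.
  by rewrite mxE col_mxEu col_mxEd !mxE.
exists (col_mx (usubmx (usubmx c)) (dsubmx c)); split.
  rewrite sume col_mxKu col_mxKd cE; apply: eq_bigr => i _; congr (_ *~ fun_of_matrix _ _ 0).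
  have cC : dsubmx (usubmx c) = - usubmx (usubmx c).
    by apply/colP => j; rewrite !mxE -cN.
  by rewrite -cC !vsubmxK.
move=> c' c'E; have := cu _ (etrans c'E (sume c')) => ->.
by rewrite !col_mxKu col_mxKd vsubmxK.
Qed.

Lemma reflection_product_antiinvariant u : V u -> V (reflection_product form e u).
Proof.
have [eV _] := antiinvariant_basisP.
move=> Vu; rewrite /reflection_product; elim: (enum _) => [//|i s IH] /=.
by apply: antiinvariantB => //; apply: antiinvariantMz; exact: eV.
Qed.

(** What is used about phi_f, which then cancels. As [charpoly] defaults to 0, the point is that the
    product of reflections has a matrix at all: it preserves the sublattice, since each reflection
    subtracts an integral multiple of a basis vector. *)
Lemma charpoly_antiinvariant_neq0 : charpoly V (reflection_product form e) != 0.
Proof.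
have [eV eu] := antiinvariant_basisP.
have dec j : exists c : 'cV[int]_(mu0 + mu1), reflection_product form e (e j) = \sum_i e i *~ c i 0.
  by have [c [cE _]] := eu _ (reflection_product_antiinvariant (eV j)); exists c.
have [c cE] := choice dec.
have ex : is_charpoly V (reflection_product form e) (char_poly (\matrix_(i, j) c j i 0)).
  exists (mu0 + mu1)%N, e, (\matrix_(i, j) c j i 0); split => // j.
  by rewrite cE; apply: eq_bigr => i _; rewrite mxE.
have [k [b [N [_ _ pE]]]] : is_charpoly V (reflection_product form e) (charpoly V (reflection_product form e)).
  exact: (xgetI 0 ex).
by rewrite pE monic_neq0 // char_poly_monic.
Qed.
End AntiinvariantBasis.

Section Involution.
Variables (R : realType) (X : topologicalType) (f : continuousType X X).
Hypothesis fK : forall x, f (f x) = x.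

Lemma push_invol n (z : chain R n X) : push1 f (push1 f z) = z.
Proof.
have cf : continuous f by exact: cts_fun.
have Tz : trivial_chain setT z by move=> s _; right.
elim/T_ind: z / Tz => [|y z yE zE|s _].
- by rewrite !push0.
- by rewrite !pushB yE zE.
rewrite /push1 cliftE clift_cub; last by apply: cts_comp1; [exact: cts_fun|].
by congr cub; apply/funext => t /=; rewrite fK.
Qed.

Lemma hmap_invol (a : homology R 2 (set0 : set X)) : hmap set0 f (hmap set0 f a) = a.
Proof.
have cf : continuous f by exact: cts_fun.
have cx := @hrep_cycle R X a; have cfx := push_cycle cf cx.
rewrite hmapE; set y := hrep _; have cy : cycle2 y by exact: (@hrep_cycle R X).
have : hclass set0 y = hclass set0 (push1 f (hrep a)) by rewrite hrepK hmapE.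
move=> /(hclassP cy cfx)[w Tw].
rewrite -[RHS](hrepK a) -(push_invol (hrep a)); apply/hclassP; try exact: push_cycle.
by exists (push1 f w); rewrite bd_push // -!pushB; apply: T_push Tw.
Qed.
End Involution.

Lemma i01 (R : realType) : is_true (((0 : R) <= 1) && ((1 : R) <= 1)).
Proof. by rewrite ler01 lexx. Qed.
Lemma i00 (R : realType) : is_true (((0 : R) <= 0) && ((0 : R) <= 1)).
Proof. by rewrite ler01 lexx. Qed.

(** * Deformations given by formulas on the ambient space *)

Section Ambient.
Variables (R : realType) (S : topologicalType) (M : set S).
Local Notation X := (M : topologicalType).
Local Notation pre A := ((val : X -> S) @^-1` A).

Definition contY (A : set S) (F : R -> S -> S) :=
  forall (Q : topologicalType) (u : Q -> R) (s : Q -> S),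
    continuous u -> continuous s ->
    (forall t, 0 <= u t <= 1) -> (forall t, A (s t)) ->
    continuous (fun t => F (u t) (s t)).

(** The default p is taken where the formula leaves M, which does not happen on the sets to be
    deformed. *)
Definition liftM (F : S -> S) (p : X) : X := insubd p (F (val p)).

Lemma val_liftM F (p : X) : M (F (val p)) -> val (liftM F p) = F (val p).
Proof. by move=> MF; rewrite /liftM insubdK //; exact: mem_set. Qed.

Lemma valM (p : X) : M (val p). Proof. by have /set_mem := valP p. Qed.

Lemma cont_liftM (A : set S) F : A `<=` M ->
  contY A F -> (forall t p, 0 <= t <= 1 -> A p -> A (F t p)) ->
  cont_on (pre A) (fun t : R => liftM (F t)).
Proof.
move=> AM cF FA Q u s cu cs u01 sA; apply: cts_into.
have -> : val \o (fun t => liftM (F (u t)) (s t)) = fun t => F (u t) (val (s t)).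
  by apply/funext => t /=; rewrite val_liftM //; apply: AM; apply: FA => //; exact: sA.
apply: cF => //; first by apply: cts_comp1 => //; exact: cts_val.
Qed.

Variables (A B : set S) (F : R -> S -> S).
Hypothesis AM : A `<=` M.
Hypothesis cF : contY A F.
Hypothesis FA : forall t p, 0 <= t <= 1 -> A p -> A (F t p).
Hypothesis F0 : forall p, A p -> F 0 p = p.

Lemma liftM_FA t (p : X) : 0 <= t <= 1 -> A (val p) -> val (liftM (F t) p) = F t (val p).
Proof. by move=> t01 Ap; rewrite val_liftM //; apply: AM; exact: FA. Qed.

Lemma RelY_retract : B `<=` A ->
  (forall t p, 0 <= t <= 1 -> B p -> B (F t p)) ->
  (forall p, A p -> B (F 1 p)) -> Rel R (pre A) (pre B).
Proof.
move=> BA FB F1; apply: (Rel_retract (F := fun t => liftM (F t))).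
- by move=> p /= /BA.
- exact: cont_liftM.
- by move=> t p t01 Ap /=; rewrite liftM_FA //; exact: FA.
- by move=> t p t01 Bp /=; rewrite liftM_FA //; [exact: FB|exact: BA].
- by move=> p Ap; apply: val_inj; rewrite liftM_FA ?F0 ?i00.
- by move=> p Ap /=; rewrite liftM_FA ?i01 //; exact: F1.
Qed.

Lemma RelY_contract c : (forall p, A p -> F 1 p = c) -> Rel R (pre A) set0.
Proof.
move=> F1; apply: (Rel_contract (F := fun t => liftM (F t))).
- exact: cont_liftM.
- by move=> t p t01 Ap /=; rewrite liftM_FA //; exact: FA.
- by move=> p Ap; apply: val_inj; rewrite liftM_FA ?F0 ?i00.
move=> n s sA t u; apply: val_inj; rewrite !liftM_FA ?i01 //; try exact: sA.
by rewrite !F1 //; exact: sA.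
Qed.

Lemma clustersY (I : eqType) (l : S -> I) (ctr : I -> S) :
  (forall p, A p -> F 1 p = ctr (l p)) ->
  (forall i, A (ctr i)) -> (forall i, l (ctr i) = i) ->
  (forall n (s : cube_set R n -> S), continuous s -> (forall t, A (s t)) ->
        forall t u, l (s t) = l (s u)) -> clusters R (pre A) (fun p => l (val p)).
Proof.
move=> F1 Actr lctr lc.
have ctrM i : ctr i \in M by apply/mem_set/AM.
apply: (@Clusters R X _ _ _ (fun i => SigSub (ctrM i)) (fun t => liftM (F t))).
- exact: cont_liftM.
- by move=> t p t01 Ap /=; rewrite liftM_FA //; exact: FA.
- by move=> p Ap; apply: val_inj; rewrite liftM_FA ?F0 ?i00.
- by move=> p Ap; apply: val_inj; rewrite liftM_FA ?i01 //= F1.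
- by move=> i /=; exact: Actr.
- by move=> i /=; exact: lctr.
- move=> n s sA t u; apply: (lc _ (val \o s)) => //.
  by apply: cts_comp1; [exact: cts_fun|exact: cts_val].
Qed.
End Ambient.

Lemma relopenU (X : topologicalType) (A B C : set X) :
  relopen A C -> relopen B C -> relopen (A `|` B) C.
Proof.
move=> oA oB p [Ap|Bp]; first by apply: filterS (oA p Ap) => q qA /qA; left.
by apply: filterS (oB p Bp) => q qB /qB; right.
Qed.

Lemma relopenI (X : topologicalType) (A B C : set X) :
  relopen A C -> relopen B C -> relopen (A `&` B) C.
Proof.
move=> oA oB p [Ap Bp]; apply: filterS2 (oA p Ap) (oB p Bp) => q qA qB Cq.
by split; [exact: qA|exact: qB].
Qed.

Lemma relopen_gt0 (R : realType) (X : topologicalType) (A C : set X) (phi : X -> R) :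
  continuous phi -> (forall p, A p -> 0 < phi p) ->
  (forall p, C p -> 0 < phi p -> A p) -> relopen A C.
Proof.
move=> cphi Aphi phiA p Ap.
have : nbhs (phi p) [set r | 0 < r].
  by apply: open_nbhs_nbhs; split; [exact: open_gt|exact: Aphi].
move=> /cphi H; have {}H : nbhs p [set q | 0 < phi q] := H.
by apply: filterS H => q q0 Cq; exact: phiA.
Qed.

Section Points.
Variable R : realType.
Local Notation C := R[i].
Local Notation C3 := 'rV[C]_3.
Local Notation Re := complex.Re.
Local Notation Im := complex.Im.

Lemma rrootM n (r s : R) : (0 < n)%N -> 0 <= r -> 0 <= s ->
  rroot n (r * s) = rroot n r * rroot n s.
Proof.
move=> n0 r0 s0; apply: rroot_uniq => //; first by rewrite mulr_ge0 ?rroot_ge0.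
by rewrite exprMn !rrootX.
Qed.

Definition mk (x y z : C) : C3 := \row_(i < 3) nth 0 [:: x; y; z] i.
Definition cx (p : C3) : C := p 0 (@Ordinal 3 0 isT).
Definition cy (p : C3) : C := p 0 (@Ordinal 3 1 isT).
Definition cz (p : C3) : C := p 0 (@Ordinal 3 2 isT).

Lemma cx_mk x y z : cx (mk x y z) = x. Proof. by rewrite /cx mxE. Qed.
Lemma cy_mk x y z : cy (mk x y z) = y. Proof. by rewrite /cy mxE. Qed.
Lemma cz_mk x y z : cz (mk x y z) = z. Proof. by rewrite /cz mxE. Qed.
Definition mkE := (cx_mk, cy_mk, cz_mk).

Lemma mk_eta p : mk (cx p) (cy p) (cz p) = p.
Proof.
by apply/rowP => -[[|[|[|//]]] i]; rewrite mxE /=; congr (p _ _); apply/val_inj.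
Qed.

Lemma cts_mk (S : topologicalType) (x y z : S -> C) : continuous x -> continuous y ->
  continuous z -> continuous (fun t => mk (x t) (y t) (z t)).
Proof.
move=> cx cy cz; apply: cts_mx => i j.
have -> : (fun t => mk (x t) (y t) (z t) i j) = (fun t => nth 0 [:: x t; y t; z t] j).
  by apply/funext => t; rewrite mxE.
case: j => -[|[|[|j0]]] j; [exact: cx|exact: cy|exact: cz|].
by exfalso; move: j; rewrite !ltnS ltn0.
Qed.

Lemma cts_cx (S : topologicalType) (p : S -> C3) : continuous p -> continuous (fun t => cx (p t)).
Proof. by move=> cp; apply: cts_comp1 cp _; exact: cts_coord. Qed.
Lemma cts_cy (S : topologicalType) (p : S -> C3) : continuous p -> continuous (fun t => cy (p t)).
Proof. by move=> cp; apply: cts_comp1 cp _; exact: cts_coord. Qed.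
Lemma cts_cz (S : topologicalType) (p : S -> C3) : continuous p -> continuous (fun t => cz (p t)).
Proof. by move=> cp; apply: cts_comp1 cp _; exact: cts_coord. Qed.

End Points.

Ltac cts :=
  lazymatch goal with
  | |- continuous (fun t => @?f t + @?g t) => apply: ctsD; cts
  | |- continuous (fun t => - @?f t) => apply: ctsN; cts
  | |- continuous (fun t => @?f t * @?g t) => apply: ctsM; cts
  | |- continuous (fun t => @?f t ^+ _) => apply: ctsX; cts
  | |- continuous (fun t => real_complex _ (@?f t)) => apply: cts_ofR; cts
  | |- continuous (fun t => Num.max (@?f t) (@?g t)) => apply: cts_max; cts
  | |- continuous (fun t => Num.min (@?f t) (@?g t)) => apply: cts_min; cts
  | |- continuous (fun t => complex.Re (@?f t)) => apply: cts_Re; cts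
  | |- continuous (fun t => complex.Im (@?f t)) => apply: cts_Im; cts
  | |- continuous (fun t => nrm (@?f t)) => apply: cts_nrm; cts
  | |- continuous (fun t => `| @?f t |) => apply: cts_norm; cts
  | |- continuous (fun t => Complex (@?f t) (@?g t)) => apply: cts_mkC; cts
  | |- continuous (fun _ => ?c) => exact: ctsC
  | |- continuous (fun t => cx (@?p t)) => apply: cts_cx; cts
  | |- continuous (fun t => cy (@?p t)) => apply: cts_cy; cts
  | |- continuous (fun t => cz (@?p t)) => apply: cts_cz; cts
  | H : continuous ?f |- continuous ?f => exact: H
  | _ => idtac
  end.

Section Points2.
Variable R : realType.
Local Notation C := R[i].
Local Notation C3 := 'rV[C]_3.
Local Notation Re := complex.Re.
Local Notation Im := complex.Im.

Definition N2 (p : C3) : R := nrm (cx p) ^+ 2 + nrm (cy p) ^+ 2 + nrm (cz p) ^+ 2.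

Lemma ReE (z : C) : Im z = 0 -> z = (Re z)%:C.
Proof. by case: z => a b /= ->. Qed.

Lemma ge0C (z : C) : 0 <= z -> z = (Re z)%:C /\ 0 <= Re z.
Proof. by rewrite lecE /= => /andP[/eqP h ?]; split => //; exact: ReE. Qed.

Lemma in01C (z : C) : 0 <= z <= 1 -> z = (Re z)%:C /\ 0 <= Re z <= 1.
Proof.
move=> /andP[/ge0C[zE z0]]; rewrite zE (_ : 1 = (1 : R)%:C) // lecR /= => z1.
by rewrite z0.
Qed.

Lemma C01 (r : R) : 0 <= r <= 1 -> 0 <= r%:C <= 1.
Proof. by rewrite (_ : 1 = (1 : R)%:C) // !lecR. Qed.

Lemma real_sqrt (w : C) : 0 <= w ^+ 2 -> Im w = 0.
Proof.
move=> /ge0C[wE w0]; have : Im (w ^+ 2) = 0 by rewrite wE.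
move: w0; rewrite expr2 cReM cImM => h1 h2.
have /eqP : Re w * Im w = 0 by move: h2; rewrite [Im w * _]mulrC; lra.
rewrite mulf_eq0 => /orP[/eqP h|/eqP//]; apply/eqP; rewrite -sqrf_eq0.
by apply/eqP; move: h1; rewrite h mul0r expr2; nra.
Qed.
End Points2.

(** * Pham's retraction of a line onto a segment *)

Section Pham.
Variable R : realType.
Local Notation C := R[i].
Local Notation Re := complex.Re.
Local Notation Im := complex.Im.
Implicit Types (T : R) (a c : C).

(* Pham's retraction of the line a + c = 1 onto the segment [0, 1]: for |a| >= 1/4
   the point (ka * a, kc * c) is ((1 - T) a + T pos (Re a), (1 - T) c + T pos (Re c))
   divided by the sum kS of its coordinates. The truncation at 1/16 only serves the
   continuity at a = 0. *)
Definition pos (r : R) : R := Num.max r 0.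
Definition cj a : C := Re a +i* (- Im a).
Definition kS T a c : R := (1 - T) + T * (pos (Re a) + pos (Re c)).
Definition ka T a c : C :=
  ((1 - T)%:C + (T * pos (Re a) / Num.max (nrm a ^+ 2) (16^-1))%:C * cj a) * ((kS T a c)^-1)%:C.
Definition kc T a c : C :=
  ((1 - T)%:C + (T * pos (Re c))%:C * c^-1) * ((kS T a c)^-1)%:C.

Lemma pos_ge0 r : 0 <= pos r. Proof. by rewrite le_max lexx orbT. Qed.
Lemma pos_ge r : r <= pos r. Proof. by rewrite le_max lexx. Qed.
Lemma pos_mul r : 0 <= pos r * r.
Proof.
rewrite /pos; case: (leP r 0) => r0; first by rewrite mul0r.
by rewrite mulr_ge0 // ltW.
Qed.
Lemma pos_nrm a : pos (Re a) <= nrm a.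
Proof. by rewrite ge_max nrm_ge0 andbT (le_trans (ler_norm _)) // Re_le_nrm. Qed.
Lemma pos_id r : 0 <= r -> pos r = r.
Proof. by move=> r0; rewrite /pos; apply/max_idPl. Qed.

Lemma cj_mul a : cj a * a = (nrm a ^+ 2)%:C.
Proof. by rewrite nrm2; apply: complexP; rewrite ?cReM ?cImM /=; ring. Qed.
Lemma nrm_cj a : nrm (cj a) = nrm a.
Proof. by rewrite /nrm /= sqrrN. Qed.

Section Fixed.
Variables (T : R) (a c : C).
Hypotheses (T01 : 0 <= T <= 1) (ac : a + c = 1).

Lemma kS_ge1 : 1 <= kS T a c.
Proof.
have := congr1 (@complex.Re _) ac; rewrite cReD /= => h.
have := pos_ge (Re a); have := pos_ge (Re c); case/andP: T01 => T0 T1 h1 h2.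
by rewrite /kS; nra.
Qed.

Let kS0 : 0 < kS T a c. Proof. by apply: lt_le_trans kS_ge1. Qed.

Lemma kS_le1 : 0 <= (kS T a c)^-1 <= 1.
Proof. by rewrite invr_ge0 ltW //= invf_le1 // kS_ge1. Qed.

Lemma kc_mul : kc T a c * c = ((1 - T)%:C * c + (T * pos (Re c))%:C) * ((kS T a c)^-1)%:C.
Proof.
rewrite /kc mulrAC mulrDl; congr ((_ + _) * _).
have [->|c0] := eqVneq c 0; first by rewrite /= /pos maxxx !mulr0.
by rewrite mulfVK.
Qed.

Lemma ka_mul : T = 0 \/ 4^-1 <= nrm a ->
  ka T a c * a = ((1 - T)%:C * a + (T * pos (Re a))%:C) * ((kS T a c)^-1)%:C.
Proof.
move=> Ta; rewrite /ka mulrAC mulrDl; congr ((_ + _) * _).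
rewrite -[LHS]mulrA cj_mul; case: Ta => [->|a4]; first by rewrite !mul0r.
have a16 : 16^-1 <= nrm a ^+ 2.
  by rewrite (_ : 16^-1 = 4^-1 ^+ 2) ?lerXn2r ?nnegrE ?invr_ge0 ?nrm_ge0 //; field.
by rewrite (max_idPl a16) -rmorphM /= divfK // gt_eqF // (lt_le_trans _ a16) // invr_gt0.
Qed.

Lemma kac_sum : T = 0 \/ 4^-1 <= nrm a -> ka T a c * a + kc T a c * c = 1.
Proof.
move=> Ta; rewrite ka_mul // kc_mul -mulrDl addrACA -mulrDr ac mulr1 -!rmorphD -rmorphM /=.
rewrite (_ : _ * _ = 1) //; apply: (mulIf (lt0r_neq0 kS0)).
by rewrite mulfVK ?gt_eqF // mul1r /kS mulrDr.
Qed.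

(** Both multipliers are convex combinations of 1 and such a number b, divided by kS >= 1. Modulus
    at most 1 keeps points in the ball; nonnegative real part keeps the principal roots
    continuous. *)
Lemma nrm_kle (b : C) (r : R) : nrm b <= 1 -> Re b >= 0 ->
  nrm (((1 - T)%:C + T%:C * b) * ((kS T a c)^-1)%:C) <= 1 /\
  0 <= Re (((1 - T)%:C + T%:C * b) * ((kS T a c)^-1)%:C).
Proof.
move=> b1 b0; case/andP: (T01) => T0 T1; case/andP: kS_le1 => S0 S1; split.
  rewrite nrmM nrmR ger0_norm // mulr_ile1 ?nrm_ge0 //.
  apply: le_trans (nrmD _ _) _; rewrite nrmM !nrmR !ger0_norm ?subr_ge0 //.
  by have := nrm_ge0 b; nra.
rewrite mulrC cReRM cReD cReRM /= mulr_ge0 //; nra.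
Qed.

Lemma kc_le : nrm (kc T a c) <= 1 /\ 0 <= Re (kc T a c).
Proof.
have -> : kc T a c = ((1 - T)%:C + T%:C * ((pos (Re c))%:C * c^-1)) * ((kS T a c)^-1)%:C.
  by rewrite /kc rmorphM /= !mulrA.
apply: (nrm_kle 0).
  rewrite nrmM nrmV nrmR ger0_norm ?pos_ge0 //.
  have [->|c0] := eqVneq c 0; first by rewrite nrm0 invr0 mulr0.
  by rewrite ler_pdivrMr ?nrm_gt0 // mul1r pos_nrm.
have [->|c0] := eqVneq c 0; first by rewrite invr0 mulr0.
have n0 : 0 < nrm c ^+ 2 by rewrite exprn_gt0 // nrm_gt0.
have -> : c^-1 = ((nrm c ^+ 2)^-1)%:C * cj c.
  apply: (mulIf c0); rewrite mulVf // -mulrA cj_mul -rmorphM /= mulVf // gt_eqF //.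
by rewrite mulrCA !cReRM /= mulr_ge0 ?invr_ge0 ?(ltW n0) // pos_mul.
Qed.

Lemma ka_le : nrm (ka T a c) <= 1 /\ 0 <= Re (ka T a c).
Proof.
set m := Num.max (nrm a ^+ 2) (16^-1).
have m0 : 0 < m by rewrite lt_max invr_gt0 ltr0n orbT.
have -> : ka T a c = ((1 - T)%:C + T%:C * ((pos (Re a) / m)%:C * cj a)) * ((kS T a c)^-1)%:C.
  by rewrite /ka -/m !rmorphM /= !mulrA.
apply: (nrm_kle 0).
  rewrite nrmM nrmR nrm_cj ger0_norm ?divr_ge0 ?pos_ge0 ?(ltW m0) //.
  rewrite mulrAC ler_pdivrMr // mul1r (le_trans _ (_ : nrm a ^+ 2 <= m)) //; last by rewrite le_max lexx.
  by rewrite expr2 ler_wpM2r ?nrm_ge0 ?pos_nrm.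
by rewrite cReRM /= mulrAC mulr_ge0 ?pos_mul // invr_ge0 ltW.
Qed.
End Fixed.

Lemma ka0 a c : ka 0 a c = 1.
Proof. by rewrite /ka /kS mul0r !subr0 !mul0r !addr0 invr1 mulr1. Qed.
Lemma kc0 a c : kc 0 a c = 1.
Proof. by rewrite /kc /kS mul0r !subr0 !mul0r !addr0 invr1 mulr1. Qed.

Section CtsPham.
Variable S : topologicalType.
Variables (T : S -> R) (a c : S -> C).
Hypotheses (cT : continuous T) (ca : continuous a) (cc : continuous c).
Hypotheses (T01 : forall t, 0 <= T t <= 1) (ac : forall t, a t + c t = 1).

Lemma cts_pos (f : S -> R) : continuous f -> continuous (fun t => pos (f t)).
Proof. by move=> cf; rewrite /pos; cts. Qed.

Lemma cts_kS : continuous (fun t => (kS (T t) (a t) (c t))^-1).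
Proof.
apply: ctsV.
  rewrite /kS; apply: ctsD; first by cts.
  by apply: ctsM => //; apply: ctsD; apply: cts_pos; cts.
by move=> t; rewrite gt_eqF // (lt_le_trans _ (kS_ge1 (T01 t) (ac t))).
Qed.

Lemma cts_ka : continuous (fun t => ka (T t) (a t) (c t)).
Proof.
rewrite /ka; apply: ctsM; last by apply: cts_ofR; exact: cts_kS.
apply: ctsD; first by cts.
apply: ctsM; last by apply: cts_mkC; cts.
apply: cts_ofR; apply: ctsM; first by apply: ctsM => //; apply: cts_pos; cts.
apply: ctsV; first by cts.
by move=> t; rewrite gt_eqF // lt_max invr_gt0 ltr0n orbT.
Qed.

Lemma cts_kc : (forall t, c t != 0) -> continuous (fun t => kc (T t) (a t) (c t)).
Proof.
move=> c0; rewrite /kc; apply: ctsM; last by apply: cts_ofR; exact: cts_kS.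
apply: ctsD; first by cts.
by apply: ctsM; [apply: cts_ofR; apply: ctsM => //; apply: cts_pos; cts|exact: ctsV].
Qed.
End CtsPham.
End Pham.

(** * From the Milnor fibre to the curve z = 0 *)

Section Suspension.
Variable R : realType.
Local Notation C := R[i].
Local Notation C3 := 'rV[C]_3.
Local Notation Re := complex.Re.
Local Notation Im := complex.Im.

Variables (g : C -> C -> C) (q1 q2 d : nat) (lam : C) (eps : R) (M : set C3).
Hypothesis q1_gt0 : (0 < q1)%N.
Hypothesis q2_gt0 : (0 < q2)%N.
Hypothesis d_gt0 : (0 < d)%N.
Hypothesis g_hom : forall s x y, g (s ^+ q1 * x) (s ^+ q2 * y) = s ^+ d * g x y.
Hypothesis g_cts : forall (S : topologicalType) (x y : S -> C),
  continuous x -> continuous y -> continuous (fun t => g (x t) (y t)).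
Hypothesis lam0 : lam != 0.
Hypothesis eps0 : 0 < eps.
Hypothesis lam_small : nrm lam * d%:R < eps ^+ 2.
Hypothesis ME : forall p, M p <-> g (cx p) (cy p) + cz p ^+ 2 = lam /\ N2 p < eps ^+ 2.

Definition aa (p : C3) : C := g (cx p) (cy p) / lam.
Definition cc (p : C3) : C := cz p ^+ 2 / lam.

Lemma aa_cc p : M p -> aa p + cc p = 1.
Proof. by move=> /ME[gp _]; rewrite /aa /cc -mulrDl gp divff. Qed.

Lemma cc_aa p : M p -> cc p = 1 - aa p.
Proof. by move=> /aa_cc <-; rewrite addrC addKr. Qed.

Definition Mpp : set C3 := [set p | M p /\ (0 <= aa p <= 1 \/ nrm (aa p) < 2^-1)].

(** A cutoff, 0 up to 1/4 and 1 from 1/2 on: near a = 0 the factor pos (Re a) / a has no limit while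
    (x, y) need not be 0, so nothing is moved there. *)
Definition chi (r : R) : R := Num.max 0 (Num.min 1 (4 * r - 1)).

Lemma chi01 r : 0 <= chi r <= 1.
Proof. by rewrite /chi le_max lexx /= ge_max ler01 ge_min lexx. Qed.

Lemma chi_0 r : r <= 4^-1 -> chi r = 0.
Proof. by move=> r4; rewrite /chi; apply/max_idPl; rewrite ge_min; apply/orP; right; lra. Qed.

Lemma chi_1 r : 2^-1 <= r -> chi r = 1.
Proof.
move=> r2; rewrite /chi (min_idPl _); last by lra.
by apply/max_idPr; exact: ler01.
Qed.

(* F1 pushes a towards [0, 1] where |a| >= 1/2, F2 contracts P, F3 pushes V into
   P, and F4 moves NN to the curve z = 0. *)
Definition F1 (t : R) (p : C3) : C3 :=
  let T := t * chi (nrm (aa p)) in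
  let s := croot d (ka T (aa p) (cc p)) in
  mk (s ^+ q1 * cx p) (s ^+ q2 * cy p) (croot 2 (kc T (aa p) (cc p)) * cz p).

Section F1.
Variables (t : R) (p : C3).
Hypotheses (t01 : 0 <= t <= 1) (Mp : M p).
Let T := t * chi (nrm (aa p)).

Let T01 : 0 <= T <= 1.
Proof.
rewrite /T; have /andP[c0 c1] := chi01 (nrm (aa p)); case/andP: t01 => h0 h1.
by rewrite mulr_ge0 //= mulr_ile1.
Qed.

Let Ta : T = 0 \/ 4^-1 <= nrm (aa p).
Proof.
have [h|h] := leP 4^-1 (nrm (aa p)); [by right|left].
by rewrite /T chi_0 ?mulr0 // ltW.
Qed.

Let ac := aa_cc Mp.

Lemma F1_aa : aa (F1 t p) = ka T (aa p) (cc p) * aa p.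
Proof.
rewrite /aa /F1 !mkE g_hom crootX ?mulrA //.
by apply: slit_Re; exact: (ka_le T01 ac).2.
Qed.

Lemma F1_cc : cc (F1 t p) = kc T (aa p) (cc p) * cc p.
Proof.
rewrite /cc /F1 !mkE exprMn crootX ?mulrA //.
by apply: slit_Re; exact: (kc_le T01 ac).2.
Qed.

Lemma nrm_croot_le1 n z : (0 < n)%N -> nrm z <= 1 -> nrm (croot n z) <= 1 :> R.
Proof. by move=> n0 z1; rewrite nrm_croot rroot_le1 // nrm_ge0. Qed.

Lemma nrm_scale_le (z w : C) : nrm z <= 1 -> nrm (z * w) ^+ 2 <= nrm w ^+ 2.
Proof.
move=> z1; rewrite lerXn2r ?nnegrE ?nrm_ge0 // nrmM.
by rewrite ler_piMl ?nrm_ge0.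
Qed.

Lemma F1_M : M (F1 t p).
Proof.
apply/ME; split.
  have : aa (F1 t p) + cc (F1 t p) = 1 by rewrite F1_aa F1_cc kac_sum.
  by rewrite /aa /cc -mulrDl => /(congr1 (fun z => z * lam)); rewrite divfK // mul1r.
have [_] := (ME p).1 Mp; apply: le_lt_trans.
rewrite /N2 /F1 !mkE -/T; apply: lerD; first apply: lerD; apply: nrm_scale_le.
- by rewrite nrmX exprn_ile1 ?nrm_ge0 // nrm_croot_le1 //; exact: (ka_le T01 ac).1.
- by rewrite nrmX exprn_ile1 ?nrm_ge0 // nrm_croot_le1 //; exact: (ka_le T01 ac).1.
- by apply: nrm_croot_le1 => //; exact: (kc_le T01 ac).1.
Qed.

Lemma nrm_aa_F1 : nrm (aa (F1 t p)) <= nrm (aa p).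
Proof.
by rewrite F1_aa nrmM ler_piMl ?nrm_ge0 //; exact: (ka_le T01 ac).1.
Qed.

Lemma F1_Mpp : Mpp p -> Mpp (F1 t p).
Proof.
move=> [_ [a01|a2]]; split; try exact: F1_M; last first.
  by right; exact: le_lt_trans nrm_aa_F1 a2.
left; have [aE /andP[a0 a1]] := in01C a01; rewrite F1_aa ka_mul //.
have cE : Re (cc p) = 1 - Re (aa p).
  by have := congr1 (@complex.Re _) ac; rewrite cReD /= => <-; rewrite addrC addKr.
have -> : kS T (aa p) (cc p) = 1.
  by rewrite /kS cE !pos_id ?subr_ge0 //; ring.
rewrite invr1 mulr1 pos_id // rmorphM /= -aE rmorphB /= mulrBl mul1r subrK.
exact: a01.
Qed.

Lemma F1_end : t = 1 -> Mpp (F1 t p).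
Proof.
move=> t1; split; first exact: F1_M.
have [a2|a2] := ltP (nrm (aa p)) 2^-1.
  by right; exact: le_lt_trans nrm_aa_F1 a2.
left; rewrite F1_aa ka_mul //.
have -> : T = 1 by rewrite /T t1 chi_1 // mulr1.
rewrite subrr mul0r add0r mul1r -rmorphM /=; apply: C01.
have S1 := kS_ge1 (i01 R) ac; have S0 : 0 < kS 1 (aa p) (cc p) by exact: lt_le_trans S1.
apply/andP; split; first by rewrite mulr_ge0 ?pos_ge0 // invr_ge0 ltW.
by rewrite ler_pdivrMr // mul1r /kS subrr add0r mul1r lerDl pos_ge0.
Qed.
End F1.

Lemma cts_aa (S : topologicalType) (p : S -> C3) : continuous p -> continuous (fun t => aa (p t)).
Proof.
move=> cp; rewrite /aa; apply: ctsM; last exact: ctsC.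
by apply: g_cts; [exact: cts_cx|exact: cts_cy].
Qed.

Lemma cts_cc (S : topologicalType) (p : S -> C3) : continuous p -> continuous (fun t => cc (p t)).
Proof. by move=> cp; rewrite /cc; cts; exact: cts_cz. Qed.

Lemma F1_cts : contY M F1.
Proof.
move=> S u p cu cp u01 Mp.
pose T t := u t * chi (nrm (aa (p t))).
have cT : continuous T by rewrite /T /chi; cts; exact: cts_aa.
have T01 t : 0 <= T t <= 1.
  have /andP[c0 c1] := chi01 (nrm (aa (p t))); case/andP: (u01 t) => h0 h1.
  by rewrite mulr_ge0 //= mulr_ile1.
have ca := cts_aa cp; have cc' := cts_cc cp.
have ac t := aa_cc (Mp t).
have cs : continuous (fun t => croot d (ka (T t) (aa (p t)) (cc (p t)))).
  apply: (cts_croot d_gt0); first exact: cts_ka.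
  by move=> t; apply: slit_Re; exact: (ka_le (T01 t) (ac t)).2.
apply: cts_mk.
- by apply: ctsM; [apply: ctsX; exact: cs|exact: cts_cx].
- by apply: ctsM; [apply: ctsX; exact: cs|exact: cts_cy].
apply: (@ctsM_bounded _ _ _ _ 1); first exact: cts_cz.
  by move=> t; apply: nrm_croot_le1 => //; exact: (kc_le (T01 t) (ac t)).1.
set S' := [set t | _].
have cv : continuous (val : S' -> S) by exact: cts_val.
apply: (@cts_croot _ _ 2 _ isT); last first.
  by move=> t; apply: slit_Re; exact: (kc_le (T01 (val t)) (ac (val t))).2.
apply: (@cts_kc _ _ (fun t : S' => T (val t)) (fun t => aa (p (val t))) (fun t => cc (p (val t)))).
- exact: cts_comp1 cv cT.
- exact: cts_comp1 cv ca.
- exact: cts_comp1 cv cc'.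
- by move=> t; exact: T01.
- by move=> t; exact: ac.
move=> t; have /set_mem := valP t; rewrite /S' /= => z0.
by rewrite /cc mulf_neq0 ?invr_eq0 // expf_neq0.
Qed.

Lemma F1_0 p : F1 0 p = p.
Proof.
rewrite /F1 mul0r ka0 kc0 !croot1 // !expr1n !mul1r; exact: mk_eta.
Qed.

Local Notation X := (M : topologicalType).
Local Notation pre A := ((val : X -> C3) @^-1` A).

Lemma Mpp_M : Mpp `<=` M. Proof. by move=> p []. Qed.

Lemma Rel_Mpp : Rel R (setT : set X) (pre Mpp).
Proof.
have -> : (setT : set X) = pre M by apply/seteqP; split => // p _; exact: valM.
apply: (RelY_retract (F := F1)) => //.
- exact: F1_cts.
- by move=> t p; exact: F1_M.
- by move=> p _; exact: F1_0.
- exact: Mpp_M.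
- by move=> t p t01 Bp; apply: F1_Mpp => //; exact: Mpp_M.
- by move=> p Mp; apply: F1_end; rewrite ?i01.
Qed.

Definition sc (r : C) (s : R) (p : C3) (w : C) : C3 :=
  mk (s%:C ^+ q1 * cx p) (s%:C ^+ q2 * cy p) (r * w).

Lemma aa_sc r s p w : aa (sc r s p w) = (s ^+ d)%:C * aa p.
Proof. by rewrite /aa /sc !mkE g_hom rmorphXn mulrA. Qed.

(** Shrinking (x, y) by s lets |w|^2 grow to at most 1 - s^d (1 - v). By 1 - s^d <= d (1 - s), the
    new squared norm is at most s times the old one plus (1 - s) |lam| d, a convex combination of
    numbers below eps^2. *)
Lemma scale_bound (s x y v : R) : 0 <= s <= 1 -> 0 <= x -> 0 <= y -> 0 <= v ->
  x + y + nrm lam * v < eps ^+ 2 ->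
  s ^+ (2 * q1) * x + s ^+ (2 * q2) * y + nrm lam * (1 - s ^+ d * (1 - v)) < eps ^+ 2.
Proof.
move=> /andP[s0 s1] x0 y0 v0 H.
have pow n : (0 < n)%N -> s ^+ n <= s.
  by case: n => // n _; rewrite exprS ler_piMr // exprn_ile1.
have sq1 := pow (2 * q1)%N; have sq2 := pow (2 * q2)%N; have sd := pow d d_gt0.
move: sq1 sq2; rewrite !muln_gt0 /= => /(_ q1_gt0) sq1 /(_ q2_gt0) sq2.
have l0 := nrm_ge0 lam.
have bern : 1 - s ^+ d <= d%:R * (1 - s).
  elim: d => [|n IHn]; first by rewrite expr0 subrr mul0r.
  have sn : 0 <= s ^+ n <= 1 by rewrite exprn_ge0 // exprn_ile1.
  rewrite exprS -natr1; nra.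
have hx := ler_wpM2r x0 sq1; have hy := ler_wpM2r y0 sq2; have hv := ler_wpM2r v0 sd.
have hb := ler_wpM2l l0 bern; have hv' := ler_wpM2l l0 hv.
have le : s ^+ (2 * q1) * x + s ^+ (2 * q2) * y + nrm lam * (1 - s ^+ d * (1 - v)) <=
   s * (x + y + nrm lam * v) + (1 - s) * (nrm lam * d%:R) by lra.
apply: le_lt_trans le _; have [->|sN1] := eqVneq s 1; first by rewrite subrr mul0r addr0 mul1r.
have s1' : 0 < 1 - s by rewrite subr_gt0 lt_neqAle sN1.
rewrite (_ : eps ^+ 2 = s * eps ^+ 2 + (1 - s) * eps ^+ 2); last by ring.
by rewrite ler_ltD // ?ltr_pM2l // ler_wpM2l // ltW.
Qed.

Lemma M_sc r s p w : r ^+ 2 = lam -> M p -> 0 <= s <= 1 ->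
  w ^+ 2 = 1 - (s ^+ d)%:C * aa p -> nrm w ^+ 2 <= 1 - s ^+ d * (1 - nrm (cz p / r) ^+ 2) ->
  M (sc r s p w).
Proof.
move=> r2 Mp s01 wE wn; have [gp np] := (ME p).1 Mp.
have r0 : r != 0 by apply: contraNneq lam0 => r0; rewrite -r2 r0 expr0n.
apply/ME; split.
  have : aa (sc r s p w) * lam + (r * w) ^+ 2 = lam.
    by rewrite aa_sc exprMn r2 wE mulrBr mulr1 mulrC addrC subrK.
  by rewrite /aa divfK // /sc !mkE.
have nr : nrm r ^+ 2 = nrm lam by rewrite -nrmX r2.
have H : nrm (cx p) ^+ 2 + nrm (cy p) ^+ 2 + nrm lam * nrm (cz p / r) ^+ 2 < eps ^+ 2.
  by rewrite nrmM nrmV exprMn exprVn nr mulrC divfK // -nr expf_neq0 // nrm_eq0.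
have := scale_bound s01 (sqr_ge0 _) (sqr_ge0 _) (sqr_ge0 _) H; apply: le_lt_trans.
have s0 : 0 <= s by case/andP: s01.
set v := nrm (cz p / r) ^+ 2 in wn H *.
rewrite /N2 /sc !mkE !nrmM !nrmX !nrmR (ger0_norm s0) !exprMn nr -!exprM !(mulnC _ 2%N).
by rewrite lerD2l ler_wpM2l ?nrm_ge0.
Qed.

Definition P r : set C3 := [set p | Mpp p /\ 0 < Re (cz p / r)].

Lemma cc_r r p : r ^+ 2 = lam -> cc p = (cz p / r) ^+ 2.
Proof. by move=> r2; rewrite /cc exprMn exprVn r2. Qed.

(** If a is in [0, 1], then w^2 = 1 - a >= 0, and it is not 0 because Re w > 0. If |a| < 1/2, then
    Re (1 - a) > 1/2. *)
Lemma Re_cc_gt0 r p : r ^+ 2 = lam -> P r p -> 0 < Re (cc p).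
Proof.
move=> r2 [[Mp [a01|a2]] w0].
  have cc01 : 0 <= cc p.
    have [aE /andP[a0 a1]] := in01C a01.
    have -> : cc p = (1 - Re (aa p))%:C.
      by rewrite (cc_aa Mp) [in LHS]aE rmorphB.
    by rewrite lecR subr_ge0.
  have [cE c0] := ge0C cc01; rewrite lt0r c0 andbT.
  apply: contraTneq w0 => c00; have : cc p == 0 by rewrite cE c00.
  by rewrite (cc_r _ r2) sqrf_eq0 => /eqP ->; rewrite ltxx.
have := congr1 (@complex.Re _) (aa_cc Mp); rewrite cReD /= => h.
have := Re_le_nrm (aa p); rewrite ler_norml => /andP[_ h2]; lra.
Qed.

(** (x, y) shrinks to 0, and w follows as the principal root of the new 1 - a, which has positive
    real part. *)
Definition F2 r (t : R) (p : C3) : C3 :=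
  sc r (1 - t) p (croot 2 ((1 - (1 - t) ^+ d)%:C + ((1 - t) ^+ d)%:C * cc p)).

Lemma F2_P r t p : r ^+ 2 = lam -> 0 <= t <= 1 -> P r p -> P r (F2 r t p).
Proof.
move=> r2 /andP[t0 t1] Pp; have c0 := Re_cc_gt0 r2 Pp; have [[Mp a] w0] := Pp.
have s01 : 0 <= 1 - t <= 1 by rewrite subr_ge0 t1 /= lerBlDr lerDl.
set tau := (1 - t) ^+ d.
have /andP[tau0 tau1] : 0 <= tau <= 1.
  by rewrite /tau; case/andP: s01 => h0 h1; rewrite exprn_ge0 // exprn_ile1.
have Rez : 0 < Re ((1 - tau)%:C + tau%:C * cc p).
  rewrite cReD cReRM /=; have [->|tN0] := eqVneq tau 0; first by rewrite subr0 mul0r addr0.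
  have : 0 < tau * Re (cc p) by rewrite mulr_gt0 // lt0r tN0.
  lra.
have slz : slit ((1 - tau)%:C + tau%:C * cc p) by right; exact: ltW.
have zN0 : (1 - tau)%:C + tau%:C * cc p != 0 by apply: contraTneq Rez => ->; rewrite ltxx.
have wE := crootX (isT : (0 < 2)%N) slz.
have r0 : r != 0 by apply: contraNneq lam0 => r0; rewrite -r2 r0 expr0n.
split; last by rewrite /F2 /sc !mkE mulrAC divff // mul1r Re_croot2_gt0.
split.
  apply: M_sc => //; rewrite -/tau.
    rewrite wE rmorphB /= -[in RHS](addrK (cc p) (aa p)) (aa_cc Mp) mulrBr mulr1.
    by rewrite opprB addrA addrAC.
  rewrite nrm_crootX // (le_trans (nrmD _ _)) // nrmM !nrmR !ger0_norm ?subr_ge0 //.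
  by rewrite (cc_r _ r2) nrmX; lra.
rewrite /F2 aa_sc -/tau; case: a => [a01|a2]; [left|right].
  have [-> /andP[a0 a1]] := in01C a01; rewrite -rmorphM /=; apply: C01.
  by rewrite mulr_ge0 //= mulr_ile1.
by rewrite nrmM nrmR ger0_norm //; apply: le_lt_trans a2; rewrite ler_piMl ?nrm_ge0.
Qed.

Lemma F2_cts r : r ^+ 2 = lam -> contY (P r) (F2 r).
Proof.
move=> r2 S u p cu cp u01 Pp; rewrite /F2 /sc.
have cs : continuous (fun t => 1 - u t) by cts.
have cc' := cts_cc cp.
apply: cts_mk; first by cts.
  by cts.
apply: ctsM; first exact: ctsC.
apply: (@cts_croot _ _ 2 _ isT); first by cts.
move=> t; right; have c0 := Re_cc_gt0 r2 (Pp t); case/andP: (u01 t) => t0 t1.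
have s01 : 0 <= 1 - u t <= 1 by rewrite subr_ge0 t1 /= lerBlDr lerDl.
have /andP[tau0 tau1] : 0 <= (1 - u t) ^+ d <= 1.
  by case/andP: s01 => h0 h1; rewrite exprn_ge0 // exprn_ile1.
by rewrite cReD cReRM /= addr_ge0 ?subr_ge0 // mulr_ge0 // ltW.
Qed.

Lemma Rel_P r : r ^+ 2 = lam -> Rel R (pre (P r)) (set0 : set X).
Proof.
move=> r2; have r0 : r != 0 by apply: contraNneq lam0 => r0; rewrite -r2 r0 expr0n.
apply: (@RelY_contract R C3 M (P r) (F2 r) _ _ _ _ (mk 0 0 r)).
- by move=> p [[]].
- exact: F2_cts.
- by move=> t p t01 Pp; exact: F2_P.
- move=> p Pp; have [_ w0] := Pp; rewrite /F2 subr0 expr1n subrr add0r mul1r (cc_r _ r2).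
  by rewrite croot2_sqr // /sc !expr1n !mul1r mulrC divfK // mk_eta.
- move=> p _; rewrite /F2 subrr expr0n gtn_eqF //= subr0 mul0r addr0 croot1 // /sc mulr1.
  by rewrite !expr0n !gtn_eqF // !mul0r.
Qed.

(* NN is the part of the fibre whose points can be scaled to z = 0 inside the ball:
   a |-> 1 means scaling (x, y) by the weighted powers of a^(-1/d). *)
Definition rs (p : C3) : R := rroot d (Num.max (Re (aa p)) 2^-1)^-1.
Definition qnorm (s : R) (p : C3) : R :=
  s ^+ (2 * q1) * nrm (cx p) ^+ 2 + s ^+ (2 * q2) * nrm (cy p) ^+ 2.
Definition NN : set C3 :=
  [set p | [/\ Mpp p, 2^-1 < Re (aa p) & qnorm (rs p) p < eps ^+ 2]].
(** P r and P (-r) are disjoint; with NN added to both they become an open cover of [Mpp] that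
    overlaps exactly in NN. *)
Definition V r : set C3 := P r `|` NN.
Definition CC : set C3 := [set p | M p /\ cz p = 0].

Section Root.
Variable r : C.
Hypothesis r2 : r ^+ 2 = lam.
Local Notation w p := (cz p / r).

Let r0 : r != 0. Proof. by apply: contraNneq lam0 => r0; rewrite -r2 r0 expr0n. Qed.

(** Either condition excludes |a| < 1/2, so a is in [0, 1] and w^2 = 1 - a >= 0 forces w to be
    real. *)
Lemma real_w p : Mpp p -> 2^-1 < Re (aa p) \/ Re (w p) ^+ 2 <= 4^-1 ->
  [/\ Im (w p) = 0, aa p = (1 - Re (w p) ^+ 2)%:C & Re (aa p) = 1 - Re (w p) ^+ 2].
Proof.
move=> [Mp a] h.
have a01 : 0 <= aa p <= 1.
  case: a => // a2; have := Re_le_nrm (aa p); rewrite ler_norml => /andP[_ h2].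
  exfalso; case: h => h; first lra.
  have : Re (cc p) = 1 - Re (aa p) by rewrite (cc_aa Mp) cReD cReN.
  rewrite (cc_r _ r2) expr2 cReM -!expr2; have := sqr_ge0 (Im (w p)); lra.
have [aE /andP[a0 a1]] := in01C a01.
have wE : Im (w p) = 0.
  apply: real_sqrt; rewrite -(cc_r _ r2) (cc_aa Mp) aE -[1]/((1 : R)%:C) -rmorphB lecR subr_ge0 //.
have E : aa p = (1 - Re (w p) ^+ 2)%:C.
  rewrite rmorphB rmorphXn /= -(ReE wE) -(cc_r _ r2) (cc_aa Mp).
  by rewrite opprB addrCA subrr addr0.
by split => //; rewrite E.
Qed.

Lemma rs_sc p m s : Re (aa p) = 1 - Re (w p) ^+ 2 -> 2^-1 < Re (aa p) -> m ^+ 2 < 2^-1 ->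
  s = rroot d ((1 - m ^+ 2) / (1 - Re (w p) ^+ 2)) ->
  s = rs p * rroot d (1 - m ^+ 2) /\ 0 <= rroot d (1 - m ^+ 2) <= 1.
Proof.
move=> aE a2 m2 ->; have m0 := sqr_ge0 m; split.
  rewrite /rs (max_idPl (ltW a2)) aE [RHS]mulrC -rrootM ?invr_ge0 //; lra.
by rewrite rroot_ge0 rroot_le1 //; lra.
Qed.

(** Moving w to m does not change the point of the curve z = 0 that the point scales to: (x, y) is
    scaled by s = rs p s', and the new [rs] is 1 / s'. So the condition on [qnorm] is inherited, and
    [scale_bound], started at that point with v = 0, keeps the moved point in the ball. *)
Lemma NN_sc p m : NN p -> m ^+ 2 < 2^-1 ->
  NN (sc r (rroot d ((1 - m ^+ 2) / (1 - Re (w p) ^+ 2))) p m%:C).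
Proof.
move=> [Mppp a2 qp] m2; have [w0 aE ReaE] := real_w Mppp (or_introl a2).
have [Mp _] := Mppp; set s := rroot d _; have m0 := sqr_ge0 m.
have [sE s01] := rs_sc ReaE a2 m2 (erefl s).
set s' := rroot d (1 - m ^+ 2) in sE s01.
have sd : s ^+ d = (1 - m ^+ 2) / (1 - Re (w p) ^+ 2) by rewrite rrootX // divr_ge0; lra.
have s'd : s' ^+ d = 1 - m ^+ 2 by rewrite rrootX //; lra.
have a0 : 1 - Re (w p) ^+ 2 != 0 by rewrite gt_eqF //; lra.
have aaE : aa (sc r s p m%:C) = (1 - m ^+ 2)%:C.
  by rewrite aa_sc sd aE -rmorphM /= divfK.
have s0 : 0 <= s by exact: rroot_ge0.
have Msc : M (sc r s p m%:C).
  apply/ME; split.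
    have : aa (sc r s p m%:C) * lam + (r * m%:C) ^+ 2 = lam.
      by rewrite aaE exprMn r2 rmorphB rmorphXn /= mulrBl mul1r [lam * _]mulrC subrK.
    by rewrite /aa divfK // /sc !mkE.
  rewrite /qnorm in qp; set x := rs p ^+ (2 * q1) * _ in qp.
  set y := rs p ^+ (2 * q2) * _ in qp.
  have x0 : 0 <= x by rewrite mulr_ge0 ?exprn_ge0 ?rroot_ge0 ?nrm_ge0.
  have y0 : 0 <= y by rewrite mulr_ge0 ?exprn_ge0 ?rroot_ge0 ?nrm_ge0.
  have H : x + y + nrm lam * 0 < eps ^+ 2 by rewrite mulr0 addr0.
  have := scale_bound s01 x0 y0 (lexx 0) H; apply: le_lt_trans.
  have nr : nrm r ^+ 2 = nrm lam by rewrite -nrmX r2.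
  rewrite /N2 /sc !mkE !nrmM !nrmX !nrmR (ger0_norm s0) !exprMn nr s'd.
  rewrite real_normK ?num_real // subr0 mulr1 opprB addrCA subrr addr0 lerD2r.
  rewrite -!exprM !(mulnC _ 2%N) sE !exprMn /x /y.
  by rewrite le_eqVlt; apply/orP; left; apply/eqP; ring.
split.
- split => //; left; rewrite aaE; apply: C01; apply/andP; split; lra.
- rewrite aaE /=; lra.
rewrite /qnorm /rs aaE /= (max_idPl _); last lra.
rewrite /sc !mkE !nrmM !nrmX !nrmR (ger0_norm s0) !exprMn sE.
have -> : rroot d (1 - m ^+ 2)^-1 = s'^-1.
  apply: rroot_uniq => //; first by rewrite invr_ge0 rroot_ge0.
  by rewrite exprVn s'd.
have s'0 : s' != 0 by rewrite gt_eqF // rroot_gt0 //; lra.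
apply: le_lt_trans qp; rewrite /qnorm le_eqVlt; apply/orP; left; apply/eqP.
by rewrite -!exprM !(mulnC _ 2%N) !exprMn !exprVn; field; rewrite !expf_neq0.
Qed.

(** Rises from -1, which is below Re w on all of V, to 1/2. [F3] pushes w up to this level only
    where Re w < 1/2, and there w is real. *)
Definition lo (t : R) : R := t * (3 / 2) - 1.

Definition F3 (t : R) (p : C3) : C3 :=
  let u := Num.min (Re (w p)) 2^-1 in
  let m := Num.max u (lo t) in
  sc r (rroot d ((1 - m ^+ 2) / (1 - u ^+ 2))) p (w p + (m - u)%:C).

Lemma w_gt p : V r p -> -1 < Re (w p).
Proof.
case=> [[_ w0]|[Mppp a2 _]]; first by apply: lt_trans w0; rewrite oppr_lt0 ltr01.
have [_ _ aE] := real_w Mppp (or_introl a2); move: a2; rewrite aE; nra.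
Qed.

Lemma sc1 p : sc r 1 p (w p) = p.
Proof. by rewrite /sc !expr1n !mul1r mulrC divfK // mk_eta. Qed.

Lemma F3_big t p : t <= 1 -> 2^-1 <= Re (w p) -> F3 t p = p.
Proof.
move=> t1 w2; rewrite /F3 (min_idPr w2) (max_idPl _); last by rewrite /lo; lra.
rewrite subrr addr0 divff ?rroot1 ?sc1 // gt_eqF //; lra.
Qed.

Lemma F3_small t p : Mpp p -> (2^-1 < Re (aa p) \/ Re (w p) ^+ 2 <= 4^-1) ->
  Re (w p) < 2^-1 -> F3 t p =
  sc r (rroot d ((1 - Num.max (Re (w p)) (lo t) ^+ 2) / (1 - Re (w p) ^+ 2))) p
     (Num.max (Re (w p)) (lo t))%:C.
Proof.
move=> Mppp h w2; have [w0 _ _] := real_w Mppp h.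
rewrite /F3 (min_idPl (ltW w2)); congr sc.
by rewrite {1}(ReE w0) -rmorphD /= addrCA subrr addr0.
Qed.

Lemma F3_P t p : 0 <= t <= 1 -> P r p -> P r (F3 t p).
Proof.
move=> /andP[t0 t1] Pp; have [w2|w2] := leP 2^-1 (Re (w p)); first by rewrite F3_big.
have [Mppp w0] := Pp; have [Mp _] := Mppp.
have h : 2^-1 < Re (aa p) \/ Re (w p) ^+ 2 <= 4^-1 by right; nra.
have [wi aE ReaE] := real_w Mppp h.
rewrite (F3_small t Mppp h w2); set m := Num.max _ _.
have m0 : 0 < m by rewrite lt_max w0.
have m1 : m <= 2^-1 by rewrite ge_max (ltW w2) /lo; lra.
have mw : Re (w p) <= m by rewrite le_max lexx.
have a0 : 0 < 1 - Re (w p) ^+ 2 by nra.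
set s := rroot d _.
have q0 : 0 <= (1 - m ^+ 2) / (1 - Re (w p) ^+ 2) <= 1.
  rewrite divr_ge0 /=; [|nra|exact: ltW].
  rewrite ler_pdivrMr // mul1r; nra.
have sd : s ^+ d = (1 - m ^+ 2) / (1 - Re (w p) ^+ 2).
  by rewrite rrootX //; case/andP: q0.
have s01 : 0 <= s <= 1 by rewrite rroot_ge0 rroot_le1.
have sa : (s ^+ d)%:C * aa p = (1 - m ^+ 2)%:C by rewrite sd aE -rmorphM /= divfK // gt_eqF.
split; last by rewrite /sc !mkE mulrAC divff // mul1r.
split; last first.
  by left; rewrite aa_sc sa; apply: C01; apply/andP; split; nra.
apply: M_sc => //.
  by rewrite sa rmorphB rmorphXn /= opprB addrCA subrr addr0.
rewrite nrmR real_normK ?num_real // (ReE wi) nrmR real_normK ?num_real //.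
rewrite sd divfK ?gt_eqF //; lra.
Qed.

Lemma F3_NN t p : 0 <= t <= 1 -> NN p -> NN (F3 t p).
Proof.
move=> /andP[t0 t1] Np; have [w2|w2] := leP 2^-1 (Re (w p)); first by rewrite F3_big.
have [Mppp a2 _] := Np; have [_ _ aE] := real_w Mppp (or_introl a2).
rewrite (F3_small t Mppp (or_introl a2) w2); apply: NN_sc => //.
have lo2 : lo t <= 2^-1 by rewrite /lo; lra.
have rw : Re (w p) ^+ 2 < 2^-1 by move: a2; rewrite aE; lra.
case: (leP (Re (w p)) (lo t)) => // h; move: (lo t) lo2 h => m lo2 h.
by have [m0|m0] := leP 0 m; nra.
Qed.

Lemma F3_end p : V r p -> P r (F3 1 p).
Proof.
case=> [Pp|Np]; first by apply: F3_P => //; exact: i01.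
have [Mppp a2 _] := Np; have [w2|w2] := leP 2^-1 (Re (w p)).
  rewrite F3_big //; split => //; lra.
have [Q _ _] := F3_NN (i01 R) Np; split => //.
rewrite (F3_small 1 Mppp (or_introl a2) w2) /sc !mkE mulrAC divff // mul1r.
apply: (@lt_le_trans _ _ 2^-1); first lra.
change (2^-1 <= Num.max (Re (w p)) (lo 1)).
by rewrite le_max; apply/orP; right; rewrite /lo; lra.
Qed.

Lemma F3_0 p : V r p -> F3 0 p = p.
Proof.
move=> Vp; have w1 := w_gt Vp; have [w2|w2] := leP 2^-1 (Re (w p)); first by rewrite F3_big.
rewrite /F3 (min_idPl (ltW w2)) (max_idPl _); last by rewrite /lo; lra.
rewrite subrr addr0 divff ?rroot1 ?sc1 // gt_eqF //; nra.
Qed.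

Lemma F3_V t p : 0 <= t <= 1 -> V r p -> V r (F3 t p).
Proof. by move=> t01 [Pp|Np]; [left; exact: F3_P|right; exact: F3_NN]. Qed.

Lemma V_M : V r `<=` M.
Proof. by move=> p [[[]]|[[]]]. Qed.

Lemma cts_w (S : topologicalType) (p : S -> C3) : continuous p ->
  continuous (fun t => w (p t)).
Proof. by move=> cp; cts. Qed.

Lemma F3_cts : contY (V r) F3.
Proof.
move=> S u p cu cp u01 Vp.
have cw := cts_w cp.
pose v t := Num.min (Re (w (p t))) 2^-1.
pose m t := Num.max (v t) (lo (u t)).
have cv : continuous v by rewrite /v; cts.
have cm : continuous m by rewrite /m /lo; cts.
have v1 t : -1 < v t <= 2^-1.
  by rewrite /v lt_min ge_min lexx orbT andbT w_gt //=; lra.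
have m1 t : m t ^+ 2 <= 1.
  have /andP[h1 h2] := v1 t; case/andP: (u01 t) => t0 t1.
  have : v t <= m t by rewrite /m le_max lexx.
  have : m t <= 2^-1 by rewrite /m ge_max h2 /= /lo; lra.
  by move=> *; nra.
have v0 t : 0 < 1 - v t ^+ 2 by have /andP[h1 h2] := v1 t; nra.
rewrite /F3 /sc; have cs : continuous (fun t => rroot d ((1 - m t ^+ 2) / (1 - v t ^+ 2))).
  apply: (cts_rroot d_gt0).
    apply: ctsM; first by cts.
    by apply: ctsV; [cts|move=> t; rewrite gt_eqF].
  by move=> t; rewrite divr_ge0 ?(ltW (v0 t)) // subr_ge0.
apply: cts_mk.
- by apply: ctsM; [apply: ctsX; apply: cts_ofR; exact: cs|exact: cts_cx].
- by apply: ctsM; [apply: ctsX; apply: cts_ofR; exact: cs|exact: cts_cy].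
apply: ctsM; first exact: ctsC.
by apply: ctsD; [exact: cw|apply: cts_ofR; apply: ctsB; [exact: cm|exact: cv]].
Qed.

Lemma Rel_V : Rel R (pre (V r)) (set0 : set X).
Proof.
apply: (@Rel_trans _ _ _ (pre (P r))); [by []|by move=> p; left| |exact: Rel_P].
apply: (@RelY_retract R C3 M (V r) (P r) F3).
- exact: V_M.
- exact: F3_cts.
- by move=> t p; exact: F3_V.
- by move=> p; exact: F3_0.
- by move=> p; left.
- by move=> t p; exact: F3_P.
- by move=> p; exact: F3_end.
Qed.

Definition F4 (t : R) (p : C3) : C3 :=
  sc r (rroot d ((1 - ((1 - t) * Re (w p)) ^+ 2) / (1 - Re (w p) ^+ 2))) p
     ((1 - t) * Re (w p))%:C.

Lemma NN_w p : NN p -> [/\ Im (w p) = 0, Re (w p) ^+ 2 < 2^-1 & M p].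
Proof.
move=> [Mppp a2 _]; have [w0 _ aE] := real_w Mppp (or_introl a2).
by split; [|move: a2; rewrite aE; lra|case: Mppp].
Qed.

Lemma F4_NN t p : 0 <= t <= 1 -> NN p -> NN (F4 t p).
Proof.
move=> /andP[t0 t1] Np; apply: NN_sc => //; have [_ w2 _] := NN_w Np.
rewrite exprMn; have := sqr_ge0 (Re (w p)) => h.
have : (1 - t) ^+ 2 <= 1 by nra.
by move=> *; nra.
Qed.

Lemma F4_cts : contY NN F4.
Proof.
move=> S u p cu cp u01 Np.
have cw := cts_w cp.
rewrite /F4 /sc.
have cs : continuous (fun t => rroot d ((1 - ((1 - u t) * Re (w (p t))) ^+ 2) / (1 - Re (w (p t)) ^+ 2))).
  apply: (cts_rroot d_gt0).
    apply: ctsM; first by cts.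
    apply: ctsV; first by cts.
    by move=> t; have [_ w2 _] := NN_w (Np t); rewrite gt_eqF //; lra.
  move=> t; have [_ w2 _] := NN_w (Np t); case/andP: (u01 t) => t0 t1.
  rewrite divr_ge0 //; last lra.
  rewrite exprMn; have := sqr_ge0 (Re (w (p t))) => h.
  have : (1 - u t) ^+ 2 <= 1 by nra.
  by move=> *; nra.
apply: cts_mk.
- by apply: ctsM; [apply: ctsX; apply: cts_ofR; exact: cs|exact: cts_cx].
- by apply: ctsM; [apply: ctsX; apply: cts_ofR; exact: cs|exact: cts_cy].
by cts.
Qed.

Lemma w0_P (r' : C) (p : C3) : r' != 0 -> cz p / r' = 0 -> cz p = 0.
Proof. by move=> h /eqP; rewrite mulf_eq0 invr_eq0 (negbTE h) orbF => /eqP. Qed.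

Lemma CC_NN p : CC p -> NN p.
Proof.
move=> [Mp z0]; have a1 : aa p = 1.
  by rewrite -(aa_cc Mp) /cc z0 expr0n mul0r addr0.
split; rewrite ?a1 /=; last 2 first.
- lra.
- rewrite /qnorm /rs a1 /= (max_idPl _); last lra.
  rewrite invr1 rroot1 // !expr1n !mul1r.
  by have [_] := (ME p).1 Mp; apply: le_lt_trans; rewrite /N2 lerDl sqr_ge0.
by split=> //; left; rewrite a1 lexx ler01.
Qed.

Lemma Rel_NN : Rel R (pre NN) (pre CC).
Proof.
apply: (@RelY_retract R C3 M NN CC F4).
- by move=> p /NN_w[].
- exact: F4_cts.
- exact: F4_NN.
- move=> p Np; have [w0 w2 _] := NN_w Np; rewrite /F4 subr0 mul1r divff ?rroot1 //.
    by rewrite -(ReE w0) sc1.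
  by rewrite gt_eqF //; lra.
- exact: CC_NN.
- move=> t p t01 Cp; have Np := F4_NN t01 (CC_NN Cp); have [_ _ MF] := NN_w Np.
  by split => //; rewrite /F4 /sc !mkE Cp.2 mul0r mulr0 mulr0.
- move=> p Np; have Np' := F4_NN (i01 R) Np; have [_ _ MF] := NN_w Np'.
  by split => //; rewrite /F4 /sc !mkE subrr mul0r mulr0.
Qed.

Lemma wN p : cz p / (- r) = - w p. Proof. by rewrite invrN mulrN. Qed.

Lemma V_cover : Mpp = V r `|` V (- r).
Proof.
apply/seteqP; split => [p Mppp|p]; last by move=> [[[]|[]]|[[]|[]]].
have [w0|w0|w0] := ltgtP (Re (w p)) 0.
- by right; left; split => //; rewrite wN cReN oppr_gt0.
- by left; left; split.
left; right; have [|w0' _ _] := real_w Mppp; first by right; rewrite w0 expr0n /=; lra.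
have [Mp _] := Mppp; apply: CC_NN; split => //; apply: (w0_P r0).
by rewrite (ReE w0') w0.
Qed.

Lemma V_meet : V r `&` V (- r) = NN.
Proof.
apply/seteqP; split => [p [[[_ h1]|//] [[_ h2]|//]]|p Np]; last by split; right.
by move: h2; rewrite wN cReN oppr_gt0 => h2; have := lt_trans h1 h2; rewrite ltxx.
Qed.

Lemma P_relopen : relopen (pre (P r)) (pre Mpp).
Proof.
apply: (@relopen_gt0 R X _ _ (fun p => Re (w (val p)))).
- by apply: cts_Re; apply: cts_w; exact: cts_val.
- by move=> p [].
- by move=> p.
Qed.

Lemma cts_qnorm (S : topologicalType) (p : S -> C3) : continuous p ->
  continuous (fun t => qnorm (rs (p t)) (p t)).
Proof.
move=> cp; have ca := cts_aa cp.
have m0 t : 0 < Num.max (Re (aa (p t))) 2^-1.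
  by rewrite lt_max; apply/orP; right; lra.
have cr : continuous (fun t => rs (p t)).
  rewrite /rs; apply: (cts_rroot d_gt0); last by move=> t; rewrite invr_ge0 ltW.
  by apply: ctsV; [cts|move=> t; rewrite gt_eqF].
by rewrite /qnorm; cts.
Qed.

Lemma NN_relopen : relopen (pre NN) (pre Mpp).
Proof.
pose A : set X := [set p | 2^-1 < Re (aa (val p))].
pose B : set X := [set p | qnorm (rs (val p)) (val p) < eps ^+ 2].
have cv := @cts_val _ M.
have oA : relopen (pre Mpp `&` A) (pre Mpp).
  apply: (@relopen_gt0 R X _ _ (fun p => Re (aa (val p)) - 2^-1)).
  - by have ca := cts_aa cv; cts.
  - by move=> p [_]; rewrite /A /= subr_gt0.
  - by move=> p Mp; rewrite subr_gt0.
have oB : relopen (pre Mpp `&` B) (pre Mpp).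
  apply: (@relopen_gt0 R X _ _ (fun p => eps ^+ 2 - qnorm (rs (val p)) (val p))).
  - by have ca := cts_qnorm cv; cts.
  - by move=> p [_]; rewrite /B /= subr_gt0.
  - by move=> p Mp; rewrite subr_gt0.
have := relopenI oA oB; congr relopen; apply/seteqP; split=> p.
  by move=> [[h1 h2] [_ h3]].
by move=> [h1 h2 h3].
Qed.

Lemma V_relopen : relopen (pre (V r)) (pre Mpp).
Proof. exact: relopenU P_relopen NN_relopen. Qed.
End Root.

Section Rotation.
Variables (w1 w2 : C).
Hypotheses (nw1 : nrm w1 = 1) (nw2 : nrm w2 = 1).
Hypothesis gw : forall x y, g (w1 * x) (w2 * y) = g x y.

Definition rot (p : C3) : C3 := mk (w1 * cx p) (w2 * cy p) (- cz p).

Lemma aa_rot p : aa (rot p) = aa p.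
Proof. by rewrite /aa /rot !mkE gw. Qed.

Lemma rot_M p : M p -> M (rot p).
Proof.
move=> /ME[gp np]; apply/ME; rewrite /rot /N2 !mkE gw sqrrN gp; split => //.
by rewrite !nrmM nrmN nw1 nw2 !mul1r.
Qed.

Lemma rot_Mpp p : Mpp p -> Mpp (rot p).
Proof. by move=> [/rot_M Mp]; rewrite /Mpp /= aa_rot. Qed.

Lemma rot_NN p : NN p -> NN (rot p).
Proof.
move=> [/rot_Mpp Mp a2 qp]; split; rewrite ?aa_rot //.
by rewrite /rs aa_rot /qnorm /rot !mkE !nrmM nw1 nw2 !mul1r.
Qed.

Lemma rot_V r p : V r p -> V (- r) (rot p).
Proof.
case=> [[Mp h]|/rot_NN]; last by right.
by left; split; [exact: rot_Mpp|rewrite /rot !mkE invrN mulrNN].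
Qed.

Lemma rot_VN r p : V (- r) p -> V r (rot p).
Proof. by move/rot_V; rewrite opprK. Qed.

Lemma cts_liftrot : continuous (liftM rot : X -> X).
Proof.
apply: cts_into.
have -> : val \o liftM rot = (fun p : X => rot (val p)).
  by apply/funext => p /=; rewrite val_liftM //; apply: rot_M; exact: valM.
have cv := @cts_val _ M.
by apply: cts_mk; cts.
Qed.

Variables (A B : set C3) (E I J : finType).
Variables (lW : C3 -> E) (lU : C3 -> I) (lV : C3 -> J) (iU : E -> I) (iV : E -> J).
Hypotheses (AC : A `<=` CC) (BC : B `<=` CC).
Hypothesis RelC : Rel R (pre CC) (pre (A `|` B)).
Hypothesis A_open : relopen (pre A) (pre A `|` pre B).
Hypothesis B_open : relopen (pre B) (pre A `|` pre B).
Hypothesis clA : clusters R (pre A) (fun p => lU (val p)).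
Hypothesis clB : clusters R (pre B) (fun p => lV (val p)).
Hypothesis clAB : clusters R (pre (A `&` B)) (fun p => lW (val p)).
Hypothesis lUW : forall p, A p -> B p -> lU p = iU (lW p).
Hypothesis lVW : forall p, A p -> B p -> lV p = iV (lW p).

Theorem suspension_homology (h : X -> X) (ch : continuous h) (F : R -> X -> X)
    (pi : E -> E) :
  cont_on setT F -> (forall p, val (F 0 p) = rot (val p)) -> F 1 = h ->
  (forall p, A p -> A (rot p)) -> (forall p, B p -> B (rot p)) ->
  injective pi -> (forall p, A p -> B p -> lW (rot p) = pi (lW p)) ->
  exists Theta : homology R 2 (set0 : set X) -> {ffun E -> int},
    [/\ forall a b, Theta (a - b) = Theta a - Theta b,
        forall a, Theta a = 0 -> a = 0,
        forall th, balanced iU iV th <-> exists a, Theta a = th &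
        forall a e, Theta (hmap set0 (mkcts ch) a) (pi e) = - Theta a e].
Proof.
move=> cF F0 F1 rA rB pi_inj lr.
have [r r2] : exists r, r ^+ 2 = lam.
  by exists (sqrtC lam); rewrite sqrtCK.
have Nr2 : (- r) ^+ 2 = lam by rewrite sqrrN.
have rM (p : X) : M (rot (val p)) by apply: rot_M; exact: valM.
have vr (p : X) : val (liftM rot p) = rot (val p) by rewrite val_liftM.
apply: (@mayer_vietoris R X (pre Mpp) (pre (V r)) (pre (V (- r))) (pre (A `|` B))
  (pre A) (pre B) E I J (fun p => lW (val p)) (fun p => lU (val p))
  (fun p => lV (val p)) iU iV _ _ _ _ _ _ _ _ _ _ _ _ _ _ _ _ h (liftM rot) ch F pi).
- exact: Rel_Mpp.
- by rewrite (V_cover r2).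
- by rewrite -[_ `|` _]/(pre (V r `|` V (- r))) -V_cover ?r2 ?sqrrN //; exact: V_relopen.
- by rewrite -[_ `|` _]/(pre (V r `|` V (- r))) -V_cover ?r2 ?sqrrN //; exact: V_relopen.
- exact: Rel_V.
- exact: Rel_V.
- rewrite (_ : _ `&` _ = pre NN); last by rewrite -(V_meet r).
  apply: (@Rel_trans _ _ _ (pre CC)); last exact: RelC.
  + by move=> p [/AC|/BC].
  + by move=> p; exact: CC_NN.
  + exact: (Rel_NN r2).
- rewrite (_ : _ `&` _ = pre NN); last by rewrite -(V_meet r).
  by move=> p [/AC|/BC] /CC_NN.
- by [].
- exact: A_open.
- exact: B_open.
- exact: clA.
- exact: clB.
- exact: clAB.
- by move=> p [Ap Bp]; exact: lUW.
- by move=> p [Ap Bp]; exact: lVW.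
- exact: cF.
- by apply/funext => p; apply: val_inj; rewrite F0 vr.
- exact: F1.
- exact: cts_liftrot.
- by move=> p Vp /=; rewrite vr; exact: rot_V.
- by move=> p Vp /=; rewrite vr; exact: rot_VN.
- by move=> p Ap /=; rewrite vr; exact: rA.
- by move=> p Bp /=; rewrite vr; exact: rB.
- exact: pi_inj.
- by move=> p [Ap Bp] /=; rewrite vr; exact: lr.
Qed.
End Rotation.
End Suspension.

(** * Roots of unity as labels of components *)

Section Labels.
Variable R : realType.
Local Notation C := R[i].
Local Notation Re := complex.Re.
Local Notation Im := complex.Im.

Definition segc n (t u : cube_set R n) (s : R) : 'rV[R]_n :=
  let s' := Num.max 0 (Num.min 1 s) in (1 - s') *: val t + s' *: val u.

Lemma segc_cube n (t u : cube_set R n) s : segc t u s \in cube_set R n.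
Proof.
apply/mem_set => j; rewrite /segc !mxE; set s' := Num.max _ _.
have /andP[s0 s1] : 0 <= s' <= 1.
  by rewrite le_max lexx /= ge_max ler01 ge_min lexx.
have /set_mem /(_ j) /andP[t0 t1] := valP t; have /set_mem /(_ j) /andP[u0 u1] := valP u.
apply/andP; split; nra.
Qed.

(** A function with open fibres is constant along the segment between two points, as R is connected.
    Clamping the parameter in [segc] makes the segment a path on all of R. *)
Lemma cube_const n (I : eqType) (l : cube_set R n -> I) :
  (forall i, open [set t | l t = i]) -> forall t u, l t = l u.
Proof.
move=> ol t u; pose p s : cube_set R n := SigSub (segc_cube t u s).
have cp : continuous p.
  pose q (s : R) := Num.max 0 (Num.min 1 s).
  have cq : continuous q.
    apply: cts_max; first exact: ctsC.
    by apply: cts_min; [exact: ctsC|move=> s; exact: cvg_id].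
  apply: cts_into; apply: cts_mx => i j.
  have -> : (fun s => (\val \o p) s i j) =
            (fun s => (1 - q s) * val t i j + q s * val u i j).
    by apply/funext => s; rewrite /= /segc !mxE.
  by cts.
have p0 : p 0 = t.
  by apply: val_inj; rewrite /= /segc (min_idPr ler01) maxxx subr0 scale1r scale0r addr0.
have p1 : p 1 = u.
  by apply: val_inj; rewrite /= /segc minxx (max_idPr ler01) subrr scale1r scale0r add0r.
have opn i : open [set s | l (p s) = i].
  by apply: (@open_comp _ _ p [set t | l t = i]) (ol i) => s _; exact: cp.
have /connected_intervalP cT : is_interval (setT : set R) by [].
have := cT [set s | l (p s) = l t]; rewrite /= => H.
have : [set s | l (p s) = l t] = setT.
  apply: H.
  - by exists 0; rewrite /= p0.
  - by exists [set s | l (p s) = l t]; rewrite ?setTI.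
  - exists [set s | l (p s) = l t]; rewrite ?setTI // -openC.
    rewrite (_ : ~` _ = \bigcup_(i in [set i | i != l t]) [set s | l (p s) = i]).
      by apply: bigcup_open => i _.
    apply/seteqP; split => s /=; last by move=> [i /= iN E]; rewrite E; apply/eqP.
    by move=> /eqP h; exists (l (p s)).
by move=> /seteqP[_ /(_ 1 Logic.I)] /=; rewrite p1.
Qed.

Lemma sign_const n (f : cube_set R n -> R) : continuous f -> (forall t, f t != 0) ->
  forall t u, (0 < f t) = (0 < f u).
Proof.
move=> cf f0; apply: cube_const => -[].
  rewrite (_ : [set t | _] = f @^-1` [set r | 0 < r]); last by [].
  by apply: open_comp; [move=> t _; exact: cf|exact: open_gt].
rewrite (_ : [set t | _] = f @^-1` [set r | r < 0]).
  by apply: open_comp; [move=> t _; exact: cf|exact: open_lt].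
by apply/seteqP; split => t /= h; [rewrite lt_neqAle f0 leNgt h|rewrite ltNge ltW].
Qed.

Definition om n : C := cis (2 * pi / n%:R).

Lemma cis_inj1 (a : R) : 0 <= a < 2 * pi -> cis a = 1 -> a = 0.
Proof.
move=> /andP[a0 a1] /(congr1 (@complex.Re _)) /= c1; apply/eqP; rewrite eq_le a0 andbT leNgt.
apply/negP => a0'.
have s : 0 < sin (a / 2) by apply: sin_gt0_pi; lra.
have : cos (a / 2 + a / 2) = 1 by rewrite (_ : a / 2 + a / 2 = a) //; lra.
rewrite cosD -!expr2; have := cos2Dsin2 (a / 2); have := exprn_gt0 2 s; lra.
Qed.

Lemma cis2pi : cis (2 * pi) = 1 :> C.
Proof. by rewrite mulr_natl /cis cos2pi sin2pi. Qed.

Lemma om_prim n : (0 < n)%N -> n.-primitive_root (om n).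
Proof.
move=> n0; have nR : (0 : R) < n%:R by rewrite ltr0n.
rewrite /primitive_root_of_unity n0 /=; apply/forallP => i; apply/eqP.
rewrite unity_rootE /om cisX; have pi0 := @pi_gt0 R.
have [->|iN] := eqVneq i.+1 n.
  by rewrite mulrC divfK ?cis2pi ?eqxx // pnatr_eq0 -lt0n.
apply/eqP => /cis_inj1; have lt : (i.+1 < n)%N by rewrite ltn_neqAle iN ltn_ord.
move=> H; have /eqP : i.+1%:R * (2 * pi / n%:R) = 0 :> R.
  apply: H.
  apply/andP; split; first by rewrite mulr_ge0 // divr_ge0 ?ltW // mulr_gt0.
  rewrite mulrA ltr_pdivrMr // mulrC ltr_pM2l ?ltr_nat //; lra.
by rewrite !mulf_eq0 invr_eq0 !pnatr_eq0 /= (gt_eqF pi0) gtn_eqF.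
Qed.

Lemma omX n : (0 < n)%N -> om n ^+ n = 1.
Proof. by move=> n0; exact: prim_expr_order (om_prim n0). Qed.

Lemma om_neq0 n : om n != 0.
Proof. by rewrite -nrm_gt0 nrm_cis. Qed.

Variable n : nat.
Local Notation w := (om n.+1).

Definition lab (z : C) : 'I_n.+1 := odflt ord0 [pick i : 'I_n.+1 | z == w ^+ i].

Lemma labP z : z ^+ n.+1 = 1 -> z = w ^+ lab z.
Proof.
move=> z1; rewrite /lab; case: pickP => [i /eqP//|none].
have [i E] := prim_rootP (om_prim (ltn0Sn n)) z1.
by have := none i; rewrite E eqxx.
Qed.

Lemma om_inj (i j : 'I_n.+1) : w ^+ i = w ^+ j -> i = j.
Proof.
move/eqP; rewrite (eq_prim_root_expr (om_prim (ltn0Sn n))) !modn_small // => /eqP h.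
exact: val_inj.
Qed.

Lemma lab_om (k : nat) : lab (w ^+ k) = inord (k %% n.+1).
Proof.
apply: om_inj; rewrite -labP; last by rewrite exprAC omX // expr1n.
rewrite inordK ?ltn_pmod //; apply/eqP.
by rewrite (eq_prim_root_expr (om_prim (ltn0Sn n))) modn_mod.
Qed.

Lemma lab_ord (i : 'I_n.+1) : lab (w ^+ i) = i.
Proof. by rewrite lab_om modn_small // inord_val. Qed.

Lemma labM z k : z ^+ n.+1 = 1 -> lab (w ^+ k * z) = inord ((k + lab z) %% n.+1).
Proof. by move=> /labP {1}->; rewrite -exprD lab_om. Qed.

Lemma cts_prod (S : topologicalType) (I : Type) (r : seq I) (P : pred I) (F : I -> S -> C) :
  (forall i, continuous (F i)) -> continuous (fun t => \prod_(i <- r | P i) F i t).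
Proof.
move=> cF; elim: r => [|i r IH]; first by under eq_fun do rewrite big_nil; exact: ctsC.
case Pi: (P i).
  under eq_fun do rewrite big_cons Pi.
  by apply: ctsM; [exact: cF|exact: IH].
by under eq_fun do rewrite big_cons Pi; exact: IH.
Qed.

(** The label of f t is i exactly if the product of the f t - w^j, j != i, is nonzero, which is an
    open condition. *)
Lemma lab_const k (f : cube_set R k -> C) : continuous f -> (forall t, f t ^+ n.+1 = 1) ->
  forall t u, lab (f t) = lab (f u).
Proof.
move=> cf f1; apply: cube_const => i.
rewrite (_ : [set t | _] = [set t | \prod_(j | j != i) (f t - w ^+ j) != 0]).
  by apply: open_neq0; apply: cts_prod => j; cts.
apply/seteqP; split => t /=.
  move=> li; apply/prodf_neq0 => j ji; rewrite subr_eq0; apply: contraNneq ji => E.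
  by rewrite -li E lab_ord.
move/prodf_neq0 => H; apply/eqP; apply/negPn/negP => /H /=.
by rewrite subr_eq0 -labP // eqxx.
Qed.
End Labels.

Section Coordinate.
Variable R : realType.
Local Notation C := R[i].
Local Notation Re := complex.Re.

(** The factor for x that moves a = x^n / lam linearly to al. For al = 0 it also serves at a = 0,
    where the quotient is 0. *)
Definition mul_to (n : nat) (t al a : R) : R := rroot n ((1 - t) + t * (al / a)).

Lemma mul_toX n t al a : (0 < n)%N -> 0 <= t <= 1 -> 0 <= al -> 0 <= a -> (al != 0 -> a != 0) ->
  mul_to n t al a ^+ n * a = (1 - t) * a + t * al.
Proof.
move=> n0 /andP[t0 t1] al0 a0 h; rewrite rrootX //; last first.
  by rewrite addr_ge0 ?subr_ge0 // mulr_ge0 // divr_ge0.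
rewrite mulrDl; congr (_ + _); rewrite -mulrA; congr (_ * _).
have [->|alN] := eqVneq al 0; first by rewrite !mul0r.
by rewrite divfK // h.
Qed.

Lemma cts_mul_to (S : topologicalType) n (t : S -> R) al (a : S -> R) : (0 < n)%N ->
  continuous t -> continuous a -> (forall s, 0 <= t s <= 1) -> 0 <= al ->
  (forall s, 0 <= a s) -> (forall s, al != 0 -> a s != 0) ->
  continuous (fun s => mul_to n (t s) al (a s)).
Proof.
move=> n0 ct ca t01 al0 a0 h; rewrite /mul_to; apply: (cts_rroot n0); last first.
  move=> s; case/andP: (t01 s) => t0 t1.
  by rewrite addr_ge0 ?subr_ge0 // mulr_ge0 // divr_ge0.
apply: ctsD; first by cts.
apply: ctsM; first exact: ct.
have [->|alN] := eqVneq al 0.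
  by under eq_fun do rewrite mul0r; exact: ctsC.
by apply: ctsM; [exact: ctsC|apply: ctsV => // s; exact: h].
Qed.

Variables (n' : nat) (lam k : C).
Local Notation n := n'.+1.
Hypotheses (lam0 : lam != 0) (kn : k ^+ n = lam).

Lemma k_neq0 : k != 0.
Proof. by apply: contraNneq lam0 => k0; rewrite -kn k0 expr0n. Qed.

Lemma ofR_eq0 (a : R) : (a%:C == 0) = (a == 0).
Proof. exact: (inj_eq (@RCinj R) a 0). Qed.

Lemma kr_neq0 (a : R) : 0 <= a -> a != 0 -> k * (rroot n a)%:C != 0.
Proof.
by move=> a0 aN; rewrite mulf_neq0 ?k_neq0 // ofR_eq0 gt_eqF // rroot_gt0 // lt0r aN.
Qed.

(** If x^n = lam a with a > 0, this is the root of unity that remains of x after division by k and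
    the positive root of a. *)
Definition cf (x : C) (a : R) : C := x / (k * (rroot n a)%:C).

Lemma cfX x a : x ^+ n / lam = a%:C -> 0 <= a -> a != 0 -> cf x a ^+ n = 1.
Proof.
move=> xE a0 aN; rewrite /cf exprMn exprVn [(k * _) ^+ _]exprMn kn -rmorphXn /= rrootX //.
by rewrite invfM mulrA xE divff // ofR_eq0.
Qed.

Lemma cf_mul_to x a al : x ^+ n / lam = a%:C -> 0 <= a -> 0 <= al -> (al != 0 -> a != 0) ->
  (mul_to n 1 al a)%:C * x = k * om R n ^+ lab n' (cf x a) * (rroot n al)%:C.
Proof.
move=> xE a0 al0 h; rewrite /mul_to subrr add0r mul1r.
have [alE|alN] := eqVneq al 0; first by rewrite alE mul0r /rroot eqxx mul0r mulr0.
have aN := h alN.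
rewrite -(labP (cfX xE a0 aN)) /cf.
have a_gt0 : 0 < a by rewrite lt0r aN.
have rE : rroot n al = rroot n (al / a) * rroot n a by rewrite -rrootM ?divr_ge0 // divfK.
have raN : (rroot n a)%:C != 0 by rewrite ofR_eq0 gt_eqF // rroot_gt0.
rewrite rE rmorphM /= mulrCA; have kN := k_neq0.
move: raN; set u := (rroot n a)%:C; set v := (rroot n (al / a))%:C => u0.
by field; rewrite u0 kN.
Qed.

Definition cpt (i : 'I_n) (al : R) : C := k * om R n ^+ i * (rroot n al)%:C.

Lemma cptX i al : 0 <= al -> cpt i al ^+ n / lam = al%:C.
Proof.
move=> al0; rewrite /cpt !exprMn kn exprAC omX // expr1n mulr1 -rmorphXn /= rrootX //.
by rewrite mulrC mulKf.
Qed.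

Lemma cf_cpt i al : 0 <= al -> al != 0 -> lab n' (cf (cpt i al) al) = i.
Proof.
move=> al0 alN; rewrite /cf /cpt -[k * _ * _]mulrA [_ ^+ _ * _]mulrC mulrA mulrAC.
by rewrite divff ?mul1r ?lab_ord // kr_neq0.
Qed.

Lemma cts_cf (S : topologicalType) (x : S -> C) (a : S -> R) : continuous x -> continuous a ->
  (forall t, 0 <= a t) -> (forall t, a t != 0) -> continuous (fun t => cf (x t) (a t)).
Proof.
move=> cx ca a0 aN; rewrite /cf; apply: ctsM; first exact: cx.
apply: ctsV.
  by apply: ctsM; [exact: ctsC|apply: cts_ofR; exact: cts_rroot].
by move=> t; exact: kr_neq0.
Qed.

Lemma cf_om x a j : cf (om R n ^+ j * x) a = om R n ^+ j * cf x a.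
Proof. by rewrite /cf mulrA. Qed.
End Coordinate.

(** * The curve x^p + y^q = lam *)

Section Brieskorn.
Variable R : realType.
Local Notation C := R[i].
Local Notation C3 := 'rV[C]_3.
Local Notation Re := complex.Re.
Local Notation Im := complex.Im.

Variables (p' q' : nat) (lam : C) (eps : R) (M : set C3).
Local Notation p := p'.+1.
Local Notation q := q'.+1.
Hypothesis lam0 : lam != 0.
Hypothesis small : forall x y : C, nrm x ^+ p <= nrm lam -> nrm y ^+ q <= nrm lam ->
  nrm x ^+ 2 + nrm y ^+ 2 < eps ^+ 2.
Hypothesis ME : forall v, M v <-> cx v ^+ p + cy v ^+ q + cz v ^+ 2 = lam /\ N2 v < eps ^+ 2.

Definition ax (v : C3) : C := cx v ^+ p / lam.
Definition bx (v : C3) : C := cy v ^+ q / lam.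

Lemma ab_sum v : CC M v -> ax v + bx v = 1.
Proof.
move=> [/ME[gv _] z0]; move: gv; rewrite z0 expr0n addr0 => gv.
by rewrite /ax /bx -mulrDl gv divff.
Qed.

Lemma M_ab v : cz v = 0 -> ax v + bx v = 1 -> N2 v < eps ^+ 2 -> CC M v.
Proof.
move=> z0 ab nv; split => //; apply/ME; rewrite z0 expr0n addr0; split => //.
by move: ab; rewrite /ax /bx -mulrDl => /(congr1 (fun z => z * lam)); rewrite divfK // mul1r.
Qed.

Definition Gam : set C3 := [set v | CC M v /\ 0 <= ax v <= 1].

(** On the curve x vanishes where [ax] does and y where [bx] does. So [kc] serves for both
    coordinates, without the cutoff of [F1]: a bounded root times x is continuous where x = 0. *)
Definition FG (t : R) (v : C3) : C3 :=
  mk (croot p (kc t (bx v) (ax v)) * cx v) (croot q (kc t (ax v) (bx v)) * cy v) 0.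

Lemma kS_sym t (a b : C) : kS t b a = kS t a b.
Proof. by rewrite /kS [pos (Re b) + _]addrC. Qed.

Section FG.
Variables (t : R) (v : C3).
Hypotheses (t01 : 0 <= t <= 1) (Cv : CC M v).
Let ab := ab_sum Cv.
Let ba : bx v + ax v = 1. Proof. by rewrite addrC. Qed.

Lemma FG_ax : ax (FG t v) = kc t (bx v) (ax v) * ax v.
Proof.
rewrite /ax /FG !mkE exprMn crootX ?mulrA //.
by apply: slit_Re; exact: (kc_le t01 ba).2.
Qed.

Lemma FG_bx : bx (FG t v) = kc t (ax v) (bx v) * bx v.
Proof.
rewrite /bx /FG !mkE exprMn crootX ?mulrA //.
by apply: slit_Re; exact: (kc_le t01 ab).2.
Qed.

Lemma FG_CC : CC M (FG t v).
Proof.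
apply: M_ab; first by rewrite /FG !mkE.
  rewrite FG_ax FG_bx !kc_mul // kS_sym -mulrDl addrACA -mulrDr ab mulr1.
  rewrite -!rmorphD -rmorphM /=; have := kS_ge1 t01 ab => S1.
  rewrite (_ : _ * _ = 1) //; apply: (mulIf (lt0r_neq0 (lt_le_trans ltr01 S1))).
  by rewrite mulfVK ?gt_eqF ?(lt_le_trans ltr01 S1) // mul1r /kS mulrDr.
have [/ME[_ nv] _] := Cv; apply: le_lt_trans nv.
rewrite /N2 /FG !mkE nrm0 expr0n addr0 -[leLHS]addr0 /= lerD ?sqr_ge0 // lerD // nrm_scale_le //.
  by apply: nrm_croot_le1 => //; exact: (kc_le t01 ba).1.
by apply: nrm_croot_le1 => //; exact: (kc_le t01 ab).1.
Qed.

Lemma FG_stay : 0 <= ax v <= 1 -> ax (FG t v) = ax v.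
Proof.
move=> a01; rewrite FG_ax kc_mul //.
have [aE /andP[a0 a1]] := in01C a01.
have bE : Re (bx v) = 1 - Re (ax v).
  by have := congr1 (@complex.Re _) ab; rewrite cReD /= => <-; rewrite addrC addKr.
have -> : kS t (bx v) (ax v) = 1.
  by rewrite /kS bE !pos_id ?subr_ge0 //; ring.
rewrite invr1 mulr1 pos_id // rmorphM /= -aE rmorphB /= mulrBl mul1r subrK //.
Qed.

Lemma FG_end : t = 1 -> Gam (FG t v).
Proof.
move=> t1; split; first exact: FG_CC.
rewrite FG_ax kc_mul // t1 subrr mul0r add0r mul1r -rmorphM /=; apply: C01.
have S1 := kS_ge1 (i01 R) ba; have S0 : 0 < kS 1 (bx v) (ax v) by exact: lt_le_trans S1.
apply/andP; split; first by rewrite mulr_ge0 ?pos_ge0 // invr_ge0 ltW.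
by rewrite ler_pdivrMr // mul1r /kS subrr add0r mul1r lerDr pos_ge0.
Qed.
End FG.

Lemma cts_ax (S : topologicalType) (s : S -> C3) : continuous s -> continuous (fun t => ax (s t)).
Proof. by move=> cs; rewrite /ax; cts. Qed.
Lemma cts_bx (S : topologicalType) (s : S -> C3) : continuous s -> continuous (fun t => bx (s t)).
Proof. by move=> cs; rewrite /bx; cts. Qed.

Lemma cts_kcroot (S : topologicalType) n (T : S -> R) (a c x : S -> C) : (0 < n)%N ->
  continuous T -> continuous a -> continuous c -> continuous x ->
  (forall t, 0 <= T t <= 1) -> (forall t, a t + c t = 1) -> (forall t, x t != 0 -> c t != 0) ->
  continuous (fun t => croot n (kc (T t) (a t) (c t)) * x t).
Proof.
move=> n0 cT ca cc cx T01 ac xc; apply: (@ctsM_bounded _ _ _ _ 1) => //.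
  by move=> t; apply: nrm_croot_le1 => //; exact: (kc_le (T01 t) (ac t)).1.
set S' := [set t | _].
have cv : continuous (val : S' -> S) by exact: cts_val.
apply: (@cts_croot _ _ n _ n0); last first.
  by move=> t; apply: slit_Re; exact: (kc_le (T01 (val t)) (ac (val t))).2.
apply: (@cts_kc _ _ (fun t : S' => T (val t)) (fun t => a (val t)) (fun t => c (val t))).
- exact: cts_comp1 cv cT.
- exact: cts_comp1 cv ca.
- exact: cts_comp1 cv cc.
- by move=> t; exact: T01.
- by move=> t; exact: ac.
by move=> t; apply: xc; have /set_mem := valP t.
Qed.

Lemma FG_cts : contY (CC M) FG.
Proof.
move=> S u s cu cs u01 Cs; have ca := cts_ax cs; have cb := cts_bx cs.
apply: cts_mk; last exact: ctsC.
  apply: (cts_kcroot (ltn0Sn p') cu cb ca (cts_cx cs) u01).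
    by move=> t; rewrite addrC ab_sum.
  by move=> t x0; rewrite /ax mulf_neq0 ?invr_eq0 // expf_neq0.
apply: (cts_kcroot (ltn0Sn q') cu ca cb (cts_cy cs) u01).
  by move=> t; rewrite ab_sum.
by move=> t x0; rewrite /bx mulf_neq0 ?invr_eq0 // expf_neq0.
Qed.

Local Notation X := (M : topologicalType).
Local Notation pre A := ((val : X -> C3) @^-1` A).

Lemma Rel_Gam : Rel R (pre (CC M)) (pre Gam).
Proof.
apply: (@RelY_retract R C3 M (CC M) Gam FG).
- by move=> v [].
- exact: FG_cts.
- by move=> t v t01; exact: FG_CC.
- move=> v [_ z0]; rewrite /FG !kc0 !croot1 // !mul1r -[RHS]mk_eta z0 //.
- by move=> v [].
- by move=> t v t01 [Cv a01]; split; [exact: FG_CC|rewrite FG_stay].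
- by move=> v Cv; apply: FG_end; rewrite ?i01.
Qed.

Lemma Gam_real v : Gam v -> exists a : R, [/\ 0 <= a <= 1, ax v = a%:C & bx v = (1 - a)%:C].
Proof.
move=> [Cv a01]; have [aE a01'] := in01C a01; exists (Re (ax v)); split => //.
by rewrite rmorphB /= -aE (_ : (1 : R)%:C = 1) // -(ab_sum Cv) addrC addKr.
Qed.

(** On the graph |x|^p and |y|^q are at most |lam|, so [small] keeps every deformation along it in
    the ball. *)
Lemma Gam_intro v (a : R) : 0 <= a <= 1 -> cz v = 0 -> ax v = a%:C -> bx v = (1 - a)%:C -> Gam v.
Proof.
move=> a01 z0 aE bE; have /andP[a0 a1] := a01.
have l0 : 0 < nrm lam by rewrite nrm_gt0.
have nx : nrm (cx v) ^+ p <= nrm lam.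
  by rewrite -nrmX -[_ ^+ _](divfK lam0) -/(ax v) aE nrmM nrmR ger0_norm // ler_piMl // ltW.
have ny : nrm (cy v) ^+ q <= nrm lam.
  rewrite -nrmX -[_ ^+ _](divfK lam0) -/(bx v) bE nrmM nrmR ger0_norm ?subr_ge0 //.
  by rewrite ler_piMl ?(ltW l0) // lerBlDr lerDl.
split; last by rewrite aE; exact: C01.
apply: M_ab => //; first by rewrite aE bE -rmorphD /= addrC subrK.
by rewrite /N2 z0 nrm0 expr0n /= addr0 small.
Qed.

(* Al 1 and Al 0 are the stars of the vertices on the two sides of the graph, and
   Al (1/2) is the union of the open edges. *)
Definition Al (al : R) : set C3 :=
  [set v | [/\ Gam v, al != 0 -> ax v != 0 & al != 1 -> bx v != 0]].

Definition Fal (al t : R) (v : C3) : C3 :=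
  mk ((mul_to p t al (Re (ax v)))%:C * cx v)
     ((mul_to q t (1 - al) (Re (bx v)))%:C * cy v) 0.

Lemma Al_M al : Al al `<=` M.
Proof. by move=> v [[[]]]. Qed.

Section Fal.
Variable al : R.
Hypothesis al01 : 0 <= al <= 1.
Let al0 : 0 <= al. Proof. by case/andP: al01. Qed.
Let al1 : 0 <= 1 - al. Proof. by rewrite subr_ge0; case/andP: al01. Qed.

Lemma Al_real v : Al al v -> exists a : R,
  [/\ 0 <= a <= 1, ax v = a%:C, bx v = (1 - a)%:C, al != 0 -> a != 0 & 1 - al != 0 -> 1 - a != 0].
Proof.
move=> [Gv h1 h2]; have [a [a01 aE bE]] := Gam_real Gv; exists a; split => //.
  by move=> /h1; rewrite aE; apply: contraNneq => ->.
rewrite subr_eq0 eq_sym => /h2; rewrite bE; by apply: contraNneq => ->.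
Qed.

Lemma Fal_ab t v a : 0 <= t <= 1 -> 0 <= a <= 1 -> ax v = a%:C -> bx v = (1 - a)%:C ->
  (al != 0 -> a != 0) -> (1 - al != 0 -> 1 - a != 0) ->
  ax (Fal al t v) = ((1 - t) * a + t * al)%:C /\
  bx (Fal al t v) = (1 - ((1 - t) * a + t * al))%:C.
Proof.
move=> t01 /andP[a0 a1] aE bE h1 h2; rewrite /Fal aE bE /ax /bx !mkE /= !exprMn -!mulrA.
rewrite -/(ax v) -/(bx v) aE bE -!rmorphXn -!rmorphM /= !mul_toX ?subr_ge0 //; last by case/andP: al01.
by split => //; congr _%:C; ring.
Qed.

Lemma Fal_Al t v : 0 <= t <= 1 -> Al al v -> Al al (Fal al t v).
Proof.
move=> t01 Av; have [a [a01 aE bE h1 h2]] := Al_real Av.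
have [aF bF] := Fal_ab t01 a01 aE bE h1 h2.
case/andP: t01 => t0 t1; case/andP: a01 => a0 a1; case/andP: al01 => _ al1'.
set a' := (1 - t) * a + t * al in aF bF.
have h3 : 0 <= (1 - t) * a by rewrite mulr_ge0 ?subr_ge0.
have h4 : 0 <= t * al by rewrite mulr_ge0.
have h5 : 0 <= (1 - t) * (1 - a) by rewrite mulr_ge0 ?subr_ge0.
have h6 : 0 <= t * (1 - al) by rewrite mulr_ge0.
have a'01 : 0 <= a' <= 1 by apply/andP; rewrite /a'; split; lra.
split; first by apply: Gam_intro a'01 _ aF bF; rewrite /Fal !mkE.
- move=> alN; rewrite aF /a' (inj_eq (@RCinj R) _ 0) gt_eqF //.
  have : 0 < al by rewrite lt0r alN.
  have : 0 < a by rewrite lt0r h1.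
  move=> *; nra.
- move=> alN; rewrite bF /a' (inj_eq (@RCinj R) _ 0) gt_eqF //.
  have alN' : 1 - al != 0 by rewrite subr_eq0 eq_sym.
  have : 0 < 1 - al by rewrite lt0r alN'.
  have : 0 < 1 - a by rewrite lt0r h2 ?subr_ge0.
  move=> *; nra.
Qed.

Lemma Fal_0 v : Al al v -> Fal al 0 v = v.
Proof.
move=> [[[_ z0] _] _ _]; rewrite /Fal /mul_to subr0 !mul0r !addr0 !rroot1 // !mul1r.
by rewrite -[RHS]mk_eta z0.
Qed.

Lemma Fal_cts : contY (Al al) (Fal al).
Proof.
move=> S u s cu cs u01 As; have ca := cts_ax cs; have cb := cts_bx cs.
have H t := Al_real (As t).
apply: cts_mk; last exact: ctsC; apply: ctsM.
- apply: cts_ofR; apply: cts_mul_to => //; first by cts.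
  + by move=> t; have [a [/andP[a0 _] -> _ _ _]] := H t.
  + by move=> t; have [a [_ -> _ h _]] := H t.
- by cts.
- apply: cts_ofR; apply: cts_mul_to => //; first by cts.
  + by move=> t; have [a [/andP[_ a1] _ -> _ _]] := H t; rewrite /= subr_ge0.
  + by move=> t; have [a [_ _ -> _ h]] := H t.
- by cts.
Qed.

Definition k1 : C := p.-root lam.
Definition k2 : C := q.-root lam.
Definition lx (v : C3) : 'I_p := lab p' (cf p' k1 (cx v) (Re (ax v))).
Definition ly (v : C3) : 'I_q := lab q' (cf q' k2 (cy v) (Re (bx v))).

Lemma k1X : k1 ^+ p = lam. Proof. exact: rootCK. Qed.
Lemma k2X : k2 ^+ q = lam. Proof. exact: rootCK. Qed.

Definition ctr (i : 'I_p) (j : 'I_q) : C3 := mk (cpt k1 i al) (cpt k2 j (1 - al)) 0.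

Lemma ctr_ab i j : ax (ctr i j) = al%:C /\ bx (ctr i j) = (1 - al)%:C.
Proof.
rewrite /ax /bx /ctr !mkE; split.
  exact: (cptX lam0 k1X i al0).
exact: (cptX lam0 k2X j al1).
Qed.

Lemma ctr_Al i j : Al al (ctr i j).
Proof.
have [aE bE] := ctr_ab i j; split.
- by apply: Gam_intro al01 _ aE bE; rewrite /ctr !mkE.
- by rewrite aE ofR_eq0.
- by rewrite bE ofR_eq0 subr_eq0 eq_sym.
Qed.

Lemma lx_ctr i j : al != 0 -> lx (ctr i j) = i.
Proof.
move=> alN; have [aE bE] := ctr_ab i j; rewrite /lx aE /= /ctr !mkE.
exact: (cf_cpt lam0 k1X i al0 alN).
Qed.

Lemma ly_ctr i j : al != 1 -> ly (ctr i j) = j.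
Proof.
move=> alN; have [aE bE] := ctr_ab i j; rewrite /ly bE /= /ctr !mkE.
by apply: (cf_cpt lam0 k2X j al1); rewrite subr_eq0 eq_sym.
Qed.

Lemma Fal_1 v : Al al v -> Fal al 1 v = ctr (lx v) (ly v).
Proof.
move=> Av; have [a [/andP[a0 a1] aE bE h1 h2]] := Al_real Av.
rewrite /Fal /ctr /lx /ly aE bE /=; congr mk.
  exact: (cf_mul_to lam0 k1X aE a0 al0 h1).
by apply: (cf_mul_to lam0 k2X bE _ al1 h2); rewrite subr_ge0.
Qed.

Section Cube.
Variables (n : nat) (s : cube_set R n -> C3).
Hypotheses (cs : continuous s) (As : forall t, Al al (s t)).

Lemma lx_const : al != 0 -> forall t u, lx (s t) = lx (s u).
Proof.
move=> alN; apply: lab_const.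
  apply: (cts_cf lam0 k1X); first exact: cts_cx.
  - by have ca := cts_ax cs; cts.
  - by move=> t; have [a [/andP[a0 a1] -> _ h1 h2]] := Al_real (As t).
  - by move=> t; have [a [_ -> _ h1 _]] := Al_real (As t); exact: h1.
move=> t; have [a [/andP[a0 a1] aE bE h1 h2]] := Al_real (As t).
by rewrite aE /=; exact: (cfX k1X aE a0 (h1 alN)).
Qed.

Lemma ly_const : al != 1 -> forall t u, ly (s t) = ly (s u).
Proof.
rewrite eq_sym -subr_eq0 => alN; apply: lab_const.
  apply: (cts_cf lam0 k2X); first exact: cts_cy.
  - by have ca := cts_bx cs; cts.
  - by move=> t; have [a [/andP[a0 a1] _ -> h1 h2]] := Al_real (As t); rewrite /= subr_ge0.
  - by move=> t; have [a [_ _ -> _ h2]] := Al_real (As t); exact: h2.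
move=> t; have [a [/andP[a0 a1] aE bE h1 h2]] := Al_real (As t).
have b0 : 0 <= 1 - a by rewrite subr_ge0.
by rewrite bE /=; exact: (cfX k2X bE b0 (h2 alN)).
Qed.
End Cube.
End Fal.

Let h01 : is_true (((0 : R) <= 1) && ((1 : R) <= 1)). Proof. by rewrite ler01 lexx. Qed.
Let h00 : is_true (((0 : R) <= 0) && ((0 : R) <= 1)). Proof. by rewrite ler01 lexx. Qed.
Let h02 : is_true (((0 : R) <= 2^-1) && ((2^-1 : R) <= 1)). Proof. by apply/andP; split; lra. Qed.
Let r0 n (k : C) (i : 'I_n.+1) : cpt k i 0 = 0 :> C.
Proof. by rewrite /cpt /rroot eqxx mulr0. Qed.

Lemma clusters_x : clusters R (pre (Al 1)) (fun v => lx (val v)).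
Proof.
apply: (@clustersY R C3 M (Al 1) (Fal 1) (@Al_M 1) (Fal_cts h01) (Fal_Al h01) (@Fal_0 1)
  _ lx (fun i => ctr 1 i ord0)).
- by move=> v Av; rewrite Fal_1 // /ctr subrr !r0.
- by move=> i; exact: ctr_Al.
- by move=> i; rewrite lx_ctr ?oner_eq0.
- by move=> n s cs As; apply: (lx_const cs As); rewrite oner_eq0.
Qed.

Lemma clusters_y : clusters R (pre (Al 0)) (fun v => ly (val v)).
Proof.
have N01 : (0 : R) != 1 by rewrite eq_sym oner_eq0.
apply: (@clustersY R C3 M (Al 0) (Fal 0) (@Al_M 0) (Fal_cts h00) (Fal_Al h00) (@Fal_0 0)
  _ ly (fun j => ctr 0 ord0 j)).
- by move=> v Av; rewrite Fal_1 // /ctr !r0.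
- by move=> i; exact: ctr_Al.
- by move=> i; rewrite ly_ctr.
- by move=> n s cs As; exact: (ly_const cs As).
Qed.

Lemma clusters_xy : clusters R (pre (Al 2^-1)) (fun v => (lx (val v), ly (val v))).
Proof.
have N0 : (2^-1 : R) != 0 by rewrite invr_eq0 pnatr_eq0.
have N1 : (2^-1 : R) != 1 by rewrite invr_eq1 (eqr_nat _ 2 1).
apply: (@clustersY R C3 M (Al 2^-1) (Fal 2^-1) (@Al_M _) (Fal_cts h02) (Fal_Al h02) (@Fal_0 _)
  _ (fun v => (lx v, ly v)) (fun ij => ctr 2^-1 ij.1 ij.2)).
- by move=> v Av; rewrite Fal_1.
- by move=> i; exact: ctr_Al.
- by move=> [i j]; rewrite lx_ctr // ly_ctr.
- by move=> n s cs As t u; rewrite (lx_const cs As N0 t u) (ly_const cs As N1 t u).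
Qed.

Lemma Al_cover : Al 1 `|` Al 0 = Gam.
Proof.
apply/seteqP; split => [v [[]|[]]//|v Gv].
have [a0|a0] := eqVneq (ax v) 0.
  right; split => //; first by rewrite eqxx.
  move=> _; have [a [_ aE bE]] := Gam_real Gv; rewrite bE ofR_eq0.
  by move: aE; rewrite a0 => -[<-]; rewrite subr0 oner_eq0.
by left; split => //; rewrite eqxx.
Qed.

Lemma Al_meet : Al 1 `&` Al 0 = Al 2^-1.
Proof.
have N0 : (2^-1 : R) != 0 by rewrite invr_eq0 pnatr_eq0.
have N1 : (2^-1 : R) != 1 by rewrite invr_eq1 (eqr_nat _ 2 1).
apply/seteqP; split => v.
  move=> [[Gv h _] [_ _ h']]; split=> // _; [apply: h|apply: h']; rewrite ?oner_eq0 //.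
  by rewrite eq_sym oner_eq0.
by move=> [Gv /(_ N0) h /(_ N1) h']; split; split.
Qed.

Lemma Al1_relopen : relopen (pre (Al 1)) (pre Gam).
Proof.
have cv := @cts_val _ M.
apply: (@relopen_gt0 R X _ _ (fun v => nrm (ax (val v)))).
- by apply: cts_nrm; exact: cts_ax.
- by move=> v [_ h _]; rewrite nrm_gt0 h ?oner_eq0.
- by move=> v Gv; rewrite nrm_gt0 => h; split => //; rewrite eqxx.
Qed.

Lemma Al0_relopen : relopen (pre (Al 0)) (pre Gam).
Proof.
have cv := @cts_val _ M.
apply: (@relopen_gt0 R X _ _ (fun v => nrm (bx (val v)))).
- by apply: cts_nrm; exact: cts_bx.
- by move=> v [_ _ h]; rewrite nrm_gt0 h // eq_sym oner_eq0.
- by move=> v Gv; rewrite nrm_gt0 => h; split => //; rewrite eqxx.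
Qed.

Definition rotA : C3 -> C3 := rot (om R p) (om R q).

Lemma rotA_ab v : ax (rotA v) = ax v /\ bx (rotA v) = bx v.
Proof. by rewrite /ax /bx /rotA /rot !mkE !exprMn !omX // !mul1r. Qed.

Lemma nrm_om n : nrm (om R n) = 1.
Proof. exact: nrm_cis. Qed.

Lemma rotA_Al al v : Al al v -> Al al (rotA v).
Proof.
have [aE bE] := rotA_ab v; rewrite /Al /Gam /= aE bE => -[[[Mv z0] a01] h1 h2]; split => //.
split => //; split; last by rewrite /rotA /rot !mkE z0 oppr0.
apply: (@rot_M R (fun x y => x ^+ p + y ^+ q) lam eps M ME _ _ (nrm_om p) (nrm_om q)) => //.
by move=> x y; rewrite !exprMn !omX // !mul1r.
Qed.

Variables (q1 q2 d : nat).
Hypotheses (d_gt0 : (0 < d)%N) (q1p : (q1 * p = d)%N) (q2q : (q2 * q = d)%N).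
Hypotheses (eps0 : 0 < eps) (lam_small : nrm lam * d%:R < eps ^+ 2).

Theorem brieskorn_homology (h : X -> X) (ch : continuous h) (F : R -> X -> X) :
  cont_on setT F -> (forall v, val (F 0 v) = rotA (val v)) -> F 1 = h ->
  exists Theta : homology R 2 (set0 : set X) -> {ffun 'I_p * 'I_q -> int},
    [/\ forall a b, Theta (a - b) = Theta a - Theta b,
        forall a, Theta a = 0 -> a = 0,
        forall th, balanced fst snd th <-> exists a, Theta a = th &
        forall a e, Theta (hmap set0 (mkcts ch) a) (ordS e.1, ordS e.2) = - Theta a e].
Proof.
move=> cF F0 F1.
have q10 : (0 < q1)%N by move: d_gt0; rewrite -q1p muln_gt0 => /andP[].
have q20 : (0 < q2)%N by move: d_gt0; rewrite -q2q muln_gt0 => /andP[].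
apply: (@suspension_homology R (fun x y => x ^+ p + y ^+ q) q1 q2 d lam eps M q10 q20 d_gt0
  _ _ lam0 lam_small ME (om R p) (om R q) (nrm_om p) (nrm_om q) _ (Al 1) (Al 0)
  ('I_p * 'I_q)%type 'I_p 'I_q (fun v => (lx v, ly v)) lx ly fst snd _ _ _ _ _ _ _ _ _ _
  h ch F (fun e => (ordS e.1, ordS e.2)) cF F0 F1).
- by move=> s x y; rewrite !exprMn -!exprM q1p q2q mulrDr.
- by move=> S x y cx cy; cts.
- by move=> x y; rewrite !exprMn !omX // !mul1r.
- by move=> v [[]].
- by move=> v [[]].
- by rewrite Al_cover; exact: Rel_Gam.
- by rewrite -[_ `|` _]/(pre (Al 1 `|` Al 0)) Al_cover; exact: Al1_relopen.
- by rewrite -[_ `|` _]/(pre (Al 1 `|` Al 0)) Al_cover; exact: Al0_relopen.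
- exact: clusters_x.
- exact: clusters_y.
- by rewrite Al_meet; exact: clusters_xy.
- by [].
- by [].
- exact: rotA_Al.
- exact: rotA_Al.
- move=> [i j] [i' j'] E; congr pair; apply: ordS_inj.
    exact: (congr1 fst E).
  exact: (congr1 snd E).
- move=> v A1 A0; have Av : Al 2^-1 v by rewrite -Al_meet.
  have [a [/andP[a0 a1] aE bE h1 h2]] := Al_real Av.
  have N0 : (2^-1 : R) != 0 by rewrite invr_eq0 pnatr_eq0.
  have N1 : 1 - (2^-1 : R) != 0 by rewrite subr_eq0 eq_sym invr_eq1 (eqr_nat _ 2 1).
  have [aF bF] := rotA_ab v; rewrite /lx /ly aF bF aE bE /= /rotA /rot !mkE -[om R p]expr1 -[om R q]expr1.
  congr pair; rewrite cf_om labM.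
  + by apply/val_inj; rewrite /= inordK ?ltn_pmod.
  + by apply: (cfX k1X aE a0); exact: h1.
  + by apply/val_inj; rewrite /= inordK ?ltn_pmod.
  + by apply: (cfX k2X bE); [rewrite subr_ge0|exact: h2].
Qed.
End Brieskorn.

(** * The curve x^2 y + y^n = lam: retraction to |y^n / lam| = 1 *)

Section DNorm.
Variable R : realType.
Implicit Types (n : nat).

(** Both sides are affine in c, so c = 1 and c = -1 suffice, where the claim follows from (s - 1) u
    <= s u^n - 1 and (s + 1) u <= s u^n + 1. The latter rests on u^n >= u^2. *)
Lemma D_norm_out n (s u c : R) : (2 <= n)%N -> 1 <= s -> 1 <= u -> -1 <= c <= 1 ->
  u ^+ 2 * (1 - 2 * s * c + s ^+ 2) <= 1 - 2 * (s * u ^+ n) * c + (s * u ^+ n) ^+ 2.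
Proof.
move=> n2 s1 u1 /andP[c0 c1].
have : u ^+ 2 <= u ^+ n by rewrite ler_weXn2l.
set U := u ^+ n => uU.
have uU1 : u <= U by apply: le_trans uU; rewrite expr2 ler_peMl // (le_trans ler01).
have h1 : 0 <= (s - 1) * u <= s * U - 1.
  apply/andP; split; first by rewrite mulr_ge0 ?subr_ge0 // (le_trans ler01).
  have : 0 <= s * (U - u) by rewrite mulr_ge0 ?subr_ge0 // (le_trans ler01).
  lra.
have h2 : 0 <= (s + 1) * u <= s * U + 1.
  apply/andP; split; first by rewrite mulr_ge0 ?addr_ge0 // (le_trans ler01).
  have : 0 <= (s - 1) * (U - u) by rewrite mulr_ge0 ?subr_ge0.
  have : 0 <= (u - 1) ^+ 2 by exact: sqr_ge0.
  lra.
have sq (x y : R) : 0 <= x <= y -> x ^+ 2 <= y ^+ 2.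
  by move=> /andP[x0 xy]; rewrite lerXn2r ?nnegrE // (le_trans x0).
have := sq _ _ h1; have := sq _ _ h2; rewrite !exprMn => e2 e1.
have k1 : 0 <= (1 + c) * ((s * U - 1) ^+ 2 - (s - 1) ^+ 2 * u ^+ 2).
  by rewrite mulr_ge0 ?subr_ge0 //; lra.
have k2 : 0 <= (1 - c) * ((s * U + 1) ^+ 2 - (s + 1) ^+ 2 * u ^+ 2).
  by rewrite mulr_ge0 ?subr_ge0 //; lra.
lra.
Qed.

Lemma bernoulli_le n (v : R) : 0 <= v <= 1 -> 1 - v ^+ n <= n%:R * (1 - v).
Proof.
move=> /andP[v0 v1]; elim: n => [|n IHn]; first by rewrite expr0 subrr mul0r.
have /andP[a0 a1] : 0 <= v ^+ n <= 1 by rewrite exprn_ge0 // exprn_ile1.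
have : 0 <= (1 - v) * (1 - v ^+ n) by rewrite mulr_ge0 ?subr_ge0.
rewrite exprS -natr1; lra.
Qed.

(** |y| grows from v Y' to Y', and X = |x|^2 has to make up for it. As s is small, B >= B' (1 - (1 -
    v) / 3), and X B' v = X' B yields X >= X' (1 + 2/3 (1 - v)). For X' > eps^2 / 2 and Y' <= eps /
    4 this loss exceeds the gain. *)
Lemma D_norm_in n (eps s v X X' Y' B B' : R) : (0 < n)%N ->
  0 < v <= 1 -> 0 <= s -> s * (4 * n%:R) <= 1 -> eps ^+ 2 / 2 < X' -> 0 <= Y' -> Y' <= eps / 4 ->
  B' - s * (1 - v ^+ n) <= B -> 1 - s <= B' -> X * (B' * v) = X' * B ->
  X' + Y' ^+ 2 <= X + (v * Y') ^+ 2.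
Proof.
move=> n0 /andP[v0 v1] s0 s4 X1 Y0 Y1 BB B1 XE.
have n1 : (1 : R) <= n%:R by rewrite ler1n.
have s4' : s <= 4^-1.
  have : 0 <= s * (n%:R - 1) by rewrite mulr_ge0 // subr_ge0.
  lra.
have ber : s * (1 - v ^+ n) <= (1 - v) / 4.
  have := @bernoulli_le n v; rewrite (ltW v0) v1 => /(_ isT) be.
  have h1 : s * (1 - v ^+ n) <= s * (n%:R * (1 - v)) by rewrite ler_wpM2l.
  have h2 : 0 <= (1 - s * (4 * n%:R)) * (1 - v) by rewrite mulr_ge0 ?subr_ge0.
  lra.
have X0 : 0 < X' by apply: le_lt_trans X1; rewrite divr_ge0 ?sqr_ge0.
have B0 : 0 < B' by lra.
have B2 : B' * (1 - (1 - v) / 3) <= B.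
  have : 0 <= (1 - v) * (B' - 3 / 4) by rewrite mulr_ge0 ?subr_ge0 //; lra.
  lra.
have XX : X' * (1 - (1 - v) / 3) <= X * v.
  rewrite -(ler_pM2r B0); have -> : X * v * B' = X' * B by rewrite -XE; ring.
  by rewrite -mulrA ler_pM2l // mulrC.
have XX2 : X' * (1 + 2 / 3 * (1 - v)) <= X.
  rewrite -(ler_pM2r v0); apply: le_trans XX.
  have : 0 <= X' * (1 - v) ^+ 2 by rewrite mulr_ge0 ?sqr_ge0 // ltW.
  lra.
have YY : Y' ^+ 2 <= eps ^+ 2 / 16.
  have -> : eps ^+ 2 / 16 = (eps / 4) ^+ 2 by rewrite exprMn exprVn; congr (_ / _); ring.
  by rewrite lerXn2r ?nnegrE // (le_trans Y0).
have h1 : 0 <= (1 - v) * (X' - eps ^+ 2 / 2) by rewrite mulr_ge0 ?subr_ge0 // ltW.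
have h2 : 0 <= (1 - v) * (eps ^+ 2 / 16 - Y' ^+ 2) by rewrite mulr_ge0 ?subr_ge0.
have h3 : 0 <= Y' ^+ 2 * (1 - v) ^+ 2 by rewrite mulr_ge0 ?sqr_ge0.
have h4 : 0 <= (1 - v) * eps ^+ 2 by rewrite mulr_ge0 ?subr_ge0 ?sqr_ge0.
rewrite exprMn; lra.
Qed.
End DNorm.

Section DRetract.
Variable R : realType.
Local Notation C := R[i].
Local Notation C3 := 'rV[C]_3.
Local Notation Re := complex.Re.
Local Notation Im := complex.Im.

Variables (n' : nat) (lam : C) (eps : R) (M : set C3).
Local Notation n := n'.+1.
Hypothesis n2 : (2 <= n)%N.
Hypothesis lam0 : lam != 0.
Hypothesis eps0 : 0 < eps.
Hypothesis small1 : nrm lam <= (eps / 4) ^+ n.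
Hypothesis small2 : 2 ^+ n * nrm lam ^+ n' * (4 * n%:R) <= (eps ^+ 2 / 2) ^+ n.
Hypothesis ME : forall v, M v <->
  cx v ^+ 2 * cy v + cy v ^+ n + cz v ^+ 2 = lam /\ N2 v < eps ^+ 2.

Definition by_ (v : C3) : C := cy v ^+ n / lam.
Local Notation b := by_.

Let L0 : 0 < nrm lam. Proof. by rewrite nrm_gt0. Qed.

Lemma CC_eq v : CC M v -> cx v ^+ 2 * cy v = lam * (1 - b v).
Proof.
move=> [/ME[gv _] z0]; move: gv; rewrite z0 expr0n addr0 => gv.
by rewrite /by_ mulrBr mulr1 [lam * _]mulrC divfK // -[in RHS]gv addrK.
Qed.

Lemma CC_intro v : cz v = 0 -> cx v ^+ 2 * cy v = lam * (1 - b v) -> N2 v < eps ^+ 2 -> CC M v.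
Proof.
move=> z0 E nv; split=> //; apply/ME; rewrite z0 expr0n addr0 E; split => //.
by rewrite /by_ mulrBr mulr1 [lam * _]mulrC divfK // subrK.
Qed.

Lemma b_neq0 v : CC M v -> b v != 0.
Proof.
move=> Cv; apply: contraNneq lam0 => b0; have := CC_eq Cv; rewrite b0 subr0 mulr1 => <-.
move: b0 => /eqP; rewrite /by_ mulf_eq0 invr_eq0 (negbTE lam0) orbF expf_eq0 /= => /eqP ->.
by rewrite mulr0.
Qed.

Lemma nrm_y v : nrm (cy v) ^+ n = nrm lam * nrm (b v).
Proof. by rewrite /by_ nrmM nrmV nrmX mulrC divfK // nrm_eq0. Qed.

Lemma nrm_xy v : CC M v -> nrm (cx v) ^+ 2 * nrm (cy v) = nrm lam * nrm (1 - b v).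
Proof. by move=> /CC_eq E; rewrite -nrmX -!nrmM E. Qed.

Definition GD : set C3 := [set v | CC M v /\ nrm (b v) = 1].

(** The origin of [small2]: the n-th power of X Y <= 2 |lam|, divided by Y^n = |lam| k, bounds X^n
    by 2^n |lam|^(n-1) / k, and 1 / k <= 4n. *)
Lemma small_x (X Y : R) (k : R) : 0 <= X -> 0 <= Y -> X * Y <= 2 * nrm lam -> Y ^+ n = nrm lam * k ->
  1 <= k * (4 * n%:R) -> X <= eps ^+ 2 / 2.
Proof.
move=> X0 Y0 XY YE k1; have k0 : 0 < k.
  rewrite ltNge; apply/negP => kN; have : k * (4 * n%:R) <= 0.
    by rewrite mulr_le0_ge0 // mulr_ge0 ?ler0n.
  by move: k1 => /le_trans h /h; rewrite ler10.
have e2 : 0 <= eps ^+ 2 / 2 by rewrite divr_ge0 ?sqr_ge0.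
rewrite -(@ler_pXn2r _ n) ?nnegrE //; apply: le_trans small2.
have h : X ^+ n * (nrm lam * k) <= 2 ^+ n * nrm lam ^+ n.
  rewrite -YE -!exprMn lerXn2r ?nnegrE ?mulr_ge0 // ltW //.
rewrite -(ler_pM2r (mulr_gt0 L0 k0)); apply: le_trans h _.
have -> : 2 ^+ n * nrm lam ^+ n' * (4 * n%:R) * (nrm lam * k) =
          2 ^+ n * nrm lam ^+ n * (k * (4 * n%:R)) by rewrite [nrm lam ^+ n]exprS; ring.
by rewrite ler_peMr // mulr_ge0 ?exprn_ge0 // ltW.
Qed.

Lemma small_y (Y : R) k : 0 <= Y -> Y ^+ n = nrm lam * k -> k <= 1 -> Y <= eps / 4.
Proof.
move=> Y0 YE k1; rewrite -(@ler_pXn2r _ n) ?nnegrE ?divr_ge0 ?(ltW eps0) //.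
by rewrite YE; apply: le_trans small1; rewrite ler_piMr // ltW.
Qed.

Lemma GD_intro v : cz v = 0 -> cx v ^+ 2 * cy v = lam * (1 - b v) -> nrm (b v) = 1 -> GD v.
Proof.
move=> z0 E b1; split => //; apply: CC_intro => //.
have yE := nrm_y v; rewrite b1 in yE.
have Y := small_y (nrm_ge0 _) yE (lexx 1).
have n1 : (1 : R) <= 1 * (4 * n%:R).
  have : (1 : R) <= n%:R by rewrite ler1n.
  lra.
have X : nrm (cx v) ^+ 2 <= eps ^+ 2 / 2.
  apply: (small_x _ _ _ yE n1); rewrite ?sqr_ge0 ?nrm_ge0 //.
  rewrite -nrmX -nrmM E nrmM mulrC ler_pM2r //; apply: le_trans (nrmD _ _) _.
  by rewrite nrmN b1 nrm1.
have Y2 : nrm (cy v) ^+ 2 <= eps ^+ 2 / 16.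
  have -> : eps ^+ 2 / 16 = (eps / 4) ^+ 2 by rewrite exprMn exprVn; congr (_ / _); ring.
  by rewrite lerXn2r ?nnegrE ?nrm_ge0 // (le_trans (nrm_ge0 _) Y).
rewrite /N2 z0 nrm0 expr0n addr0 /=; have : 0 < eps ^+ 2 by rewrite exprn_gt0.
lra.
Qed.

(** rho |b| runs linearly from |b| to 1, so b moves radially to the unit circle, and [quo] is the
    factor that x^2 y = lam (1 - b) then requires. At b = 1 it is 0 by default, and x = 0 there. *)
Definition rho (t : R) (v : C3) : R := (1 - t) + t / nrm (b v).
Definition quo (t : R) (v : C3) : C := (1 - (rho t v)%:C * b v) / (1 - b v).
Definition FD (t : R) (v : C3) : C3 :=
  let u := rroot n (rho t v) in
  mk (croot 2 (quo t v) * cx v * ((rroot 2 u)^-1)%:C) (u%:C * cy v) 0.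

Section FD.
Variables (t : R) (v : C3).
Hypotheses (t01 : 0 <= t <= 1) (Cv : CC M v).
Let r := nrm (b v).
Let r0 : 0 < r. Proof. by rewrite nrm_gt0; exact: b_neq0. Qed.
Let t0 : 0 <= t. Proof. by case/andP: t01. Qed.
Let t1 : t <= 1. Proof. by case/andP: t01. Qed.

Lemma rho_gt0 : 0 < rho t v.
Proof.
rewrite /rho -/r; have [->|tN] := eqVneq t 0; first by rewrite subr0 mul0r addr0 ltr01.
by apply: ltr_wpDl; rewrite ?subr_ge0 // divr_gt0 // lt0r tN.
Qed.

Lemma rho_r : rho t v * r = (1 - t) * r + t.
Proof. by rewrite /rho -/r mulrDl divfK // gt_eqF. Qed.

(** Up to a positive factor the imaginary part is Im b (1 - rho). It vanishes only for rho = 1,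
    where the numerator is |1 - b|^2, or for real b, where 1 - rho b and 1 - b do not have opposite
    signs because rho |b| stays on the same side of 1 as |b|. *)
Lemma slit_quo : slit (quo t v).
Proof.
have [b1|b1] := eqVneq (b v) 1; first by right; rewrite /quo b1 subrr invr0 mulr0.
have D0 : 0 < nrm (1 - b v) ^+ 2 by rewrite exprn_gt0 // nrm_gt0 subr_eq0 eq_sym.
have qE : quo t v = ((nrm (1 - b v) ^+ 2)^-1)%:C * ((1 - (rho t v)%:C * b v) * cj (1 - b v)).
  have cE : (1 - b v)^-1 = ((nrm (1 - b v) ^+ 2)^-1)%:C * cj (1 - b v).
    have bN : 1 - b v != 0 by rewrite subr_eq0 eq_sym.
    by apply: (mulIf bN); rewrite mulVf // -mulrA cj_mul -rmorphM /= mulVf // gt_eqF.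
  by rewrite /quo cE mulrCA.
set D := nrm (1 - b v) ^+ 2 in D0 qE.
have rE := nrm2 (b v); rewrite -/r in rE; have rr := rho_r.
rewrite /slit qE cReRM cImRM cReM cImM /= !cReD !cImD !cReN !cImN cReRM cImRM /=.
move: rE rr; set x := Re (b v); set y := Im (b v); set q := rho t v => rE rr.
have [h|h] := eqVneq (y * (1 - q)) 0; last first.
  left; rewrite mulf_neq0 //; first by rewrite invr_eq0 gt_eqF.
  by rewrite (_ : _ + _ = y * (1 - q)) //; ring.
right; rewrite mulr_ge0 ?invr_ge0 ?(ltW D0) //.
move/eqP: h; rewrite mulf_eq0 subr_eq0 => /orP[/eqP y0|/eqP q1]; last first.
  have : 0 <= (1 - x) ^+ 2 + y ^+ 2 by rewrite addr_ge0 ?sqr_ge0.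
  rewrite -q1; lra.
have : 0 <= (1 - q * x) * (1 - x).
  have [x0|x0] := leP x 0.
    have : 0 <= q * (- x) by rewrite mulr_ge0 ?oppr_ge0 // ltW // rho_gt0.
    move=> h; rewrite mulr_ge0 //; lra.
  have rx : r = x.
    apply/eqP; rewrite -(@eqrXn2 _ 2) ?(ltW r0) ?(ltW x0) //.
    by rewrite rE y0 expr0n addr0.
  rewrite -rx rr; have -> : (1 - ((1 - t) * r + t)) * (1 - r) = (1 - t) * (1 - r) ^+ 2 by ring.
  by rewrite mulr_ge0 ?sqr_ge0 // subr_ge0.
rewrite y0; lra.
Qed.

Lemma quo_mul : quo t v * (cx v ^+ 2 * cy v) = lam * (1 - (rho t v)%:C * b v).
Proof.
rewrite (CC_eq Cv) /quo; have [b1|b1] := eqVneq (b v) 1; last first.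
  by rewrite mulrCA divfK // subr_eq0 eq_sym.
have rh : rho t v = 1 by rewrite /rho b1 nrm1 divr1 subrK.
by rewrite rh b1 mulr1 subrr !mulr0.
Qed.

Lemma nrm_quo : nrm (quo t v) <= 2.
Proof.
rewrite /quo nrmM nrmV.
have [b1|b1] := eqVneq (b v) 1; first by rewrite b1 subrr nrm0 invr0 mulr0.
have D0 : 0 < nrm (1 - b v) by rewrite nrm_gt0 subr_eq0 eq_sym.
rewrite ler_pdivrMr //.
have -> : 1 - (rho t v)%:C * b v = (1 - b v) + (1 - rho t v)%:C * b v.
  by rewrite rmorphB /= mulrBl mul1r addrA subrK.
apply: le_trans (nrmD _ _) _; rewrite mulr_natl mulr2n lerD2l nrmM nrmR.
rewrite -/r -[X in _ * X](ger0_norm (ltW r0)) -normrM mulrBl rho_r mul1r.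
rewrite (_ : r - _ = t * (r - 1)); last by ring.
rewrite normrM ger0_norm //; apply: le_trans (_ : `|r - 1| <= _).
  by rewrite ler_piMl.
rewrite ler_norml; apply/andP; split.
  by have := nrmD (b v) (1 - b v); rewrite addrCA subrr addr0 nrm1 -/r; lra.
by have := nrmD (b v - 1) 1; rewrite subrK nrm1 -/r -[b v - 1]opprB nrmN; lra.
Qed.

Let u := rroot n (rho t v).
Let u0 : 0 < u. Proof. by apply: rroot_gt0; exact: rho_gt0. Qed.
Let uX : u ^+ n = rho t v. Proof. by apply: rrootX => //; apply: ltW; exact: rho_gt0. Qed.

Lemma FD_b : b (FD t v) = (rho t v)%:C * b v.
Proof. by rewrite /by_ /FD !mkE exprMn -rmorphXn /= -/u uX mulrA. Qed.

Lemma FD_eq : cx (FD t v) ^+ 2 * cy (FD t v) = lam * (1 - b (FD t v)).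
Proof.
rewrite FD_b -quo_mul /FD !mkE -/u exprMn [(_ * cx v) ^+ 2]exprMn crootX //; last exact: slit_quo.
rewrite -rmorphXn /= exprVn rrootX ?(ltW u0) // fmorphV /=.
have uN : u%:C != 0 by rewrite ofR_eq0 gt_eqF.
by field.
Qed.

Lemma nrm_FDb : nrm (b (FD t v)) = (1 - t) * r + t.
Proof. by rewrite FD_b nrmM nrmR ger0_norm ?(ltW rho_gt0) // rho_r. Qed.

Lemma FD_N2 : N2 (FD t v) < eps ^+ 2.
Proof.
have [/ME[_ nv] z0] := Cv; move: nv; rewrite /N2 z0 nrm0 expr0n addr0 /= => nv.
have -> : cz (FD t v) = 0 by rewrite /FD !mkE.
rewrite nrm0 expr0n addr0 /=.
set X := nrm (cx v) ^+ 2 in nv; set Y := nrm (cy v) in nv.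
set X' := nrm (cx (FD t v)) ^+ 2; set Y' := nrm (cy (FD t v)).
have X0 : 0 <= X by exact: sqr_ge0.
have X'0 : 0 <= X' by exact: sqr_ge0.
have Y0 : 0 <= Y by exact: nrm_ge0.
have YE : Y' = u * Y by rewrite /Y' /FD !mkE nrmM nrmR ger0_norm // ltW.
have Y'0 : 0 <= Y' by exact: nrm_ge0.
have XY : X * Y = nrm lam * nrm (1 - b v) by exact: nrm_xy.
have XY' : X' * Y' = nrm lam * nrm (1 - b (FD t v)).
  by rewrite /X' /Y' -nrmX -!nrmM FD_eq.
have Yn : Y ^+ n = nrm lam * r by exact: nrm_y.
have Yn' : Y' ^+ n = nrm lam * nrm (b (FD t v)) by exact: nrm_y.
have sE := nrm_FDb; set s := nrm (b (FD t v)) in sE Yn'.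
have sr : s = r * u ^+ n by rewrite sE uX [RHS]mulrC rho_r.
set B := nrm (1 - b v) in XY; set B' := nrm (1 - b (FD t v)) in XY'.
have Yp : 0 < Y.
  rewrite lt0r Y0 andbT; apply/negP => /eqP Y00; move: Yn.
  by rewrite Y00 expr0n /= => /esym/eqP; rewrite gt_eqF // mulr_gt0.
have Bc : B ^+ 2 = 1 - 2 * Re (b v) + r ^+ 2.
  by rewrite /B /r !nrm2 cReD cImD cReN cImN /=; ring.
have B'c : B' ^+ 2 = 1 - 2 * ((rho t v) * Re (b v)) + (rho t v * r) ^+ 2.
  rewrite /B' FD_b exprMn /r !nrm2 cReD cImD cReN cImN cReRM cImRM /=; ring.
have [r1|r1] := leP 1 r.
  (* outside the unit circle both norms decrease *)
  have s1 : 1 <= s.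
    have : 0 <= (1 - t) * (r - 1) by rewrite mulr_ge0 ?subr_ge0.
    rewrite sE; lra.
  have u1 : u <= 1.
    apply: rroot_le1 => //; rewrite (ltW rho_gt0) /=.
    rewrite -(ler_pM2r r0) mul1r rho_r.
    have : 0 <= t * (r - 1) by rewrite mulr_ge0 ?subr_ge0.
    lra.
  have YY : Y' ^+ 2 <= Y ^+ 2 by rewrite YE lerXn2r ?nnegrE ?mulr_ge0 ?(ltW u0) // ler_piMl.
  suff XX : X' <= X by apply: le_lt_trans nv; exact: lerD.
  have c1 : -1 <= Re (b v) / r <= 1.
    rewrite ler_pdivlMr // ler_pdivrMr // mul1r mulN1r.
    by have := Re_le_nrm (b v); rewrite ler_norml -/r.
  have u1' : 1 <= u^-1 by rewrite invf_ge1.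
  (* [D_norm_out] with 1 / u for u, and with the cosine of the argument of b for c. *)
  have sq : (u^-1 * B') ^+ 2 <= B ^+ 2.
    have h0 := D_norm_out n2 s1 u1' c1.
    have su : s * u^-1 ^+ n = r by rewrite sr exprVn mulfK // expf_neq0 // gt_eqF.
    have rN : r != 0 by rewrite gt_eqF.
    have e1 : 2 * s * (Re (b v) / r) = 2 * (rho t v * Re (b v)) by rewrite sr uX; field.
    have e3 : 2 * r * (Re (b v) / r) = 2 * Re (b v) by field.
    by rewrite exprMn B'c Bc; move: h0; rewrite su e1 e3 sr uX [r * rho t v]mulrC.
  have uB : B' <= u * B.
    have : u^-1 * B' <= B.
      move: sq; rewrite ler_pXn2r ?nnegrE ?mulr_ge0 ?nrm_ge0 ?invr_ge0 ?(ltW u0) //.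
    by rewrite ler_pdivrMl.
  rewrite -(ler_pM2r (_ : 0 < Y')); last by rewrite YE mulr_gt0.
  rewrite XY' YE mulrCA XY mulrCA; apply: ler_wpM2l => //; exact: ltW.
(* Inside the circle |y| grows but stays below eps / 4. If X' <= eps^2 / 2 this is enough; otherwise
   [small_x] shows that s is at most 1 / (4n), and [D_norm_in] applies. *)
have s1 : s <= 1.
  have : 0 <= (1 - t) * (1 - r) by rewrite mulr_ge0 ?subr_ge0 // ltW.
  rewrite sE; lra.
have Y4 := small_y Y'0 Yn' s1.
have e2 : 0 < eps ^+ 2 by rewrite exprn_gt0.
have YY : Y' ^+ 2 <= eps ^+ 2 / 16.
  have -> : eps ^+ 2 / 16 = (eps / 4) ^+ 2 by rewrite exprMn exprVn; congr (_ / _); ring.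
  by rewrite lerXn2r ?nnegrE // (le_trans Y'0).
have [X2|X2] := leP X' (eps ^+ 2 / 2); first lra.
have B'2 : B' <= 2.
  apply: le_trans (nrmD _ _) _; rewrite nrmN nrm1 -/s; lra.
have s4 : s * (4 * n%:R) <= 1.
  rewrite leNgt; apply/negP => /ltW s4; move: X2; rewrite ltNge; apply/negP/negPn.
  apply: (small_x X'0 Y'0 _ Yn' s4); rewrite XY' mulrC ler_wpM2r ?(ltW L0) //.
have u1 : 1 <= u.
  rewrite leNgt; apply/negP => u1.
  have : u ^+ n < 1 by rewrite exprn_ilt1 // ltW.
  rewrite uX -(ltr_pM2r r0) mul1r rho_r.
  have : 0 <= t * (1 - r) by rewrite mulr_ge0 ?subr_ge0 // ltW.
  lra.
have vX : u^-1 * Y' = Y by rewrite YE mulKf // gt_eqF.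
apply: le_lt_trans nv; rewrite -vX.
have rv : s * u^-1 ^+ n = r by rewrite sr exprVn mulfK // expf_neq0 // gt_eqF.
apply: (@D_norm_in _ n eps s u^-1 X X' Y' B B') => //.
- by rewrite invr_gt0 u0 invf_le1.
- exact: nrm_ge0.
- rewrite mulrBr mulr1 rv; have := nrmD (1 - b v) (b v - b (FD t v)).
  rewrite addrA subrK -/B' -/B.
  have -> : nrm (b v - b (FD t v)) = s - r.
    rewrite FD_b -{1}[b v]mul1r -mulrBl nrmM -/r -[1]/((1 : R)%:C) -rmorphB nrmR ler0_norm.
      by rewrite opprB mulrBl mul1r sr uX mulrC.
    by rewrite subr_le0 -uX exprn_ege1.
  lra.
- have := nrmD (1 - b (FD t v)) (b (FD t v)); rewrite subrK nrm1 -/B' -/s; lra.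
have : (X * Y) * B' = (X' * Y') * B by rewrite XY XY'; ring.
rewrite -vX => H; apply: (mulIf (_ : Y' != 0)).
  by rewrite YE mulf_neq0 // gt_eqF.
by rewrite -[RHS]mulrAC -H; ring.
Qed.

Lemma FD_CC : CC M (FD t v).
Proof.
apply: CC_intro; first by rewrite /FD !mkE.
  exact: FD_eq.
exact: FD_N2.
Qed.
End FD.

Lemma cts_b (S : topologicalType) (s : S -> C3) : continuous s -> continuous (fun t => b (s t)).
Proof. by move=> cs; rewrite /by_; cts. Qed.

Lemma FD_cts : contY (CC M) FD.
Proof.
move=> S w s cw cs w01 Cs; have cb := cts_b cs.
have cr : continuous (fun t => rho (w t) (s t)).
  rewrite /rho; apply: ctsD; first by cts.
  apply: ctsM; first exact: cw.
  by apply: ctsV; [cts|move=> t; rewrite nrm_eq0; exact: b_neq0].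
have cu : continuous (fun t => rroot n (rho (w t) (s t))).
  by apply: cts_rroot => // t; apply: ltW; exact: rho_gt0.
have u0 t : 0 < rroot n (rho (w t) (s t)) by apply: rroot_gt0; exact: rho_gt0.
apply: cts_mk; last exact: ctsC.
  apply: ctsM; last first.
    apply: cts_ofR; apply: ctsV; last by move=> t; rewrite gt_eqF // rroot_gt0.
    by apply: cts_rroot => // t; exact: ltW.
  apply: (@ctsM_bounded _ _ _ _ 2); first by cts.
    move=> t; have h := nrm_quo (w01 t) (Cs t).
    have := nrm_crootX (quo (w t) (s t)) (isT : (0 < 2)%N).
    have := nrm_ge0 (croot 2 (quo (w t) (s t))).
    by nra.
  set S' := [set t | _].
  have cv : continuous (val : S' -> S) by exact: cts_val.
  apply: (@cts_croot _ _ 2 _ isT); last by move=> t; exact: slit_quo.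
  rewrite /quo; apply: ctsM.
    have cN : continuous (fun t => 1 - (rho (w t) (s t))%:C * b (s t)) by cts.
    exact: (cts_comp1 cv cN).
  apply: ctsV.
    have cN : continuous (fun t => 1 - b (s t)) by cts.
    exact: (cts_comp1 cv cN).
  move=> t; have /set_mem := valP t; rewrite /S' /= => x0.
  apply: contraNneq x0 => b1; have := CC_eq (Cs (val t)); rewrite b1 mulr0 => /eqP.
  rewrite mulf_eq0 expf_eq0 /= => /orP[//|/eqP y0].
  by have := b_neq0 (Cs (val t)); rewrite /by_ y0 expr0n mul0r eqxx.
by apply: ctsM; [apply: cts_ofR|cts].
Qed.

Local Notation X := (M : topologicalType).
Local Notation pre A := ((val : X -> C3) @^-1` A).

Lemma Rel_GD : Rel R (pre (CC M)) (pre GD).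
Proof.
apply: (@RelY_retract R C3 M (CC M) GD FD).
- by move=> v [].
- exact: FD_cts.
- by move=> t v t01; exact: FD_CC.
- move=> v Cv; have [_ z0] := Cv; rewrite /FD /rho subr0 mul0r addr0 !rroot1 // invr1 mul1r mulr1.
  rewrite -[RHS]mk_eta z0; congr mk; rewrite /quo /rho subr0 mul0r addr0 mul1r.
  have [b1|b1] := eqVneq (b v) 1; last first.
    by rewrite divff ?croot1 ?mul1r // subr_eq0 eq_sym.
  suff -> : cx v = 0 by rewrite mulr0.
  have := CC_eq Cv; rewrite b1 subrr mulr0 => /eqP.
  rewrite mulf_eq0 expf_eq0 /= => /orP[/eqP //|/eqP y0].
  by have := b_neq0 Cv; rewrite /by_ y0 expr0n mul0r eqxx.
- by move=> v [].
- move=> t v t01 [Cv b1]; split; first exact: FD_CC.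
  by rewrite nrm_FDb // b1 mulr1 subrK.
- move=> v Cv; split; first by apply: FD_CC; rewrite ?i01.
  by rewrite nrm_FDb ?i01 // subrr mul0r add0r.
Qed.
End DRetract.

Section Angles.
Variable R : realType.
Local Notation C := R[i].
Local Notation Re := complex.Re.
Local Notation Im := complex.Im.
Let pi0 := @pi_gt0 R.

Lemma cts_sin (S : topologicalType) (f : S -> R) : continuous f -> continuous (fun t => sin (f t)).
Proof. by move=> cf; apply: (cts_comp1 cf); exact: continuous_sin. Qed.

Lemma carg_lt (z : C) : - pi < carg z < pi.
Proof.
have := @atan_gtNpi2 R (Im z / (nrm z + Re z)).
have := @atan_ltpi2 R (Im z / (nrm z + Re z)).
have -> : carg z = atan (Im z / (nrm z + Re z)) * 2 by rewrite /carg mulr_natr.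
by move=> h1 h2; apply/andP; split; lra.
Qed.

Lemma cisN (a : R) : cis (- a) * cis a = 1.
Proof. by rewrite -cisD addNr cis0. Qed.

Lemma cis_pi : cis pi = -1 :> C.
Proof. by rewrite /cis cospi sinpi; apply: complexP; rewrite /= ?oppr0. Qed.

Lemma cis_inj (a c : R) : `|a - c| < 2 * pi -> cis a = cis c -> a = c.
Proof.
wlog ca : a c / c <= a.
  move=> H; have [h|/ltW h] := leP c a; first exact: H.
  by rewrite distrC => h1 h2; apply/esym/H.
rewrite ger0_norm ?subr_ge0 // => h E; apply/eqP; rewrite -subr_eq0; apply/eqP.
apply: cis_inj1; first by rewrite subr_ge0 ca.
by rewrite cisD E -cisD subrr cis0.
Qed.

Lemma slit_unit (z : C) : nrm z = 1 -> z != -1 -> slit z.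
Proof.
move=> z1 zN; have [h|h] := eqVneq (Im z) 0; last by left.
have := nrm2 z; rewrite z1 h expr0n addr0 expr1n => /esym/eqP.
rewrite sqrf_eq1 => /orP[] /eqP e; first by right; rewrite e.
by exfalso; move/eqP: zN; apply; apply: complexP; rewrite /= ?e ?h ?oppr0.
Qed.

Lemma carg_unit (z : C) : nrm z = 1 -> z != -1 -> z = cis (carg z).
Proof. by move=> z1 zN; rewrite {1}(cargP (slit_unit z1 zN)) z1 mul1r. Qed.

Lemma cis_neqN1 (a : R) : - pi < a < pi -> cis a != -1 :> C.
Proof.
move=> /andP[a1 a2]; apply/eqP => E; have := @cos_gt0_pihalf R (a / 2).
have h : - (pi / 2) < a / 2 < pi / 2 by apply/andP; split; lra.
move/(_ h) => c0; have := congr1 (@complex.Re _) E; rewrite /=.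
rewrite (_ : a = a / 2 + a / 2) ?cosD -?expr2; last lra.
by have := cos2Dsin2 (a / 2); have := exprn_gt0 2 c0; lra.
Qed.

Lemma carg_cis (a : R) : - pi < a < pi -> carg (cis a) = a.
Proof.
move=> a1; have E := carg_unit (nrm_cis a) (cis_neqN1 a1).
apply: cis_inj; last by rewrite -E.
have := carg_lt (cis a); case/andP: a1 => ? ? /andP[? ?].
by rewrite ltr_norml; apply/andP; split; lra.
Qed.

Lemma cis_neq1 (a : R) : 0 < a < 2 * pi -> cis a != 1 :> C.
Proof.
move=> /andP[a0 a1]; apply/eqP => /cis_inj1 H.
have a00 : a = 0 by apply: H; rewrite (ltW a0).
by move: a0; rewrite a00 ltxx.
Qed.

Lemma chord (a : R) : 1 - cis a = (0 +i* (- 2 * sin (a / 2))) * cis (a / 2).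
Proof.
have e : a / 2 + a / 2 = a by lra.
have := cosD (a / 2) (a / 2); have := sinD (a / 2) (a / 2); rewrite e => hs hc.
have := cos2Dsin2 (a / 2) => h.
apply: complexP; rewrite ?cReD ?cImD ?cReN ?cImN ?cReM ?cImM /= ?hs ?hc; last by ring.
by lra.
Qed.
End Angles.

(** * The graph over the circle |y^n / lam| = 1 *)

Section DAngle.
Variable R : realType.
Local Notation C := R[i].
Local Notation C3 := 'rV[C]_3.
Local Notation Re := complex.Re.
Local Notation Im := complex.Im.
Let pi0 := @pi_gt0 R.

Variables (n' : nat) (lam : C) (eps : R) (M : set C3).
Local Notation n := n'.+1.
Local Notation N := (n'.*2.+2).
Hypothesis n2 : (2 <= n)%N.
Hypothesis lam0 : lam != 0.
Hypothesis eps0 : 0 < eps.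
Hypothesis small1 : nrm lam <= (eps / 4) ^+ n.
Hypothesis small2 : 2 ^+ n * nrm lam ^+ n' * (4 * n%:R) <= (eps ^+ 2 / 2) ^+ n.
Hypothesis ME : forall v, M v <->
  cx v ^+ 2 * cy v + cy v ^+ n + cz v ^+ 2 = lam /\ N2 v < eps ^+ 2.

Local Notation b := (by_ n' lam).
Local Notation GD := (GD n' lam M).
Local Notation X := (M : topologicalType).
Local Notation pre A := ((val : X -> C3) @^-1` A).

Let nR : (n%:R : R) != 0. Proof. by rewrite pnatr_eq0. Qed.
Definition ee : R := 4^-1 - (2 * n%:R)^-1.

(* slide k de turns b by the angle de; the exponent ee is chosen so that x^2 y then
   turns by de / 2, as 1 - b = - 2 i sin (phi / 2) e^(i phi / 2) does for
   b = e^(i phi), and k accounts for the change of sin (phi / 2). *)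
Definition slide (k de : R) (v : C3) : C3 :=
  mk ((rroot 2 k)%:C * cis (de * ee) * cx v) (cis (de / n%:R) * cy v) 0.

Lemma cisn (a : R) : cis (a / n%:R) ^+ n = cis a.
Proof. by rewrite cisX mulrC divfK. Qed.

Lemma slide_b k de v : b (slide k de v) = cis de * b v.
Proof. by rewrite /by_ /slide !mkE exprMn cisn mulrA. Qed.

Lemma slide_eq k de v : 0 <= k ->
  cx (slide k de v) ^+ 2 * cy (slide k de v) = k%:C * cis (de / 2) * (cx v ^+ 2 * cy v).
Proof.
move=> k0; rewrite /slide !mkE [(_ * cx v) ^+ 2]exprMn [(_ * cis _) ^+ 2]exprMn -rmorphXn /= rrootX // cisX.
have -> : cis (de / 2) = cis (2 * (de * ee)) * cis (de / n%:R).
  by rewrite -cisD; congr cis; rewrite /ee; field.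
by ring.
Qed.

Lemma slide_slide k k' de de' v : 0 <= k -> 0 <= k' ->
  slide k de (slide k' de' v) = slide (k * k') (de + de') v.
Proof.
move=> k0 k0'; rewrite /slide !mkE rrootM // !mulrDl !cisD rmorphM /=; congr mk; ring.
Qed.

Lemma slide_id v : cz v = 0 -> slide 1 0 v = v.
Proof. by move=> z0; rewrite /slide rroot1 // !mul0r cis0 !mul1r -[RHS]mk_eta z0. Qed.

Lemma GD_eq v : GD v -> cx v ^+ 2 * cy v = lam * (1 - b v).
Proof. by move=> [Cv _]; exact: CC_eq lam0 ME _ Cv. Qed.

Lemma GD_z v : GD v -> cz v = 0. Proof. by move=> [[]]. Qed.

Lemma slide_GD k de v phi : GD v -> b v = cis phi -> 0 <= k ->
  k * sin (phi / 2) = sin ((phi + de) / 2) -> GD (slide k de v).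
Proof.
move=> Gv bE k0 kE; apply: (GD_intro lam0 eps0 small1 small2 ME).
- by rewrite /slide !mkE.
- rewrite slide_eq // slide_b (GD_eq Gv) bE -cisD !chord [de + phi]addrC -kE mulrDl cisD.
  have -> : 0 +i* (- 2 * (k * sin (phi / 2))) = k%:C * (0 +i* (- 2 * sin (phi / 2))) :> C.
    by apply: complexP; rewrite ?cReRM ?cImRM /=; ring.
  by ring.
- by rewrite slide_b nrmM nrm_cis mul1r; case: Gv.
Qed.

(** U retracts to the n points over b = 1, where x = 0 and y^n = lam; V to the 2n points over b =
    -1, where x^2 y = 2 lam and y^n = - lam; their intersection to the 4n points over b = i and b =
    -i. *)
Definition US : set C3 := [set v | GD v /\ b v != -1].
Definition VS : set C3 := [set v | GD v /\ b v != 1].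
Definition WS : set C3 := [set v | GD v /\ Im (b v) != 0].

Lemma VS_meet : US `&` VS = WS.
Proof.
apply/seteqP; split => v.
  move=> [[Gv bN] [_ b1]]; split => //; apply: contraNneq bN => i0.
  have := nrm2 (b v); rewrite Gv.2 i0 expr0n addr0 expr1n => /esym/eqP.
  rewrite sqrf_eq1 => /orP[] /eqP e; last by apply/eqP/complexP; rewrite /= ?e ?i0 ?oppr0.
  by move: b1; rewrite (_ : b v = 1) ?eqxx //; apply: complexP; rewrite /= ?e ?i0.
by move=> [Gv i0]; split; split => //; apply: contraNneq i0 => ->; rewrite /= ?oppr0.
Qed.

Lemma VS_cover : US `|` VS = GD.
Proof.
apply/seteqP; split => [v [[]|[]]//|v Gv].
have [b1|b1] := eqVneq (b v) 1; last by right.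
by left; split => //; rewrite b1 -subr_eq0 opprK (_ : 1 + 1 = 2%:R) ?pnatr_eq0.
Qed.

Section U.
(** The path is the one on which sin (phi / 2) shrinks by the factor 1 - t. Then k = 1 - t, whereas
    moving phi linearly would give a quotient 0 / 0 at b = 1. *)
Definition FU (t : R) (v : C3) : C3 :=
  slide (1 - t) (2 * asin ((1 - t) * sin (carg (b v) / 2)) - carg (b v)) v.

Lemma US_arg v : US v -> [/\ GD v, b v = cis (carg (b v)) & -1 < sin (carg (b v) / 2) < 1].
Proof.
move=> [Gv bN]; split => //; first by apply: carg_unit => //; case: Gv.
have /andP[a1 a2] := carg_lt (b v).
have c0 : 0 < cos (carg (b v) / 2) by apply: cos_gt0_pihalf; apply/andP; split; lra.
have := cos2Dsin2 (carg (b v) / 2); have := exprn_gt0 2 c0 => h1 h2.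
by apply/andP; split; nra.
Qed.

Lemma US_h t v : 0 <= t <= 1 -> US v -> -1 < (1 - t) * sin (carg (b v) / 2) < 1.
Proof.
move=> /andP[t0 t1] /US_arg[_ _ /andP[h1 h2]]; apply/andP; split; nra.
Qed.

Lemma FU_US t v : 0 <= t <= 1 -> US v -> US (FU t v).
Proof.
move=> t01 Uv; have [Gv bE _] := US_arg Uv; have /andP[h1 h2] := US_h t01 Uv.
set h := _ * _ in h1 h2 *; split.
  apply: (slide_GD Gv bE); first by rewrite subr_ge0; case/andP: t01.
  rewrite addrCA subrr addr0 mulrAC divff ?pnatr_eq0 // mul1r asinK //.
  by rewrite in_itv /= (ltW h1) (ltW h2).
have -> : b (FU t v) = cis (2 * asin h) by rewrite slide_b [X in _ * X]bE -cisD subrK.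
rewrite cis_neqN1 //.
have := @asin_ltpi2 R h; have := @asin_gtNpi2 R h.
rewrite (ltW h1) (ltW h2) h1 h2 /= => /(_ isT) k1 /(_ isT) k2.
by apply/andP; split; lra.
Qed.

Lemma sinK' (a : R) : - pi <= a <= pi -> asin (sin (a / 2)) = a / 2.
Proof. by move=> /andP[h1 h2]; apply: sinK; rewrite in_itv /=; apply/andP; split; lra. Qed.

Lemma FU_0 v : US v -> FU 0 v = v.
Proof.
move=> Uv; have [Gv _ _] := US_arg Uv; rewrite /FU subr0 mul1r.
have /andP[a1 a2] := carg_lt (b v).
rewrite sinK' ?(ltW a1) ?(ltW a2) // (_ : _ - _ = 0); last lra.
by rewrite slide_id // GD_z.
Qed.

Lemma FU_1 v : FU 1 v = mk 0 (cis (- carg (b v) / n%:R) * cy v) 0.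
Proof.
rewrite /FU subrr mul0r.
have -> : asin 0 = 0 :> R.
  by have := @sinK' 0; rewrite mul0r sin0; apply; rewrite oppr_le0 ltW.
by rewrite mulr0 add0r /slide /rroot eqxx !mul0r.
Qed.

Lemma FU_cts : contY US FU.
Proof.
move=> S u s cu cs u01 Us; have cb := cts_b (n' := n') (lam := lam) cs.
have ca : continuous (fun t => carg (b (s t))).
  apply: cts_carg => // t; have [[_ b1] bN] := Us t; first exact: slit_unit.
  by rewrite -nrm_gt0 b1 ltr01.
have cA : continuous (fun t => asin ((1 - u t) * sin (carg (b (s t)) / 2))).
  apply: (@cts_comp_at _ _ _ (fun t => (1 - u t) * sin (carg (b (s t)) / 2)) (@asin R)).
    by apply: ctsM; [cts|apply: cts_sin; cts].
  by move=> t; apply: continuous_asin; exact: US_h.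
rewrite /FU /slide; apply: cts_mk; last exact: ctsC.
  apply: ctsM; last by cts.
  apply: ctsM.
    apply: cts_ofR; apply: cts_rroot => //; first by cts.
    by move=> t; rewrite subr_ge0; case/andP: (u01 t).
  by apply: cts_cis; cts.
by apply: ctsM; [apply: cts_cis; cts|cts].
Qed.

Definition kU : C := n.-root lam.
Lemma kUX : kU ^+ n = lam. Proof. exact: rootCK. Qed.
Lemma kU0 : kU != 0. Proof. exact: (k_neq0 lam0 kUX). Qed.

Definition fU (v : C3) : C := cis (- carg (b v) / n%:R) * cy v / kU.
Definition lU (v : C3) : 'I_n := lab n' (fU v).

Lemma fUX v : US v -> fU v ^+ n = 1.
Proof.
move=> /US_arg[_ bE _]; rewrite /fU exprMn exprVn kUX exprMn cisn -mulrA -/(b v).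
by rewrite {2}bE cisN.
Qed.

Definition ctrU (i : 'I_n) : C3 := mk 0 (kU * om R n ^+ i) 0.

Lemma ctrU_b i : b (ctrU i) = 1.
Proof. by rewrite /by_ /ctrU !mkE exprMn kUX exprAC omX // expr1n mulr1 divff. Qed.

Lemma ctrU_US i : US (ctrU i).
Proof.
split; last by rewrite ctrU_b -subr_eq0 opprK (_ : 1 + 1 = 2%:R) ?pnatr_eq0.
apply: (GD_intro lam0 eps0 small1 small2 ME); rewrite ?ctrU_b ?nrm1 //.
  by rewrite /ctrU !mkE.
by rewrite /ctrU !mkE subrr mulr0 expr0n mul0r.
Qed.

Lemma lU_ctr i : lU (ctrU i) = i.
Proof.
rewrite /lU /fU ctrU_b (carg_real 1) oppr0 mul0r cis0 mul1r /ctrU !mkE mulrC mulKf ?lab_ord //.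
exact: kU0.
Qed.

Lemma clusters_U : clusters R (pre US) (fun v => lU (val v)).
Proof.
apply: (@clustersY R C3 M US FU _ FU_cts FU_US FU_0 _ lU ctrU).
- by move=> v [[[]]].
- move=> v Uv; rewrite FU_1 /ctrU /lU -(labP (fUX Uv)) /fU [kU * _]mulrC divfK //; exact: kU0.
- exact: ctrU_US.
- exact: lU_ctr.
move=> k s cs As; apply: lab_const; last by move=> t; exact: fUX.
have cb := cts_b (n' := n') (lam := lam) cs.
apply: ctsM; last exact: ctsC; apply: ctsM; last by cts.
apply: cts_cis; apply: ctsM; last exact: ctsC; apply: ctsN.
apply: cts_carg => // t; have [[_ b1] bN] := As t; first exact: slit_unit.
by rewrite -nrm_gt0 b1 ltr01.
Qed.
End U.

Definition aV (v : C3) : R := pi + carg (- b v).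

Lemma VS_arg v : VS v -> [/\ GD v, b v = cis (aV v) & 0 < aV v < 2 * pi].
Proof.
move=> [Gv bN]; split => //.
  rewrite /aV cisD cis_pi -carg_unit ?mulN1r ?opprK //; first by rewrite nrmN; case: Gv.
  by rewrite eqr_opp.
by have /andP[h1 h2] := carg_lt (- b v); rewrite /aV; apply/andP; split; lra.
Qed.

Lemma sin_half_gt0 (a : R) : 0 < a < 2 * pi -> 0 < sin (a / 2).
Proof. by move=> /andP[h1 h2]; apply: sin_gt0_pi; apply/andP; split; lra. Qed.

Lemma cts_aV (S : topologicalType) (s : S -> C3) : continuous s -> (forall t, VS (s t)) ->
  continuous (fun t => aV (s t)).
Proof.
move=> cs Vs; rewrite /aV; apply: ctsD; first exact: ctsC.
have cb := cts_b (n' := n') (lam := lam) cs.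
apply: cts_carg; first by cts.
  move=> t; have [[_ b1] bN] := Vs t; apply: slit_unit; first by rewrite nrmN.
  by rewrite eqr_opp.
by move=> t; have [[_ b1] bN] := Vs t; rewrite -nrm_gt0 nrmN b1 ltr01.
Qed.

Section Target.
Variable tau : C3 -> R.
Hypothesis tau_lt : forall v, 0 < tau v < 2 * pi.

(** Off b = 1 the angle lies in (0, 2 pi), where sin (phi / 2) > 0, so it can be moved linearly to
    any target in this interval. *)
Definition FT (t : R) (v : C3) : C3 :=
  slide (sin ((aV v + t * (tau v - aV v)) / 2) / sin (aV v / 2)) (t * (tau v - aV v)) v.

Lemma aT_lt t v : 0 <= t <= 1 -> VS v -> 0 < aV v + t * (tau v - aV v) < 2 * pi.
Proof.
move=> /andP[t0 t1] /VS_arg[_ _ /andP[a0 a1]]; have /andP[c0 c1] := tau_lt v.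
have [t00|tN0] := eqVneq t 0; first by rewrite t00 mul0r addr0 a0 a1.
have tp : 0 < t by rewrite lt0r tN0.
have h1 : 0 < t * tau v by rewrite mulr_gt0.
have h2 : 0 <= (1 - t) * aV v by rewrite mulr_ge0 ?subr_ge0 // ltW.
have h3 : 0 < t * (2 * pi - tau v) by rewrite mulr_gt0 ?subr_gt0.
have h4 : 0 <= (1 - t) * (2 * pi - aV v) by rewrite mulr_ge0 ?subr_ge0 // ltW.
by apply/andP; split; lra.
Qed.

Lemma FT_b t v : VS v -> b (FT t v) = cis (aV v + t * (tau v - aV v)).
Proof. by move=> /VS_arg[_ bE _]; rewrite /FT slide_b [X in _ * X]bE -cisD addrC. Qed.

Lemma FT_GD t v : 0 <= t <= 1 -> VS v -> GD (FT t v).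
Proof.
move=> t01 Vv; have [Gv bE a01] := VS_arg Vv; have s0 := sin_half_gt0 a01.
have s1 := sin_half_gt0 (aT_lt t01 Vv).
apply: (slide_GD Gv bE); first by rewrite divr_ge0 // ltW.
by rewrite divfK // gt_eqF.
Qed.

Lemma FT_VS t v : 0 <= t <= 1 -> VS v -> VS (FT t v).
Proof.
by move=> t01 Vv; split; [exact: FT_GD|rewrite FT_b // cis_neq1 // aT_lt].
Qed.

Lemma FT_0 v : VS v -> FT 0 v = v.
Proof.
move=> Vv; have [Gv _ a01] := VS_arg Vv; have s0 := sin_half_gt0 a01.
by rewrite /FT mul0r addr0 divff ?slide_id ?gt_eqF // GD_z.
Qed.

Lemma FT_1 v : FT 1 v = slide (sin (tau v / 2) / sin (aV v / 2)) (tau v - aV v) v.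
Proof. by rewrite /FT mul1r addrCA subrr addr0. Qed.

Lemma FT_cts (A : set C3) : A `<=` VS ->
  (forall (S : topologicalType) (s : S -> C3), continuous s -> (forall t, A (s t)) ->
     continuous (fun t => tau (s t))) -> contY A FT.
Proof.
move=> AV ctau S u s cu cs u01 As; have Vs t : VS (s t) by apply: AV.
have ca := cts_aV cs Vs; have ct := ctau S s cs As.
have s0 t : 0 < sin (aV (s t) / 2) by have [_ _ h] := VS_arg (Vs t); exact: sin_half_gt0.
rewrite /FT /slide; apply: cts_mk; last exact: ctsC.
  apply: ctsM; last by cts.
  apply: ctsM; last by apply: cts_cis; cts.
  apply: cts_ofR; apply: cts_rroot => //.
    apply: ctsM; first by apply: cts_sin; cts.
    by apply: ctsV; [apply: cts_sin; cts|move=> t; rewrite gt_eqF].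
  by move=> t; rewrite divr_ge0 ?(ltW (s0 t)) // ltW // sin_half_gt0 // aT_lt.
by apply: ctsM; [apply: cts_cis; cts|cts].
Qed.
End Target.

Let tpi (v : C3) : R := pi.
Let tpi_lt v : 0 < tpi v < 2 * pi. Proof. by have p0 := pi_gt0 R; rewrite /tpi; apply/andP; split; lra. Qed.
Local Notation om' := (om R N).

Lemma om'n : om' ^+ n = -1.
Proof.
rewrite /om cisX -cis_pi; congr cis; rewrite -doubleS -muln2 natrM.
by field.
Qed.

Lemma om'2 : om' ^+ 2 = om R n.
Proof. by rewrite /om cisX; congr cis; rewrite -doubleS -muln2 natrM; field. Qed.

(** Chosen so that (kk, kU om') solves x^2 y = 2 lam and y^n = - lam. The solutions are the
    [ctrV j], told apart by x = kk / om'^j. *)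
Definition kk : C := 2.-root (2 * lam / (kU * om')).
Lemma kk2 : kk ^+ 2 * (kU * om') = 2 * lam.
Proof. by rewrite rootCK // divfK // mulf_neq0 ?om_neq0 ?kU0. Qed.
Lemma kk0 : kk != 0.
Proof.
have := kk2; apply: contra_eqN => /eqP ->; rewrite expr0n mul0r eq_sym mulf_neq0 //.
Qed.

Definition EV (v : C3) : C3 := FT tpi 1 v.
Definition fV (v : C3) : C := kk / cx (EV v).
Definition lV (v : C3) : 'I_N := lab n'.*2.+1 (fV v).

Lemma EV_b v : VS v -> b (EV v) = -1.
Proof. by move=> Vv; rewrite /EV FT_b // mul1r addrCA subrr addr0 cis_pi. Qed.

Lemma EV_VS v : VS v -> VS (EV v).
Proof. by move=> Vv; exact: (FT_VS tpi_lt (i01 R) Vv). Qed.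

Lemma EV_eq v : VS v -> cx (EV v) ^+ 2 * cy (EV v) = 2 * lam /\ cy (EV v) ^+ n = - lam.
Proof.
move=> Vv; have [Gv bE _] := VS_arg (EV_VS Vv); split.
  by rewrite (GD_eq Gv) EV_b // opprK mulrC.
by have := EV_b Vv; rewrite /by_ => /(congr1 (fun z => z * lam)); rewrite divfK // mulN1r.
Qed.

Lemma EV_x0 v : VS v -> cx (EV v) != 0.
Proof.
move=> /EV_eq[+ _]; apply: contra_eqN => /eqP ->; rewrite expr0n mul0r eq_sym mulf_neq0 //.
Qed.

Lemma EV_y v : VS v -> cy (EV v) = kU * om' * fV v ^+ 2.
Proof.
move=> Vv; have x0 := EV_x0 Vv; have [E _] := EV_eq Vv.
apply: (mulfI (_ : cx (EV v) ^+ 2 != 0)); first by rewrite expf_neq0.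
rewrite E /fV exprMn exprVn -kk2; move: (cx (EV v)) x0 => x x0.
by field.
Qed.

Lemma fVX v : VS v -> fV v ^+ N = 1.
Proof.
move=> Vv; have [_ yn] := EV_eq Vv; rewrite -doubleS -mul2n exprM.
have := yn; rewrite EV_y // exprMn [(kU * _) ^+ _]exprMn kUX om'n mulrN1 => h.
by apply: (mulfI (_ : - lam != 0)); rewrite ?oppr_eq0 // h mulr1.
Qed.

Definition ctrV (j : 'I_N) : C3 := mk (kk / om' ^+ j) (kU * om' * om' ^+ j ^+ 2) 0.

Lemma EV_ctr v : VS v -> EV v = ctrV (lV v).
Proof.
move=> Vv; have x0 := EV_x0 Vv; rewrite /ctrV -(labP (fVX Vv)) -EV_y //.
rewrite /fV invf_div mulrC divfK; last exact: kk0.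
by rewrite -[LHS]mk_eta (GD_z (EV_VS Vv).1).
Qed.

Lemma ctrV_b j : b (ctrV j) = -1.
Proof.
rewrite /by_ /ctrV !mkE exprMn [(kU * _) ^+ _]exprMn kUX om'n [om' ^+ j ^+ 2]exprAC.
by rewrite om'2 exprAC omX // expr1n mulr1 mulrN1 mulNr divff.
Qed.

Lemma ctrV_VS j : VS (ctrV j).
Proof.
split; last by rewrite ctrV_b eq_sym -subr_eq0 opprK (_ : 1 + 1 = 2%:R) ?pnatr_eq0.
apply: (GD_intro lam0 eps0 small1 small2 ME); rewrite ?ctrV_b ?nrmN ?nrm1 //.
  by rewrite /ctrV !mkE.
rewrite opprK /ctrV !mkE exprMn exprVn (mulrC lam) -[1 + 1]/(2%:R) -kk2.
have := om_neq0 R N; move: om' => w w0.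
by field; rewrite expf_neq0.
Qed.

Lemma ctrV_aV j : aV (ctrV j) = pi.
Proof. by rewrite /aV ctrV_b opprK (carg_real 1) addr0. Qed.

Lemma EV_ctrV j : EV (ctrV j) = ctrV j.
Proof.
rewrite /EV FT_1 /tpi ctrV_aV subrr sin_pihalf divr1 slide_id //.
by rewrite /ctrV !mkE.
Qed.

Lemma lab_EV v j : EV v = ctrV j -> lV v = j.
Proof.
move=> E; rewrite /lV /fV E /ctrV !mkE invf_div mulrC divfK ?lab_ord //; exact: kk0.
Qed.

Lemma fV_cts (S : topologicalType) (s : S -> C3) : continuous s -> (forall t, VS (s t)) ->
  continuous (fun t => fV (s t)).
Proof.
move=> cs Vs; rewrite /fV; apply: ctsM; first exact: ctsC.
apply: ctsV; last by move=> t; exact: EV_x0.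
apply: cts_cx; apply: (@FT_cts tpi tpi_lt VS _ _ S (fun=> 1) s) => //.
- by move=> S' s' _ _; exact: ctsC.
- exact: ctsC.
- by move=> _; rewrite i01.
Qed.

Lemma clusters_V : clusters R (pre VS) (fun v => lV (val v)).
Proof.
apply: (@clustersY R C3 M VS (FT tpi) _ _ (FT_VS tpi_lt) (@FT_0 tpi) _ lV ctrV).
- by move=> v [[[]]].
- by apply: (FT_cts tpi_lt) => // S' s' _ _; exact: ctsC.
- exact: EV_ctr.
- exact: ctrV_VS.
- by move=> j; apply: lab_EV; exact: EV_ctrV.
move=> k s cs As; apply: lab_const; last by move=> t; exact: fVX.
exact: fV_cts.
Qed.

(** The angle pi / 2 or 3 pi / 2 according to the sign of Im b, as a formula that is continuous
    where Im b is not 0. *)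
Definition tW (v : C3) : R := pi - pi / 2 * (Im (b v) / Num.norm (Im (b v))).

Definition tS (s : bool) : R := if s then pi / 2 else pi / 2 * 3.

Lemma WS_VS : WS `<=` VS. Proof. by rewrite -VS_meet => v []. Qed.
Lemma WS_US : WS `<=` US. Proof. by rewrite -VS_meet => v []. Qed.

Lemma tW_tS v : WS v -> tW v = tS (0 < Im (b v)).
Proof.
move=> [_ i0]; rewrite /tW; case: (ltgtP (Im (b v)) 0) i0 => // h _ /=.
  by rewrite ltr0_norm // invrN mulrN divff ?lt_eqF //; lra.
by rewrite gtr0_norm // divff ?gt_eqF //; lra.
Qed.

Lemma tS_lt s : 0 < tS s < 2 * pi.
Proof. by have p0 := pi_gt0 R; case: s; rewrite /tS; apply/andP; split; lra. Qed.

Lemma aV_half v : WS v -> if 0 < Im (b v) then 0 < aV v < pi else pi < aV v < 2 * pi.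
Proof.
move=> Wv; have [_ bE /andP[a0 a1]] := VS_arg (WS_VS Wv); have [_ i0] := Wv.
have iE : Im (b v) = sin (aV v) by rewrite bE.
rewrite {}iE in i0 *; case: (ltP 0 (sin (aV v))) => h; apply/andP; split => //.
  rewrite ltNge; apply/negP => h'.
  have : 0 <= sin (aV v - pi) by apply: sin_ge0_pi; apply/andP; split; lra.
  have := sinDpi (aV v - pi); rewrite subrK => e; lra.
rewrite ltNge; apply/negP => h'.
have : 0 <= sin (aV v) by apply: sin_ge0_pi; rewrite (ltW a0).
by move=> h2; move/eqP: i0; apply; apply/eqP; rewrite eq_le h h2.
Qed.

Lemma cis_aV_inj (a : R) v : WS v -> b v = cis a ->
  (if 0 < Im (b v) then 0 < a < pi else pi < a < 2 * pi) -> a = aV v.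
Proof.
move=> Wv bE; have := aV_half Wv; have [_ bE' _] := VS_arg (WS_VS Wv).
have p0 := pi_gt0 R; case: ifP => _ /andP[h1 h2] /andP[h3 h4]; apply: cis_inj; rewrite -?bE -?bE' //.
  by rewrite ltr_norml; apply/andP; split; lra.
by rewrite ltr_norml; apply/andP; split; lra.
Qed.

Lemma aV_cis v (a : R) : b v = cis a -> 0 < a < 2 * pi -> aV v = a.
Proof.
move=> bE /andP[a0 a1]; rewrite /aV bE.
have -> : - cis a = cis (a - pi) :> C.
  by rewrite cisD -[cis (- pi)]mulr1 -[X in _ * (_ * X)](opprK 1) -cis_pi mulrN cisN mulrN1.
have p0 := pi_gt0 R.
by rewrite carg_cis; [rewrite addrC subrK|apply/andP; split; lra].
Qed.

Lemma sin_tS s : 0 < sin (tS s / 2).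
Proof. exact: sin_half_gt0 (tS_lt s). Qed.

Definition ctrW (e : bool * 'I_N) : C3 := slide (sin (tS e.1 / 2)) (tS e.1 - pi) (ctrV e.2).

Lemma Im_tS s : 0 < (if s then 1 else -1) * Im (cis (tS s) : C).
Proof.
case: s; rewrite /= /tS ?sin_pihalf ?mul1r //.
have -> : pi / 2 * 3 = pi / 2 + pi :> R by lra.
by rewrite sinDpi sin_pihalf mulrNN mulr1.
Qed.

Lemma ctrW_b e : b (ctrW e) = cis (tS e.1).
Proof. by rewrite /ctrW slide_b ctrV_b -cis_pi -cisD subrK. Qed.

Lemma ctrW_WS e : WS (ctrW e).
Proof.
split.
  apply: (@slide_GD _ _ _ pi (ctrV_VS _).1).
  - by rewrite ctrV_b cis_pi.
  - exact: ltW (sin_tS _).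
  - by rewrite sin_pihalf mulr1 addrCA subrr addr0.
rewrite ctrW_b; have := Im_tS e.1; case: e.1; first by rewrite mul1r => /gt_eqF ->.
by rewrite mulN1r oppr_gt0 => /lt_eqF ->.
Qed.

Lemma ctrW_sign e : (0 < Im (b (ctrW e))) = e.1.
Proof.
rewrite ctrW_b; have := Im_tS e.1; case: e.1; first by rewrite mul1r.
by rewrite mulN1r oppr_gt0 => h; rewrite ltNge (ltW h).
Qed.

Lemma ctrW_aV e : aV (ctrW e) = tS e.1.
Proof. by apply: aV_cis; [exact: ctrW_b|exact: tS_lt]. Qed.

Lemma lV_ctrW e : lV (ctrW e) = e.2.
Proof.
apply: lab_EV; rewrite /EV FT_1 /tpi ctrW_aV sin_pihalf /ctrW.
have s0 := sin_tS e.1.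
rewrite slide_slide ?divr_ge0 ?(ltW s0) //.
rewrite divfK ?gt_eqF // addrA subrK subrr slide_id //.
by rewrite /ctrV !mkE.
Qed.

Lemma tW_lt v : 0 < tW v < 2 * pi.
Proof.
have p0 := pi_gt0 R; rewrite /tW; set q := Im (b v) / _.
have : -1 <= q <= 1.
  rewrite -ler_norml /q normf_div normr_id.
  have [->|h] := eqVneq (Im (b v)) 0; first by rewrite normr0 mul0r ler01.
  by rewrite divff ?normr_eq0.
case/andP=> h1 h2; have h3 : 0 <= pi * (1 - q) by rewrite mulr_ge0 ?subr_ge0 // ltW.
have h4 : 0 <= pi * (1 + q) by rewrite mulr_ge0 ?(ltW p0) //; lra.
by apply/andP; split; lra.
Qed.

Lemma FW_WS t v : 0 <= t <= 1 -> WS v -> WS (FT tW t v).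
Proof.
move=> t01 Wv; have Vv := WS_VS Wv; split; first exact: FT_GD tW_lt _ _ t01 Vv.
rewrite FT_b //= (tW_tS Wv); have := aV_half Wv; have p0 := pi_gt0 R.
case/andP: t01 => t0 t1; case: ifP => _ /andP[a0 a1] /=.
  have h1 : 0 <= (1 - t) * aV v by rewrite mulr_ge0 ?subr_ge0 // ltW.
  have h2 : 0 <= (1 - t) * (pi - aV v) by rewrite mulr_ge0 ?subr_ge0 // ltW.
  have h3 : 0 <= t * pi by rewrite mulr_ge0 // ltW.
  have [t00|tN] := eqVneq t 0.
    by rewrite t00 mul0r addr0 gt_eqF // sin_gt0_pi // a0.
  have h4 : 0 < t * pi by rewrite mulr_gt0 // lt0r tN.
  by rewrite gt_eqF // sin_gt0_pi //; apply/andP; split; lra.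
rewrite -[_ + _](subrK pi) sinDpi oppr_eq0 gt_eqF // sin_gt0_pi //.
have h1 : 0 <= (1 - t) * (aV v - pi) by rewrite mulr_ge0 ?subr_ge0 // ltW.
have h2 : 0 <= (1 - t) * (2 * pi - aV v) by rewrite mulr_ge0 ?subr_ge0 // ltW.
have [t00|tN] := eqVneq t 0.
  by rewrite t00 mul0r addr0; apply/andP; split; lra.
have h4 : 0 < t * pi by rewrite mulr_gt0 // lt0r tN.
by apply/andP; split; lra.
Qed.

Definition lW (v : C3) : bool * 'I_N := (0 < Im (b v), lV v).

Lemma FW_1 v : WS v -> FT tW 1 v = ctrW (lW v).
Proof.
move=> Wv; have Vv := WS_VS Wv; rewrite FT_1 (tW_tS Wv) /ctrW /lW /=.
have [_ _ /sin_half_gt0 s0] := VS_arg Vv; have s1 := sin_tS (0 < Im (b v)).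
rewrite -(EV_ctr Vv) /EV FT_1 /tpi sin_pihalf slide_slide ?divr_ge0 ?(ltW s0) ?(ltW s1) //.
by rewrite mul1r addrA subrK.
Qed.

Lemma clusters_W : clusters R (pre WS) (fun v => lW (val v)).
Proof.
apply: (@clustersY R C3 M WS (FT tW) _ _ FW_WS _ _ lW ctrW).
- by move=> v [[[]]].
- apply: (FT_cts tW_lt WS_VS) => S s cs Ws; rewrite /tW.
  have cb := cts_b (n' := n') (lam := lam) cs.
  apply: ctsB; first exact: ctsC; apply: ctsM; first exact: ctsC.
  apply: ctsM; first by cts.
  by apply: ctsV; [cts|move=> t; rewrite normr_eq0; case: (Ws t)].
- by move=> v Wv; apply: FT_0; exact: WS_VS.
- exact: FW_1.
- exact: ctrW_WS.
- by move=> [s j]; rewrite /lW ctrW_sign lV_ctrW.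
move=> k s cs As t u; rewrite /lW /lV.
have Vs x : VS (s x) by exact: WS_VS.
rewrite (lab_const (fV_cts cs Vs) (fun x => fVX (Vs x)) t u).
have cb := cts_b (n' := n') (lam := lam) cs.
have ci : continuous (fun t => Im (b (s t))) by cts.
by rewrite (sign_const ci (fun x => (As x).2) t u).
Qed.

(** [lU] uses the argument of b in (-pi, pi), [lV] the one in (0, 2 pi). They differ by 2 pi if Im b
    < 0, which turns y by one more n-th root of unity: hence the shift by [~~ e.1]. *)
Definition iU (e : bool * 'I_N) : 'I_n := inord ((e.2 + ~~ e.1) %% n).

Lemma carg_aV v : WS v -> carg (b v) = aV v - (~~ (0 < Im (b v)))%:R * (2 * pi).
Proof.
move=> Wv; have p0 := pi_gt0 R; have [_ bE _] := US_arg (WS_US Wv).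
have /andP[c1 c2] := carg_lt (b v); have iE : Im (b v) = sin (carg (b v)) by rewrite {1}bE.
have [_ i0] := Wv.
case: ltP => h /=.
  rewrite mul0r subr0; apply: cis_aV_inj => //; rewrite h c2 andbT ltNge; apply/negP => c0.
  have : 0 <= sin (- carg (b v)) by apply: sin_ge0_pi; apply/andP; split; lra.
  rewrite sinN -iE; lra.
rewrite mul1r; apply/eqP; rewrite -subr_eq opprK; apply/eqP; apply: cis_aV_inj => //.
  by rewrite cisD cis2pi mulr1.
rewrite ltNge h /=; have h' : Im (b v) < 0 by rewrite lt_neqAle i0.
apply/andP; split; first lra.
rewrite -subr_lt0 addrK ltNge; apply/negP => c0.
have : 0 <= sin (carg (b v)) by apply: sin_ge0_pi; rewrite c0 ltW.
rewrite -iE; lra.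
Qed.

Lemma lU_iU v : WS v -> lU v = iU (lW v).
Proof.
move=> Wv; have Vv := WS_VS Wv; apply: (@om_inj R n'); rewrite /lU -(labP (fUX (WS_US Wv))).
rewrite /iU inordK ?ltn_pmod // prim_expr_mod ?om_prim // /lW /=.
rewrite exprD -om'2 -exprM mulnC exprM -(labP (fVX Vv)).
have E : kU * om' * fV v ^+ 2 = cis ((pi - aV v) / n%:R) * cy v.
  by rewrite -EV_y // /EV FT_1 /slide !mkE.
have c1 : cis (- carg (b v) / n%:R) * om' =
    cis ((pi - aV v) / n%:R) * om' ^+ 2 ^+ (~~ (0 < Im (b v))).
  rewrite carg_aV // /om -exprM cisX -!cisD; congr cis.
  rewrite -doubleS -[n.*2]muln2 !natrM; by field.
have w0 := om_neq0 R N; have k0 := kU0.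
have {}E : fV v ^+ 2 = cis ((pi - aV v) / n%:R) * cy v / (kU * om').
  by rewrite -E [_ * fV v ^+ 2]mulrC mulfK // mulf_neq0.
rewrite E /fU.
have -> : cis ((pi - aV v) / n%:R) * cy v / (kU * om') * om' ^+ 2 ^+ (~~ (0 < Im (b v))) =
  cis ((pi - aV v) / n%:R) * om' ^+ 2 ^+ (~~ (0 < Im (b v))) * (cy v / (kU * om')) by ring.
rewrite -c1; move: om' kU w0 k0 => w k w0 k0.
by field; rewrite w0 k0.
Qed.

Definition rotD : C3 -> C3 := rot (om' ^+ n') (om' ^+ 2).

Lemma gw x y : (om' ^+ n' * x) ^+ 2 * (om' ^+ 2 * y) + (om' ^+ 2 * y) ^+ n = x ^+ 2 * y + y ^+ n.
Proof.
rewrite [(om' ^+ n' * x) ^+ 2]exprMn [(om' ^+ 2 * y) ^+ n]exprMn [om' ^+ 2 ^+ n]exprAC om'n sqrrN expr1n mul1r; congr (_ + _).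
rewrite mulrACA -exprM -exprD (_ : (n' * 2 + 2 = N)%N); last by rewrite muln2 addn2.
by rewrite omX // mul1r.
Qed.

Lemma rotD_b v : b (rotD v) = b v.
Proof. by rewrite /by_ /rotD /rot !mkE exprMn exprAC om'n sqrrN expr1n mul1r. Qed.

Lemma rotD_GD v : GD v -> GD (rotD v).
Proof.
move=> [[Mv z0] b1]; split; last by rewrite rotD_b.
split; last by rewrite /rotD /rot !mkE z0 oppr0.
apply: (@rot_M R (fun x y => x ^+ 2 * y + y ^+ n) lam eps M ME) => //.
- by rewrite nrmX nrm_cis expr1n.
- by rewrite nrmX nrm_cis expr1n.
- exact: gw.
Qed.

Lemma rotD_US v : US v -> US (rotD v).
Proof. by move=> [Gv h]; split; [exact: rotD_GD|rewrite rotD_b]. Qed.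
Lemma rotD_VS v : VS v -> VS (rotD v).
Proof. by move=> [Gv h]; split; [exact: rotD_GD|rewrite rotD_b]. Qed.

(** x is multiplied by om'^(n-1) and enters [fV] inversely; om'^(-(n-1)) = om'^(n+1) because om' has
    order 2n. *)
Lemma rotD_lV v : VS v -> lV (rotD v) = inord ((n'.+2 + lV v) %% N).
Proof.
move=> Vv; rewrite -labM; last exact: fVX.
congr lab; rewrite /fV /EV !FT_1 /tpi /aV rotD_b /slide !mkE.
set c := _%:C * _; rewrite [in LHS]mulrCA invfM mulrCA; congr (_ * _).
apply: (mulfI (_ : om' ^+ n' != 0)); first by rewrite expf_neq0 ?om_neq0.
rewrite divff ?expf_neq0 ?om_neq0 // -exprD (_ : (n' + n'.+2 = N)%N) ?omX //.
by rewrite !addnS addnn.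
Qed.

Lemma GU_relopen : relopen (pre US) (pre GD).
Proof.
have cv := @cts_val _ M; have cb := cts_b (n' := n') (lam := lam) cv.
apply: (@relopen_gt0 R X _ _ (fun v => nrm (b (val v) + 1))).
- by cts.
- by move=> v [_ h]; rewrite nrm_gt0 addr_eq0.
- by move=> v Gv; rewrite nrm_gt0 addr_eq0.
Qed.

Lemma GV_relopen : relopen (pre VS) (pre GD).
Proof.
have cv := @cts_val _ M; have cb := cts_b (n' := n') (lam := lam) cv.
apply: (@relopen_gt0 R X _ _ (fun v => nrm (b (val v) - 1))).
- by cts.
- by move=> v [_ h]; rewrite nrm_gt0 subr_eq0.
- by move=> v Gv; rewrite nrm_gt0 subr_eq0.
Qed.

Hypothesis lam_small : nrm lam * N%:R < eps ^+ 2.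

Definition piD (e : bool * 'I_N) : bool * 'I_N := (e.1, inord ((n'.+2 + e.2) %% N)).

Theorem dihedral_homology (h : X -> X) (ch : continuous h) (F : R -> X -> X) :
  cont_on setT F -> (forall v, val (F 0 v) = rotD (val v)) -> F 1 = h ->
  exists Theta : homology R 2 (set0 : set X) -> {ffun bool * 'I_N -> int},
    [/\ forall a a', Theta (a - a') = Theta a - Theta a',
        forall a, Theta a = 0 -> a = 0,
        forall th, balanced iU snd th <-> exists a, Theta a = th &
        forall a e, Theta (hmap set0 (mkcts ch) a) (piD e) = - Theta a e].
Proof.
move=> cF F0 F1.
have n'0 : (0 < n')%N by [].
apply: (@suspension_homology R (fun x y => x ^+ 2 * y + y ^+ n) n' 2 N lam eps M n'0 isT isT
  _ _ lam0 lam_small ME (om' ^+ n') (om' ^+ 2) _ _ gw US VS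
  (bool * 'I_N)%type 'I_n 'I_N lW lU lV iU snd _ _ _ _ _ _ _ _ _ _
  h ch F piD cF F0 F1).
- move=> s x y; rewrite [(s ^+ n' * x) ^+ 2]exprMn [(s ^+ 2 * y) ^+ n]exprMn -!exprM mulrDr; congr (_ + _).
    by rewrite mulrACA -exprD muln2 addn2.
  by rewrite mul2n.
- by move=> S x y cx cy; cts.
- by rewrite nrmX nrm_cis expr1n.
- by rewrite nrmX nrm_cis expr1n.
- by move=> v [[]].
- by move=> v [[]].
- by rewrite VS_cover; exact: (Rel_GD n2 lam0 eps0 small1 small2 ME).
- by rewrite -[_ `|` _]/(pre (US `|` VS)) VS_cover; exact: GU_relopen.
- by rewrite -[_ `|` _]/(pre (US `|` VS)) VS_cover; exact: GV_relopen.
- exact: clusters_U.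
- exact: clusters_V.
- by rewrite VS_meet; exact: clusters_W.
- by move=> v Uv Vv; apply: lU_iU; rewrite -VS_meet.
- by [].
- exact: rotD_US.
- exact: rotD_VS.
- move=> [s i] [s' i'] [-> /(congr1 val)]; rewrite /= !inordK ?ltn_pmod // => /eqP.
  by rewrite eqn_modDl !modn_small // => /eqP/val_inj ->.
- by move=> v _ Vv; rewrite /lW /piD rotD_b /= rotD_lV.
Qed.
End DAngle.

(** * Monodromy on balanced functions: type D *)

Section PhiDihedral.
Variables (H : zmodType) (T : H -> H) (n' : nat).
Local Notation n := n'.+1.
Local Notation N := (n'.*2.+2).
Variable Theta : H -> {ffun bool * 'I_N -> int}.
Hypothesis n'0 : (0 < n')%N.
Hypothesis ThetaB : forall a b, Theta (a - b) = Theta a - Theta b.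
Hypothesis Theta0 : forall a, Theta a = 0 -> a = 0.
Hypothesis ThetaE : forall th, balanced (@iU n') snd th <-> exists a, Theta a = th.
Hypothesis ThetaT : forall a e, Theta (T a) (piD e) = - Theta a e.

Let ve (th : {ffun bool * 'I_N -> int}) (j : nat) : int := th (true, inord j).

Lemma sum_modn (k c : nat) (G : nat -> int) : (k < n)%N ->
  \sum_(j < N | (j + c) %% n == k %[mod n]) G j =
  G ((k + (n - c %% n)) %% n)%N + G ((k + (n - c %% n)) %% n + n)%N.
Proof.
move=> kn; set m := ((k + _) %% n)%N.
have mn : (m < n)%N by rewrite ltn_pmod.
have m1 : (m < N)%N by lia.
have m2 : (m + n < N)%N by lia.
have mE : (m + c = k %[mod n])%N.
  rewrite /m modnDml -addnA -modnDmr.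
  have -> : (((n - c %% n) + c) %% n = 0)%N.
    have cn : (c %% n < n)%N by rewrite ltn_pmod.
    by rewrite -modnDmr subnK ?modnn // ltnW.
  by rewrite addn0.
rewrite (bigD1 (Ordinal m1)) ?modn_mod /= ?mE //.
rewrite (bigD1 (Ordinal m2)) /=; last first.
  by rewrite modn_mod addnAC modnDr mE eqxx /= -val_eqE /= -[X in _ != X]addn0 eqn_add2l.
rewrite addrA big_pred0 ?addr0 // => j; apply/negP => /andP[/andP[/eqP jE j1] j2].
move: jE; rewrite modn_mod -mE => /eqP; rewrite eqn_modDr (modn_small mn) => /eqP jE.
have jn := divn_eq j n; have jN := ltn_ord j.
have : (j %/ n < 2)%N by rewrite ltn_divLR //; lia.
move: j1 j2; rewrite -!val_eqE /= {1 2}jn jE.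
case: (j %/ n)%N => [|[|//]]; rewrite ?mul0n ?mul1n ?add0n ?eqxx //.
by rewrite addnC eqxx.
Qed.

(** Every component of V meets two edges, whence the first condition. Given it, those of U say that
    v_j + v_(j+n) does not change from j - 1 to j; [(i + n') %% n] is i - 1 modulo n. *)
Lemma balanced_dihedral th : balanced (@iU n') snd th <->
  (forall j, (j < N)%N -> th (false, inord j) = - ve th j) /\
  (forall j, (j < n)%N -> ve th j + ve th (j + n) = ve th 0 + ve th n).
Proof.
have S (j : 'I_N) : \sum_(e | e.2 == j) th e = th (true, j) + th (false, j).
  by rewrite sum_snd big_bool.
have U (i : 'I_n) : (forall j, (j < N)%N -> th (false, inord j) = - ve th j) ->
    \sum_(e | iU e == i) th e = (ve th i + ve th (i + n)) -
      (ve th ((i + n') %% n)%N + ve th ((i + n') %% n + n)%N).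
  move=> h; rewrite (eq_bigl (fun e => true && (iU (e.1, e.2) == i))); last by case.
  rewrite (eq_bigr (fun e => th (e.1, e.2))); last by case.
  rewrite -(pair_big_dep xpredT (fun s j => iU (s, j) == i) (fun s j => th (s, j))) /= big_bool.
  have iUE s (j : 'I_N) : (iU (s, j) == i) = ((j + ~~ s) %% n == i %[mod n]).
    by rewrite modn_mod (modn_small (ltn_ord i)) /iU -val_eqE /= inordK ?ltn_pmod.
  congr (_ + _).
    rewrite (eq_bigl _ _ (iUE true)) (eq_bigr (fun j : 'I_N => ve th j)); last first.
      by move=> j _; rewrite /ve inord_val.
    by rewrite (sum_modn 0 (ve th) (ltn_ord i)) /= mod0n subn0 modnDr modn_small.
  rewrite (eq_bigl _ _ (iUE false)) (eq_bigr (fun j : 'I_N => - ve th j)); last first.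
    by move=> j _; rewrite -h // inord_val.
  rewrite sumrN (sum_modn 1 (ve th) (ltn_ord i)) /=.
  by rewrite (@modn_small 1 n) ?ltnS // subSS subn0.
split=> [[bU bV]|[h1 h2]].
  have h1 j : (j < N)%N -> th (false, inord j) = - ve th j.
    by move=> jN; have := bV (inord j); rewrite S => /eqP; rewrite addrC addr_eq0 => /eqP.
  split=> // j; elim: j => [|j IH] jn; first by rewrite add0n.
  rewrite -IH ?(ltnW jn) //; have := bU (Ordinal jn); rewrite U //= => /eqP.
  rewrite subr_eq0 => /eqP ->; have -> : ((j.+1 + n') %% n = j)%N.
    by rewrite addSnnS modnDr modn_small // ltnW.
  by [].
split=> [i|j]; last by rewrite S -(inord_val j) h1 // subrr.
by rewrite U // !h2 ?ltn_pmod // subrr.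
Qed.

(** With v for the values on the edges (true, j) and w for the common sum v_j + v_(j+n), the
    monodromy gives v_(j+1)' = v_j - w for j < n - 1, v_0' = - v_(n-1) and w' = - w. So its matrix
    is block triangular, with the companion matrix of X^n + 1 and the entry -1. *)
Definition kapD (th : {ffun bool * 'I_N -> int}) : 'cV[int]_(n + 1) :=
  col_mx (\col_i ve th (rev_ord i)) (\col_i (ve th 0 + ve th n)).

Definition matD : 'M[int]_(n + 1) :=
  block_mx (comp_mx n (fun j => (j == 0)%:R)) (\col_i - (i < n')%N%:R) 0 (- 1)%:M.

Lemma char_matD : char_poly matD = ('X^n + 1) * ('X + 1).
Proof.
rewrite /matD /char_poly /char_poly_mx map_block_mx scalar_mx_block opp_block_mx add_block_mx.
rewrite map_mx0 oppr0 addr0 det_ublock; congr (_ * _).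
  rewrite -[LHS]/(char_poly _) char_comp_mx //; congr (_ + _).
  by apply/polyP => i; rewrite coef_poly coef1; case: i => [|i] //=; case: ifP.
by rewrite map_scalar_mx det_mx11 !mxE eqxx !mulr1n rmorphN1 opprK.
Qed.

Lemma charpoly_dihedral : charpoly setT T = ('X^n + 1) * ('X + 1).
Proof.
rewrite -char_matD.
apply: (@charpoly_Theta _ _ _ _ _ _ kapD _ ThetaB Theta0 ThetaE).
- move=> x y; rewrite /kapD opp_col_mx add_col_mx.
  congr col_mx; apply/colP => i; rewrite !mxE /ve !ffunE // opprD addrACA //.
- move=> th /balanced_dihedral[h1 h2]; rewrite -[X in _ = X]col_mx0 => /eq_col_mx[k0 k1].
  have wE : ve th 0 + ve th n = 0 by have := congr1 (fun M : 'cV_1 => M 0 0) k1; rewrite !mxE.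
  have vn j : (j < n)%N -> ve th j = 0.
    move=> jn; have := congr1 (fun M : 'cV_n => M (rev_ord (Ordinal jn)) 0) k0.
    by rewrite !mxE rev_ordK.
  have v0 j : (j < N)%N -> ve th j = 0.
    move=> jN; have [|jn] := ltnP j n; first exact: vn.
    have jn' : (j - n < n)%N by lia.
    by have := h2 _ jn'; rewrite subnK // wE vn // add0r.
  apply/ffunP => -[s j]; rewrite ffunE -(inord_val j).
  by case: s; [exact: v0|rewrite h1 // v0 // oppr0].
- move=> x; pose u := usubmx x; pose wd := dsubmx x 0 0.
  pose v (j : nat) : int := if (j < n)%N then u (inord (n' - j)) 0
                            else wd - u (inord (n' - (j - n))) 0.
  pose th : {ffun bool * 'I_N -> int} := [ffun e : bool * 'I_N => if e.1 then v e.2 else - v e.2].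
  have vE j : (j < N)%N -> ve th j = v j by move=> jN; rewrite /ve ffunE /= inordK.
  have vw j : (j < n)%N -> ve th j + ve th (j + n) = wd.
    move=> jn; rewrite !vE; [|lia|lia].
    have h : (j + n < n)%N = false by lia.
    by rewrite /v jn h addnK addrC subrK.
  have vw0 : ve th 0 + ve th n = wd by have := vw 0%N isT; rewrite add0n.
  exists th.
    apply/balanced_dihedral; split=> j jn; first by rewrite vE // ffunE /= inordK.
    by rewrite vw // vw0.
  rewrite /kapD -[RHS]vsubmxK; congr col_mx; apply/colP => i; rewrite mxE; last first.
    by rewrite vw0 // (ord1 i).
  rewrite vE; last by have := ltn_ord (rev_ord i); lia.
  rewrite /v ltn_ord; congr (u _ 0); apply: val_inj; rewrite /= inordK; have := ltn_ord i; lia.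
move=> a; have /balanced_dihedral[h1 h2] : balanced (@iU n') snd (Theta a) by apply/ThetaE; exists a.
have step j : (j < N)%N -> ve (Theta (T a)) ((n'.+2 + j) %% N)%N = - ve (Theta a) j.
  by move=> jN; rewrite /ve -ThetaT /piD /= (inordK jN).
have w' : ve (Theta (T a)) 0 = - ve (Theta a) n'.
  rewrite -step; last lia.
  by congr ve; rewrite (_ : (n'.+2 + n' = N)%N) ?modnn //; lia.
have wn' : ve (Theta (T a)) n = - ve (Theta a) (n' + n).
  rewrite -step; last lia.
  by congr ve; rewrite (_ : (n'.+2 + (n' + n) = n + N)%N) ?modnDr ?modn_small //; lia.
have wj j : (j < n')%N -> ve (Theta (T a)) j.+1 = ve (Theta a) j - (ve (Theta a) 0 + ve (Theta a) n).
  move=> jn; rewrite -(h2 j); last lia.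
  rewrite opprD addrA subrr add0r -step; last lia.
  by congr ve; rewrite (_ : (n'.+2 + (j + n) = j.+1 + N)%N) ?modnDr ?modn_small //; lia.
rewrite /kapD /matD mul_block_col mul0mx add0r; congr col_mx; last first.
  apply/colP => i; rewrite mul_scalar_mx !mxE w' wn' -opprD h2 ?ltnS // mulN1r //.
set w := ve (Theta a) 0 + ve (Theta a) n in wj *.
have -> : (\col_(i < n) - (i < n')%N%:R) *m (\col_(i < 1) w) = \col_i (- ((i < n')%N%:R * w)) :> 'cV[int]_n.
  by apply/colP => i; rewrite mxE big_ord1 !mxE mulNr.
apply/eqP; rewrite -subr_eq; apply/eqP; apply: comp_mxP => [i j ij|i iE].
  have jn := ltn_ord j; have in' : (i < n')%N by lia.
  rewrite !mxE in' mul1r opprK /= !subSS.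
  have -> : (n' - i = (n' - j).+1)%N by lia.
  by rewrite wj ?subrK //; lia.
rewrite (bigD1 ord0) //= big1 => [|j jN]; last first.
  by rewrite (_ : (j == 0 :> nat) = false) ?mul0r //; apply/negbTE.
by rewrite !mxE /= iE ltnn mul0r oppr0 subr0 !subSS subnn subn0 w' mul1r addr0.
Qed.
End PhiDihedral.

(** * The monodromy is homotopic to a rotation *)

Section Monodromy.
Variable R : realType.
Local Notation C := R[i].
Local Notation C3 := 'rV[C]_3.
Local Notation poly3 := (mpoly.mpoly 3 R[i]).

Lemma ball_N2 (p : C3) (e : R) : (\sum_i `|p 0 i| ^+ 2 < (e ^+ 2)%:C) = (N2 p < e ^+ 2).
Proof.
rewrite !big_ord_recl big_ord0 addr0 !normE -!rmorphXn -!rmorphD /= ltcR /N2 addrA.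
by congr (nrm _ ^+ 2 + nrm _ ^+ 2 + nrm _ ^+ 2 < _); congr (p _ _); apply: val_inj.
Qed.

Variables (g : C -> C -> C) (q1 q2 d : nat) (f : poly3) (eps : R) (lam : C).
Hypothesis d_gt0 : (0 < d)%N.
Hypothesis g_hom : forall s x y, g (s ^+ q1 * x) (s ^+ q2 * y) = s ^+ d * g x y.
Hypothesis fE : forall p, peval f p = g (cx p) (cy p) + cz p ^+ 2.

Lemma milnorE mu v : milnor_fibre f eps mu v <->
  g (cx v) (cy v) + cz v ^+ 2 = mu /\ N2 v < eps ^+ 2.
Proof. by rewrite -fE -ball_N2. Qed.

Definition turn (q : nat) (t : R) : C := cis (2 * pi * t * q%:R / d%:R).

(** z has weight d / 2, whence its half turn. *)
Definition rotS (t : R) (v : C3) : C3 :=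
  mk (turn q1 t * cx v) (turn q2 t * cy v) (cis (pi * t) * cz v).

Lemma turnX q t : turn q t = cis (2 * pi * t / d%:R) ^+ q.
Proof. by rewrite /turn cisX; congr cis; ring. Qed.

Lemma rotS_milnor t mu v : milnor_fibre f eps mu v ->
  milnor_fibre f eps (cis (2 * pi * t) * mu) (rotS t v).
Proof.
move=> /milnorE[gv nv]; apply/milnorE; rewrite /rotS /N2 !mkE; split.
  have e1 : cis (pi * t) ^+ 2 = cis (2 * pi * t) :> C by rewrite cisX; congr cis; ring.
  have e2 : cis (2 * pi * t / d%:R) ^+ d = cis (2 * pi * t) :> C.
    by rewrite cisX; congr cis; rewrite mulrC divfK // pnatr_eq0 -lt0n.
  by rewrite !turnX g_hom e2 exprMn e1 -gv; ring.
by rewrite !nrmM !nrm_cis !mul1r.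
Qed.

Lemma cts_snd (S T U : topologicalType) (s : S -> (T * U)%type) :
  continuous s -> continuous (fun t => (s t).2).
Proof. by move=> cs t; apply: continuous_comp (cs t) _; exact: cvg_snd. Qed.

Local Notation M := (milnor_fibre f eps lam).
Local Notation X := (M : topologicalType).

Lemma I01P : (0 : R) \in @unit_interval R.
Proof. by apply/mem_set; rewrite /unit_interval /= in_itv /= lexx ler01. Qed.
Definition I0 : @unit_interval R := SigSub I01P.

(** At time t the trivialization has carried p to the fibre over lam e^(2 i pi t), and the weighted
    rotation for the remaining time 1 - t brings it back to the fibre over lam. At t = 0 this is the
    full rotation, at t = 1 it is h. *)
Lemma monodromy_homotopy (h : continuousType X X) : geometric_monodromy h ->
  exists F : R -> X -> X, [/\ cont_on setT F,
    forall v, val (F 0 v) = rot (turn q1 1) (turn q2 1) (val v) &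
    F 1 = h].
Proof.
move=> [Phi [Psi [[cPhi _ _ _] [P1 P0 Ph]]]].
pose u0 (t : R) : @unit_interval R := insubd I0 t.
have u0E t : 0 <= t <= 1 -> val (u0 t) = t.
  by move=> t01; rewrite /u0 insubdK //; apply/mem_set; rewrite /unit_interval /= in_itv.
pose G t p := rotS (1 - t) (val (Phi (u0 t, p))).2.
have GM t (p : X) : 0 <= t <= 1 -> M (G t p).
  move=> t01; have [_ m] := set_mem (valP (Phi (u0 t, p))); rewrite P1 u0E // in m.
  have := rotS_milnor (1 - t) m; rewrite /loop (_ : _ * _ = lam) //.
  rewrite [_ * (lam * _)]mulrCA -[_ +i* _]/(cis (2 * pi * t)) -cisD.
  by rewrite (_ : _ + _ = 2 * pi) ?cis2pi ?mulr1 //; ring.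
pose F t p : X := insubd p (G t p).
have FE t p : 0 <= t <= 1 -> val (F t p) = G t p.
  by move=> t01; rewrite /F insubdK //; apply/mem_set/GM.
exists F; split.
- move=> S u s cu cs u01 _; apply: cts_into.
  have -> : val \o (fun t => F (u t) (s t)) = fun t => G (u t) (s t).
    by apply/funext => t; rewrite /= FE.
  have cv : continuous (fun t => u0 (u t)).
    apply: cts_into; rewrite (_ : _ \o _ = u) //.
    by apply/funext => t; rewrite /= u0E.
  have cP : continuous (fun t => Phi (u0 (u t), s t)).
    exact: cts_comp1 (cts_pair cv cs) cPhi.
  have c2 : continuous (fun t => (val (Phi (u0 (u t), s t))).2).
    by apply: cts_snd; exact: cts_comp1 cP (@cts_val _ _).
  have ct q : continuous (fun t => turn q (1 - u t)).
    by apply: cts_cis; cts.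
  have cp : continuous (fun t => cis (pi * (1 - u t))) by apply: cts_cis; cts.
  apply: cts_mk.
  + by apply: ctsM; [exact: ct|exact: cts_cx].
  + by apply: ctsM; [exact: ct|exact: cts_cy].
  + by apply: ctsM; [exact: cp|exact: cts_cz].
- move=> v; rewrite FE ?i00 // /G subr0 P0 ?u0E ?i00 // /rotS /rot mulr1.
  by rewrite cis_pi mulN1r.
apply/funext => p; apply: val_inj; rewrite FE ?i01 // /G subrr.
have c0 : cis 0 = 1 :> C by exact: cis0.
rewrite /rotS /turn !mulr0 !mul0r c0 !mul1r mk_eta Ph // u0E ?i01 //.
Qed.
End Monodromy.

Section PevalAmbient.
Variable R : realType.
Local Notation C3 := 'rV[R[i]]_3.

Lemma peval_ambient (fb : mpoly.mpoly 3 R[i]) (p : C3) :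
  peval (ambient fb) p = mpoly.meval (fun i => nth 0 [:: cx p ^+ 2; cy p; cz p] i) fb.
Proof.
rewrite /peval /ambient !mpoly.comp_mpoly_meval.
apply: mpoly.meval_eq => -[[|[|[|//]]] h];
  rewrite !(tnth_nth 0) /= /px /py /pz /pvar ?rmorphXn /= !mpoly.mevalXU.
- by congr (p _ _ ^+ 2); apply: val_inj.
- by congr (p _ _); apply: val_inj.
- by congr (p _ _); apply: val_inj.
Qed.

Lemma peval_B n p : peval (ambient (fbar R (B_type n))) p = cx p ^+ (2 * n) + cy p ^+ 2 + cz p ^+ 2.
Proof.
rewrite peval_ambient /fbar /px /py /pz /pvar !rmorphD !rmorphXn /= !mpoly.mevalXU /=.
by rewrite exprM.
Qed.

Lemma peval_C n p : peval (ambient (fbar R (C_type n))) p = cx p ^+ 2 * cy p + cy p ^+ n + cz p ^+ 2.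
Proof.
by rewrite peval_ambient /fbar /px /py /pz /pvar !rmorphD rmorphM !rmorphXn /= !mpoly.mevalXU.
Qed.

Lemma peval_F p : peval (ambient (fbar R F4_type)) p = cx p ^+ 4 + cy p ^+ 3 + cz p ^+ 2.
Proof.
rewrite peval_ambient /fbar /px /py /pz /pvar !rmorphD !rmorphXn /= !mpoly.mevalXU /=.
by rewrite -exprM.
Qed.
End PevalAmbient.

(** * Poincare series *)

Section PoincareSeries.
Variable R : realType.
Local Notation C := R[i].
Local Notation mcoef p e := (mcoeff e p).

Section Dimension.
Variables (w : 'I_3 -> nat) (f : mpoly 3 C).

(** Expanding each family in the other gives P Q = 1, by uniqueness of coordinates modulo f. So the
    number chosen in [poincare_coef] is determined. *)
Lemma graded_basis_le m k k' (b : 'I_k -> mpoly 3 C) (b' : 'I_k' -> mpoly 3 C) :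
  graded_basis w f m b -> graded_basis w f m b' -> (k <= k')%N.
Proof.
move=> [bm bP] [b'm b'P].
have ex1 (U : Type) (S : U -> Prop) : (exists! x, S x) -> exists x, S x.
  by move=> [x [Sx _]]; exists x.
have [P PE] := choice (fun i => ex1 _ _ (b'P _ (bm i))).
have [Q QE] := choice (fun j => ex1 _ _ (bP _ (b'm j))).
pose Pm : 'M[C]_(k, k') := \matrix_(i, j) P i j 0.
pose Qm : 'M[C]_(k', k) := \matrix_(j, i) Q j i 0.
suff : Pm *m Qm = 1%:M by exact: mulmx1_min.
apply/matrixP => i l.
have [c [_ cu]] := bP _ (bm i).
have c1 : c = \col_l (i == l)%:R.
  apply: cu; exists 0; rewrite mul0r (bigD1 i) //= big1 => [|l' li]; rewrite !mxE.
    by rewrite eqxx scale1r addr0 subrr.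
  by rewrite eq_sym (negbTE li) scale0r.
have c2 : c = \col_l (Pm *m Qm) i l.
  apply: cu; have [q qE] := PE i; have [r rE] := choice QE.
  exists (q + \sum_j P i j 0 *: r j).
  rewrite mulrDl mulr_suml -qE.
  have -> : \sum_j (P i j 0 *: r j) * f = \sum_j P i j 0 *: b' j - \sum_l (Pm *m Qm) i l *: b l.
    rewrite (eq_bigr (fun j => P i j 0 *: b' j - \sum_l (P i j 0 * Q j l 0) *: b l)).
      rewrite sumrB exchange_big /=; congr (_ - _); apply: eq_bigr => l' _.
      by rewrite mxE scaler_suml; apply: eq_bigr => j _; rewrite !mxE.
    move=> j _; rewrite -scalerAl -rE scalerBr scaler_sumr; congr (_ - _).
    by apply: eq_bigr => l' _; rewrite scalerA.
  rewrite addrA subrK; congr (_ - _); apply: eq_bigr => l' _; by rewrite mxE.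
by have := congr1 (fun M : 'cV_k => M l 0) (etrans (esym c2) c1); rewrite !mxE.
Qed.

Lemma poincare_coefE m k (b : 'I_k -> mpoly 3 C) :
  graded_basis w f m b -> poincare_coef w f m = k.
Proof.
move=> bP; rewrite /poincare_coef.
have [b' b'P] : exists b : 'I_(poincare_coef w f m) -> mpoly 3 C, graded_basis w f m b.
  by apply: (@xgetI _ 0%N [set k | exists b : 'I_k -> mpoly 3 C, graded_basis w f m b] k); exists b.
by apply/eqP; rewrite eqn_leq (graded_basis_le b'P bP) (graded_basis_le bP b'P).
Qed.
End Dimension.

Section MonomialBasis.
Variables (w : 'I_3 -> nat) (g : mpoly 3 C).
Local Notation i0 := (@Ordinal 3 0 isT).
Local Notation i1 := (@Ordinal 3 1 isT).
Local Notation i2 := (@Ordinal 3 2 isT).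
Hypothesis w_gt0 : forall i, (0 < w i)%N.
Hypothesis g_z : forall e, e \in msupp g -> e i2 = 0%N.
Hypothesis g_hom : weighted_homogeneous w (w i2 * 2) g.

Let f := g + pz R ^+ 2.
Let zz : multinom 3 := mnm_muln (mnm1 i2) 2.

Lemma wsum (e : multinom 3) : (\sum_i w i * e i = w i0 * e i0 + w i1 * e i1 + w i2 * e i2)%N.
Proof. by rewrite !big_ord_recr big_ord0 /= add0n; congr (w _ * e _ + w _ * e _ + w _ * e _)%N; apply: val_inj. Qed.

Lemma zzE i : zz i = ((i == i2) * 2)%N.
Proof. by rewrite mulmnE mnm1E eq_sym. Qed.

Lemma f_zz : f = g + mpolyX C zz.
Proof. by rewrite /f /pz /pvar mpolyXn. Qed.

Section Box.
Variables M m : nat.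
Hypothesis mM : (m <= M)%N.

(** The exponents are bounded by M rather than m so that one finite type serves all degrees up to M;
    as the weights are positive, no monomial is lost. *)
Definition box : {set 'I_M.+1 * 'I_M.+1 * 'I_2} :=
  finset (fun p : 'I_M.+1 * 'I_M.+1 * 'I_2 =>
    w i0 * p.1.1 + w i1 * p.1.2 + w i2 * p.2 == m)%N.

Definition box_mnm (p : 'I_M.+1 * 'I_M.+1 * 'I_2) : multinom 3 :=
  mnm_add (mnm_add (mnm_muln (mnm1 i0) p.1.1) (mnm_muln (mnm1 i1) p.1.2)) (mnm_muln (mnm1 i2) p.2).

Lemma box_mnmE p : [/\ box_mnm p i0 = p.1.1, box_mnm p i1 = p.1.2 & box_mnm p i2 = p.2].
Proof. by split; rewrite !mnmDE !mulmnE !mnm1E /= ?mul1n ?mul0n ?addn0 ?add0n. Qed.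

Lemma mnm3P (e e' : multinom 3) : e i0 = e' i0 -> e i1 = e' i1 -> e i2 = e' i2 -> e = e'.
Proof.
by move=> e0 e1 e2; apply/mnmP => -[[|[|[|//]]] hi]; rewrite (bool_irrelevance hi isT).
Qed.

Definition box_basis (i : 'I_#|box|) : mpoly 3 C := mpolyX C (box_mnm (enum_val i)).

Lemma box_basis_hom i : weighted_homogeneous w m (box_basis i).
Proof.
move=> e; rewrite msuppX inE => /eqP ->; rewrite wsum.
have [-> -> ->] := box_mnmE (enum_val i).
by have := enum_valP i; rewrite inE => /eqP.
Qed.

Lemma span_all (h : mpoly 3 C) :
  (forall e, e \in msupp h ->
    exists c : 'cV[C]_#|box|, exists q, mpolyX C e - \sum_i c i 0 *: box_basis i = q * f) ->
  exists c : 'cV[C]_#|box|, exists q, h - \sum_i c i 0 *: box_basis i = q * f.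
Proof.
move=> hP; rewrite [h]mpolyE.
have : {subset msupp h <= msupp h} by []. move: {1 3}(msupp h) => s.
elim: s => [_|a s IHs sh].
  by exists 0, 0; rewrite big_nil mul0r big1 ?subr0 // => i _; rewrite mxE scale0r.
have [c [q cq]] : exists c : 'cV[C]_#|box|, exists q,
    \sum_(e <- s) mcoef h e *: mpolyX C e - \sum_i c i 0 *: box_basis i = q * f.
  by apply: IHs => x xs; apply: sh; rewrite inE xs orbT.
have [c' [q' cq']] := hP a (sh a (mem_head _ _)).
exists (mcoef h a *: c' + c), (mcoef h a *: q' + q).
rewrite big_cons mulrDl -scalerAl -cq -cq' scalerBr scaler_sumr.
rewrite (eq_bigr (fun i => mcoef h a *: (c' i 0 *: box_basis i) + c i 0 *: box_basis i)); last first.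
  by move=> i _; rewrite !mxE scalerDl scalerA.
by rewrite big_split /= opprD addrACA.
Qed.

(** Induction on the exponent of z: modulo f, z^2 can be replaced by - g, which does not contain
    z. *)
Lemma box_span_mnm (e : multinom 3) : (\sum_i w i * e i)%N = m ->
  exists c : 'cV[C]_#|box|, exists q, mpolyX C e - \sum_i c i 0 *: box_basis i = q * f.
Proof.
have [k] := ubnP (e i2); elim: k e => // k IH e; rewrite ltnS => ek we.
have we' := we; rewrite wsum in we'.
have [e2|e2] := ltnP (e i2) 2.
  have e0M : (e i0 < M.+1)%N by have := w_gt0 i0; nia.
  have e1M : (e i1 < M.+1)%N by have := w_gt0 i1; nia.
  pose p := (Ordinal e0M, Ordinal e1M, Ordinal e2).
  have pb : p \in box by rewrite inE /= we'.
  exists (\col_i (i == enum_rank_in pb p)%:R), 0.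
  rewrite mul0r (bigD1 (enum_rank_in pb p)) //= big1 => [|i ip].
    rewrite mxE eqxx scale1r addr0 /box_basis enum_rankK_in //.
    have [p0 p1 p2] := box_mnmE p.
    by rewrite (@mnm3P (box_mnm p) e) ?subrr.
  by rewrite mxE (negbTE ip) scale0r.
pose e' := mnm_sub e zz.
have ee' : e = mnm_add e' zz.
  by apply/mnmP => i; rewrite mnmDE mnmBE zzE; case: eqP => [->|_] /=; lia.
have [c [q cq]] : exists c : 'cV[C]_#|box|, exists q, mpolyX C e' * g - \sum_i c i 0 *: box_basis i = q * f.
  apply: span_all => a /msuppM_le /allpairsP [[a1 a2] /= [+ a2g ->]].
  rewrite msuppX inE => /eqP ->.
  have := g_hom a2g; rewrite wsum (g_z a2g) => ga.
  have E i : e i = (e' i + (i == i2) * 2)%N by rewrite [in LHS]ee' mnmDE zzE.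
  move: (E i0) (E i1) (E i2) => /=; rewrite !addn0 => E0 E1 E2.
  by rewrite E0 E1 E2 in we'; rewrite E2 in ek; apply: IH; [|rewrite !wsum !mnmDE (g_z a2g)]; rewrite ?mnmDE ?(g_z a2g); nia.
exists (- c), (mpolyX C e' - q); rewrite mulrBl -cq f_zz mulrDr -mpolyXD -ee'.
rewrite (eq_bigr (fun i => - (c i 0 *: box_basis i))); last by move=> i _; rewrite mxE scaleNr.
by rewrite sumrN; ring.
Qed.

Lemma box_graded_basis : graded_basis w f m box_basis.
Proof.
split; first exact: box_basis_hom.
move=> h hm.
have ex_c : exists c : 'cV[C]_#|box|, exists q, h - \sum_i c i 0 *: box_basis i = q * f.
  apply: span_all => e eh; exact: box_span_mnm (hm e eh).
have [c [q cq]] := ex_c; exists c; split; first by exists q.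
move=> c' [q' cq'].
have E : \sum_i (c' i 0 - c i 0) *: box_basis i = (q - q') * f.
  rewrite mulrBl -cq -cq' (eq_bigr (fun i => c' i 0 *: box_basis i - c i 0 *: box_basis i)).
    by rewrite sumrB; ring.
  by move=> i _; rewrite scalerBl.
have coefE (e : multinom 3) : mcoef (\sum_i (c' i 0 - c i 0) *: box_basis i) e =
    \sum_i (c' i 0 - c i 0) * (box_mnm (enum_val i) == e)%:R.
  by rewrite raddf_sum; apply: eq_bigr => i _; rewrite /= mcoeffZ mcoeffX.
have [r0|r0] := eqVneq (q - q') 0.
  apply/colP => i; have := coefE (box_mnm (enum_val i)).
  rewrite E r0 mul0r mcoeff0 (bigD1 i) //= eqxx mulr1 big1 ?addr0 => [/esym/eqP|j ji].
    by rewrite subr_eq0 => /eqP.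
  rewrite (_ : (_ == _) = false) ?mulr0 //; apply/negbTE; apply: contraNneq ji => E'.
  apply/eqP/enum_val_inj.
  have [a0 a1 a2] := box_mnmE (enum_val j); have [b0 b1 b2] := box_mnmE (enum_val i).
  move: a0 a1 a2; rewrite E' b0 b1 b2; case: (enum_val i) (enum_val j) => [[? ?] ?] [[? ?] ?] /=.
  by move=> /val_inj -> /val_inj -> /val_inj ->.
(* Let e be a monomial of q - q' of maximal degree in z. Then e z^2 occurs in (q - q') f with the
   same nonzero coefficient, whereas the left side of E has degree at most 1 in z. *)
exfalso; have [e er emax] : exists2 e, e \in msupp (q - q') & forall a, a \in msupp (q - q') -> (a i2 <= e i2)%N.
  have : msupp (q - q') != [::] by rewrite msupp_eq0.
  elim: (msupp _) => [//|a s IH] _; case: s IH => [_|b s /(_ isT) [e es eM]].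
    by exists a; rewrite ?mem_head // => x; rewrite inE => /eqP ->.
  have [ae|ea] := leqP (a i2) (e i2).
    exists e; first by rewrite inE es orbT.
    by move=> x; rewrite inE => /predU1P[-> //|]; exact: eM.
  exists a; first exact: mem_head.
  by move=> x; rewrite inE => /predU1P[-> //|/eM xe]; rewrite (leq_trans xe) // ltnW.
have := coefE (mnm_add zz e).
rewrite E f_zz mulrDr mcoeffD mcoeffMX big1 => [|i _]; last first.
  rewrite (_ : (_ == _) = false) ?mulr0 //; apply/negbTE/eqP => /mnmP /(_ i2).
  have [_ _ ->] := box_mnmE (enum_val i); rewrite mnmDE zzE /=.
  by case: (enum_val i) => [? [t tl]] /=; lia.
have -> : mcoef ((q - q') * g) (mnm_add zz e) = 0.
  apply: memN_msupp_eq0; apply/negP => /msuppM_le /allpairsP [[a1 a2] /= [a1r a2g /mnmP /(_ i2)]].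
  by rewrite mnmDE zzE mnmDE (g_z a2g) /=; have := emax _ a1r; lia.
by rewrite add0r => /eqP; apply/negP; rewrite -mcoeff_msupp.
Qed.

End Box.

(** Up to degree m the series is the polynomial A that enumerates the box. It is the product of N
    and two geometric sums, whose tails begin beyond degree m. *)
Lemma poincare_expand m :
  \sum_(i < m.+1) ((1 - 'X^(w i0)) * (1 - 'X^(w i1)) : {poly int})`_i *
    (poincare_coef w f (m - i)%N)%:Z = (1 + 'X^(w i2) : {poly int})`_m.
Proof.
set D : {poly int} := _ * _; set N : {poly int} := 1 + _.
pose A : {poly int} := \sum_(p : 'I_m.+1 * 'I_m.+1 * 'I_2)
  'X^(w i0 * p.1.1 + w i1 * p.1.2 + w i2 * p.2).
have AE k : (k <= m)%N -> A`_k = (poincare_coef w f k)%:Z.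
  move=> km; rewrite (poincare_coefE (box_graded_basis km)) coef_sum -natz -sum1_card natr_sum.
  rewrite [RHS]big_mkcond; apply: eq_bigr => p _; rewrite coefXn inE eq_sym.
  by case: eqP.
rewrite (eq_bigr (fun i : 'I_m.+1 => D`_i * A`_(m - i))) => [|i _]; last by rewrite AE ?leq_subr.
rewrite -coefM.
have AF : A = (\sum_(i < m.+1) 'X^(w i0) ^+ i) * (\sum_(j < m.+1) 'X^(w i1) ^+ j) * N.
  rewrite (_ : N = \sum_(e < 2) 'X^(w i2) ^+ e); last by rewrite !big_ord_recl big_ord0 addr0 expr0 expr1.
  rewrite big_distrlr pair_bigA /= big_distrlr pair_bigA /=; apply: eq_bigr => p _.
  by rewrite -!exprM -!exprD.
have geom a : (1 - 'X^a : {poly int}) * \sum_(i < m.+1) 'X^a ^+ i = 1 - 'X^(a * m.+1).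
  by rewrite exprM -[in RHS]opprB subrX1 -mulNr opprB.
have -> : D * A = N - N * 'X^(w i0 * m.+1) - N * 'X^(w i1 * m.+1) +
    N * 'X^(w i0 * m.+1) * 'X^(w i1 * m.+1).
  rewrite AF /D; transitivity (((1 - 'X^(w i0 * m.+1)) * (1 - 'X^(w i1 * m.+1))) * N); last by ring.
  by rewrite -!geom; ring.
have lt_m i : (m < w i * m.+1)%N by have := w_gt0 i; nia.
clearbody N; by rewrite coefD !coefB !coefMXn !lt_m ?subr0 ?addr0.
Qed.
End MonomialBasis.
End PoincareSeries.

(** * Characteristic polynomials of the monodromy for the three types *)

Section PhiX.
Variable R : realType.
Local Notation C := R[i].
Implicit Types (eps : R) (lam : C).

Lemma hmap_mkcts (X : topologicalType) (h : continuousType X X) (a : homology R 2 (set0 : set X)) :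
  hmap set0 (mkcts (@cts_fun _ _ h)) a = hmap set0 h a.
Proof. by rewrite !hmapE. Qed.

Lemma nrm_root_le p eps (x lam : C) : 0 < eps -> nrm x ^+ p.+1 <= nrm lam ->
  nrm lam <= (eps / 2) ^+ p.+1 -> nrm x <= eps / 2.
Proof.
move=> e0 h1 h2; have := le_trans h1 h2.
by rewrite ler_pXn2r // nnegrE ?nrm_ge0 // divr_ge0 // ltW.
Qed.

Lemma brieskorn_monodromy p' q' q1 q2 d (f : mpoly.mpoly 3 C) eps lam
    (h : continuousType (milnor_fibre f eps lam) (milnor_fibre f eps lam)) :
  (forall v, peval f v = cx v ^+ p'.+1 + cy v ^+ q'.+1 + cz v ^+ 2) ->
  0 < eps -> lam != 0 -> nrm lam <= (eps / 2) ^+ p'.+1 -> nrm lam <= (eps / 2) ^+ q'.+1 ->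
  (0 < d)%N -> (q1 * p'.+1)%N = d -> (q2 * q'.+1)%N = d -> nrm lam * d%:R < eps ^+ 2 ->
  geometric_monodromy h ->
  exists Theta : homology R 2 (set0 : set (milnor_fibre f eps lam)) ->
      {ffun 'I_p'.+1 * 'I_q'.+1 -> int},
    [/\ forall a b, Theta (a - b) = Theta a - Theta b,
        forall a, Theta a = 0 -> a = 0,
        forall th, balanced fst snd th <-> exists a, Theta a = th &
        forall a e, Theta (hmap set0 h a) (ordS e.1, ordS e.2) = - Theta a e].
Proof.
move=> fE e0 l0 lp lq d0 q1p q2q ld hm.
have g_hom s x y : (s ^+ q1 * x) ^+ p'.+1 + (s ^+ q2 * y) ^+ q'.+1 =
    s ^+ d * (x ^+ p'.+1 + y ^+ q'.+1) :> C.
  by rewrite !exprMn -!exprM q1p q2q mulrDr.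
have [F [cF F0 F1]] := @monodromy_homotopy _ (fun x y => x ^+ p'.+1 + y ^+ q'.+1) q1 q2 d f eps lam d0 g_hom fE h hm.
have small x y : nrm x ^+ p'.+1 <= nrm lam -> nrm y ^+ q'.+1 <= nrm lam ->
    nrm x ^+ 2 + nrm y ^+ 2 < eps ^+ 2.
  move=> /(nrm_root_le e0)/(_ lp) hx /(nrm_root_le e0)/(_ lq) hy.
  have := nrm_ge0 x; have := nrm_ge0 y; nra.
have turnE q r : (q * r.+1)%N = d -> turn d q 1 = om R r.+1.
  move=> qd; rewrite /turn /om; congr cis; rewrite -qd natrM mulr1.
  have q0 : q%:R != 0 :> R.
    by rewrite pnatr_eq0; apply: contraTneq d0 => q0; rewrite -qd q0.
  have r0 : 1 + r%:R != 0 :> R by rewrite nat1r pnatr_eq0.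
  by field; rewrite r0 q0.
have rotE v : val (F 0 v) = rotA p' q' (val v).
  by rewrite F0 (turnE _ _ q1p) (turnE _ _ q2q).
have [Th [h1 h2 h3 h4]] := brieskorn_homology l0 small
  (@milnorE _ (fun x y => x ^+ p'.+1 + y ^+ q'.+1) f eps fE lam) d0 q1p q2q ld (@cts_fun _ _ h) cF rotE F1.
by exists Th; split => // a e; rewrite -hmap_mkcts.
Qed.

Lemma nrm_lt (lam : C) (eta : R) : 0 < `|lam| < eta%:C -> lam != 0 /\ nrm lam < eta.
Proof. by rewrite normr_gt0 normE ltcR => /andP[]. Qed.

Definition phi_X_eq (T : simple_boundary) (phi : {poly int}) := let f := ambient (fbar R T) in
  forall eps, 0 < eps -> exists2 eta : R, 0 < eta &
  forall lam, 0 < `|lam| < eta%:C ->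
  forall h : continuousType (milnor_fibre f eps lam) (milnor_fibre f eps lam),
  geometric_monodromy h -> charpoly setT (hmap set0 h : homology R 2 set0 -> _) = phi.

Lemma phi_B n : (1 < n)%N -> phi_X_eq (B_type n) ('X^((2 * n).-1) + \poly_(i < (2 * n).-1) 1).
Proof.
move=> n1 f eps e0.
have pE : (2 * n)%N = (2 * n).-1.+1 by lia.
have hf : 0 < eps / 2 by lra.
have nR : 0 < (2 * n)%:R :> R by rewrite ltr0n; lia.
(* The first two bounds keep the graph inside the ball; the third is the one that [scale_bound] asks
   for. *)
exists (Num.min ((eps / 2) ^+ (2 * n)) (Num.min ((eps / 2) ^+ 2) (eps ^+ 2 / (2 * n)%:R))).
  by rewrite !lt_min !exprn_gt0 //= divr_gt0 // exprn_gt0.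
move=> lam /nrm_lt[l0]; rewrite !lt_min => /and3P[lp lq ld] h hm.
have [|||||||Th [h1 h2 h3 h4]] := @brieskorn_monodromy (2 * n).-1 1 1 n (2 * n) _ eps lam h _ e0 l0 _ _ _ _ _ _ hm.
- by move=> v; rewrite peval_B -pE.
- by rewrite -pE ltW.
- exact: ltW.
- by lia.
- by lia.
- by lia.
- by rewrite -ltr_pdivlMr.
apply: (charpoly_brieskorn2 _ h1 h2 h3 h4); lia.
Qed.

Lemma phi_F : phi_X_eq F4_type ('X^6 + \poly_(i < 6) poly43 i).
Proof.
move=> eps e0.
have hf : 0 < eps / 2 by lra.
exists (Num.min ((eps / 2) ^+ 4) (Num.min ((eps / 2) ^+ 3) (eps ^+ 2 / 12%:R))).
  by rewrite !lt_min !exprn_gt0 //= divr_gt0 // exprn_gt0.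
move=> lam /nrm_lt[l0]; rewrite !lt_min => /and3P[lp lq ld] h hm.
have [|||||||Th [h1 h2 h3 h4]] := @brieskorn_monodromy 3 2 3 4 12 _ eps lam h _ e0 l0 _ _ _ _ _ _ hm => //.
- exact: peval_F.
- exact: ltW.
- exact: ltW.
- by rewrite -ltr_pdivlMr.
exact: (charpoly_brieskorn43 h1 h2 h3 h4).
Qed.

Lemma phi_C n : (2 < n)%N -> phi_X_eq (C_type n) (('X^n + 1) * ('X + 1)).
Proof.
case: n => // n' n2 f eps e0; set n := n'.+1.
have n0 : 0 < n%:R :> R by rewrite ltr0n.
(* |lam| < 1 gives |lam|^(n-1) <= |lam|, which reduces [small2] to the third bound; the second is
   [small1], and the last one serves [scale_bound]. *)
exists (Num.min 1 (Num.min ((eps / 4) ^+ n)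
    (Num.min ((eps ^+ 2 / 2) ^+ n / (2 ^+ n * (4 * n%:R))) (eps ^+ 2 / n'.*2.+2%:R)))).
  by rewrite !lt_min ltr01 exprn_gt0 ?divr_gt0 ?mulr_gt0 ?exprn_gt0 ?divr_gt0 ?exprn_gt0 //=.
move=> lam /nrm_lt[l0]; rewrite !lt_min => /and4P[l1 lp lq ld] h hm.
pose g (x y : C) := x ^+ 2 * y + y ^+ n.
have g_hom s x y : g (s ^+ n' * x) (s ^+ 2 * y) = s ^+ n'.*2.+2 * g x y.
  rewrite /g [(s ^+ n' * x) ^+ 2]exprMn [(s ^+ 2 * y) ^+ n]exprMn -!exprM mulrDr; congr (_ + _).
    by rewrite mulrACA -exprD muln2 addn2.
  by rewrite mul2n.
have fE v : peval (ambient (fbar R (C_type n))) v = g (cx v) (cy v) + cz v ^+ 2 by rewrite peval_C.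
have [F [cF F0 F1]] := @monodromy_homotopy _ g n' 2 n'.*2.+2 _ eps lam isT g_hom fE h hm.
have rotE v : val (F 0 v) = rotD n' (val v).
  rewrite F0 /rotD /turn /om !cisX mulr1; congr (rot (cis _) (cis _) _); by rewrite mulrAC mulrC mulrA.
have small2 : 2 ^+ n * nrm lam ^+ n' * (4 * n%:R) <= (eps ^+ 2 / 2) ^+ n.
  have lX : nrm lam ^+ n' <= nrm lam.
    by rewrite -[leRHS]expr1; apply: ler_wiXn2l; [exact: nrm_ge0|exact: ltW|exact: ltnW].
  have c0 : 0 < 2 ^+ n * (4 * n%:R) :> R by rewrite mulr_gt0 ?exprn_gt0 ?mulr_gt0.
  rewrite mulrAC mulrC; apply: (le_trans (ler_wpM2r (ltW c0) lX)).
  by rewrite -ler_pdivlMr // ltW.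
have ld' : nrm lam * n'.*2.+2%:R < eps ^+ 2 by rewrite -ltr_pdivlMr ?ltr0n.
have [Th [h1 h2 h3 h4]] := dihedral_homology (ltnW n2) l0 e0 (ltW lp) small2
  (milnorE eps fE lam) ld' (@cts_fun _ _ h) cF rotE F1.
have n'0 : (0 < n')%N by exact: ltnW.
by apply: (charpoly_dihedral n'0 h1 h2 h3) => a e; rewrite -hmap_mkcts.
Qed.
End PhiX.

Section PoincareSimple.
Variable R : realType.
Local Notation i0 := (@Ordinal 3 0 isT).
Local Notation i1 := (@Ordinal 3 1 isT).
Local Notation i2 := (@Ordinal 3 2 isT).

Definition mnm_xy (a b : nat) : multinom 3 :=
  mnm_add (mnm_muln (mnm1 i0) a) (mnm_muln (mnm1 i1) b).

Lemma mnm_xyE a b : [/\ mnm_xy a b i0 = a, mnm_xy a b i1 = b & mnm_xy a b i2 = 0%N].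
Proof. by split; rewrite mnmDE !mulmnE !mnm1E /= ?mul1n ?mul0n ?addn0 ?add0n. Qed.

Lemma ambientE T : let f := ambient (fbar R T) in
  match T with
  | B_type n => f = px R ^+ (2 * n) + py R ^+ 2 + pz R ^+ 2
  | C_type n => f = px R ^+ 2 * py R + py R ^+ n + pz R ^+ 2
  | F4_type => f = px R ^+ 4 + py R ^+ 3 + pz R ^+ 2
  end.
Proof.
have [c0 c1 c2] : [/\ ambient (px R) = px R ^+ 2, ambient (py R) = py R & ambient (pz R) = pz R].
  by split; rewrite /ambient comp_mpolyXU.
have cX p n : ambient (p ^+ n) = ambient p ^+ n by exact: rmorphXn.
have cD p q : ambient (p + q) = ambient p + ambient q by exact: rmorphD.
have cM p q : ambient (p * q) = ambient p * ambient q by exact: rmorphM.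
case: T => [n|n|] /=; rewrite !(cX, cD, cM) ?c0 ?c1 ?c2 //.
  by rewrite -exprM.
by rewrite -exprM.
Qed.

Lemma poincare_simple (w : 'I_3 -> nat) a b c d m : (forall i, (0 < w i)%N) ->
  (w i0 * a + w i1 * b = w i2 * 2)%N -> (w i0 * c + w i1 * d = w i2 * 2)%N ->
  \sum_(i < m.+1) ((1 - 'X^(w i0)) * (1 - 'X^(w i1)) : {poly int})`_i *
    (poincare_coef w (px R ^+ a * py R ^+ b + px R ^+ c * py R ^+ d + pz R ^+ 2) (m - i)%N)%:Z =
  (1 + 'X^(w i2) : {poly int})`_m.
Proof.
move=> w0 ab cd; have xyE k l : px R ^+ k * py R ^+ l = mpolyX R[i] (mnm_xy k l).
  by rewrite /px /py /pvar !mpolyXn mpolyXD.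
have suppE e : e \in msupp (px R ^+ a * py R ^+ b + px R ^+ c * py R ^+ d) ->
    e = mnm_xy a b \/ e = mnm_xy c d.
  rewrite !xyE => /msuppD_le; rewrite mem_cat !msuppX !inE => /orP[]/eqP; first by left.
  by right.
apply: poincare_expand => // e /suppE [] ->.
- by have [_ _ ->] := mnm_xyE a b.
- by have [_ _ ->] := mnm_xyE c d.
- by rewrite wsum; have [-> -> ->] := mnm_xyE a b; rewrite muln0 addn0.
- by rewrite wsum; have [-> -> ->] := mnm_xyE c d; rewrite muln0 addn0.
Qed.

Lemma weights_gt0 (T : simple_boundary) i : admissible T -> (0 < weights T i)%N.
Proof.
by move=> aT; case: i => [[|[|[|//]]] hi]; move: aT; case: T => [n|n|] //=; rewrite /weights /=; lia.
Qed.

Lemma poincare_simple_boundary (T : simple_boundary) m : admissible T ->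
  \sum_(i < m.+1) ((1 - 'X^(weights T i0)) * (1 - 'X^(weights T i1)) : {poly int})`_i *
    (poincare_coef (weights T) (ambient (fbar R T)) (m - i)%N)%:Z =
  (1 + 'X^(weights T i2) : {poly int})`_m.
Proof.
move=> aT; have w0 i : (0 < weights T i)%N by exact: weights_gt0.
have := ambientE T; move: aT w0; case: T => [n|n|] aT w0 /= ->.
- have := @poincare_simple (weights (B_type n)) (2 * n) 0 0 2 m w0.
  rewrite !expr0 mulr1 mul1r; apply; rewrite /weights /=; lia.
- have := @poincare_simple (weights (C_type n)) 2 1 0 n m w0.
  by rewrite expr0 expr1 mul1r; apply; rewrite /weights /=; move: aT => /= aT; nia.
- have := @poincare_simple (weights F4_type) 4 0 0 3 m w0.
  by rewrite !expr0 mulr1 mul1r; apply.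
Qed.
End PoincareSimple.

(** * Comparison of the two sides *)

Definition phi_poly (T : simple_boundary) : {poly int} :=
  match T with
  | B_type n => 'X^((2 * n).-1) + \poly_(i < (2 * n).-1) 1
  | C_type n => ('X^n + 1) * ('X + 1)
  | F4_type => 'X^6 + \poly_(i < 6) poly43 i
  end.

Definition psi_poly (T : simple_boundary) : {poly int} :=
  match T with
  | B_type n => ('X^n - 1) ^+ 2
  | C_type n => ('X + 1) ^+ 2 * (('X^(n.-1) - 1) * ('X - 1))
  | F4_type => ('X + 1) * ('X - 1) ^+ 2 * ('X^2 + 'X + 1) ^+ 2
  end.

Lemma phi_XP (R : realType) T : admissible T -> phi_X_eq R T (phi_poly T).
Proof. by case: T => [n|n|] h; [exact: phi_B|exact: phi_C|exact: phi_F]. Qed.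

Lemma psi_XP T (s : seq 'I_(affine_size T)) : admissible T -> coxeter_order s ->
  char_poly (affine_coxeter s) = psi_poly T.
Proof.
by case: T s => [n|n|] s h; [exact: psi_B|exact: psi_C|exact: psi_F].
Qed.

(** phi_X / psi_X = (1 + t^q3) / ((1 - t^q1) (1 - t^q2)) with denominators cleared. For B_n the
    geometric sum phi_X (1 - t) = 1 - t^(2n) has to be recognized first. *)
Lemma phi_psiE T : admissible T ->
  phi_poly T * ((1 - 'X^(weights T (@Ordinal 3 0 isT))) * (1 - 'X^(weights T (@Ordinal 3 1 isT)))) =
  (1 + 'X^(weights T (@Ordinal 3 2 isT))) * psi_poly T.
Proof.
case: T => [n|n|] /= h; rewrite /weights /=.
- have E : ('X^((2 * n).-1) + \poly_(i < (2 * n).-1) 1) * (1 - 'X^1) = 1 - 'X^(2 * n) :> {poly int}.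
    have -> : 'X^((2 * n).-1) + \poly_(i < (2 * n).-1) 1 = \sum_(i < (2 * n)) 'X^i :> {poly int}.
      have -> : (2 * n)%N = (2 * n).-1.+1 by lia.
      rewrite big_ord_recr /= addrC; congr (_ + _); rewrite poly_def.
      by apply: eq_bigr => i _; rewrite scale1r.
    by rewrite mulrC expr1 -[RHS]opprB subrX1 -mulNr opprB.
  by rewrite mulrA E mul2n -addnn exprD; ring.
- have -> : 'X^n = 'X^(n.-1) * 'X :> {poly int} by rewrite -exprSr prednK //; lia.
  by ring.
- have -> : \poly_(i < 6) poly43 i = 'X^5 - 'X^3 + 'X + 1 :> {poly int}.
    by apply/polyP => -[|[|[|[|[|[|i]]]]]]; rewrite coef_poly !coefD coefN !coefXn coefX coef1 /= ?addr0.
  by ring.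
Qed.

Lemma involutionK (R : realType) fb eps lam : involutive (@involution R fb eps lam).
Proof.
move=> v; apply: val_inj; apply/rowP => i; rewrite !mxE.
by case: eqP => // _; rewrite opprK.
Qed.

Lemma div_divCK (F : fieldType) (a b p : F) : b != 0 -> b / (p / (a / b)) = a / p.
Proof. by move=> b0; rewrite invf_div mulrA mulrCA divff // mulr1. Qed.

Lemma tofrac_div (D : idomainType) (a b c d : D) : b != 0 -> d != 0 -> a * d = c * b ->
  tofrac a / tofrac b = tofrac c / tofrac d.
Proof.
by move=> b0 d0 E; apply/eqP; rewrite eqr_div ?tofrac_eq0 // -!rmorphM tofrac_eq E.
Qed.

Theorem corollary2 (R : realType) (T : simple_boundary) (hT : admissible T) :
  let f := ambient (fbar R T) in
  exists2 eps0 : R, 0 < eps0 &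
  forall eps : R, 0 < eps < eps0 ->
  exists2 eta : R, 0 < eta &
  forall lam : R[i], 0 < `|lam| < eta%:C ->
  let H2 := homology R 2 (set0 : set (milnor_fibre f eps lam)) in
  forall h : continuousType (milnor_fibre f eps lam) (milnor_fibre f eps lam),
  geometric_monodromy h ->
  let c : H2 -> H2 := hmap set0 h in
  let sigma : H2 -> H2 := hmap set0 (involution (fbar R T) eps lam) in
  forall form : H2 -> H2 -> int, intersection_form form ->
  forall (mu0 mu1 : nat) (d : 'I_(mu0 + mu0 + mu1) -> H2),
  boundary_basis d form sigma ->
  forall s : seq 'I_(affine_size T), coxeter_order s ->
  let phi_X := tofrac (charpoly setT c) in
  let phi_f := tofrac (charpoly (antiinvariant sigma)
                 (reflection_product form (antiinvariant_basis d))) in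
  let psi_X := tofrac (char_poly (affine_coxeter s)) in
  let phi_1 := phi_X / phi_f in
  let psi_f := psi_X / phi_1 in
  expands_to (phi_f / psi_f) (poincare_coef (weights T) f).
Proof.
(* Every radius will do, f being weighted homogeneous; only the bound for lam depends on eps. *)
move=> f; exists 1 => // eps /andP[eps_gt0 _].
have [eta eta0 phiP] := phi_XP hT eps_gt0; exists eta => // lam lamP H2 h hm c sigma form _.
move=> mu0 mu1 d bd s s_cox phi_X phi_f psi_X phi_1 psi_f.
(* Once phi_f is nonzero, phi_f / (psi_X / (phi_X / phi_f)) reduces to phi_X / psi_X. *)
have phi_f0 : phi_f != 0.
  rewrite tofrac_eq0; apply: charpoly_antiinvariant_neq0 bd.
    exact: hmapB.
  by apply: hmap_invol; exact: involutionK.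
pose D : {poly int} := (1 - 'X^(weights T (@Ordinal 3 0 isT))) * (1 - 'X^(weights T (@Ordinal 3 1 isT))).
have D0 : D != 0.
  have w_gt0 i : (0 < weights T i)%N by exact: weights_gt0.
  apply/negP => /eqP /(congr1 (fun p : {poly int} => p.[0])); rewrite /D !hornerE !expr0n.
  by rewrite ![_ == 0%N]gtn_eqF // !subr0 mulr1.
exists (1 + 'X^(weights T (@Ordinal 3 2 isT))), D; split => // [|m].
  rewrite (div_divCK _ _ phi_f0); apply: tofrac_div => //.
    by rewrite monic_neq0 // char_poly_monic.
  by rewrite [charpoly _ _](phiP lam lamP h hm) (psi_XP hT s_cox) phi_psiE.
exact: poincare_simple_boundary.
Qed.
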